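(* Let $K\in\{-1,0,1\}$, $c_1,c_2\in\mathbb{R}$, $\varepsilon>0$, and let $v\in C^2(\overline{D_\varepsilon^+}\setminus\{0\})$ solve $$\Delta v+2Ke^v=0\text{ in }D_\varepsilon^+,\qquad \frac{\partial v}{\partial t}=c_1e^{v/2}\text{ on }I_\varepsilon^+,\qquad \frac{\partial v}{\partial t}=c_2e^{v/2}\text{ on }I_\varepsilon^-,$$ and assume $\int_{D_\varepsilon^+}e^v<\infty$. Then a developing map $g$ of $v$ has one of the forms $g(z)=\psi(z^\gamma F(z))$ with $\gamma\in[0,1)$, $F$ meromorphic on $D_\varepsilon^*$ and real (or $\infty$) on $\mathbb{R}\cap D_\varepsilon^*$, or $g(z)=\psi(F(z)+\log z)$ with $F$ meromorphic on $D_\varepsilon^*$ and real (or $\infty$) on $\mathbb{R}\cap D_\varepsilon^*$, where $\psi$ is a Möbius transformation; and in either case $F$ does not have an essential singularity at the origin. In particular, $g$ extends continuously to the origin, and the Schwarzian map $Q$ of $v$ (extended to $D_\varepsilon^*$) has at most a pole of order two at $0$.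
   Context: Identify $\mathbb{R}^2\equiv\mathbb{C}$, $z=s+it$. $D_\varepsilon^+=\{|z|<\varepsilon,\ \mathrm{Im} z>0\}$, $D_\varepsilon^*=\{0<|z|<\varepsilon\}$, $I_\varepsilon^\pm=\{(s,0):0<\pm s<\varepsilon\}$. On the closed upper half-plane minus $0$, $\log z=\ln|z|+i\arg z$, $\arg z\in[0,\pi]$, $z^\gamma=e^{\gamma\log z}$. A developing map of $v$ is a locally univalent meromorphic function $g$ (holomorphic with $1+K|g|^2>0$ if $K\le0$) with $v=\log\frac{4|g'|^2}{(1+K|g|^2)^2}$; it is unique up to Möbius transformations of the form $g\mapsto\frac{\alpha g-\bar\beta}{K\beta g+\bar\alpha}$, $|\alpha|^2+K|\beta|^2=1$. The Schwarzian map of $v$ is $Q=v_{zz}-\frac12 v_z^2$ (with $v_z=(v_s-iv_t)/2$), which equals the Schwarzian derivative $\{g,z\}=(g''/g')'-\frac12(g''/g')^2$; it is holomorphic on $D_\varepsilon^+$, real on the boundary segments, and extends holomorphically to $D_\varepsilon^*$ by $Q(\bar z)=\overline{Q(z)}$. *)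

(* Defs.v *)
From mathcomp Require Import all_boot all_order all_algebra.
From mathcomp Require Import all_classical all_reals all_analysis.
From mathcomp Require Import Rstruct Rstruct_topology.
From Stdlib Require Import Reals.

Module MCInt.
Import Order.TTheory GRing.Theory Num.Theory.
Local Open Scope ring_scope.
Local Open Scope classical_set_scope.
Local Open Scope ereal_scope.
Definition leb2 := ((@lebesgue_measure R) \x (@lebesgue_measure R)).
Definition finite_exp_integral (A : set (R * R)) (f : R * R -> R) : Prop :=
  (\int[leb2]_(x in A) (Rtrigo_def.exp (f x))%:E < +oo)%E.
End MCInt.

From Coquelicot Require Import Coquelicot.
Open Scope R_scope.

(** ** Domains. z = s + i t is the pair (s, t). *)
Definition Dplus (eps : R) (z : C) : Prop := Cmod z < eps /\ 0 < Im z.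
Definition Dstar (eps : R) (z : C) : Prop := 0 < Cmod z < eps.
Definition Dbar (eps : R) (z : C) : Prop :=
  Cmod z <= eps /\ 0 <= Im z /\ z <> RtoC 0.

Definition cont_on (A : C -> Prop) (f : C -> R) : Prop :=
  forall x, A x -> forall e, 0 < e -> exists d, 0 < d /\
    forall y, A y -> Cmod (Cminus y x) < d -> Rabs (f y - f x) < e.

(** v is C^2 in the open set A and all its derivatives up to order 2
    extend continuously to B (here B = closure of A minus 0). *)
Definition C2_upto (A B : C -> Prop) (v : C -> R) : Prop :=
  exists vs vt vss vst vts vtt : C -> R,
    cont_on B v /\ cont_on B vs /\ cont_on B vt /\ cont_on B vss /\
    cont_on B vst /\ cont_on B vts /\ cont_on B vtt /\
    forall z, A z ->
      is_derive (fun s => v (s, snd z)) (fst z) (vs z) /\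
      is_derive (fun t => v (fst z, t)) (snd z) (vt z) /\
      is_derive (fun s => vs (s, snd z)) (fst z) (vss z) /\
      is_derive (fun t => vs (fst z, t)) (snd z) (vst z) /\
      is_derive (fun s => vt (s, snd z)) (fst z) (vts z) /\
      is_derive (fun t => vt (fst z, t)) (snd z) (vtt z).

Definition pd_s (f : C -> R) (z : C) : R := Derive (fun s => f (s, snd z)) (fst z).
Definition pd_t (f : C -> R) (z : C) : R := Derive (fun t => f (fst z, t)) (snd z).
Definition laplacian (f : C -> R) (z : C) : R := pd_s (pd_s f) z + pd_t (pd_t f) z.

Definition dt_boundary (v : C -> R) (s l : R) : Prop :=
  filterlim (fun t => (v (s, t) - v (s, 0)) / t) (at_right 0) (locally l).

Definition v_z (v : C -> R) (z : C) : C := (pd_s v z / 2, - pd_t v z / 2).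
Definition v_zz (v : C -> R) (z : C) : C :=
  ((pd_s (pd_s v) z - pd_t (pd_t v) z) / 4,
   - (pd_t (pd_s v) z + pd_s (pd_t v) z) / 4).
Definition schwarzian_map (v : C -> R) (z : C) : C :=
  Cminus (v_zz v z) (Cmult (RtoC (1/2)) (Cmult (v_z v z) (v_z v z))).

(** ** Riemann sphere = option C (None = infinity) *)
Definition fin (x : option C) : C := match x with Some a => a | None => RtoC 0 end.

Definition meromorphic_on (U : C -> Prop) (f : C -> option C) : Prop :=
  (forall z, U z -> exists r, 0 < r /\
     forall w, U w -> 0 < Cmod (Cminus w z) < r -> f w <> None) /\
  (forall z, U z -> f z <> None -> ex_derive (fun w => fin (f w)) z) /\
  (forall z, U z -> f z = None -> forall M, exists r, 0 < r /\
     forall w, U w -> 0 < Cmod (Cminus w z) < r -> M < Cmod (fin (f w))).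

Definition locally_univalent (U : C -> Prop) (f : C -> option C) : Prop :=
  forall z, U z -> exists r, 0 < r /\
    forall w1 w2, U w1 -> U w2 -> Cmod (Cminus w1 z) < r -> Cmod (Cminus w2 z) < r ->
      f w1 = f w2 -> w1 = w2.

(** developing map of v on D_eps^+ :
    v = log (4|g'|^2 / (1 + K|g|^2)^2) (at the non-poles; at poles it then
    holds by continuity); if K <= 0, g is holomorphic with 1 + K|g|^2 > 0. *)
Definition developing_map (K eps : R) (v : C -> R) (g : C -> option C) : Prop :=
  meromorphic_on (Dplus eps) g /\ locally_univalent (Dplus eps) g /\
  (K <= 0 -> forall z, Dplus eps z -> exists a, g z = Some a /\ 0 < 1 + K * Cmod a ^ 2) /\
  (forall z a, Dplus eps z -> g z = Some a -> exists l,
     is_derive (fun w => fin (g w)) z l /\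
     v z = ln (4 * Cmod l ^ 2 / (1 + K * Cmod a ^ 2) ^ 2)).

Definition mobius_maps (a b c d : C) (x y : option C) : Prop :=
  match x with
  | Some w =>
      (Cplus (Cmult c w) d <> RtoC 0 /\
         y = Some (Cdiv (Cplus (Cmult a w) b) (Cplus (Cmult c w) d))) \/
      (Cplus (Cmult c w) d = RtoC 0 /\ y = None)
  | None => (c <> RtoC 0 /\ y = Some (Cdiv a c)) \/ (c = RtoC 0 /\ y = None)
  end.

(** log z = ln|z| + i arg z, arg z in [0, pi], on the closed upper half-plane minus 0 *)
Definition clog (z : C) : C := (ln (Cmod z), acos (Re z / Cmod z)).
Definition cexp (w : C) : C := (exp (Re w) * cos (Im w), exp (Re w) * sin (Im w)).
Definition cpow (z : C) (gamma : R) : C := cexp (Cmult (RtoC gamma) (clog z)).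

Definition real_on_axis (eps : R) (F : C -> option C) : Prop :=
  forall z u, Dstar eps z -> Im z = 0 -> F z = Some u -> Im u = 0.

Definition not_essential_at_0 (F : C -> option C) : Prop :=
  exists r n M, 0 < r /\ forall z, 0 < Cmod z < r ->
    exists u, F z = Some u /\ Cmod z ^ n * Cmod u <= M.

Definition extends_cont_to_0 (eps : R) (g : C -> option C) : Prop :=
  exists L : option C,
    match L with
    | Some l => forall e, 0 < e -> exists d, 0 < d /\ forall z, Dplus eps z -> Cmod z < d ->
                  exists u, g z = Some u /\ Cmod (Cminus u l) < e
    | None => forall M, exists d, 0 < d /\ forall z, Dplus eps z -> Cmod z < d ->
                  forall u, g z = Some u -> M < Cmod u
    end.

(* Main.v *)
(** The finite area and the maximum principle give [e^v |z|^2 <= C] near [0], and a barrier on half annuli, which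
    uses only the Neumann data, gives [-v(0,r) = O(|ln r|^3)].  With Harnack's inequality this bounds [Q] by a power
    of [ln |z|] over [|z|^2], up to a factor that degenerates at the axis; Cauchy estimates for
    [Q(w) ((w - x0)^2 - s^2)^18] on discs centred on the axis remove that factor.  As [Q] is real on the axis, it
    reflects (Morera), so [z^2 Q] is a power series with real coefficients.  The equation [y'' + Q y / 2 = 0] then
    has a Frobenius basis [y1 = z^((1+sigma)/2) H1], [y2 = z^((1-sigma)/2) H2 + beta y1 log z], and a developing map
    is a quotient of two independent solutions (near one regular point by Liouville's formula, everywhere by the
    identity theorem), that is, a Moebius function of [y2 / y1].  If [sigma] were imaginary, then
    [e^v >= c / |z|^2], against finite area; so [sigma] is real, and [y2 / y1] has one of the two asserted forms. *)
Require Import Defs.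
From mathcomp Require all_boot all_order all_algebra all_classical all_reals all_analysis Rstruct Rstruct_topology.
From Stdlib Require Import Reals Lra.

(** The regularity of [v] at the axis is only qualitative, so every quantitative estimate is an
    interior one and degenerates at the axis. The loss is polynomial in [|z| / Im z], and at the
    origin it is only a power of [ln |z|]; a holomorphic function forgives both. A polynomial that
    vanishes where a circle meets the axis absorbs the first, and the second disappears in the
    removable singularity theorem for [z ^ 4 Q]. The exponents determine each other: a relative rate
    of change [8 / t] at height [t] lets [m0 - v] grow at most like [t ^ -8] towards the axis, the
    gradient like [t ^ -9], and [Q], quadratic in the gradient, like [t ^ -18]; the cube of the
    logarithm becomes a sixth power in the same way. The area is used twice, each time because there
    are no squares tending to the origin on which [l ^ 2 e^v] stays above a positive constant.
    Square roots of [g'], which would need a branch, never occur: a combination of the two Frobenius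
    solutions takes the place of [1 / sqrt g'], and a nonzero Wronskian supplies independence,
    simple zeros and the lower bound of the density. *)

Module AreaLink.
Import all_boot all_order all_algebra all_classical all_reals all_analysis Rstruct Rstruct_topology.
Import Order.TTheory GRing.Theory Num.Theory.
Import HBNNSimple.
Local Open Scope classical_set_scope.
Local Open Scope ring_scope.
Local Open Scope ereal_scope.

(** * Disjoint squares and the Lebesgue integral *)

Notation RR := (measurableTypeR R * measurableTypeR R)%type.

Definition square (a b l : R) : set (R * R) := `[a, (a + l)%R] `*` `[b, (b + l)%R].

Lemma measurable_square a b l : measurable (square a b l : set RR).
Proof. by apply: measurableX; exact: measurable_itv. Qed.

Lemma area_square a b l : (0 < l)%R -> MCInt.leb2 (square a b l) = (l * l)%:E.
Proof.
move=> l0; rewrite /MCInt.leb2 /square product_measure1E; try exact: measurable_itv.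
by rewrite /= !lebesgue_measure_itv /= !lte_fin !ltrDl l0 -!EFinD EFinM; congr (_ %:E * _ %:E); rewrite addrAC subrr add0r.
Qed.

(** Each square lies in a shell [d' <= N < d], and the next one is sought below [d']; so the squares
    are disjoint, and each contributes at least [k] to the integral. *)
Lemma infinite_area (A : R * R -> Prop) (f N : R * R -> R) (k : R) :
  MCInt.finite_exp_integral A f -> (0 < k)%R ->
  (forall d, (0 < d)%R -> exists a b l d' : R, [/\ (0 < l)%R, (0 < d')%R &
     forall z, square a b l z -> [/\ A z, (d' <= N z)%R, (N z < d)%R & (k / (l * l) <= Rtrigo_def.exp (f z))%R]]) -> False.
Proof.
move=> fin k0 step.
have ef z : (0 <= Rtrigo_def.exp (f z))%R by apply/RleP; left; exact: exp_pos.
pose F := (fun z => (Rtrigo_def.exp (f z))%:E) \_ A.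
(* The simple function is carried along with a threshold of [N] below which it vanishes: a square
   found below that threshold is added without breaking [h <= F]. *)
have Ind (n : nat) : exists h : {nnsfun RR >-> R}, [/\ (n%:R * k)%:E <= sintegral MCInt.leb2 h,
   (forall z, (h z)%:E <= F z) & exists2 d, (0 < d)%R & forall z, (N z < d)%R -> h z = 0%R].
  elim: n => [|n [h [Ih hF [d d0 hd]]]].
    exists (nnsfun0 : {nnsfun RR >-> R}); split => [|z|].
    - by rewrite mul0r sintegral_ge0.
    - by rewrite /F /patch; case: ifP => // _; rewrite lee_fin.
    - by exists 1%R.
  have [a [b [l [d' [l0 d'0 sq]]]]] := step d d0.
  have c0 : (0 <= k / (l * l))%R by rewrite divr_ge0 ?mulr_ge0 ?ltW.
  pose h' := add_nnsfun h (scale_nnsfun (indic_nnsfun R (measurable_square a b l)) c0).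
  have hE z : h' z = (h z + k / (l * l) * (z \in square a b l)%:R)%R by [].
  exists h'; split.
  - rewrite sintegralD sintegralrM sintegral_indic [X in (_ + _ * X)](_ : _ = (l * l)%:E); last exact: area_square.
    rewrite -EFinM divfK; last by rewrite mulf_neq0 // gt_eqF.
    by rewrite -natr1 mulrDl mul1r EFinD leeD.
  - move=> z; rewrite hE; case: (boolP (z \in square a b l)) => [|_].
      rewrite inE => /sq[Az _ Nz kz]; rewrite hd // add0r mulr1 /F patchE mem_set // lee_fin.
    by rewrite mulr0 addr0 hF.
  - exists (Num.min d d'); first by rewrite lt_min d0 d'0.
    move=> z; rewrite lt_min => /andP[zd zd']; rewrite hE hd // add0r.
    case: (boolP (z \in square a b l)) => [|_]; last by rewrite mulr0.
    by rewrite inE => /sq[_ Nz _ _]; move: zd'; rewrite ltNge Nz.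
move: fin; rewrite /MCInt.finite_exp_integral ge0_integralE; last by move=> z _; rewrite lee_fin.
set s := ereal_sup _ => sfin.
have sn n : (n%:R * k)%:E <= s.
  have [h [h1 h2 _]] := Ind n; apply: (le_trans h1); apply: ereal_sup_ubound; by exists h.
have s0 : 0 <= s by have := sn 0%N; rewrite mul0r.
have sE : s \is a fin_num by rewrite ge0_fin_numE.
(* An [n] for which [n k] exceeds the finite value of the integral. *)
have := sn (Num.truncn (fine s / k)).+1; rewrite -(fineK sE) lee_fin leNgt.
by rewrite -ltr_pdivrMr // truncnS_gt.
Qed.

(** The bridge to the analytic part, which uses the order and the operations of the Stdlib reals and
    describes squares by inequalities. *)
Lemma squares_not_accumulating (A : R * R -> Prop) (f N : R * R -> R) (k : R) :
  MCInt.finite_exp_integral A f -> Rlt 0%R k ->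
  (forall d, Rlt 0%R d -> exists a b l d' : R, Rlt 0%R l /\ Rlt 0%R d' /\
     forall s t, Rle a s -> Rle s (Rplus a l) -> Rle b t -> Rle t (Rplus b l) ->
     A (s, t) /\ Rle d' (N (s, t)) /\ Rlt (N (s, t)) d /\ Rle k (Rmult (Rmult l l) (Rtrigo_def.exp (f (s, t))))) -> False.
Proof.
move=> fin /RltP k0 step; apply: (infinite_area A f N k fin k0) => d /RltP d0.
have [a [b [l [d' [/RltP l0 [/RltP d'0 sq]]]]]] := step d d0.
exists a, b, l, d'; split => // -[s t] [] /=; rewrite !in_itv /= => /andP[/RleP s1 /RleP s2] /andP[/RleP t1 /RleP t2].
have [Ast [/RleP Nd [/RltP Nd' /RleP ke]]] := sq s t s1 s2 t1 t2.
by split => //; rewrite ler_pdivrMr ?mulr_gt0 // mulrC.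
Qed.
End AreaLink.

From Stdlib Require Import ZArith Lia Classical ClassicalDescription FunctionalExtensionality.
From Coquelicot Require Import Coquelicot.
Open Scope R_scope.

(** * Differentiability in the plane *)

Definition cder (f : C -> C) (z l : C) : Prop :=
  forall e, 0 < e -> exists d, 0 < d /\ forall w, Cmod (w - z) < d ->
    Cmod (f w - f z - l * (w - z)) <= e * Cmod (w - z).

(** The total differential, with gradient [(p, q)]. For the real and imaginary parts of a complex
    function, [cder] amounts to two of these linked by the Cauchy-Riemann equations ([cder_fder],
    [fder_cder]). *)
Definition fder (f : C -> R) (z : C) (p q : R) : Prop :=
  forall e, 0 < e -> exists d, 0 < d /\ forall w, Cmod (w - z) < d ->
    Rabs (f w - f z - (p * (fst w - fst z) + q * (snd w - snd z))) <= e * Cmod (w - z).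

Definition contR (f : C -> R) (z : C) : Prop :=
  forall e, 0 < e -> exists d, 0 < d /\ forall w, Cmod (w - z) < d -> Rabs (f w - f z) < e.

Ltac Cring := apply injective_projections; simpl; ring.
Tactic Notation "lt_min" constr(H) ident(A) ident(B) := assert (A := Rlt_le_trans _ _ _ H (Rmin_l _ _)); assert (B := Rlt_le_trans _ _ _ H (Rmin_r _ _)).
Tactic Notation "min_le" constr(x) constr(y) ident(A) ident(B) := assert (A := Rmin_l x y); assert (B := Rmin_r x y).

Lemma exp_le_exp x y : x <= y -> exp x <= exp y.
Proof. intros [H|H]. apply Rlt_le, exp_increasing; auto. rewrite H. lra. Qed.

Lemma Cmod_diag (z : C) : Cmod (z - z) = 0.
Proof. replace (z - z)%C with (RtoC 0) by ring. apply Cmod_0. Qed.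

Lemma ex_derive_cont (f : R -> R) x : ex_derive f x -> continuous f x.
Proof. apply (ex_derive_continuous (K := R_AbsRing) (V := R_NormedModule)). Qed.

Lemma Cmod_fst (z : C) : Rabs (fst z) <= Cmod z.
Proof. apply Rle_trans with (2 := Rmax_Cmod z), Rmax_l. Qed.

Lemma Cmod_snd (z : C) : Rabs (snd z) <= Cmod z.
Proof. apply Rle_trans with (2 := Rmax_Cmod z), Rmax_r. Qed.

Lemma Cmod_le_sum (z : C) : Cmod z <= Rabs (fst z) + Rabs (snd z).
Proof.
unfold Cmod. apply Rsqr_incr_0_var.
- rewrite Rsqr_sqrt by nra. rewrite <- (Rabs_pos_eq (fst z ^ 2)) by nra.
  rewrite <- (Rabs_pos_eq (snd z ^ 2)) by nra.
  rewrite <- !RPow_abs. unfold Rsqr.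
  generalize (Rabs_pos (fst z)) (Rabs_pos (snd z)); nra.
- generalize (Rabs_pos (fst z)) (Rabs_pos (snd z)); lra.
Qed.

Lemma fder_contR f z p q : fder f z p q -> contR f z.
Proof.
intros H e He.
destruct (H 1) as [d [Hd Hf]]; try lra.
set (A := 1 + Rabs p + Rabs q).
assert (HA : 0 < A) by (unfold A; generalize (Rabs_pos p) (Rabs_pos q); lra).
exists (Rmin d (e / A)). split.
{ apply Rmin_pos; auto. apply Rdiv_lt_0_compat; auto. }
intros w Hw.
assert (H1 := Rlt_le_trans _ _ _ Hw (Rmin_l _ _)).
assert (H2 := Rlt_le_trans _ _ _ Hw (Rmin_r _ _)).
assert (H3 := Hf w H1).
assert (H4 := Cmod_fst (w - z)). assert (H5 := Cmod_snd (w - z)). simpl in H4, H5.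
apply (Rmult_lt_compat_r A) in H2; auto.
unfold Rdiv in H2; rewrite Rmult_assoc, Rinv_l, Rmult_1_r in H2 by lra.
assert (Rabs (f w - f z) <= Cmod (w - z) * A); try lra.
replace (f w - f z) with ((f w - f z - (p * (fst w - fst z) + q * (snd w - snd z))) +
   (p * (fst w - fst z) + q * (snd w - snd z))) by ring.
eapply Rle_trans. apply Rabs_triang.
assert (Rabs (p * (fst w - fst z) + q * (snd w - snd z)) <= Rabs p * Cmod (w - z) + Rabs q * Cmod (w - z)).
{ eapply Rle_trans. apply Rabs_triang. rewrite !Rabs_mult.
  apply Rplus_le_compat; apply Rmult_le_compat_l; auto; apply Rabs_pos. }
unfold A; lra.
Qed.

Lemma contR_slice_s f x t : contR f (x, t) -> continuous (fun s => f (s, t)) x.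
Proof.
intros H. apply continuity_pt_filterlim. intros e He.
destruct (H e He) as [d [Hd Hf]]. exists d. split; auto.
intros y [_ Hy]. apply Hf. simpl in Hy. unfold R_dist in Hy.
eapply Rle_lt_trans. apply Cmod_le_sum. simpl.
replace (t + - t) with 0 by ring. rewrite Rabs_R0. unfold Rminus in Hy. lra.
Qed.

Lemma contR_slice_t f s x : contR f (s, x) -> continuous (fun t => f (s, t)) x.
Proof.
intros H. apply continuity_pt_filterlim. intros e He.
destruct (H e He) as [d [Hd Hf]]. exists d. split; auto.
intros y [_ Hy]. apply Hf. simpl in Hy. unfold R_dist in Hy.
eapply Rle_lt_trans. apply Cmod_le_sum. simpl.
replace (s + - s) with 0 by ring. rewrite Rabs_R0. unfold Rminus in Hy. lra.
Qed.

(** * Bisection of rectangles and Goursat's lemma *)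

Section Cousin.
Variable P : R -> R -> R -> Prop.
Variables a0 b0 w0 h0 : R.
Hypothesis Hw : 0 <= w0.
Hypothesis Hh : 0 <= h0.
Hypothesis Hstep : forall a b l, 0 < l <= 1 ->
  a0 <= a -> a + l * w0 <= a0 + w0 -> b0 <= b -> b + l * h0 <= b0 + h0 ->
  P a b (l / 2) -> P (a + l / 2 * w0) b (l / 2) -> P a (b + l / 2 * h0) (l / 2) ->
  P (a + l / 2 * w0) (b + l / 2 * h0) (l / 2) -> P a b l.
Hypothesis Hloc : forall x y, a0 <= x <= a0 + w0 -> b0 <= y <= b0 + h0 ->
  exists d, 0 < d /\ forall a b l, 0 < l < d -> l <= 1 ->
    a0 <= a -> a + l * w0 <= a0 + w0 -> b0 <= b -> b + l * h0 <= b0 + h0 ->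
    a <= x <= a + l * w0 -> b <= y <= b + l * h0 -> P a b l.

Let dec (Q : Prop) : bool := if excluded_middle_informative Q then true else false.

(** The fourth quarter is returned untested: if [P] fails on a rectangle and holds on three
    quarters, [Hstep] makes it fail on the fourth. All rectangles are similar to the first, so a
    single scale describes both sides. *)
Let next (p : R * R) (l : R) : R * R :=
  let (a, b) := p in
  if dec (P a b (l / 2)) then
  if dec (P (a + l / 2 * w0) b (l / 2)) then
  if dec (P a (b + l / 2 * h0) (l / 2)) then (a + l / 2 * w0, b + l / 2 * h0)
  else (a, b + l / 2 * h0) else (a + l / 2 * w0, b) else (a, b).

Let lev (n : nat) := (/ 2) ^ n.
Let sq := fix sq n := match n with O => (a0, b0) | S n => next (sq n) (lev n) end.

Let lev_pos n : 0 < lev n <= 1.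
Proof.
induction n; unfold lev in *; simpl; lra.
Qed.

(** Otherwise [P] fails on nested quarters shrinking to a point, against [Hloc] at that point. It
    serves for Goursat's lemma, for compactness and for uniform continuity. *)
Lemma cousin2 : P a0 b0 1.
Proof using Type*.
apply NNPP. intros HP.
assert (Hlev : forall n, lev (S n) = lev n / 2) by (intros; unfold lev; simpl; lra).
assert (Hn : forall n, ~ P (fst (sq n)) (snd (sq n)) (lev n) /\
  a0 <= fst (sq n) /\ fst (sq n) + lev n * w0 <= a0 + w0 /\
  b0 <= snd (sq n) /\ snd (sq n) + lev n * h0 <= b0 + h0).
{ induction n as [|n IH].
  - unfold lev; simpl. repeat split; auto; lra.
  - destruct IH as (H1 & H2 & H3 & H4 & H5).
    change (sq (S n)) with (next (sq n) (lev n)). rewrite Hlev.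
    assert (Hl := lev_pos n).
    unfold next. destruct (sq n) as [a b]. simpl in H1, H2, H3, H4, H5.
    unfold dec.
    destruct (excluded_middle_informative (P a b (lev n / 2))); simpl.
    2: { repeat split; auto; nra. }
    destruct (excluded_middle_informative (P (a + lev n / 2 * w0) b (lev n / 2))); simpl.
    2: { repeat split; auto; nra. }
    destruct (excluded_middle_informative (P a (b + lev n / 2 * h0) (lev n / 2))); simpl.
    2: { repeat split; auto; nra. }
    split. { intros H6. apply H1. apply Hstep; auto. } repeat split; nra. }
assert (Hm : forall n, fst (sq n) <= fst (sq (S n)) <= fst (sq n) + lev n / 2 * w0 /\
    snd (sq n) <= snd (sq (S n)) <= snd (sq n) + lev n / 2 * h0).
{ intros n. change (sq (S n)) with (next (sq n) (lev n)). assert (Hl := lev_pos n).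
  unfold next. destruct (sq n) as [a b]. unfold dec.
  destruct (excluded_middle_informative _); simpl; [destruct (excluded_middle_informative _); simpl; [destruct (excluded_middle_informative _); simpl|]|]; nra. }
assert (Hup : forall n m, (n <= m)%nat ->
   fst (sq n) <= fst (sq m) /\ fst (sq m) + lev m * w0 <= fst (sq n) + lev n * w0 /\
   snd (sq n) <= snd (sq m) /\ snd (sq m) + lev m * h0 <= snd (sq n) + lev n * h0).
{ intros n m H. induction H. repeat split; lra.
  rewrite Hlev. specialize (Hm m). assert (Hl := lev_pos m). repeat split; nra. }
(* Lower corners increase and upper corners decrease, so their common limit belongs to every
   rectangle of the sequence. *)
assert (Lim1 : forall u c, (forall n, u n <= u (S n)) ->
   (forall n m, (n <= m)%nat -> u m + lev m * c <= u n + lev n * c) -> 0 <= c ->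
   exists x : R, forall n, u n <= x <= u n + lev n * c).
{ intros u c Hu1 Hu2 Hc.
  destruct (ex_finite_lim_seq_incr u (u 0%nat + lev 0 * c)) as [x Hx]; auto.
  - intros n. specialize (Hu2 0%nat n ltac:(lia)). assert (Hl := lev_pos n). nra.
  - exists x. intros n. split.
    + apply (is_lim_seq_incr_compare u x); auto.
    + assert (Rbar_le x (u n + lev n * c)); auto.
      apply (is_lim_seq_le_loc u (fun _ => u n + lev n * c)); auto using is_lim_seq_const.
      exists n. intros m Hnm. specialize (Hu2 n m Hnm). assert (Hl := lev_pos m). nra. }
destruct (Lim1 (fun n => fst (sq n)) w0) as [x Hx]; auto.
{ intros; apply Hm. } { intros; apply Hup; auto. }
destruct (Lim1 (fun n => snd (sq n)) h0) as [y Hy]; auto.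
{ intros; apply Hm. } { intros; apply Hup; auto. }
destruct (Hloc x y) as [d [Hd Hl]].
- specialize (Hx O). simpl in Hx. unfold lev in Hx; simpl in Hx. lra.
- specialize (Hy O). simpl in Hy. unfold lev in Hy; simpl in Hy. lra.
- destruct (pow_lt_1_zero (/ 2) ltac:(rewrite Rabs_pos_eq; lra) d Hd) as [N HN].
  specialize (HN N ltac:(lia)). fold (lev N) in HN. assert (Hp := lev_pos N).
  rewrite Rabs_pos_eq in HN by lra.
  destruct (Hn N) as (H1 & H2 & H3 & H4 & H5).
  apply H1. apply Hl; auto; try lra.
Qed.
End Cousin.

(** The counterclockwise integral of the form [al ds + be dt] around the rectangle with corner
    [(a, b)] and sides [w], [h]. *)
Definition RI (al be : C -> R) (a b w h : R) : R :=
  RInt (fun s => al (s, b)) a (a + w) + RInt (fun t => be (a + w, t)) b (b + h)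
  - RInt (fun s => al (s, b + h)) a (a + w) - RInt (fun t => be (a, t)) b (b + h).

Definition inrect (a b w h : R) (z : C) : Prop :=
  a <= fst z <= a + w /\ b <= snd z <= b + h.

Section RectInt.
Variables al be : C -> R.
Variables a0 b0 w0 h0 : R.
Hypothesis Ha : forall z, inrect a0 b0 w0 h0 z -> contR al z.
Hypothesis Hb : forall z, inrect a0 b0 w0 h0 z -> contR be z.

Lemma ex_RInt_slice_s x y t : a0 <= x -> x <= y -> y <= a0 + w0 -> b0 <= t <= b0 + h0 ->
  ex_RInt (fun s => al (s, t)) x y.
Proof using Ha.
intros. apply (ex_RInt_continuous (V := R_CompleteNormedModule)).
intros s. rewrite Rmin_left, Rmax_right by lra. intros Hs.
apply contR_slice_s, Ha. unfold inrect; simpl; lra.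
Qed.

Lemma ex_RInt_slice_t s x y : b0 <= x -> x <= y -> y <= b0 + h0 -> a0 <= s <= a0 + w0 ->
  ex_RInt (fun t => be (s, t)) x y.
Proof using Hb.
intros. apply (ex_RInt_continuous (V := R_CompleteNormedModule)).
intros t. rewrite Rmin_left, Rmax_right by lra. intros Hs.
apply contR_slice_t, Hb. unfold inrect; simpl; lra.
Qed.

Lemma RI_vsplit a b w1 w2 h : 0 <= w1 -> 0 <= w2 -> 0 <= h ->
  a0 <= a -> a + w1 + w2 <= a0 + w0 -> b0 <= b -> b + h <= b0 + h0 ->
  RI al be a b (w1 + w2) h = RI al be a b w1 h + RI al be (a + w1) b w2 h.
Proof using Ha Hb.
intros. unfold RI.
rewrite <- (RInt_Chasles (fun s => al (s, b)) a (a + w1) (a + (w1 + w2))) by (apply ex_RInt_slice_s; lra).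
rewrite <- (RInt_Chasles (fun s => al (s, b + h)) a (a + w1) (a + (w1 + w2))) by (apply ex_RInt_slice_s; lra).
unfold plus; simpl. replace (a + w1 + w2) with (a + (w1 + w2)) by ring. ring.
Qed.

Lemma RI_hsplit a b w h1 h2 : 0 <= h1 -> 0 <= h2 -> 0 <= w ->
  a0 <= a -> a + w <= a0 + w0 -> b0 <= b -> b + h1 + h2 <= b0 + h0 ->
  RI al be a b w (h1 + h2) = RI al be a b w h1 + RI al be a (b + h1) w h2.
Proof using Ha Hb.
intros. unfold RI.
rewrite <- (RInt_Chasles (fun t => be (a, t)) b (b + h1) (b + (h1 + h2))) by (apply ex_RInt_slice_t; lra).
rewrite <- (RInt_Chasles (fun t => be (a + w, t)) b (b + h1) (b + (h1 + h2))) by (apply ex_RInt_slice_t; lra).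
unfold plus; simpl. replace (b + h1 + h2) with (b + (h1 + h2)) by ring. ring.
Qed.
End RectInt.

Lemma RInt_near_const f a w c e : 0 <= w -> ex_RInt f a (a + w) ->
  (forall x, a <= x <= a + w -> Rabs (f x - c) <= e) -> Rabs (RInt f a (a + w) - c * w) <= e * w.
Proof.
intros Hw Hf H.
assert (Hc : RInt (fun _ => c) a (a + w) = w * c).
{ rewrite RInt_const. change ((a + w - a) * c = w * c :> R). ring. }
rewrite (Rmult_comm c w), <- Hc.
change (Rabs (minus (RInt f a (a + w)) (RInt (fun _ => c) a (a + w))) <= e * w).
rewrite <- (RInt_minus f (fun _ => c)); auto. 2: apply ex_RInt_const.
eapply Rle_trans.
apply (abs_RInt_le_const _ a (a + w) e); try lra.
- apply (ex_RInt_minus f (fun _ => c)); auto. apply ex_RInt_const.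
- intros t Ht. apply H; auto.
- right; ring.
Qed.

(** Goursat's argument for a real form that is closed in the pointwise sense [al_t = be_s], without
    continuity of the derivatives: at each point the affine parts of [al] and [be] integrate to [0]
    by that symmetry, and only the error of linearisation is left. *)
Lemma goursat_form al be a0 b0 w0 h0 : 0 <= w0 -> 0 <= h0 ->
  (forall z, inrect a0 b0 w0 h0 z -> exists p q r, fder al z p q /\ fder be z q r) ->
  RI al be a0 b0 w0 h0 = 0.
Proof.
intros Hw Hh Hd.
assert (Ha : forall z, inrect a0 b0 w0 h0 z -> contR al z).
{ intros z Hz. destruct (Hd z Hz) as (p & q & r & H & _). eapply fder_contR; eauto. }
assert (Hb : forall z, inrect a0 b0 w0 h0 z -> contR be z).
{ intros z Hz. destruct (Hd z Hz) as (p & q & r & _ & H). eapply fder_contR; eauto. }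
assert (Hmain : forall e, 0 < e -> Rabs (RI al be a0 b0 w0 h0) <= e).
2: { destruct (Req_dec (RI al be a0 b0 w0 h0) 0) as [|Hne]; auto.
     apply Rabs_pos_lt in Hne. specialize (Hmain (Rabs (RI al be a0 b0 w0 h0) / 2)). lra. }
intros e He.
(* With this [A] the linearisation errors on the four sides add up to at most [e l ^ 2], a bound
   that is additive under quartering. *)
set (A := 8 * (w0 + h0 + 1) * (w0 + h0 + 1)).
assert (HA : 0 < A) by (unfold A; nra).
set (P := fun a b l => Rabs (RI al be a b (l * w0) (l * h0)) <= e * (l * l)).
assert (HP : P a0 b0 1).
2: { unfold P in HP. rewrite !Rmult_1_l in HP. lra. }
apply cousin2 with w0 h0; auto.
- intros a b l Hl H1 H2 H3 H4 P1 P2 P3 P4. unfold P in *.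
  replace (l * w0) with (l / 2 * w0 + l / 2 * w0) by field.
  replace (l * h0) with (l / 2 * h0 + l / 2 * h0) by field.
  assert (0 <= l / 2 * w0) by nra. assert (0 <= l / 2 * h0) by nra.
  rewrite (RI_vsplit al be a0 b0 w0 h0) by (auto; lra).
  rewrite !(RI_hsplit al be a0 b0 w0 h0) by (auto; lra).
  eapply Rle_trans. apply Rabs_triang.
  generalize (Rabs_triang (RI al be a b (l / 2 * w0) (l / 2 * h0)) (RI al be a (b + l / 2 * h0) (l / 2 * w0) (l / 2 * h0))).
  generalize (Rabs_triang (RI al be (a + l / 2 * w0) b (l / 2 * w0) (l / 2 * h0)) (RI al be (a + l / 2 * w0) (b + l / 2 * h0) (l / 2 * w0) (l / 2 * h0))).
  nra.
- intros x y Hx Hy.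
  destruct (Hd (x, y)) as (p & q & r & Hal & Hbe). { split; simpl; lra. }
  assert (He' : 0 < e / A) by (apply Rdiv_lt_0_compat; auto).
  destruct (Hal _ He') as [d1 [Hd1 F1]]. destruct (Hbe _ He') as [d2 [Hd2 F2]].
  exists (Rmin d1 d2 / (w0 + h0 + 1)). split.
  { apply Rdiv_lt_0_compat; try lra. apply Rmin_pos; auto. }
  intros a b l [Hl0 Hl] Hl1 H1 H2 H3 H4 H5 H6. unfold P.
  apply (Rmult_lt_compat_r (w0 + h0 + 1)) in Hl; try lra.
  unfold Rdiv in Hl; rewrite Rmult_assoc, Rinv_l, Rmult_1_r in Hl by lra.
  set (D := l * (w0 + h0 + 1)) in *.
  assert (Dist : forall s t, a <= s <= a + l * w0 -> b <= t <= b + l * h0 -> Cmod ((s, t) - (x, y)) <= D).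
  { intros s t Hs Ht. eapply Rle_trans. apply Cmod_le_sum. simpl.
    assert (Rabs (s + - x) <= l * w0) by (apply Rabs_le; lra).
    assert (Rabs (t + - y) <= l * h0) by (apply Rabs_le; lra). unfold D; lra. }
  assert (G1 : forall s t, a <= s <= a + l * w0 -> b <= t <= b + l * h0 ->
     Rabs (al (s, t) - al (x, y) - (p * (s - x) + q * (t - y))) <= e / A * D).
  { intros s t Hs Ht. assert (Hdd := Dist s t Hs Ht).
    eapply Rle_trans. apply (F1 (s, t)).
    - eapply Rle_lt_trans. apply Hdd. eapply Rlt_le_trans. apply Hl. apply Rmin_l.
    - apply Rmult_le_compat_l; lra. }
  assert (G2 : forall s t, a <= s <= a + l * w0 -> b <= t <= b + l * h0 ->
     Rabs (be (s, t) - be (x, y) - (q * (s - x) + r * (t - y))) <= e / A * D).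
  { intros s t Hs Ht. assert (Hdd := Dist s t Hs Ht).
    eapply Rle_trans. apply (F2 (s, t)).
    - eapply Rle_lt_trans. apply Hdd. eapply Rlt_le_trans. apply Hl. apply Rmin_r.
    - apply Rmult_le_compat_l; lra. }
  assert (W : 0 <= l * w0) by nra. assert (Hg : 0 <= l * h0) by nra.
  assert (K1 : Rabs (RInt (fun s => al (s, b) - al (s, b + l * h0)) a (a + l * w0) - (- (q * (l * h0))) * (l * w0)) <= (2 * (e / A * D)) * (l * w0)).
  { apply RInt_near_const; auto.
    - apply (ex_RInt_minus (fun s => al (s, b)) (fun s => al (s, b + l * h0)));
        apply (ex_RInt_slice_s al a0 b0 w0 h0); auto; lra.
    - intros s Hs. assert (E1 := G1 s b Hs ltac:(lra)). assert (E2 := G1 s (b + l * h0) Hs ltac:(lra)).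
      apply Rabs_le_between in E1. apply Rabs_le_between in E2. apply Rabs_le. lra. }
  assert (K2 : Rabs (RInt (fun t => be (a + l * w0, t) - be (a, t)) b (b + l * h0) - (q * (l * w0)) * (l * h0)) <= (2 * (e / A * D)) * (l * h0)).
  { apply RInt_near_const; auto.
    - apply (ex_RInt_minus (fun t => be (a + l * w0, t)) (fun t => be (a, t)));
        apply (ex_RInt_slice_t be a0 b0 w0 h0); auto; lra.
    - intros s Hs. assert (E1 := G2 (a + l * w0) s ltac:(lra) Hs). assert (E2 := G2 a s ltac:(lra) Hs).
      apply Rabs_le_between in E1. apply Rabs_le_between in E2. apply Rabs_le. lra. }
  rewrite (RInt_minus (fun s => al (s, b)) (fun s => al (s, b + l * h0))) in K1
    by (apply (ex_RInt_slice_s al a0 b0 w0 h0); auto; lra).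
  rewrite (RInt_minus (fun t => be (a + l * w0, t)) (fun t => be (a, t))) in K2
    by (apply (ex_RInt_slice_t be a0 b0 w0 h0); auto; lra).
  unfold minus, plus, opp in K1, K2; simpl in K1, K2.
  unfold RI. apply Rabs_le_between in K1. apply Rabs_le_between in K2.
  assert (2 * (e / A * D) * (l * w0) + 2 * (e / A * D) * (l * h0) <= e * (l * l)).
  { replace (2 * (e / A * D) * (l * w0) + 2 * (e / A * D) * (l * h0)) with
      ((e * (l * l)) * ((2 * (w0 + h0 + 1) * (w0 + h0)) / A)) by (unfold D; field; lra).
    rewrite <- (Rmult_1_r (e * (l * l))) at 2. apply Rmult_le_compat_l. nra.
    apply Rle_div_l; auto. unfold A. nra. }
  apply Rabs_le. lra.
Qed.

(* If the supremum were not attained, [1 / (sup f - f)] would be locally bounded, hence bounded. *)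
Lemma compact_max (S : C -> Prop) (f : C -> R) (B : R) (z0 : C) :
  S z0 ->
  (forall z, S z -> Rabs (fst z) <= B /\ Rabs (snd z) <= B) ->
  (forall z, ~ S z -> exists d, 0 < d /\ forall w, Cmod (w - z) < d -> ~ S w) ->
  (forall z, S z -> forall e, 0 < e -> exists d, 0 < d /\
     forall w, S w -> Cmod (w - z) < d -> Rabs (f w - f z) < e) ->
  exists z, S z /\ forall w, S w -> f w <= f z.
Proof.
intros Hz0 HB Hcl Hf.
assert (HB0 : 0 <= B). { generalize (HB z0 Hz0) (Rabs_pos (fst z0)); lra. }
assert (bd : forall g : C -> R, (forall z, S z -> exists d M, 0 < d /\
     forall w, S w -> Cmod (w - z) < d -> g w <= M) -> exists M, forall w, S w -> g w <= M).
{ intros g Hg.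
  set (P := fun a b l : R => exists M, forall w, S w -> inrect a b (l * (2 * B)) (l * (2 * B)) w -> g w <= M).
  assert (HP : P (- B) (- B) 1).
  - apply cousin2 with (2 * B) (2 * B); try lra.
    + intros a b l Hl _ _ _ _ [M1 P1] [M2 P2] [M3 P3] [M4 P4].
      exists (Rmax (Rmax M1 M2) (Rmax M3 M4)). intros w Hw [Hx Hy].
      assert (X1 := Rmax_l (Rmax M1 M2) (Rmax M3 M4)). assert (X2 := Rmax_r (Rmax M1 M2) (Rmax M3 M4)).
      assert (X3 := Rmax_l M1 M2). assert (X4 := Rmax_r M1 M2).
      assert (X5 := Rmax_l M3 M4). assert (X6 := Rmax_r M3 M4).
      destruct (Rle_dec (fst w) (a + l / 2 * (2 * B))); destruct (Rle_dec (snd w) (b + l / 2 * (2 * B))).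
      * assert (g w <= M1) by (apply P1; auto; split; lra). lra.
      * assert (g w <= M3) by (apply P3; auto; split; lra). lra.
      * assert (g w <= M2) by (apply P2; auto; split; lra). lra.
      * assert (g w <= M4) by (apply P4; auto; split; lra). lra.
    + intros x y Hx Hy.
      assert (H : exists d M, 0 < d /\ forall w, S w -> Cmod (w - (x, y)) < d -> g w <= M).
      { destruct (classic (S (x, y))) as [Hs|Hs]. apply Hg; auto.
        destruct (Hcl _ Hs) as [d [Hd H]]. exists d, 0. split; auto. intros w Hw Hd'. elim (H w); auto. }
      destruct H as (d & M & Hd & H).
      exists (d / (4 * B + 1)). split. apply Rdiv_lt_0_compat; lra.
      intros a b l [Hl0 Hl] Hl1 _ _ _ _ H5 H6. exists M. intros w Hw [W1 W2].
      apply H; auto. eapply Rle_lt_trans. apply Cmod_le_sum. simpl.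
      apply (Rmult_lt_compat_r (4 * B + 1)) in Hl; try lra.
      unfold Rdiv in Hl; rewrite Rmult_assoc, Rinv_l, Rmult_1_r in Hl by lra.
      assert (Rabs (fst w + - x) <= l * (2 * B)) by (apply Rabs_le; lra).
      assert (Rabs (snd w + - y) <= l * (2 * B)) by (apply Rabs_le; lra). lra.
  - destruct HP as [M HM]. exists M. intros w Hw. apply HM; auto.
    destruct (HB w Hw) as [H1 H2]. apply Rabs_le_between in H1. apply Rabs_le_between in H2.
    split; lra. }
destruct (bd f) as [M HM].
{ intros z Hz. destruct (Hf z Hz 1) as [d [Hd H]]; try lra. exists d, (f z + 1). split; auto.
  intros w Hw Hd'. specialize (H w Hw Hd'). apply Rabs_lt_between in H. lra. }
destruct (completeness (fun y => exists z, S z /\ y = f z)) as [m [Hm1 Hm2]].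
{ exists M. intros y [z [Hz ->]]; auto. }
{ exists (f z0), z0; auto. }
apply NNPP. intros Hno.
assert (Hlt : forall z, S z -> f z < m).
{ intros z Hz. destruct (Rle_lt_or_eq_dec (f z) m); auto. { apply Hm1; exists z; auto. }
  elim Hno. exists z. split; auto. intros w Hw. rewrite e. apply Hm1. exists w; auto. }
destruct (bd (fun z => / (m - f z))) as [N HN].
{ intros z Hz. specialize (Hlt z Hz). destruct (Hf z Hz ((m - f z) / 2)) as [d [Hd H]]; try lra.
  exists d, (/ ((m - f z) / 2)). split; auto. intros w Hw Hd'. specialize (H w Hw Hd').
  apply Rabs_lt_between in H. apply Rinv_le_contravar; lra. }
assert (HN0 : 0 < N). { eapply Rlt_le_trans. 2: apply (HN z0 Hz0). apply Rinv_0_lt_compat. specialize (Hlt z0 Hz0). lra. }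
assert (m <= m - / N). 2: { assert (0 < / N) by (apply Rinv_0_lt_compat; auto). lra. }
apply Hm2. intros y [z [Hz ->]]. specialize (HN z Hz). specialize (Hlt z Hz).
apply Rinv_le_contravar in HN. 2: apply Rinv_0_lt_compat; lra.
rewrite Rinv_inv in HN. lra.
Qed.

(** * Calculus of complex derivatives *)

Ltac cder_is_derive_for V :=
  split; intros H;
  [ split; [apply (is_linear_scal_l (K := C_AbsRing) (V := V))|];
    let x := fresh in let Hx := fresh in intros x Hx e;
    rewrite <- (is_filter_lim_locally_unique (V := AbsRing_NormedModule C_AbsRing) _ x Hx);
    destruct (H e (cond_pos e)) as [d [Hd Hf]];
    exists (mkposreal d Hd); intros w Hw; specialize (Hf w Hw); rewrite Cmult_comm in Hf; exact Hf
  | destruct H as [_ H]; intros e He;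
    destruct (H _ (fun P HP => HP) (mkposreal e He)) as [d Hf];
    exists d; split; [apply cond_pos|]; intros w Hw; specialize (Hf w Hw); rewrite Cmult_comm; exact Hf ].

Lemma cder_is_derive (f : C -> C) (z l : C) :
  cder f z l <-> is_derive (K := C_AbsRing) (V := C_NormedModule) f z l.
Proof. cder_is_derive_for C_NormedModule. Qed.

(** The product rule and the inner function of the chain rule are typed with the absolute ring
    [C_AbsRing] as a module over itself, the other rules with [C_NormedModule]; hence two forms. *)
Lemma cder_is_derive_abs (f : C -> C) (z l : C) :
  cder f z l <-> is_derive (K := C_AbsRing) (V := AbsRing_NormedModule C_AbsRing) f z l.
Proof. cder_is_derive_for (AbsRing_NormedModule C_AbsRing). Qed.

Lemma cder_ext f g z l : (exists d, 0 < d /\ forall w, Cmod (w - z) < d -> f w = g w) ->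
  cder f z l -> cder g z l.
Proof.
intros [d [Hd E]] H e He. destruct (H e He) as [d' [Hd' H']].
exists (Rmin d d'). split. apply Rmin_pos; auto. intros w Hw.
rewrite <- !E. apply H'. eapply Rlt_le_trans; [apply Hw|apply Rmin_r].
rewrite Cmod_diag; auto.
eapply Rlt_le_trans; [apply Hw|apply Rmin_l].
Qed.

Lemma cder_const c z : cder (fun _ => c) z 0.
Proof. apply cder_is_derive. apply (is_derive_const (K := C_AbsRing) (V := C_NormedModule)). Qed.

Lemma cder_id z : cder (fun w => w) z 1.
Proof. intros e He. exists 1. split; try lra. intros w _. replace (w - z - 1 * (w - z))%C with (RtoC 0) by ring.
rewrite Cmod_0. apply Rmult_le_pos; try lra. apply Cmod_ge_0. Qed.

Lemma cder_plus f g z l m : cder f z l -> cder g z m -> cder (fun w => f w + g w)%C z (l + m)%C.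
Proof. rewrite !cder_is_derive. apply (is_derive_plus (K := C_AbsRing) (V := C_NormedModule)). Qed.

Lemma cder_mult f g z l m : cder f z l -> cder g z m ->
  cder (fun w => f w * g w)%C z (l * g z + f z * m)%C.
Proof.
rewrite !cder_is_derive_abs. intros H1 H2.
apply (is_derive_mult (K := C_AbsRing) f g z l m H1 H2). intros; apply Cmult_comm.
Qed.

Lemma cder_eq f z l m : l = m -> cder f z l -> cder f z m.
Proof. intros ->; auto. Qed.

Lemma cder_scal c f z l : cder f z l -> cder (fun w => c * f w)%C z (c * l)%C.
Proof.
intros H. eapply cder_eq. 2: apply cder_mult; [apply cder_const|exact H]. cbv beta; ring.
Qed.

Lemma cder_minus f g z l m : cder f z l -> cder g z m -> cder (fun w => f w - g w)%C z (l - m)%C.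
Proof. rewrite !cder_is_derive. apply (is_derive_minus (K := C_AbsRing) (V := C_NormedModule)). Qed.

Lemma cder_unique f z l m : cder f z l -> cder f z m -> l = m.
Proof.
rewrite !cder_is_derive. intros H1 H2.
rewrite <- (is_C_derive_unique f z l H1). apply (is_C_derive_unique f z m H2).
Qed.

Lemma cder_comp f g z l m : cder g z l -> cder f (g z) m -> cder (fun w => f (g w)) z (m * l)%C.
Proof.
rewrite (cder_is_derive f), (cder_is_derive_abs g), (cder_is_derive (fun w => f (g w))).
intros H1 H2. rewrite Cmult_comm.
apply (is_derive_comp (K := C_AbsRing) (V := C_NormedModule) f g z m l H2 H1).
Qed.

Lemma cder_pow n z : cder (fun w => w ^ n)%C z (INR n * z ^ pred n)%C.
Proof.
induction n as [|n IH].
- simpl. eapply cder_eq. 2: apply cder_const. simpl. ring.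
- eapply cder_eq. 2: apply (cder_mult (fun w => w) (fun w => w ^ n)%C z 1 _ (cder_id z) IH).
  rewrite S_INR, RtoC_plus. destruct n; [simpl|cbn [pred Cpow]]; ring.
Qed.

Definition ccont (f : C -> C) (z : C) : Prop :=
  forall e, 0 < e -> exists d, 0 < d /\ forall w, Cmod (w - z) < d -> Cmod (f w - f z) < e.

Lemma ccont_pair f z : contR (fun w => fst (f w)) z -> contR (fun w => snd (f w)) z -> ccont f z.
Proof.
intros H1 H2 e He.
destruct (H1 (e / 2)) as [d1 [Hd1 F1]]; try lra. destruct (H2 (e / 2)) as [d2 [Hd2 F2]]; try lra.
exists (Rmin d1 d2). split. apply Rmin_pos; auto. intros w Hw.
eapply Rle_lt_trans. apply Cmod_le_sum. simpl.
specialize (F1 w (Rlt_le_trans _ _ _ Hw (Rmin_l _ _))). specialize (F2 w (Rlt_le_trans _ _ _ Hw (Rmin_r _ _))).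
unfold Rminus in *. lra.
Qed.

Lemma ccont_fst f z : ccont f z -> contR (fun w => fst (f w)) z.
Proof.
intros H e He. destruct (H e He) as [d [Hd F]]. exists d. split; auto. intros w Hw.
eapply Rle_lt_trans. 2: apply (F w Hw). apply (Cmod_fst (f w - f z)).
Qed.

Lemma ccont_snd f z : ccont f z -> contR (fun w => snd (f w)) z.
Proof.
intros H e He. destruct (H e He) as [d [Hd F]]. exists d. split; auto. intros w Hw.
eapply Rle_lt_trans. 2: apply (F w Hw). apply (Cmod_snd (f w - f z)).
Qed.

Lemma cder_fder f z l : cder f z l ->
  fder (fun w => fst (f w)) z (fst l) (- snd l) /\ fder (fun w => snd (f w)) z (snd l) (fst l).
Proof.
intros H. split; intros e He; destruct (H e He) as [d [Hd F]]; exists d; split; auto; intros w Hw;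
 (eapply Rle_trans; [|apply (F w Hw)]).
- eapply Rle_trans. 2: apply Cmod_fst. right. f_equal. simpl. ring.
- eapply Rle_trans. 2: apply Cmod_snd. right. f_equal. simpl. ring.
Qed.

Lemma fder_cder f z p q : fder (fun w => fst (f w)) z p (- q) -> fder (fun w => snd (f w)) z q p ->
  cder f z (p, q).
Proof.
intros H1 H2 e He.
destruct (H1 (e / 2)) as [d1 [Hd1 F1]]; try lra. destruct (H2 (e / 2)) as [d2 [Hd2 F2]]; try lra.
exists (Rmin d1 d2). split. apply Rmin_pos; auto. intros w Hw.
eapply Rle_trans. apply Cmod_le_sum.
specialize (F1 w (Rlt_le_trans _ _ _ Hw (Rmin_l _ _))). specialize (F2 w (Rlt_le_trans _ _ _ Hw (Rmin_r _ _))).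
match goal with |- Rabs ?x + Rabs ?y <= _ =>
 replace x with (fst (f w) - fst (f z) - (p * (fst w - fst z) + - q * (snd w - snd z))) by (simpl; ring);
 replace y with (snd (f w) - snd (f z) - (q * (fst w - fst z) + p * (snd w - snd z))) by (simpl; ring) end.
lra.
Qed.

Lemma cder_ccont f z l : cder f z l -> ccont f z.
Proof.
intros H. apply cder_fder in H. destruct H as [H1 H2].
apply ccont_pair; eapply fder_contR; eauto.
Qed.

Lemma ccont_mult f g z : ccont f z -> ccont g z -> ccont (fun w => f w * g w)%C z.
Proof.
intros Hf Hg e He.
set (A := 1 + Cmod (f z) + Cmod (g z)).
assert (P1 := Cmod_ge_0 (f z)). assert (P2 := Cmod_ge_0 (g z)).
assert (He' : 0 < Rmin 1 (e / (2 * A))).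
{ apply Rmin_pos; try lra. apply Rdiv_lt_0_compat; unfold A; lra. }
destruct (Hf _ He') as [d1 [Hd1 F1]]. destruct (Hg _ He') as [d2 [Hd2 F2]].
exists (Rmin d1 d2). split. apply Rmin_pos; auto. intros w Hw.
specialize (F1 w (Rlt_le_trans _ _ _ Hw (Rmin_l _ _))). specialize (F2 w (Rlt_le_trans _ _ _ Hw (Rmin_r _ _))).
replace (f w * g w - f z * g z)%C with ((f w - f z) * (g w - g z) + (f w - f z) * g z + f z * (g w - g z))%C by ring.
eapply Rle_lt_trans. apply Cmod_triangle. eapply Rle_lt_trans. apply Rplus_le_compat_r. apply Cmod_triangle.
rewrite !Cmod_mult.
set (x := Cmod (f w - f z)) in *. set (y := Cmod (g w - g z)) in *.
assert (0 <= x) by apply Cmod_ge_0. assert (0 <= y) by apply Cmod_ge_0.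
assert (x < 1) by (eapply Rlt_le_trans; [apply F1|apply Rmin_l]).
assert (Hx : x < e / (2 * A)) by (eapply Rlt_le_trans; [apply F1|apply Rmin_r]).
assert (Hy : y < e / (2 * A)) by (eapply Rlt_le_trans; [apply F2|apply Rmin_r]).
apply Rlt_le_trans with (2 * A * (e / (2 * A))). 2: { right; field. unfold A; lra. }
unfold A in *. set (m := e / (2 * (1 + Cmod (f z) + Cmod (g z)))) in *. nra.
Qed.

Lemma ccont_neq f z c : ccont f z -> f z <> c ->
  exists d, 0 < d /\ forall w, Cmod (w - z) < d -> f w <> c.
Proof.
intros H Hz. destruct (H (Cmod (f z - c))) as [d [Hd F]].
{ apply Cmod_gt_0. intros E. apply Hz. replace (f z) with (f z - c + c)%C by ring. rewrite E. ring. }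
exists d. split; auto. intros w Hw E. specialize (F w Hw). rewrite E in F.
replace (c - f z)%C with (- (f z - c))%C in F by ring. rewrite Cmod_opp in F. lra.
Qed.

Lemma cder_inv f z l : cder f z l -> f z <> 0 -> cder (fun w => / f w)%C z (- l / (f z * f z))%C.
Proof.
intros H Hz.
assert (Hinv : cder (fun w => / w)%C (f z) (- / (f z * f z))%C).
{ set (a := f z) in *. intros e He.
  assert (Ha : 0 < Cmod a) by (apply Cmod_gt_0; auto).
  exists (Rmin (Cmod a / 2) (e * Cmod a ^ 3 / 2)). split.
  { apply Rmin_pos; try lra. assert (0 < e * Cmod a ^ 3). apply Rmult_lt_0_compat; auto. apply pow_lt; auto. lra. }
  intros w Hw.
  lt_min Hw W1 W2.
  assert (W3 : Cmod a / 2 < Cmod w).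
  { assert (T := Cmod_triangle w (- (w - a))). rewrite Cmod_opp in T.
    replace (w + - (w - a))%C with a in T by ring. lra. }
  assert (Hw0 : w <> 0). { intros ->. rewrite Cmod_0 in W3. lra. }
  replace (/ w - / a - - / (a * a) * (w - a))%C with ((w - a) * (w - a) / (w * (a * a)))%C by (field; auto).
  rewrite Cmod_div. 2: { repeat apply Cmult_neq_0; auto. }
  rewrite !Cmod_mult. set (x := Cmod (w - a)) in *.
  assert (0 <= x) by apply Cmod_ge_0.
  apply Rle_div_l. { apply Rmult_lt_0_compat; nra. }
  apply Rle_trans with (e * x * (Cmod a / 2 * (Cmod a * Cmod a))).
  - replace (e * x * (Cmod a / 2 * (Cmod a * Cmod a))) with (x * (e * Cmod a ^ 3 / 2)) by field.
    apply Rmult_le_compat_l; lra.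
  - apply Rmult_le_compat_l. nra. apply Rmult_le_compat_r; nra. }
eapply cder_eq. 2: apply (cder_comp (fun w => / w)%C f z _ _ H Hinv). field; auto.
Qed.

Lemma cder_div f g z l m : cder f z l -> cder g z m -> g z <> 0 ->
  cder (fun w => f w / g w)%C z ((l * g z - f z * m) / (g z * g z))%C.
Proof.
intros H1 H2 Hz. eapply cder_eq. 2: apply (cder_mult f (fun w => / g w)%C); [exact H1|apply cder_inv; eauto].
cbv beta; field; auto.
Qed.

(** * Power series *)

(** The sum over [k < n], one term fewer than [sum_n], so that the remainder of a geometric
    expansion starts at [zeta ^ n]. *)
Fixpoint csum (u : nat -> C) (n : nat) : C :=
  match n with O => 0 | S n => csum u n + u n end.

(** Radius of convergence at least [R0], in Abel's form: the terms are bounded on each smaller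
    circle. The algebra of series preserves this by elementary estimates. *)
Definition cvr (a : nat -> C) (R0 : R) : Prop :=
  forall r, 0 < r < R0 -> exists M, forall n, Cmod (a n) * r ^ n <= M.

Definition is_PS (a : nat -> C) (z l : C) : Prop :=
  forall e, 0 < e -> exists N, forall n, (N <= n)%nat -> Cmod (csum (fun k => a k * z ^ k)%C n - l) < e.

(** Summed by real and imaginary parts so as to be total; inside the disc of convergence it is the
    limit of the partial sums ([PS_is]). *)
Definition PS (a : nat -> C) (z : C) : C :=
  (Series (fun k => fst (a k * z ^ k)%C), Series (fun k => snd (a k * z ^ k)%C)).

Lemma csum_fst u n : fst (csum u (S n)) = sum_n (fun k => fst (u k)) n.
Proof.
induction n. rewrite sum_O. simpl. ring.
rewrite sum_Sn, <- IHn. reflexivity.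
Qed.

Lemma csum_snd u n : snd (csum u (S n)) = sum_n (fun k => snd (u k)) n.
Proof.
induction n. rewrite sum_O. simpl. ring.
rewrite sum_Sn, <- IHn. reflexivity.
Qed.

Lemma Cmod_le_all (x : C) : (forall e, 0 < e -> Cmod x <= e) -> x = 0.
Proof.
intros H. apply Cmod_eq_0. assert (P := Cmod_ge_0 x).
destruct (Req_dec (Cmod x) 0); auto. specialize (H (Cmod x / 2)). lra.
Qed.

Lemma is_PS_unique a z l m : is_PS a z l -> is_PS a z m -> l = m.
Proof.
intros H1 H2. assert (l - m = 0)%C. 2: { replace l with (l - m + m)%C by ring. rewrite H; ring. }
apply Cmod_le_all. intros e He.
destruct (H1 (e / 2)) as [N1 F1]; try lra. destruct (H2 (e / 2)) as [N2 F2]; try lra.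
specialize (F1 (N1 + N2)%nat ltac:(lia)). specialize (F2 (N1 + N2)%nat ltac:(lia)).
set (s := csum _ _) in *. replace (l - m)%C with ((s - m) + - (s - l))%C by ring.
eapply Rle_trans. apply Cmod_triangle. rewrite Cmod_opp. lra.
Qed.

Lemma geom_small q e M : 0 <= q < 1 -> 0 < e -> 0 <= M -> exists N, forall n, (N <= n)%nat -> M * q ^ n < e.
Proof.
intros Hq He HM.
destruct (pow_lt_1_zero q ltac:(rewrite Rabs_pos_eq; lra) (e / (M + 1)) ltac:(apply Rdiv_lt_0_compat; lra)) as [N H].
exists N. intros n Hn. specialize (H n Hn).
assert (0 <= q ^ n) by (apply pow_le; lra). rewrite Rabs_pos_eq in H by auto.
apply (Rmult_lt_compat_r (M + 1)) in H; try lra.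
unfold Rdiv in H. rewrite Rmult_assoc, Rinv_l, Rmult_1_r in H by lra. nra.
Qed.

Lemma csum_tail (u : nat -> C) M q : 0 <= q < 1 -> (forall n, Cmod (u n) <= M * q ^ n) ->
  forall n m, (n <= m)%nat -> Cmod (csum u m - csum u n) <= M / (1 - q) * (q ^ n - q ^ m).
Proof.
intros Hq H n m Hnm. induction Hnm.
- replace (csum u n - csum u n)%C with (RtoC 0) by ring. rewrite Cmod_0. right; field. lra.
- simpl. replace (csum u m + u m - csum u n)%C with ((csum u m - csum u n) + u m)%C by ring.
  eapply Rle_trans. apply Cmod_triangle. specialize (H m).
  replace (M / (1 - q) * (q ^ n - q * q ^ m)) with (M / (1 - q) * (q ^ n - q ^ m) + M * q ^ m) by (field; lra).
  lra.
Qed.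

Lemma PS_is a R0 z : cvr a R0 -> Cmod z < R0 -> is_PS a z (PS a z).
Proof.
intros Ha Hz. assert (Pz := Cmod_ge_0 z).
destruct (Ha ((Cmod z + R0) / 2)) as [M HM]; try lra.
set (r := (Cmod z + R0) / 2) in *. assert (Hr : 0 < r) by (unfold r; lra).
set (q := Cmod z / r). assert (Hq : 0 <= q < 1).
{ split. apply Rdiv_le_0_compat; lra. apply Rlt_div_l; unfold r; lra. }
assert (HM0 : 0 <= M). { eapply Rle_trans. 2: apply (HM O). simpl. rewrite Rmult_1_r. apply Cmod_ge_0. }
assert (Hu : forall n, Cmod (a n * z ^ n)%C <= M * q ^ n).
{ intros n. rewrite Cmod_mult, Cmod_pow. specialize (HM n).
  replace (Cmod z) with (q * r) by (unfold q; field; lra). rewrite Rpow_mult_distr.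
  assert (0 <= q ^ n) by (apply pow_le; lra). nra. }
assert (E : forall g : C -> R, (forall x, Rabs (g x) <= Cmod x) -> ex_series (fun n => g (a n * z ^ n)%C)).
{ intros g Hg. apply (ex_series_le (V := R_CompleteNormedModule) _ (fun n => M * q ^ n)).
  - intros n. eapply Rle_trans. apply Hg. apply Hu.
  - apply (ex_series_scal (K := R_AbsRing) (V := R_NormedModule) M). apply ex_series_geom. rewrite Rabs_pos_eq; lra. }
assert (E1 := Series_correct _ (E fst Cmod_fst)). assert (E2 := Series_correct _ (E snd Cmod_snd)).
intros e He.
assert (He2 : 0 < e / 2) by lra.
destruct (proj1 (filterlim_locally _ _) E1 (mkposreal _ He2)) as [N1 F1].
destruct (proj1 (filterlim_locally _ _) E2 (mkposreal _ He2)) as [N2 F2].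
exists (S (N1 + N2)). intros [|n] Hn; try lia.
eapply Rle_lt_trans. apply Cmod_le_sum.
specialize (F1 n ltac:(lia)). specialize (F2 n ltac:(lia)).
change (Rabs (sum_n (fun k => fst (a k * z ^ k)%C) n - fst (PS a z)) < e / 2) in F1.
change (Rabs (sum_n (fun k => snd (a k * z ^ k)%C) n - snd (PS a z)) < e / 2) in F2.
rewrite <- csum_fst in F1. rewrite <- csum_snd in F2.
unfold Rminus in *. cbn [fst snd Cminus Cplus Copp]. unfold Cminus, Cplus, Copp in *. cbn [fst snd] in *. lra.
Qed.

Lemma is_PS_PS a R0 z l : cvr a R0 -> Cmod z < R0 -> is_PS a z l -> PS a z = l.
Proof. intros. eapply is_PS_unique; eauto. eapply PS_is; eauto. Qed.

(** Bernoulli's inequality for [(/ x) ^ n]. *)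
Lemma nx_pow_bound x n : 0 < x < 1 -> INR n * x ^ n <= / (/ x - 1).
Proof.
intros Hx.
assert (Hix : 1 < / x) by (rewrite <- Rinv_1 at 1; apply Rinv_lt_contravar; lra).
assert (H := poly n (/ x - 1) ltac:(lra)).
replace (1 + (/ x - 1)) with (/ x) in H by ring. rewrite pow_inv in H.
assert (Hp : 0 < x ^ n) by (apply pow_lt; lra).
apply (Rmult_le_compat_r (x ^ n)) in H; try lra. rewrite Rinv_l in H by lra.
apply Rmult_le_reg_r with (/ x - 1); try lra. rewrite Rinv_l by lra. lra.
Qed.

Lemma cvr_INR a R0 : cvr a R0 -> cvr (fun n => INR n * a n)%C R0.
Proof.
intros H r Hr. destruct (H ((r + R0) / 2)) as [M HM]; try lra.
set (s := (r + R0) / 2) in *.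
assert (Hx : 0 < r / s < 1). { split. apply Rdiv_lt_0_compat; unfold s; lra. apply Rlt_div_l; unfold s; lra. }
exists (M * / (/ (r / s) - 1)). intros n.
rewrite Cmod_mult, Cmod_R, Rabs_pos_eq by apply pos_INR.
replace (r ^ n) with (s ^ n * (r / s) ^ n).
2: { rewrite <- Rpow_mult_distr. f_equal. field. unfold s; lra. }
assert (B := nx_pow_bound _ n Hx).
replace (INR n * Cmod (a n) * (s ^ n * (r / s) ^ n)) with ((Cmod (a n) * s ^ n) * (INR n * (r / s) ^ n)) by ring.
apply Rmult_le_compat; auto.
- apply Rmult_le_pos. apply Cmod_ge_0. apply pow_le. unfold s; lra.
- apply Rmult_le_pos. apply pos_INR. apply pow_le. lra.
Qed.

Lemma cvr_shift a R0 : cvr a R0 -> cvr (fun n => a (S n)) R0.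
Proof.
intros H r Hr. destruct (H r Hr) as [M HM]. exists (M / r). intros n. specialize (HM (S n)).
apply (Rle_div_r _ M r); try lra. rewrite <- tech_pow_Rmult in HM. lra.
Qed.

Definition dps (a : nat -> C) (n : nat) : C := (INR (S n) * a (S n))%C.

Lemma cvr_dps a R0 : cvr a R0 -> cvr (dps a) R0.
Proof. intros H. apply (cvr_shift _ _ (cvr_INR a R0 H)). Qed.

Lemma cvr_le a R0 R1 : R1 <= R0 -> cvr a R0 -> cvr a R1.
Proof. intros H Ha r Hr. apply Ha. lra. Qed.

Lemma csum_ext u v n : (forall k, (k < n)%nat -> u k = v k) -> csum u n = csum v n.
Proof. intros H. induction n; simpl; auto. rewrite IHn, H by auto. auto. Qed.

Lemma csum_S_l u n : csum u (S n) = (u O + csum (fun k => u (S k)) n)%C.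
Proof. induction n. simpl; ring. change (csum u (S (S n))) with (csum u (S n) + u (S n))%C. rewrite IHn. simpl. ring. Qed.

Lemma csum_plus u v n : csum (fun k => u k + v k)%C n = (csum u n + csum v n)%C.
Proof. induction n; simpl. ring. rewrite IHn; ring. Qed.

Lemma csum_scal c u n : csum (fun k => c * u k)%C n = (c * csum u n)%C.
Proof. induction n; simpl. ring. rewrite IHn; ring. Qed.

Lemma PS_shift a R0 z : cvr a R0 -> Cmod z < R0 -> PS a z = (a O + z * PS (fun n => a (S n)) z)%C.
Proof.
intros Ha Hz. apply (is_PS_PS a R0); auto.
assert (H := PS_is _ R0 z (cvr_shift _ _ Ha) Hz). intros e He.
destruct (H (e / (Cmod z + 1))) as [N HN].
{ apply Rdiv_lt_0_compat; auto. generalize (Cmod_ge_0 z); lra. }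
exists (S N). intros [|n] Hn; try lia. specialize (HN n ltac:(lia)).
rewrite csum_S_l.
rewrite (csum_ext (fun k => a (S k) * z ^ S k)%C (fun k => z * (a (S k) * z ^ k))%C) by (intros; simpl; ring).
rewrite csum_scal. set (s := csum _ n) in *. set (t := PS _ z) in *.
replace (a O * z ^ 0 + z * s - (a O + z * t))%C with (z * (s - t))%C by (simpl; ring).
rewrite Cmod_mult. assert (P := Cmod_ge_0 z). assert (P' := Cmod_ge_0 (s - t)).
apply Rlt_div_r in HN; nra.
Qed.

Lemma PS_0 a : PS a 0 = a O.
Proof.
unfold PS.
assert (E : forall g : C -> R, g 0 = 0 -> Series (fun k => g (a k * 0 ^ k)%C) = g (a O)).
{ intros g Hg. apply is_series_unique.
  apply filterlim_ext with (fun _ : nat => g (a O)). 2: apply filterlim_const.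
  intros n. symmetry. induction n as [|n IH].
  - rewrite sum_O. f_equal. simpl. ring.
  - rewrite sum_Sn, IH. replace (a (S n) * 0 ^ S n)%C with (RtoC 0) by (simpl; ring).
    rewrite Hg. apply Rplus_0_r. }
rewrite (E fst), (E snd); auto. destruct (a O); auto.
Qed.

Lemma is_PS_plus a b z l m : is_PS a z l -> is_PS b z m -> is_PS (fun n => a n + b n)%C z (l + m)%C.
Proof.
intros H1 H2 e He. destruct (H1 (e / 2)) as [N1 F1]; try lra. destruct (H2 (e / 2)) as [N2 F2]; try lra.
exists (N1 + N2)%nat. intros n Hn. specialize (F1 n ltac:(lia)). specialize (F2 n ltac:(lia)).
rewrite (csum_ext _ (fun k => a k * z ^ k + b k * z ^ k)%C) by (intros; ring). rewrite csum_plus.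
set (s := csum (fun k => a k * z ^ k)%C n) in *. set (t := csum (fun k => b k * z ^ k)%C n) in *.
replace (s + t - (l + m))%C with ((s - l) + (t - m))%C by ring.
eapply Rle_lt_trans. apply Cmod_triangle. lra.
Qed.

Lemma is_PS_scal c a z l : is_PS a z l -> is_PS (fun n => c * a n)%C z (c * l)%C.
Proof.
intros H e He. destruct (H (e / (Cmod c + 1))) as [N F].
{ apply Rdiv_lt_0_compat; auto. generalize (Cmod_ge_0 c); lra. }
exists N. intros n Hn. specialize (F n Hn).
rewrite (csum_ext _ (fun k => c * (a k * z ^ k))%C) by (intros; ring). rewrite csum_scal.
set (s := csum _ n) in *. replace (c * s - c * l)%C with (c * (s - l))%C by ring.
rewrite Cmod_mult. assert (P := Cmod_ge_0 c). assert (P' := Cmod_ge_0 (s - l)).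
apply Rlt_div_r in F; nra.
Qed.

Lemma pow_diff_bound r (z w : C) n : 0 < r -> Cmod z <= r -> Cmod w <= r ->
  Cmod (w ^ n - z ^ n) * r <= INR n * r ^ n * Cmod (w - z).
Proof.
intros Hr Hz Hw. induction n as [|n IH].
- simpl. rewrite Cmod_diag. lra.
- replace (w ^ S n - z ^ S n)%C with (w * (w ^ n - z ^ n) + (w - z) * z ^ n)%C by (simpl; ring).
  eapply Rle_trans. apply Rmult_le_compat_r. lra. apply Cmod_triangle. rewrite !Cmod_mult, Cmod_pow.
  rewrite S_INR. simpl.
  assert (Cmod z ^ n <= r ^ n) by (apply pow_incr; split; auto; apply Cmod_ge_0).
  assert (P1 := Cmod_ge_0 (w ^ n - z ^ n)). assert (P2 := Cmod_ge_0 (w - z)). assert (P3 := Cmod_ge_0 w).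
  assert (Cmod w * (Cmod (w ^ n - z ^ n) * r) <= r * (INR n * r ^ n * Cmod (w - z))).
  { apply Rmult_le_compat; auto. nra. }
  assert (Cmod (w - z) * Cmod z ^ n <= Cmod (w - z) * r ^ n) by (apply Rmult_le_compat_l; auto).
  nra.
Qed.

(** A Taylor remainder of second order. Its factor [n ^ 2] is absorbed by two applications of
    [cvr_INR], which makes termwise differentiation of a series uniform. *)
Lemma pow_taylor_bound r (z w : C) n : 0 < r -> Cmod z <= r -> Cmod w <= r ->
  Cmod (w ^ n - z ^ n - INR n * z ^ pred n * (w - z)) * (r * r) <= INR n * INR n * r ^ n * (Cmod (w - z) * Cmod (w - z)).
Proof.
intros Hr Hz Hw. induction n as [|n IH].
- simpl. replace (1 - 1 - 0 * 1 * (w - z))%C with (RtoC 0) by ring. rewrite Cmod_0. lra.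
- replace (w ^ S n - z ^ S n - INR (S n) * z ^ pred (S n) * (w - z))%C with
    (z * (w ^ n - z ^ n - INR n * z ^ pred n * (w - z)) + (w - z) * (w ^ n - z ^ n))%C.
  2: { rewrite S_INR, RtoC_plus. destruct n; [simpl|cbn [pred Cpow]]; ring. }
  eapply Rle_trans. apply Rmult_le_compat_r. nra. apply Cmod_triangle. rewrite !Cmod_mult.
  assert (H := pow_diff_bound r z w n Hr Hz Hw).
  set (x := Cmod (w - z)) in *. set (A := Cmod (w ^ n - z ^ n - INR n * z ^ pred n * (w - z))) in *.
  set (B := Cmod (w ^ n - z ^ n)) in *.
  assert (0 <= x) by apply Cmod_ge_0. assert (0 <= A) by apply Cmod_ge_0. assert (Pz := Cmod_ge_0 z).
  assert (G1 : Cmod z * (A * (r * r)) <= r * (INR n * INR n * r ^ n * (x * x))).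
  { apply Rmult_le_compat; auto. nra. }
  assert (G2 : x * r * (B * r) <= x * r * (INR n * r ^ n * x)).
  { apply Rmult_le_compat_l; nra. }
  rewrite S_INR. simpl. assert (0 < r ^ n) by (apply pow_lt; auto). assert (Pn := pos_INR n).
  assert (0 <= x * x * (r * r ^ n)). { apply Rmult_le_pos; nra. }
  nra.
Qed.

Lemma csum_geom_bound (u : nat -> C) M q : 0 <= q < 1 -> 0 <= M -> (forall n, Cmod (u n) <= M * q ^ n) ->
  forall n, Cmod (csum u n) <= M / (1 - q).
Proof.
intros Hq HM H n. assert (T := csum_tail u M q Hq H 0 n ltac:(lia)).
replace (csum u n - csum u 0)%C with (csum u n) in T by (simpl; ring).
eapply Rle_trans. apply T. rewrite <- (Rmult_1_r (M / (1 - q))) at 2.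
apply Rmult_le_compat_l. apply Rdiv_le_0_compat; lra. simpl. generalize (pow_le q n ltac:(lra)). lra.
Qed.

Lemma PS_cder a R0 z : cvr a R0 -> Cmod z < R0 -> cder (PS a) z (PS (dps a) z).
Proof.
intros Ha Hz. assert (Pz := Cmod_ge_0 z).
(* [r] leaves room for [w] around [z]; [s], still larger, turns bounded terms into a geometric
   majorant of ratio [r / s]. *)
set (r := (Cmod z + R0) / 2). set (s := (r + R0) / 2).
assert (Hr : 0 < r /\ Cmod z < r /\ r < R0) by (unfold r; lra). assert (Hs : r < s < R0) by (unfold s; lra).
destruct (cvr_INR _ _ (cvr_INR _ _ Ha) s ltac:(lra)) as [M HM].
assert (HM0 : 0 <= M). { eapply Rle_trans. 2: apply (HM O). simpl. rewrite Rmult_1_r. apply Cmod_ge_0. }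
set (q := r / s). assert (Hq : 0 <= q < 1).
{ unfold q; split. apply Rdiv_le_0_compat; lra. apply Rlt_div_l; lra. }
set (K := M / (1 - q) / (r * r)).
assert (HK : 0 <= K). { unfold K. apply Rdiv_le_0_compat. 2: nra. apply Rdiv_le_0_compat; lra. }
assert (Main : forall w, Cmod w <= r -> Cmod (PS a w - PS a z - PS (dps a) z * (w - z)) <= K * (Cmod (w - z) * Cmod (w - z))).
{ intros w Hw.
  assert (Hsum : forall n, Cmod (csum (fun k => a k * w ^ k)%C (S n) - csum (fun k => a k * z ^ k)%C (S n)
     - csum (fun k => dps a k * z ^ k)%C n * (w - z)) <= K * (Cmod (w - z) * Cmod (w - z))).
  { intros n.
    replace (csum (fun k => dps a k * z ^ k)%C n) with (csum (fun k => a k * (INR k * z ^ pred k))%C (S n)).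
    2: { rewrite csum_S_l. rewrite (csum_ext _ (fun k => dps a k * z ^ k)%C n).
         simpl; ring. intros; unfold dps; cbn [pred]; ring. }
    replace (csum (fun k => a k * w ^ k)%C (S n) - csum (fun k => a k * z ^ k)%C (S n)
     - csum (fun k => a k * (INR k * z ^ pred k))%C (S n) * (w - z))%C
     with (csum (fun k => a k * (w ^ k - z ^ k - INR k * z ^ pred k * (w - z)))%C (S n)).
    2: { generalize (S n). clear. induction n; simpl. ring. rewrite IHn. simpl. ring. }
    unfold K. set (x := Cmod (w - z)). assert (0 <= x) by apply Cmod_ge_0.
    replace (M / (1 - q) / (r * r) * (x * x)) with ((M / (r * r) * (x * x)) / (1 - q)) by (field; lra).
    apply csum_geom_bound; auto.
    { apply Rmult_le_pos. apply Rdiv_le_0_compat; nra. nra. }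
    intros k. rewrite Cmod_mult.
    assert (B := pow_taylor_bound r z w k ltac:(lra) ltac:(lra) Hw). fold x in B.
    specialize (HM k). rewrite !Cmod_mult, Cmod_R, Rabs_pos_eq in HM by apply pos_INR.
    set (T := Cmod _) in B |- * at 2.
    replace (r ^ k) with (q ^ k * s ^ k) in B. 2: { rewrite <- Rpow_mult_distr. f_equal. unfold q; field; lra. }
    apply Rmult_le_reg_r with (r * r). nra.
    replace (M / (r * r) * (x * x) * q ^ k * (r * r)) with (M * (x * x * q ^ k)) by (field; lra).
    assert (0 <= x * x * q ^ k). { apply Rmult_le_pos. nra. apply pow_le; lra. }
    apply Rle_trans with ((INR k * (INR k * Cmod (a k)) * s ^ k) * (x * x * q ^ k)).
    2: apply Rmult_le_compat_r; auto.
    apply (Rmult_le_compat_l (Cmod (a k))) in B. 2: apply Cmod_ge_0. lra. }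
  assert (L1 := PS_is a R0 w Ha ltac:(lra)). assert (L2 := PS_is a R0 z Ha Hz).
  assert (L3 := PS_is _ R0 z (cvr_dps _ _ Ha) Hz).
  apply le_epsilon. intros e He.
  set (x := Cmod (w - z)) in *. assert (0 <= x) by apply Cmod_ge_0.
  destruct (L1 (e / 3)) as [N1 F1]; try lra. destruct (L2 (e / 3)) as [N2 F2]; try lra.
  destruct (L3 (e / 3 / (x + 1))) as [N3 F3]. { apply Rdiv_lt_0_compat; lra. }
  set (n := (N1 + N2 + N3)%nat).
  specialize (F1 (S n) ltac:(lia)). specialize (F2 (S n) ltac:(lia)). specialize (F3 n ltac:(lia)). specialize (Hsum n).
  set (s1 := csum _ _) in F1. set (s2 := csum _ _) in F2. set (s3 := csum _ _) in F3.
  fold s1 s2 s3 in Hsum.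
  replace (PS a w - PS a z - PS (dps a) z * (w - z))%C with
    ((s1 - s2 - s3 * (w - z)) + (- (s1 - PS a w) + ((s2 - PS a z) + (s3 - PS (dps a) z) * (w - z))))%C by ring.
  eapply Rle_trans. apply Cmod_triangle. apply Rplus_le_compat; auto.
  eapply Rle_trans. apply Cmod_triangle. rewrite Cmod_opp.
  assert (T := Cmod_triangle (s2 - PS a z) ((s3 - PS (dps a) z) * (w - z))). rewrite Cmod_mult in T.
  fold x in T. apply Rlt_div_r in F3; try lra. assert (P := Cmod_ge_0 (s3 - PS (dps a) z)). nra. }
intros e He.
exists (Rmin (r - Cmod z) (e / (K + 1))). split.
{ apply Rmin_pos; try lra. apply Rdiv_lt_0_compat; lra. }
intros w Hw. lt_min Hw W1 W2.
eapply Rle_trans. apply Main.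
{ assert (T := Cmod_triangle z (w - z)). replace (z + (w - z))%C with w in T by ring. lra. }
set (x := Cmod (w - z)) in *. assert (0 <= x) by apply Cmod_ge_0. apply Rlt_div_r in W2; nra.
Qed.

Lemma PS_ccont a R0 z : cvr a R0 -> Cmod z < R0 -> ccont (PS a) z.
Proof. intros. eapply cder_ccont, PS_cder; eauto. Qed.

(** Zeros accumulating at [0] force the constant coefficient to vanish by continuity; dividing by
    [z] shifts the sequence and keeps the zeros. This is the local form of the identity theorem. *)
Lemma PS_zero_coef a R0 : 0 < R0 -> cvr a R0 ->
  (forall d, 0 < d -> exists z, 0 < Cmod z < d /\ PS a z = 0) -> forall n, a n = 0.
Proof.
intros HR Ha Hz.
assert (H0 : forall b, cvr b R0 -> (forall d, 0 < d -> exists z, 0 < Cmod z < d /\ PS b z = 0) -> b O = 0).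
{ intros b Hb Hbz. destruct (Ceq_dec (b O) 0) as [|Hne]; auto. exfalso.
  destruct (ccont_neq (PS b) 0 0) as [d [Hd F]].
  - apply (PS_ccont b R0); auto. rewrite Cmod_0; auto.
  - rewrite PS_0; auto.
  - destruct (Hbz d Hd) as [z [Hz1 Hz2]]. apply (F z); auto. replace (z - 0)%C with z by ring. lra. }
assert (Hs : forall n, cvr (fun k => a (n + k)%nat) R0 /\ (forall d, 0 < d -> exists z, 0 < Cmod z < d /\ PS (fun k => a (n + k)%nat) z = 0)).
{ induction n as [|n [IH1 IH2]]. split; auto.
  assert (Hc : cvr (fun k => a (S n + k)%nat) R0).
  { replace (fun k => a (S n + k)%nat) with (fun k => a (n + S k)%nat).
    apply (cvr_shift (fun k => a (n + k)%nat)); auto. apply functional_extensionality. intros; f_equal; lia. }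
  split; auto. intros d Hd.
  destruct (IH2 (Rmin d R0)) as [z [Hz1 Hz2]]. apply Rmin_pos; auto.
  assert (Z1 := Rlt_le_trans _ _ _ (proj2 Hz1) (Rmin_l _ _)). assert (Z2 := Rlt_le_trans _ _ _ (proj2 Hz1) (Rmin_r _ _)).
  exists z. split. lra. rewrite (PS_shift _ R0) in Hz2 by auto.
  assert (E0 := H0 _ IH1 IH2). simpl in E0. rewrite E0 in Hz2.
  replace (fun k => a (S n + k)%nat) with (fun k => a (n + S k)%nat).
  2: { apply functional_extensionality. intros; f_equal; lia. }
  assert (z <> 0) by (apply Cmod_gt_0; lra).
  set (p := PS _ z) in *. replace p with (/ z * (0 + z * p))%C by (field; auto). rewrite Hz2. ring. }
intros n. destruct (Hs n) as [H1 H2]. replace n with (n + 0)%nat by lia. apply (H0 (fun k => a (n + k)%nat)); auto.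
Qed.

Lemma RtoC_neq (x y : R) : x <> y -> RtoC x <> RtoC y.
Proof. intros H E. apply H. apply RtoC_inj; auto. Qed.

(** * Integrals and derivatives along paths *)

Lemma RInt_param_deriv (f g : R -> R -> R) a b x d : a <= b -> 0 < d ->
  (forall y t, Rabs (y - x) < d -> is_derive (fun u => f u t) y (g y t)) ->
  (forall t, continuity_2d_pt g x t) ->
  (forall y t, Rabs (y - x) < d -> continuous (fun t => f y t) t) ->
  is_derive (fun y => RInt (f y) a b) x (RInt (g x) a b).
Proof.
intros Hab Hd Hder Hcont Hf.
assert (E : RInt (fun t => Derive (fun u => f u t) x) a b = RInt (g x) a b).
{ apply RInt_ext. intros t _. apply is_derive_unique, Hder.
  replace (x - x) with 0 by ring. rewrite Rabs_R0; auto. }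
rewrite <- E.
apply is_derive_RInt_param.
- exists (mkposreal d Hd). intros y Hy t _. exists (g y t). apply Hder. exact Hy.
- intros t _. apply continuity_2d_pt_ext_loc with g; auto.
  exists (mkposreal d Hd). intros u v Hu _. symmetry. apply is_derive_unique, Hder. exact Hu.
- exists (mkposreal d Hd). intros y Hy. apply (ex_RInt_continuous (V := R_CompleteNormedModule)).
  intros t _. apply Hf. exact Hy.
Qed.

Lemma RInt_extR (f g : R -> R) (a b : R) : (forall x, f x = g x) -> RInt f a b = RInt g a b :> R.
Proof. intros H. apply RInt_ext. intros; apply H. Qed.

Definition pcont (f : R -> C) : Prop :=
  forall t, continuous (fun x => fst (f x)) t /\ continuous (fun x => snd (f x)) t.

Definition cpder (f : R -> C) (t : R) (l : C) : Prop :=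
  is_derive (fun x => fst (f x)) t (fst l) /\ is_derive (fun x => snd (f x)) t (snd l).

Definition CInt (f : R -> C) (a b : R) : C :=
  (RInt (fun t => fst (f t)) a b, RInt (fun t => snd (f t)) a b).

Lemma pcont_ex f a b : pcont f -> ex_RInt (fun t => fst (f t)) a b /\ ex_RInt (fun t => snd (f t)) a b.
Proof.
intros H. split; apply (ex_RInt_continuous (V := R_CompleteNormedModule)); intros t _; apply H.
Qed.

Lemma cpder_pcont f : (forall t, exists l, cpder f t l) -> pcont f.
Proof.
intros H t. destruct (H t) as [l [H1 H2]].
split; eapply ex_derive_cont; eexists; eauto.
Qed.

Lemma pcont_mult f g : pcont f -> pcont g -> pcont (fun t => f t * g t)%C.
Proof.
intros Hf Hg t. destruct (Hf t) as [F1 F2], (Hg t) as [G1 G2]. split; simpl.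
- apply (continuous_minus (fun x => fst (f x) * fst (g x)) (fun x => snd (f x) * snd (g x)));
    apply (continuous_mult (K := R_AbsRing)); auto.
- apply (continuous_plus (fun x => fst (f x) * snd (g x)) (fun x => snd (f x) * fst (g x)));
    apply (continuous_mult (K := R_AbsRing)); auto.
Qed.

Lemma pcont_const c : pcont (fun _ => c).
Proof. intros t; split; apply continuous_const. Qed.

Lemma RInt_lin2 (f g : R -> R) x y a b : ex_RInt f a b -> ex_RInt g a b ->
  RInt (fun t => x * f t + y * g t) a b = x * RInt f a b + y * RInt g a b.
Proof.
intros Hf Hg.
rewrite (RInt_plus (fun t => x * f t) (fun t => y * g t));
 [|apply (ex_RInt_scal (V := R_CompleteNormedModule) f)|apply (ex_RInt_scal (V := R_CompleteNormedModule) g)]; auto.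
rewrite (RInt_scal (V := R_CompleteNormedModule) f), (RInt_scal (V := R_CompleteNormedModule) g); auto.
Qed.

Lemma CInt_scal c f a b : pcont f -> CInt (fun t => c * f t)%C a b = (c * CInt f a b)%C.
Proof.
intros Hf. destruct (pcont_ex f a b Hf) as [E1 E2]. unfold CInt. simpl.
rewrite (RInt_extR (fun t => fst c * fst (f t) - snd c * snd (f t)) (fun t => fst c * fst (f t) + (- snd c) * snd (f t))) by (intros; ring).
rewrite (RInt_lin2 (fun t => fst (f t)) (fun t => snd (f t))) by auto.
rewrite (RInt_lin2 (fun t => snd (f t)) (fun t => fst (f t))) by auto.
Cring.
Qed.

Lemma CInt_plus f g a b : pcont f -> pcont g -> CInt (fun t => f t + g t)%C a b = (CInt f a b + CInt g a b)%C.
Proof.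
intros Hf Hg. destruct (pcont_ex f a b Hf), (pcont_ex g a b Hg). unfold CInt. simpl.
rewrite (RInt_plus (fun t => fst (f t)) (fun t => fst (g t))), (RInt_plus (fun t => snd (f t)) (fun t => snd (g t))); auto.
Qed.

Lemma CInt_ext f g a b : (forall t, f t = g t) -> CInt f a b = CInt g a b.
Proof. intros H. unfold CInt. f_equal; apply RInt_ext; intros; rewrite H; auto. Qed.

(** Bounding the two components separately costs the factor 2, which Cauchy's estimates below
    inherit. *)
Lemma CInt_bound f a b M : a <= b -> pcont f -> (forall t, a <= t <= b -> Cmod (f t) <= M) -> Cmod (CInt f a b) <= 2 * M * (b - a).
Proof.
intros Hab Hf HM. destruct (pcont_ex f a b Hf) as [E1 E2].
eapply Rle_trans. apply Cmod_le_sum. simpl.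
assert (Rabs (RInt (fun t => fst (f t)) a b) <= (b - a) * M).
{ apply abs_RInt_le_const; auto. intros; eapply Rle_trans; [apply Cmod_fst|auto]. }
assert (Rabs (RInt (fun t => snd (f t)) a b) <= (b - a) * M).
{ apply abs_RInt_le_const; auto. intros; eapply Rle_trans; [apply Cmod_snd|auto]. }
lra.
Qed.

Lemma CInt_deriv f f' a b : (forall t, cpder f t (f' t)) -> pcont f' -> CInt f' a b = (f b - f a)%C.
Proof.
intros H Hc. unfold CInt. apply injective_projections; simpl; apply is_RInt_unique.
- apply (is_RInt_derive (V := R_CompleteNormedModule) (fun x => fst (f x)) (fun x => fst (f' x)));
  intros; [apply H|apply Hc].
- apply (is_RInt_derive (V := R_CompleteNormedModule) (fun x => snd (f x)) (fun x => snd (f' x)));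
  intros; [apply H|apply Hc].
Qed.

Lemma is_derive_eps (f : R -> R) x l : is_derive f x l <->
  forall e, 0 < e -> exists d, 0 < d /\ forall y, Rabs (y - x) < d -> Rabs (f y - f x - l * (y - x)) <= e * Rabs (y - x).
Proof.
rewrite is_derive_Reals. split.
- intros H e He. destruct (H e He) as [d Hd]. exists d. split. apply cond_pos.
  intros y Hy. destruct (Req_dec y x) as [->|Hne].
  + replace (f x - f x - l * (x - x)) with 0 by ring. replace (x - x) with 0 by ring. rewrite Rabs_R0; lra.
  + specialize (Hd (y - x) ltac:(lra) Hy). replace (x + (y - x)) with y in Hd by ring.
    replace (f y - f x - l * (y - x)) with (((f y - f x) / (y - x) - l) * (y - x)) by (field; lra).
    rewrite Rabs_mult. apply Rmult_le_compat_r. apply Rabs_pos. lra.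
- intros H e He. destruct (H (e / 2) ltac:(lra)) as [d [Hd F]]. exists (mkposreal d Hd).
  intros h Hh Hhd. simpl in Hhd. specialize (F (x + h)).
  replace (x + h - x) with h in F by ring. specialize (F Hhd).
  replace ((f (x + h) - f x) / h - l) with ((f (x + h) - f x - l * h) / h) by (field; auto).
  rewrite Rabs_div by auto. assert (0 < Rabs h) by (apply Rabs_pos_lt; auto).
  apply Rlt_div_l; auto. nra.
Qed.

Lemma is_derive_lip (f : R -> R) x l : is_derive f x l -> exists d, 0 < d /\ forall y, Rabs (y - x) < d ->
  Rabs (f y - f x) <= (Rabs l + 1) * Rabs (y - x).
Proof.
intros H. apply is_derive_eps with (e := 1) in H; try lra. destruct H as [d [Hd H]].
exists d. split; auto. intros y Hy. specialize (H y Hy).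
replace (f y - f x) with ((f y - f x - l * (y - x)) + l * (y - x)) by ring.
eapply Rle_trans. apply Rabs_triang. rewrite Rabs_mult. lra.
Qed.

Lemma fder_path (F : C -> R) (g1 g2 : R -> R) x p q a b :
  fder F (g1 x, g2 x) p q -> is_derive g1 x a -> is_derive g2 x b ->
  is_derive (fun t => F (g1 t, g2 t)) x (p * a + q * b).
Proof.
intros HF H1 H2. apply is_derive_eps. intros e He.
destruct (is_derive_lip _ _ _ H1) as [d1 [Hd1 L1]]. destruct (is_derive_lip _ _ _ H2) as [d2 [Hd2 L2]].
set (K := Rabs a + 1 + (Rabs b + 1)).
assert (HK : 0 < K) by (unfold K; generalize (Rabs_pos a) (Rabs_pos b); lra).
set (A := Rabs p + Rabs q + 1). assert (HA : 0 < A) by (unfold A; generalize (Rabs_pos p) (Rabs_pos q); lra).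
destruct (HF (e / 2 / K)) as [d3 [Hd3 L3]]. { apply Rdiv_lt_0_compat; lra. }
apply is_derive_eps with (e := e / 2 / A) in H1. 2: { apply Rdiv_lt_0_compat; lra. }
apply is_derive_eps with (e := e / 2 / A) in H2. 2: { apply Rdiv_lt_0_compat; lra. }
destruct H1 as [d4 [Hd4 L4]]. destruct H2 as [d5 [Hd5 L5]].
exists (Rmin (Rmin d1 d2) (Rmin (d3 / K) (Rmin d4 d5))). split.
{ repeat apply Rmin_pos; auto. apply Rdiv_lt_0_compat; auto. }
intros y Hy.
min_le (Rmin d1 d2) (Rmin (d3 / K) (Rmin d4 d5)) B1 B2.
min_le d1 d2 B3 B4. min_le (d3 / K) (Rmin d4 d5) B5 B6. min_le d4 d5 B7 B8.
specialize (L1 y ltac:(lra)). specialize (L2 y ltac:(lra)). specialize (L4 y ltac:(lra)). specialize (L5 y ltac:(lra)).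
assert (Hy3 : Rabs (y - x) < d3 / K) by lra. apply Rlt_div_r in Hy3; auto.
set (h := Rabs (y - x)) in *. assert (Hh : 0 <= h) by apply Rabs_pos.
assert (HC : Cmod ((g1 y, g2 y) - (g1 x, g2 x)) <= K * h).
{ eapply Rle_trans. apply Cmod_le_sum. simpl. unfold Rminus in L1, L2. unfold K. lra. }
specialize (L3 (g1 y, g2 y) ltac:(lra)). simpl in L3.
assert (L3' : e / 2 / K * Cmod ((g1 y, g2 y) - (g1 x, g2 x)) <= e / 2 * h).
{ apply Rle_trans with (e / 2 / K * (K * h)). apply Rmult_le_compat_l; auto.
  apply Rlt_le, Rdiv_lt_0_compat; lra. right; field; lra. }
replace (F (g1 y, g2 y) - F (g1 x, g2 x) - (p * a + q * b) * (y - x)) with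
 ((F (g1 y, g2 y) - F (g1 x, g2 x) - (p * (g1 y - g1 x) + q * (g2 y - g2 x))) +
  (p * (g1 y - g1 x - a * (y - x)) + q * (g2 y - g2 x - b * (y - x)))) by ring.
eapply Rle_trans. apply Rabs_triang.
assert (Rabs (p * (g1 y - g1 x - a * (y - x)) + q * (g2 y - g2 x - b * (y - x))) <= e / 2 * h).
2: lra.
eapply Rle_trans. apply Rabs_triang. rewrite !Rabs_mult.
assert (Z1 := Rmult_le_compat_l (Rabs p) _ _ (Rabs_pos p) L4). assert (Z2 := Rmult_le_compat_l (Rabs q) _ _ (Rabs_pos q) L5).
apply Rle_trans with ((Rabs p + Rabs q) * (e / 2 / A * h)); try lra.
replace (e / 2 * h) with (A * (e / 2 / A * h)) by (field; lra).
apply Rmult_le_compat_r. apply Rmult_le_pos; auto. apply Rlt_le, Rdiv_lt_0_compat; lra. unfold A; lra.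
Qed.

Lemma cder_path f (g : R -> C) t m l : cder f (g t) m -> cpder g t l -> cpder (fun x => f (g x)) t (m * l)%C.
Proof.
intros Hf [H1 H2]. apply cder_fder in Hf. destruct Hf as [F1 F2].
assert (E : forall x, g x = (fst (g x), snd (g x))) by (intros; destruct (g x); auto).
rewrite (E t) in F1, F2.
split.
- apply (is_derive_ext (fun x => fst (f (fst (g x), snd (g x))))). { intros x; rewrite <- E; auto. }
  evar_last. apply (fder_path (fun w => fst (f w)) (fun x => fst (g x)) (fun x => snd (g x)) t _ _ _ _ F1 H1 H2).
  simpl; ring.
- apply (is_derive_ext (fun x => snd (f (fst (g x), snd (g x))))). { intros x; rewrite <- E; auto. }
  evar_last. apply (fder_path (fun w => snd (f w)) (fun x => fst (g x)) (fun x => snd (g x)) t _ _ _ _ F2 H1 H2).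
  simpl; ring.
Qed.

Lemma ccont_path f (g : R -> C) : pcont g -> (forall t, ccont f (g t)) -> pcont (fun t => f (g t)).
Proof.
intros Hg Hf t.
assert (H : forall e, 0 < e -> exists d, 0 < d /\ forall y, Rabs (y - t) < d -> Cmod (f (g y) - f (g t)) < e).
{ intros e He. destruct (Hf t e He) as [d [Hd F]]. destruct (Hg t) as [G1 G2].
  apply continuity_pt_filterlim in G1. apply continuity_pt_filterlim in G2.
  destruct (G1 (d / 2)) as [d1 [Hd1 K1]]; try lra. destruct (G2 (d / 2)) as [d2 [Hd2 K2]]; try lra.
  exists (Rmin d1 d2). split. apply Rmin_pos; auto. intros y Hy.
  destruct (Req_dec y t) as [->|Hne].
  { replace (f (g t) - f (g t))%C with (RtoC 0) by ring. rewrite Cmod_0; auto. }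
  apply F. eapply Rle_lt_trans. apply Cmod_le_sum. simpl.
  assert (Y1 := Rlt_le_trans _ _ _ Hy (Rmin_l _ _)). assert (Y2 := Rlt_le_trans _ _ _ Hy (Rmin_r _ _)).
  specialize (K1 y). specialize (K2 y). simpl in K1, K2. unfold R_dist, D_x, no_cond in K1, K2.
  unfold Rminus in *. assert (t <> y) by auto. specialize (K1 ltac:(auto)). specialize (K2 ltac:(auto)). lra. }
split; apply continuity_pt_filterlim; intros e He; destruct (H e He) as [d [Hd F]]; exists d; split; auto;
 intros y [_ Hy]; (eapply Rle_lt_trans; [|apply (F y Hy)]).
apply (Cmod_fst (f (g y) - f (g t))). apply (Cmod_snd (f (g y) - f (g t))).
Qed.

(** * Cauchy's integral formula and power series *)

Definition cis (t : R) : C := (cos t, sin t).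

Lemma cis_der t : cpder cis t (Ci * cis t)%C.
Proof. split; simpl; evar_last; [apply is_derive_cos| |apply is_derive_sin|]; simpl; ring. Qed.

Lemma Cmod_cis t : Cmod (cis t) = 1.
Proof.
unfold Cmod, cis; simpl. replace (cos t * (cos t * 1) + sin t * (sin t * 1)) with 1. apply sqrt_1.
generalize (sin2_cos2 t). unfold Rsqr. lra.
Qed.

Lemma cis_neq0 t : cis t <> 0.
Proof. apply Cmod_gt_0. rewrite Cmod_cis; lra. Qed.

Lemma pcont_cis : pcont cis.
Proof. apply cpder_pcont. intros t; eexists; apply cis_der. Qed.

Lemma cis_2PI : cis (2 * PI) = cis 0.
Proof. unfold cis. rewrite cos_2PI, sin_2PI, cos_0, sin_0; auto. Qed.

Section CauchyKernel.
Variable rho : R.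
Variable zeta : C.
Hypothesis Hz : Cmod zeta < rho.

Let Hrho : 0 < rho. Proof. generalize (Cmod_ge_0 zeta); lra. Qed.

(** Cauchy's kernel [dw / (w - zeta)] on the circle [w = rho e^(it)], divided by [i dt]. *)
Definition ck (t : R) : C := (rho * cis t / (rho * cis t - zeta))%C.

Let nz t : (rho * cis t - zeta)%C <> 0.
Proof.
intros E. assert (H : Cmod zeta = rho). 2: lra.
replace zeta with (rho * cis t)%C. rewrite Cmod_mult, Cmod_cis, Cmod_R, Rabs_pos_eq by lra. ring.
replace (rho * cis t)%C with (rho * cis t - zeta + zeta)%C by ring. rewrite E; ring.
Qed.

Let nz' t : (rho * cis t)%C <> 0.
Proof. apply Cmult_neq_0. apply RtoC_neq; lra. apply cis_neq0. Qed.

Lemma pcont_inv_pow n : pcont (fun t => (/ (rho * cis t)) ^ n)%C.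
Proof.
apply (ccont_path (fun w => (/ (rho * w)) ^ n)%C cis pcont_cis). intros t.
eapply cder_ccont. apply (cder_comp (fun w => w ^ n)%C (fun w => / (rho * w))%C).
- apply (cder_inv (fun w => rho * w)%C). apply (cder_scal rho (fun w => w)), cder_id. apply nz'.
- apply cder_pow.
Qed.

Lemma pcont_ck : pcont ck.
Proof.
apply (ccont_path (fun w => rho * w / (rho * w - zeta))%C cis pcont_cis). intros t.
eapply cder_ccont. apply (cder_div (fun w => rho * w)%C (fun w => rho * w - zeta)%C).
- apply (cder_scal rho (fun w => w)), cder_id.
- apply (cder_minus (fun w => rho * w)%C (fun _ => zeta)). apply (cder_scal rho (fun w => w)), cder_id. apply cder_const.
- apply nz.
Qed.

Definition ccoef (f : R -> C) (n : nat) : C := CInt (fun t => f t * (/ (rho * cis t)) ^ n)%C 0 (2 * PI).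

(** The finite geometric expansion of the kernel with its exact remainder. It holds for any
    continuous function of the angle, and so precedes Cauchy's formula. *)
Lemma ck_expand f n : pcont f ->
  CInt (fun t => f t * ck t)%C 0 (2 * PI) =
  (csum (fun k => ccoef f k * zeta ^ k) n + zeta ^ n * CInt (fun t => f t * (/ (rho * cis t)) ^ n * ck t) 0 (2 * PI))%C.
Proof.
intros Hf. induction n as [|n IH].
- simpl. rewrite (CInt_ext (fun t => f t * 1 * ck t)%C (fun t => f t * ck t)%C). ring. intros; ring.
- rewrite IH.
  rewrite (CInt_ext (fun t => f t * (/ (rho * cis t)) ^ n * ck t)%C
   (fun t => f t * (/ (rho * cis t)) ^ n + zeta * (f t * (/ (rho * cis t)) ^ S n * ck t))%C).
  + rewrite CInt_plus, CInt_scal.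
    * change (CInt (fun t => f t * (/ (rho * cis t)) ^ n)%C 0 (2 * PI)) with (ccoef f n).
      cbn [csum Cpow]. ring.
    * apply (pcont_mult (fun t => f t * (/ (rho * cis t)) ^ S n)%C); [apply pcont_mult; auto; apply pcont_inv_pow|apply pcont_ck].
    * apply pcont_mult; auto; apply pcont_inv_pow.
    * apply (pcont_mult (fun _ => zeta)). apply pcont_const.
      apply (pcont_mult (fun t => f t * (/ (rho * cis t)) ^ S n)%C); [apply pcont_mult; auto; apply pcont_inv_pow|apply pcont_ck].
  + intros t. unfold ck. cbn [Cpow]. set (u := ((/ (rho * cis t)) ^ n)%C). field.
    repeat split; auto; try (apply RtoC_neq; lra); apply cis_neq0.
Qed.

Lemma ccoef_bound f M n : pcont f -> (forall t, Cmod (f t) <= M) -> Cmod (ccoef f n) * rho ^ n <= 4 * PI * M.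
Proof.
intros Hf HM. unfold ccoef.
assert (H : Cmod (CInt (fun t => f t * (/ (rho * cis t)) ^ n)%C 0 (2 * PI)) <= 2 * (M * / rho ^ n) * (2 * PI - 0)).
{ apply CInt_bound. generalize PI_RGT_0; lra. apply pcont_mult; auto; apply pcont_inv_pow.
  intros t _. rewrite Cmod_mult, Cmod_pow, Cmod_inv, Cmod_mult, Cmod_cis, Cmod_R, Rabs_pos_eq, Rmult_1_r, pow_inv by (auto; lra).
  apply Rmult_le_compat_r; auto. apply Rlt_le, Rinv_0_lt_compat, pow_lt; auto. }
assert (0 < rho ^ n) by (apply pow_lt; auto).
apply (Rmult_le_compat_r (rho ^ n)) in H; try lra. eapply Rle_trans. apply H. right; field. lra.
Qed.

Lemma ck_is_PS f M : pcont f -> (forall t, Cmod (f t) <= M) ->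
  is_PS (ccoef f) zeta (CInt (fun t => f t * ck t)%C 0 (2 * PI)).
Proof.
intros Hf HM e He. assert (Pz := Cmod_ge_0 zeta). assert (Ppi := PI_RGT_0).
assert (HM0 : 0 <= M) by (eapply Rle_trans; [apply Cmod_ge_0|apply (HM 0)]).
set (q := Cmod zeta / rho). assert (Hq : 0 <= q < 1).
{ unfold q; split. apply Rdiv_le_0_compat; lra. apply Rlt_div_l; lra. }
set (B := 2 * (M * (rho / (rho - Cmod zeta))) * (2 * PI)).
assert (HB : 0 <= B). { unfold B. assert (0 <= rho / (rho - Cmod zeta)) by (apply Rdiv_le_0_compat; lra). apply Rmult_le_pos; nra. }
destruct (geom_small q e B Hq He HB) as [N HN]. exists N. intros n Hn. specialize (HN n Hn).
rewrite (ck_expand f n Hf). set (s := csum _ n). set (I := CInt _ _ _).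
replace (s - (s + zeta ^ n * I))%C with (- (zeta ^ n * I))%C by ring.
rewrite Cmod_opp, Cmod_mult, Cmod_pow. eapply Rle_lt_trans. 2: apply HN.
assert (HI : Cmod I <= 2 * (M * / rho ^ n * (rho / (rho - Cmod zeta))) * (2 * PI - 0)).
{ apply CInt_bound. lra.
  apply (pcont_mult (fun t => f t * (/ (rho * cis t)) ^ n)%C); [apply pcont_mult; auto; apply pcont_inv_pow|apply pcont_ck].
  intros t _. rewrite !Cmod_mult, Cmod_pow, Cmod_inv, Cmod_mult, Cmod_cis, Cmod_R, Rabs_pos_eq, Rmult_1_r, pow_inv by (auto; lra).
  assert (0 < / rho ^ n) by (apply Rinv_0_lt_compat, pow_lt; auto).
  apply Rmult_le_compat. apply Rmult_le_pos; [apply Cmod_ge_0|lra]. apply Cmod_ge_0. apply Rmult_le_compat_r; auto; lra.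
  unfold ck. rewrite Cmod_div, Cmod_mult, Cmod_cis, Cmod_R, Rabs_pos_eq, Rmult_1_r by (auto; lra).
  apply Rmult_le_compat_l. lra. apply Rinv_le_contravar. lra.
  assert (T := Cmod_triangle (rho * cis t - zeta) zeta). replace (rho * cis t - zeta + zeta)%C with (rho * cis t)%C in T by ring.
  rewrite Cmod_mult, Cmod_cis, Cmod_R, Rabs_pos_eq, Rmult_1_r in T by lra. lra. }
apply (Rmult_le_compat_l (Cmod zeta ^ n)) in HI. 2: apply pow_le; auto.
eapply Rle_trans. apply HI. right. unfold B, q, Rdiv. rewrite Rpow_mult_distr, pow_inv. ring.
Qed.

(** The kernel is expanded against the constant [1]: every coefficient but the first is the integral
    of the derivative of a periodic function. *)
Lemma CInt_ck : CInt ck 0 (2 * PI) = RtoC (2 * PI).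
Proof.
rewrite (CInt_ext ck (fun t => 1 * ck t)%C) by (intros; ring).
eapply is_PS_unique. apply (ck_is_PS (fun _ => 1) 1). apply pcont_const. intros; rewrite Cmod_1; lra.
assert (C0 : ccoef (fun _ => 1) 0 = RtoC (2 * PI)).
{ unfold ccoef. rewrite (CInt_ext _ (fun _ => 1)) by (intros; simpl; ring). unfold CInt. simpl.
  rewrite !RInt_const. unfold scal; simpl; unfold mult; simpl. unfold RtoC. f_equal; ring. }
assert (CS : forall n, ccoef (fun _ => 1) (S n) = 0).
{ intros n. unfold ccoef.
  rewrite (CInt_ext _ (fun t => (/ (rho * cis t)) ^ S n)%C) by (intros; ring).
  (* With respect to the angle, a primitive of [w ^ (-N)] is [(i / N) w ^ (-N)]; here [N = S n]. *)
  set (c := (Ci / INR (S n))%C).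
  assert (Hn : RtoC (INR (S n)) <> 0) by (apply RtoC_neq, not_0_INR; lia).
  rewrite (CInt_deriv (fun t => c * (/ (rho * cis t)) ^ S n)%C).
  - rewrite cis_2PI. ring.
  - intros t.
    assert (H := cder_path (fun w => c * (/ (rho * w)) ^ S n)%C cis t
      (c * (INR (S n) * (/ (rho * cis t)) ^ n * (- (rho * 1) / ((rho * cis t) * (rho * cis t)))))%C (Ci * cis t)%C).
    replace ((/ (rho * cis t)) ^ S n)%C with (c * (INR (S n) * (/ (rho * cis t)) ^ n * (- (rho * 1) / ((rho * cis t) * (rho * cis t)))) * (Ci * cis t))%C.
    + apply H. 2: apply cis_der. apply (cder_scal c).
      apply (cder_comp (fun w => w ^ S n)%C (fun w => / (rho * w))%C). 2: apply cder_pow.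
      apply (cder_inv (fun w => rho * w)%C). apply (cder_scal rho (fun w => w)), cder_id. apply nz'.
    + unfold c. cbn [Cpow]. set (u := ((/ (rho * cis t)) ^ n)%C).
      assert (HCi : (Ci * Ci)%C = (- (1))%C) by Cring.
      transitivity ((Ci * Ci) * (- (/ (rho * cis t) * u)))%C. { field. repeat split; auto. apply cis_neq0. apply RtoC_neq; lra. }
      rewrite HCi. ring.
  - apply pcont_inv_pow. }
intros e He. exists 1%nat. intros [|n] Hn; try lia. rewrite csum_S_l, C0.
rewrite (csum_ext _ (fun k => 0 * 0)%C) by (intros; rewrite CS; ring). rewrite csum_scal.
match goal with |- Cmod ?x < _ => replace x with (RtoC 0) by (simpl; ring) end. rewrite Cmod_0; auto.
Qed.
End CauchyKernel.

Definition cont2 (F : R -> R -> C) (x y : R) : Prop :=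
  continuity_2d_pt (fun u v => fst (F u v)) x y /\ continuity_2d_pt (fun u v => snd (F u v)) x y.

Lemma cont2_mult F G x y : cont2 F x y -> cont2 G x y -> cont2 (fun u v => F u v * G u v)%C x y.
Proof.
intros [F1 F2] [G1 G2]. split; simpl.
- apply (continuity_2d_pt_minus (fun u v => fst (F u v) * fst (G u v)) (fun u v => snd (F u v) * snd (G u v)));
  apply continuity_2d_pt_mult; auto.
- apply (continuity_2d_pt_plus (fun u v => fst (F u v) * snd (G u v)) (fun u v => snd (F u v) * fst (G u v)));
  apply continuity_2d_pt_mult; auto.
Qed.

Lemma cont2_plus F G x y : cont2 F x y -> cont2 G x y -> cont2 (fun u v => F u v + G u v)%C x y.
Proof. intros [F1 F2] [G1 G2]. split; simpl; apply continuity_2d_pt_plus; auto. Qed.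

Lemma cont2_const c x y : cont2 (fun _ _ => c) x y.
Proof. split; apply continuity_2d_pt_const. Qed.

Lemma cont2_fst x y : cont2 (fun u v => RtoC u) x y.
Proof. split; simpl. apply continuity_2d_pt_id1. apply continuity_2d_pt_const. Qed.

Lemma cont2_cis x y : cont2 (fun u v => cis v) x y.
Proof.
split; simpl; apply continuity_1d_2d_pt_comp; try apply continuity_2d_pt_id2; apply derivable_continuous_pt.
apply derivable_pt_cos. apply derivable_pt_sin.
Qed.

Lemma cont2_comp_eps F x y : cont2 F x y -> forall e, 0 < e -> exists d, 0 < d /\
  forall u v, Rabs (u - x) < d -> Rabs (v - y) < d -> Cmod (F u v - F x y) < e.
Proof.
intros [F1 F2] e He. destruct (F1 (mkposreal (e / 2) ltac:(lra))) as [d1 H1]. destruct (F2 (mkposreal (e / 2) ltac:(lra))) as [d2 H2].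
exists (Rmin d1 d2). split. apply Rmin_pos; apply cond_pos. intros u v Hu Hv.
eapply Rle_lt_trans. apply Cmod_le_sum. simpl.
specialize (H1 u v (Rlt_le_trans _ _ _ Hu (Rmin_l _ _)) (Rlt_le_trans _ _ _ Hv (Rmin_l _ _))).
specialize (H2 u v (Rlt_le_trans _ _ _ Hu (Rmin_r _ _)) (Rlt_le_trans _ _ _ Hv (Rmin_r _ _))).
simpl in H1, H2. unfold Rminus in *. lra.
Qed.

Lemma contR_cont2 (f : C -> R) F x y : contR f (F x y) -> cont2 F x y -> continuity_2d_pt (fun u v => f (F u v)) x y.
Proof.
intros Hf HF e. destruct (Hf e (cond_pos e)) as [d [Hd H]].
destruct (cont2_comp_eps F x y HF d Hd) as [d' [Hd' H']].
exists (mkposreal d' Hd'). intros u v Hu Hv. apply H, H'; auto.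
Qed.

Lemma ccont_cont2 f F x y : ccont f (F x y) -> cont2 F x y -> cont2 (fun u v => f (F u v)) x y.
Proof.
intros Hf HF. split; [apply (contR_cont2 (fun w => fst (f w)))|apply (contR_cont2 (fun w => snd (f w)))]; auto;
 [apply ccont_fst|apply ccont_snd]; auto.
Qed.

Lemma cpder_affine (a b : C) t : cpder (fun x => a + RtoC x * b)%C t b.
Proof.
split; simpl; auto_derive; auto; ring.
Qed.

Lemma cpder_scal_r f c t l : cpder f t l -> cpder (fun x => f x * c)%C t (l * c)%C.
Proof.
intros H. apply (cder_path (fun w => w * c)%C f t c l) in H.
- replace (c * l)%C with (l * c)%C in H by ring. exact H.
- eapply cder_eq. 2: apply (cder_mult (fun w => w) (fun _ => c)); [apply cder_id|apply cder_const]. cbv beta. ring.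
Qed.

Section CauchyDisc.
Variables f f' : C -> C.
Variables R0 rho : R.
Hypothesis Hrho : 0 < rho < R0.
Hypothesis Hf : forall z, Cmod z < R0 -> cder f z (f' z).
Hypothesis Hf' : forall z, Cmod z < R0 -> ccont f' z.

Lemma pcont_circle : pcont (fun t => f (rho * cis t)%C).
Proof using Hrho Hf.
apply (ccont_path f (fun t => rho * cis t)%C).
- apply (pcont_mult (fun _ => RtoC rho)). apply pcont_const. apply pcont_cis.
- intros t. eapply cder_ccont, Hf. rewrite Cmod_mult, Cmod_cis, Cmod_R, Rabs_pos_eq; lra.
Qed.

Variable zeta : C.
Hypothesis Hz : Cmod zeta < rho.

Let P (l t : R) : C := (zeta + RtoC l * (rho * cis t - zeta))%C.
(** A margin that keeps [P l t] in the disc for [l] slightly outside [[0, 1]], as two-sided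
    derivatives at the end points require. *)
Let d0 := (R0 - rho) / (4 * rho).
Let Hd0 : 0 < d0. Proof. unfold d0. apply Rdiv_lt_0_compat; lra. Qed.

Let P_in l t : - d0 < l < 1 + d0 -> Cmod (P l t) < R0.
Proof.
intros Hl. assert (Pz := Cmod_ge_0 zeta).
assert (E : P l t = (RtoC (1 - l) * zeta + RtoC l * (rho * cis t))%C) by (unfold P; rewrite RtoC_minus; ring).
rewrite E. eapply Rle_lt_trans. apply Cmod_triangle. rewrite !Cmod_mult, Cmod_cis, !Cmod_R, (Rabs_pos_eq rho) by lra.
assert (d0 * (4 * rho) = R0 - rho) by (unfold d0; field; lra).
assert (Rabs (1 - l) <= 1 - l + 2 * d0 /\ Rabs l <= l + 2 * d0).
{ split; unfold Rabs; destruct (Rcase_abs _); lra. }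
assert (0 <= Rabs (1 - l)) by apply Rabs_pos. assert (0 <= Rabs l) by apply Rabs_pos.
nra.
Qed.

Let cont2_P l t : cont2 P l t.
Proof.
unfold P. apply (cont2_plus (fun _ _ => zeta)). apply cont2_const.
apply (cont2_mult (fun u _ => RtoC u)). apply cont2_fst.
apply (cont2_plus (fun _ v => rho * cis v)%C (fun _ _ => - zeta)%C). 2: apply cont2_const.
apply (cont2_mult (fun _ _ => RtoC rho)). apply cont2_const. apply cont2_cis.
Qed.

Let pcont_P l : pcont (P l).
Proof.
intros t. assert (H : cpder (fun t => zeta + RtoC l * (rho * cis t - zeta))%C t (RtoC l * rho * (Ci * cis t))%C).
{ apply (cder_path (fun w => zeta + RtoC l * (rho * w - zeta))%C cis). 2: apply cis_der.
  eapply cder_eq. 2: { apply (cder_plus (fun _ => zeta) (fun w => RtoC l * (rho * w - zeta))%C). apply cder_const.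
   apply cder_scal. apply (cder_minus (fun w => rho * w)%C (fun _ => zeta)). apply (cder_scal rho (fun w => w)), cder_id. apply cder_const. }
  ring. }
destruct H as [H1 H2]. split; eapply ex_derive_cont; eexists; eauto.
Qed.

Let nz t : (rho * cis t - zeta)%C <> 0.
Proof.
intros E. assert (H : Cmod zeta = rho). 2: lra.
replace zeta with (rho * cis t)%C. rewrite Cmod_mult, Cmod_cis, Cmod_R, Rabs_pos_eq by lra. ring.
replace (rho * cis t)%C with (rho * cis t - zeta + zeta)%C by ring. rewrite E; ring.
Qed.

Let J (l : R) : C := CInt (fun t => f (P l t) * ck rho zeta t)%C 0 (2 * PI).
Let J' (l : R) : C := CInt (fun t => f' (P l t) * (rho * cis t))%C 0 (2 * PI).

Let pcont_f' l : - d0 < l < 1 + d0 -> pcont (fun t => f' (P l t)).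
Proof. intros Hl. apply (ccont_path f' (P l)). apply pcont_P. intros; apply Hf', P_in; auto. Qed.

Let pcont_rc : pcont (fun t => rho * cis t)%C.
Proof. apply (pcont_mult (fun _ => RtoC rho)). apply pcont_const. apply pcont_cis. Qed.

Let J_der l : 0 <= l <= 1 -> cpder J l (J' l).
Proof.
intros Hl.
assert (D : forall y t, Rabs (y - l) < d0 -> cpder (fun u => f (P u t) * ck rho zeta t)%C y (f' (P y t) * (rho * cis t))%C).
{ intros y t Hy. apply Rabs_lt_between in Hy.
  replace (f' (P y t) * (rho * cis t))%C with (f' (P y t) * (rho * cis t - zeta) * ck rho zeta t)%C.
  2: { unfold ck. field. apply nz. }
  apply (cpder_scal_r (fun u => f (P u t))). apply (cder_path f (fun u => P u t)).
  apply Hf, P_in; lra. apply cpder_affine. }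
assert (C2 : forall t, cont2 (fun y t => f' (P y t) * (rho * cis t))%C l t).
{ intros t. apply (cont2_mult (fun y t => f' (P y t))).
  apply (ccont_cont2 f' P). apply Hf', P_in; lra. apply cont2_P.
  apply (cont2_mult (fun _ _ => RtoC rho)). apply cont2_const. apply cont2_cis. }
assert (CC : forall y, Rabs (y - l) < d0 -> pcont (fun t => f (P y t) * ck rho zeta t)%C).
{ intros y Hy. apply Rabs_lt_between in Hy. apply (pcont_mult (fun t => f (P y t))).
  apply (ccont_path f (P y)). apply pcont_P. intros; eapply cder_ccont, Hf, P_in; lra. apply pcont_ck; auto. }
assert (Ppi := PI_RGT_0).
split.
- apply (RInt_param_deriv (fun y t => fst (f (P y t) * ck rho zeta t)%C) (fun y t => fst (f' (P y t) * (rho * cis t))%C) 0 (2 * PI) l d0); try lra; auto.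
  + intros y t Hy. apply (D y t Hy).
  + intros t. apply C2.
  + intros y t Hy. apply (CC y Hy t).
- apply (RInt_param_deriv (fun y t => snd (f (P y t) * ck rho zeta t)%C) (fun y t => snd (f' (P y t) * (rho * cis t))%C) 0 (2 * PI) l d0); try lra; auto.
  + intros y t Hy. apply (D y t Hy).
  + intros t. apply C2.
  + intros y t Hy. apply (CC y Hy t).
Qed.

(* Away from l = 0 the integrand of J' is, up to the factor i*l, the angular derivative of f (P l t). *)
Let J'_0 l : 0 <= l <= 1 -> J' l = 0.
Proof.
intros Hl. destruct (Req_dec l 0) as [->|Hl0].
- unfold J'. rewrite (CInt_ext _ (fun t => (f' zeta * (rho / Ci)) * (Ci * cis t))%C).
  2: { intros t. unfold P. replace (zeta + 0 * (rho * cis t - zeta))%C with zeta by ring. field. intros E. apply (f_equal snd) in E. simpl in E. lra. }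
  rewrite CInt_scal, (CInt_deriv cis (fun t => Ci * cis t)%C), cis_2PI. ring.
  apply cis_der. apply (pcont_mult (fun _ => Ci)); [apply pcont_const|apply pcont_cis].
  apply (pcont_mult (fun _ => Ci)); [apply pcont_const|apply pcont_cis].
- assert (HCi : Ci <> 0). { intros E. apply (f_equal snd) in E. simpl in E. lra. }
  assert (Hlc : RtoC l <> 0) by (apply RtoC_neq; auto).
  assert (Pc : pcont (fun t => f' (P l t) * (rho * cis t))%C).
  { apply (pcont_mult (fun t => f' (P l t))). apply pcont_f'; lra. apply pcont_rc. }
  unfold J'. rewrite (CInt_ext _ (fun t => / (RtoC l * Ci) * ((RtoC l * Ci) * (f' (P l t) * (rho * cis t))))%C).
  2: { intros t. field. split; auto. }
  assert (Pc' : pcont (fun t => RtoC l * Ci * (f' (P l t) * (rho * cis t)))%C).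
  { apply (pcont_mult (fun _ => RtoC l * Ci)%C); auto. apply pcont_const. }
  rewrite CInt_scal; auto. rewrite (CInt_deriv (fun t => f (P l t))).
  + unfold P. rewrite cis_2PI. ring.
  + intros t.
    replace (RtoC l * Ci * (f' (P l t) * (rho * cis t)))%C with (f' (P l t) * (RtoC l * rho * (Ci * cis t)))%C by ring.
    apply (cder_path f (P l)). apply Hf, P_in; lra.
    apply (cder_path (fun w => zeta + RtoC l * (rho * w - zeta))%C cis). 2: apply cis_der.
    eapply cder_eq. 2: { apply (cder_plus (fun _ => zeta) (fun w => RtoC l * (rho * w - zeta))%C). apply cder_const.
     apply cder_scal. apply (cder_minus (fun w => rho * w)%C (fun _ => zeta)). apply (cder_scal rho (fun w => w)), cder_id. apply cder_const. }
    ring.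
  + auto.
Qed.

(** The circle is contracted to [zeta] along [P], and [J] stays constant during the contraction. At
    [l = 1] it is the left side; at [l = 0] it is [f zeta] times the integral of the kernel. *)
Lemma cauchy_integral : CInt (fun t => f (rho * cis t) * ck rho zeta t)%C 0 (2 * PI) = (RtoC (2 * PI) * f zeta)%C.
Proof using Hrho Hf Hf' Hz.
assert (E : J 1 = J 0).
{ apply injective_projections.
  - symmetry. apply (eq_is_derive (V := R_NormedModule) (fun l => fst (J l))); try lra.
    intros t Ht. destruct (J_der t Ht) as [H _]. rewrite J'_0 in H; auto.
  - symmetry. apply (eq_is_derive (V := R_NormedModule) (fun l => snd (J l))); try lra.
    intros t Ht. destruct (J_der t Ht) as [_ H]. rewrite J'_0 in H; auto. }
transitivity (J 1).
{ apply CInt_ext. intros t. unfold P. replace (zeta + 1 * (rho * cis t - zeta))%C with (rho * cis t)%C by ring. auto. }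
rewrite E. unfold J. rewrite (CInt_ext _ (fun t => f zeta * ck rho zeta t)%C).
2: { intros t. unfold P. replace (zeta + 0 * (rho * cis t - zeta))%C with zeta by ring. auto. }
rewrite CInt_scal, CInt_ck; auto. ring. apply pcont_ck; auto.
Qed.

End CauchyDisc.

Lemma cvr_plus a b R0 : cvr a R0 -> cvr b R0 -> cvr (fun n => a n + b n)%C R0.
Proof.
intros Ha Hb r Hr. destruct (Ha r Hr) as [M HM]. destruct (Hb r Hr) as [M' HM']. exists (M + M').
intros n. specialize (HM n). specialize (HM' n). assert (T := Cmod_triangle (a n) (b n)).
assert (0 <= r ^ n) by (apply pow_le; lra). nra.
Qed.

Lemma cvr_scal c a R0 : cvr a R0 -> cvr (fun n => c * a n)%C R0.
Proof.
intros Ha r Hr. destruct (Ha r Hr) as [M HM]. exists (Cmod c * M). intros n. specialize (HM n).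
rewrite Cmod_mult. assert (P := Cmod_ge_0 c). nra.
Qed.

Lemma PS_eq_coef a b R0 : 0 < R0 -> cvr a R0 -> cvr b R0 ->
  (forall d, 0 < d -> exists z, 0 < Cmod z < d /\ PS a z = PS b z) -> forall n, a n = b n.
Proof.
intros HR Ha Hb H n.
assert (E : forall n, (a n + (- (1)) * b n)%C = 0).
{ apply (PS_zero_coef (fun n => a n + (- (1)) * b n)%C R0); auto.
  apply cvr_plus; auto. apply cvr_scal; auto.
  intros d Hd. destruct (H (Rmin d R0)) as [z [Hz Ez]]. apply Rmin_pos; auto.
  assert (Z1 := Rlt_le_trans _ _ _ (proj2 Hz) (Rmin_l _ _)). assert (Z2 := Rlt_le_trans _ _ _ (proj2 Hz) (Rmin_r _ _)).
  exists z. split. lra. apply (is_PS_PS _ R0); auto. apply cvr_plus; auto. apply cvr_scal; auto.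
  replace (RtoC 0) with (PS a z + (- (1)) * PS b z)%C by (rewrite Ez; ring).
  apply is_PS_plus. apply (PS_is a R0); auto. apply is_PS_scal, (PS_is b R0); auto. }
specialize (E n). replace (a n) with (a n + - (1) * b n + b n)%C by ring. rewrite E. ring.
Qed.

Lemma circle_bounded (f : R -> C) : pcont f -> exists M, forall t, 0 <= t <= 2 * PI -> Cmod (f t) <= M.
Proof.
intros Hf. assert (P := PI_RGT_0).
destruct (continuity_ab_maj (fun t => Rabs (fst (f t)) + Rabs (snd (f t))) 0 (2 * PI)) as [x [Hx _]]; try lra.
{ intros t _. destruct (Hf t) as [H1 H2]. apply continuity_pt_plus; apply (continuity_pt_comp (fun t => _) Rabs);
  try apply Rcontinuity_abs; apply continuity_pt_filterlim; auto. }
eexists. intros t Ht. eapply Rle_trans. apply Cmod_le_sum. apply (Hx t Ht).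
Qed.

Lemma cis_period_reduce t : exists t', 0 <= t' <= 2 * PI /\ cis t = cis t'.
Proof.
assert (P := PI_RGT_0).
destruct (archimed (t / (2 * PI))) as [A1 A2].
set (k := (up (t / (2 * PI)) - 1)%Z).
assert (Hk : IZR k <= t / (2 * PI) < IZR k + 1) by (unfold k; rewrite minus_IZR; lra).
exists (t - 2 * IZR k * PI). split.
{ destruct Hk as [K1 K2]. apply Rle_div_r in K1; try lra. apply Rlt_div_l in K2; lra. }
assert (Per : forall n : nat, cis (t - 2 * INR n * PI) = cis t /\ cis (t + 2 * INR n * PI) = cis t).
{ intros n. unfold cis. rewrite cos_period, sin_period. split; auto.
  rewrite <- (cos_period (t - 2 * INR n * PI) n), <- (sin_period (t - 2 * INR n * PI) n).
  replace (t - 2 * INR n * PI + 2 * INR n * PI) with t by ring. auto. }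
destruct (Z_le_gt_dec 0 k) as [Hp|Hn].
- rewrite <- (Z2Nat.id k) by lia. rewrite <- INR_IZR_INZ. symmetry; apply Per.
- replace k with (- Z.of_nat (Z.to_nat (- k)))%Z by lia. rewrite opp_IZR, <- INR_IZR_INZ.
  replace (t - 2 * - INR (Z.to_nat (- k)) * PI) with (t + 2 * INR (Z.to_nat (- k)) * PI) by ring.
  symmetry; apply Per.
Qed.

(** The coefficients are computed on a circle of radius [rho]. By uniqueness they do not depend on
    it, so one series serves the whole disc and Cauchy's estimate holds on every circle. *)
Lemma cauchy_PS f f' R0 : 0 < R0 -> (forall z, Cmod z < R0 -> cder f z (f' z)) ->
  (forall z, Cmod z < R0 -> ccont f' z) ->
  exists a, cvr a R0 /\ (forall z, Cmod z < R0 -> f z = PS a z) /\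
   forall rho M, 0 < rho < R0 -> (forall t, Cmod (f (rho * cis t)%C) <= M) -> forall n, Cmod (a n) * rho ^ n <= 2 * M.
Proof.
intros HR Hf Hf'. assert (Ppi := PI_RGT_0).
set (co := fun rho n => (/ RtoC (2 * PI) * ccoef rho (fun t => f (rho * cis t)%C) n)%C).
assert (H2pi : RtoC (2 * PI) <> 0) by (apply RtoC_neq; lra).
assert (Hb : forall rho, 0 < rho < R0 -> exists M, forall t, Cmod (f (rho * cis t)%C) <= M).
{ intros rho Hr. destruct (circle_bounded _ (pcont_circle f f' R0 rho Hr Hf)) as [M HM].
  exists M. intros t. destruct (cis_period_reduce t) as [t' [Ht' ->]]. auto. }
assert (Bd : forall rho M, 0 < rho < R0 -> (forall t, Cmod (f (rho * cis t)%C) <= M) -> forall n, Cmod (co rho n) * rho ^ n <= 2 * M).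
{ intros rho M Hr HM n. assert (B := ccoef_bound rho 0 ltac:(rewrite Cmod_0; lra) _ M n (pcont_circle f f' R0 rho Hr Hf) HM).
  unfold co. rewrite Cmod_mult, Cmod_inv, Cmod_R, Rabs_pos_eq by (auto; lra).
  apply Rmult_le_reg_l with (2 * PI). lra.
  replace (2 * PI * (/ (2 * PI) * Cmod (ccoef rho (fun t => f (rho * cis t)%C) n) * rho ^ n)) with
    (Cmod (ccoef rho (fun t => f (rho * cis t)%C) n) * rho ^ n) by (field; lra). lra. }
assert (Cv : forall rho, 0 < rho < R0 -> cvr (co rho) rho).
{ intros rho Hr r Hr'. destruct (Hb rho Hr) as [M HM]. exists (2 * M). intros n.
  eapply Rle_trans. 2: apply (Bd rho M Hr HM n). apply Rmult_le_compat_l. apply Cmod_ge_0. apply pow_incr; lra. }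
assert (Rep : forall rho z, 0 < rho < R0 -> Cmod z < rho -> f z = PS (co rho) z).
{ intros rho z Hr Hz. symmetry. apply (is_PS_PS _ rho); auto.
  destruct (Hb rho Hr) as [M HM].
  replace (f z) with (/ RtoC (2 * PI) * (RtoC (2 * PI) * f z))%C by (field; auto).
  rewrite <- (cauchy_integral f f' R0 rho Hr Hf Hf' z Hz).
  apply is_PS_scal. apply (ck_is_PS rho z Hz (fun t => f (rho * cis t)%C) M); auto.
  apply (pcont_circle f f' R0); auto. }
assert (Eq : forall rho, 0 < rho < R0 -> co rho = co (R0 / 2)).
{ intros rho Hr. apply functional_extensionality. set (r := Rmin rho (R0 / 2)).
  assert (Hr' : 0 < r) by (apply Rmin_pos; lra). assert (r <= rho) by apply Rmin_l. assert (r <= R0 / 2) by apply Rmin_r.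
  apply (PS_eq_coef _ _ r); auto. eapply cvr_le; [|apply Cv]; auto. eapply cvr_le; [|apply Cv]; lra.
  intros d Hd. exists (RtoC (Rmin d r / 2)).
  assert (0 < Rmin d r) by (apply Rmin_pos; auto). assert (Rmin d r <= d) by apply Rmin_l. assert (Rmin d r <= r) by apply Rmin_r.
  rewrite Cmod_R, Rabs_pos_eq by lra. split. lra.
  rewrite <- !Rep; auto; try lra; rewrite Cmod_R, Rabs_pos_eq; lra. }
exists (co (R0 / 2)). split; [|split].
- intros r Hr. rewrite <- (Eq ((r + R0) / 2)) by lra. apply (Cv ((r + R0) / 2)); lra.
- intros z Hz. assert (Pz := Cmod_ge_0 z). rewrite <- (Eq ((Cmod z + R0) / 2)) by lra. apply Rep; lra.
- intros rho M Hr HM n. rewrite <- (Eq rho Hr). apply Bd; auto.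
Qed.

(** * Primitives, Morera's theorem and analyticity *)

Definition inrect' (a b w h : R) (z : C) : Prop :=
  Rmin a (a + w) <= fst z <= Rmax a (a + w) /\ Rmin b (b + h) <= snd z <= Rmax b (b + h).

Section Primitive.
Variables al be : C -> R.
Variable p : C.
Variable R0 : R.
Hypothesis Ha : forall z, Cmod (z - p) < R0 -> contR al z.
Hypothesis Hb : forall z, Cmod (z - p) < R0 -> contR be z.
Hypothesis Hclosed : forall a b w h, 0 <= w -> 0 <= h ->
  (forall z, inrect a b w h z -> Cmod (z - p) < R0) -> RI al be a b w h = 0.

Lemma ex_RInt_s x y t : (forall s, Rmin x y <= s <= Rmax x y -> Cmod ((s, t) - p) < R0) ->
  ex_RInt (fun s => al (s, t)) x y.
Proof using Ha.
intros. apply (ex_RInt_continuous (V := R_CompleteNormedModule)).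
intros s Hs. apply contR_slice_s, Ha. auto.
Qed.

Lemma ex_RInt_t x y s : (forall t, Rmin x y <= t <= Rmax x y -> Cmod ((s, t) - p) < R0) ->
  ex_RInt (fun t => be (s, t)) x y.
Proof using Hb.
intros. apply (ex_RInt_continuous (V := R_CompleteNormedModule)).
intros t Ht. apply contR_slice_t, Hb. auto.
Qed.

(** Negative sides reverse the orientation; this spares [prim_fder] a discussion of the relative
    position of three points. *)
Lemma RI_signed a b w h : (forall z, inrect' a b w h z -> Cmod (z - p) < R0) -> RI al be a b w h = 0.
Proof using Ha Hb Hclosed.
assert (Fw : forall a b w h, (forall z, inrect' a b w h z -> Cmod (z - p) < R0) ->
   RI al be (a + w) b (- w) h = - RI al be a b w h).
{ intros a1 b1 w1 h1 Hin. unfold RI. replace (a1 + w1 + - w1) with a1 by ring.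
  assert (In : forall s, Rmin a1 (a1 + w1) <= s <= Rmax a1 (a1 + w1) -> Cmod ((s, b1) - p) < R0 /\ Cmod ((s, b1 + h1) - p) < R0).
  { intros s Hs. split; apply Hin; split; simpl; auto.
    split; [apply Rmin_l|apply Rmax_l]. split; [apply Rmin_r|apply Rmax_r]. }
  rewrite <- (opp_RInt_swap (fun s => al (s, b1)) a1 (a1 + w1)) by (apply ex_RInt_s; intros; apply In; auto).
  rewrite <- (opp_RInt_swap (fun s => al (s, b1 + h1)) a1 (a1 + w1)) by (apply ex_RInt_s; intros; apply In; auto).
  unfold opp; simpl. ring. }
assert (Fh : forall a b w h, (forall z, inrect' a b w h z -> Cmod (z - p) < R0) ->
   RI al be a (b + h) w (- h) = - RI al be a b w h).
{ intros a1 b1 w1 h1 Hin. unfold RI. replace (b1 + h1 + - h1) with b1 by ring.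
  assert (In : forall s, Rmin b1 (b1 + h1) <= s <= Rmax b1 (b1 + h1) -> Cmod ((a1, s) - p) < R0 /\ Cmod ((a1 + w1, s) - p) < R0).
  { intros s Hs. split; apply Hin; split; simpl; auto.
    split; [apply Rmin_l|apply Rmax_l]. split; [apply Rmin_r|apply Rmax_r]. }
  rewrite <- (opp_RInt_swap (fun s => be (a1, s)) b1 (b1 + h1)) by (apply ex_RInt_t; intros; apply In; auto).
  rewrite <- (opp_RInt_swap (fun s => be (a1 + w1, s)) b1 (b1 + h1)) by (apply ex_RInt_t; intros; apply In; auto).
  unfold opp; simpl. ring. }
assert (Pos : forall a b w h, 0 <= w -> 0 <= h -> (forall z, inrect' a b w h z -> Cmod (z - p) < R0) -> RI al be a b w h = 0).
{ intros a1 b1 w1 h1 Hw Hh Hin. apply Hclosed; auto. intros z [Z1 Z2]. apply Hin.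
  split; rewrite Rmin_left, Rmax_right; lra. }
assert (Half : forall a b w h, 0 <= h -> (forall z, inrect' a b w h z -> Cmod (z - p) < R0) -> RI al be a b w h = 0).
{ intros a1 b1 w1 h1 Hh Hin. destruct (Rle_dec 0 w1). apply Pos; auto.
  assert (E := Fw a1 b1 w1 h1 Hin). rewrite Pos in E; try lra.
  intros z [Z1 Z2]. apply Hin. split; auto. replace (a1 + w1 + - w1) with a1 in Z1 by ring. rewrite Rmin_comm, Rmax_comm; auto. }
intros Hin. destruct (Rle_dec 0 h). apply Half; auto.
assert (E := Fh a b w h Hin). rewrite Half in E; try lra.
intros z [Z1 Z2]. apply Hin. split; auto. replace (b + h + - h) with b in Z2 by ring. rewrite Rmin_comm, Rmax_comm; auto.
Qed.

(** The integral from [p] along the horizontal line through [p], then vertically to [z]. *)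
Definition prim (z : C) : R :=
  RInt (fun x => al (x, snd p)) (fst p) (fst z) + RInt (fun y => be (fst z, y)) (snd p) (snd z).

Lemma near_const f a b c e : ex_RInt f a b -> (forall x, Rmin a b <= x <= Rmax a b -> Rabs (f x - c) <= e) ->
  Rabs (RInt f a b - c * (b - a)) <= e * Rabs (b - a).
Proof.
intros Hf H. destruct (Rle_dec a b) as [Hab|Hab].
- replace b with (a + (b - a)) at 1 by ring. rewrite (Rabs_pos_eq (b - a)) by lra.
  apply RInt_near_const; try lra; replace (a + (b - a)) with b by ring; auto.
  intros x Hx. apply H. rewrite Rmin_left, Rmax_right; lra.
- rewrite <- (opp_RInt_swap f b a) by (apply ex_RInt_swap; auto).
  replace (Rabs (b - a)) with (a - b) by (rewrite Rabs_left; lra).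
  change (Rabs (- RInt f b a - c * (b - a)) <= e * (a - b)).
  replace (- RInt f b a - c * (b - a)) with (- (RInt f b a - c * (a - b))) by ring. rewrite Rabs_Ropp.
  replace a with (b + (a - b)) at 1 by ring.
  apply RInt_near_const; try lra; replace (b + (a - b)) with a by ring. apply ex_RInt_swap; auto.
  intros x Hx. apply H. rewrite Rmin_right, Rmax_left; lra.
Qed.

Lemma Cmod_le_of_abs (x y x' y' : R) : Rabs x <= Rabs x' -> Rabs y <= Rabs y' -> Cmod (x, y) <= Cmod (x', y').
Proof.
intros Hx Hy. unfold Cmod; simpl. apply sqrt_le_1_alt. rewrite !Rmult_1_r.
apply Rsqr_le_abs_1 in Hx. apply Rsqr_le_abs_1 in Hy. unfold Rsqr in *. lra.
Qed.

(** Closedness on a rectangle with vertical sides over the abscissas of [z] and [w] moves the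
    horizontal increment from the height of [p] to the height of [z], where continuity of the form
    controls it. *)
Lemma prim_fder z : Cmod (z - p) < R0 -> fder prim z (al z) (be z).
Proof using Ha Hb Hclosed.
intros Hz e He.
destruct (Ha z Hz (e / 2)) as [d1 [Hd1 F1]]; try lra. destruct (Hb z Hz (e / 2)) as [d2 [Hd2 F2]]; try lra.
set (d := Rmin (Rmin d1 d2) (R0 - Cmod (z - p))).
assert (B1 : d <= Rmin d1 d2) by apply Rmin_l. assert (B2 : d <= R0 - Cmod (z - p)) by apply Rmin_r.
min_le d1 d2 B3 B4.
assert (Hd : 0 < d). { repeat apply Rmin_pos; auto; lra. }
exists (d / 2). split. lra. intros w Hw. destruct z as [s t]. destruct w as [s' t'].
assert (W1 := Cmod_fst ((s', t') - (s, t))). assert (W2 := Cmod_snd ((s', t') - (s, t))). simpl in W1, W2.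
set (D := Cmod ((s', t') - (s, t))) in *.
set (p1 := fst p). set (p2 := snd p). simpl.
assert (Near : forall x y, Rabs (x - s) <= Rabs (s' - s) -> Rabs (y - t) <= Rabs (t' - t) ->
   Cmod ((x, y) - (s, t)) < d).
{ intros x y Hx Hy. apply Rle_lt_trans with D. apply Cmod_le_of_abs; unfold Rminus in *; auto. lra. }
assert (InD : forall x y, Rabs (x - s) <= Rabs (s' - s) -> Rabs (y - t) <= Rabs (t' - t) ->
   Cmod ((x, y) - p) < R0).
{ intros x y Hx Hy. assert (T := Cmod_triangle ((x, y) - (s, t)) ((s, t) - p)).
  replace ((x, y) - (s, t) + ((s, t) - p))%C with ((x, y) - p)%C in T by ring.
  specialize (Near x y Hx Hy). lra. }
(* A disc contains, with each point, the segments to the two lines through its centre parallel to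
   the axes, hence the path of [prim]. *)
assert (Shr : forall x y y0, Cmod ((x, y) - p) < R0 -> Rmin p2 y <= y0 <= Rmax p2 y -> Cmod ((x, y0) - p) < R0).
{ intros x y y0 H1 H2. eapply Rle_lt_trans; [|apply H1]. apply Cmod_le_of_abs. simpl; lra. fold p2. change (Rabs (y0 + - p2) <= Rabs (y + - p2)).
  unfold Rmin, Rmax in H2. destruct (Rle_dec p2 y); simpl.
  rewrite !Rabs_pos_eq; lra. rewrite !Rabs_left1; lra. }
assert (Shrx : forall x y x0, Cmod ((x, y) - p) < R0 -> Rmin p1 x <= x0 <= Rmax p1 x -> Cmod ((x0, y) - p) < R0).
{ intros x y x0 H1 H2. eapply Rle_lt_trans; [|apply H1]. apply Cmod_le_of_abs. 2: simpl; lra. change (Rabs (x0 + - p1) <= Rabs (x + - p1)).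
  unfold Rmin, Rmax in H2. destruct (Rle_dec p1 x); simpl.
  rewrite !Rabs_pos_eq; lra. rewrite !Rabs_left1; lra. }
assert (Btw : forall a b c, Rmin a b <= c <= Rmax a b -> Rabs (c - a) <= Rabs (b - a)).
{ intros a b c H. unfold Rmin, Rmax in H. destruct (Rle_dec a b).
  rewrite !Rabs_pos_eq; lra. rewrite !Rabs_left1; lra. }
assert (Bot : forall x y y0, Cmod ((x, y) - p) < R0 -> y0 = p2 -> Cmod ((x, y0) - p) < R0).
{ intros x y y0 H1 ->. apply (Shr x y); auto. split; [apply Rmin_l|apply Rmax_l]. }
assert (Rs : RI al be s p2 (s' - s) (t - p2) = 0).
{ apply RI_signed. intros [x y] [Z1 Z2]. simpl in Z1, Z2.
  replace (s + (s' - s)) with s' in Z1 by ring. replace (p2 + (t - p2)) with t in Z2 by ring.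
  apply (Shr x t); auto. apply InD. apply Btw; auto. replace (t - t) with 0 by ring. rewrite Rabs_R0; apply Rabs_pos. }
unfold RI in Rs. replace (s + (s' - s)) with s' in Rs by ring. replace (p2 + (t - p2)) with t in Rs by ring.
assert (Z0 : Rabs (t - t) <= Rabs (t' - t)) by (replace (t - t) with 0 by ring; rewrite Rabs_R0; apply Rabs_pos).
assert (Z1 : Rabs (s - s) <= Rabs (s' - s)) by (replace (s - s) with 0 by ring; rewrite Rabs_R0; apply Rabs_pos).
assert (Ch1 : RInt (fun x => al (x, p2)) p1 s' = RInt (fun x => al (x, p2)) p1 s + RInt (fun x => al (x, p2)) s s').
{ symmetry. apply (RInt_Chasles (V := R_CompleteNormedModule)).
  - apply ex_RInt_s. intros x Hx. apply (Bot x t); auto. apply (Shrx s); auto.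
  - apply ex_RInt_s. intros x Hx. apply (Bot x t); auto. }
assert (Ch2 : RInt (fun y => be (s', y)) p2 t' = RInt (fun y => be (s', y)) p2 t + RInt (fun y => be (s', y)) t t').
{ symmetry. apply (RInt_Chasles (V := R_CompleteNormedModule)).
  - apply ex_RInt_t. intros y Hy. apply (Shr s' t); auto. apply InD; auto. lra.
  - apply ex_RInt_t. intros y Hy. apply InD; auto. lra. }
unfold prim. fold p1 p2. cbn [fst snd]. rewrite Ch1, Ch2.
assert (N1 : Rabs (RInt (fun x => al (x, t)) s s' - al (s, t) * (s' - s)) <= e / 2 * Rabs (s' - s)).
{ apply near_const. apply ex_RInt_s. intros x Hx. apply InD; auto.
  intros x Hx. left. apply F1. specialize (Near x t (Btw _ _ _ Hx) Z0). lra. }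
assert (N2 : Rabs (RInt (fun y => be (s', y)) t t' - be (s, t) * (t' - t)) <= e / 2 * Rabs (t' - t)).
{ apply near_const. apply ex_RInt_t. intros y Hy. apply InD; auto. lra.
  intros y Hy. left. apply F2. specialize (Near s' y (Rle_refl _) (Btw _ _ _ Hy)). lra. }
match goal with |- Rabs ?X <= _ => replace X with
 ((RInt (fun x => al (x, t)) s s' - al (s, t) * (s' - s)) + (RInt (fun y => be (s', y)) t t' - be (s, t) * (t' - t)))
 by lra end.
eapply Rle_trans. apply Rabs_triang. unfold Rminus in *. nra.
Qed.
End Primitive.

(* f dz = (u + i v)(ds + i dt) = (u ds - v dt) + i (v ds + u dt). *)
Definition null_rect (f : C -> C) (a b w h : R) : Prop :=
  RI (fun z => fst (f z)) (fun z => - snd (f z)) a b w h = 0 /\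
  RI (fun z => snd (f z)) (fun z => fst (f z)) a b w h = 0.

Lemma contR_opp f z : contR f z -> contR (fun w => - f w) z.
Proof.
intros H e He. destruct (H e He) as [d [Hd F]]. exists d. split; auto. intros w Hw.
replace (- f w - - f z) with (- (f w - f z)) by ring. rewrite Rabs_Ropp. auto.
Qed.

Lemma ccont_shift f p z : ccont f (p + z)%C -> ccont (fun w => f (p + w)%C) z.
Proof.
intros H e He. destruct (H e He) as [d [Hd F]]. exists d. split; auto. intros w Hw. apply F.
replace (p + w - (p + z))%C with (w - z)%C by ring. auto.
Qed.

Lemma cder_shift f p z l : cder f (p + z)%C l -> cder (fun w => f (p + w)%C) z l.
Proof.
intros H e He. destruct (H e He) as [d [Hd F]]. exists d. split; auto. intros w Hw.
specialize (F (p + w)%C). replace (p + w - (p + z))%C with (w - z)%C in F by ring. auto.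
Qed.

(** The primitive has the continuous complex derivative [f], so the elementary form of Cauchy's
    formula applies to it; [f] is then the derived series. *)
Lemma morera_PS f p R0 : 0 < R0 -> (forall z, Cmod (z - p) < R0 -> ccont f z) ->
  (forall a b w h, 0 <= w -> 0 <= h -> (forall z, inrect a b w h z -> Cmod (z - p) < R0) -> null_rect f a b w h) ->
  exists P, (forall z, Cmod (z - p) < R0 -> cder P z (f z)) /\
  (forall z, P z = (prim (fun z => fst (f z)) (fun z => - snd (f z)) p z, prim (fun z => snd (f z)) (fun z => fst (f z)) p z)) /\
  exists a, cvr a R0 /\ (forall z, Cmod z < R0 -> P (p + z)%C = PS a z) /\
   (forall z, Cmod z < R0 -> f (p + z)%C = PS (dps a) z) /\
   forall rho M, 0 < rho < R0 -> (forall t, Cmod (P (p + rho * cis t)%C) <= M) -> forall n, Cmod (a n) * rho ^ n <= 2 * M.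
Proof.
intros HR Hc Hn.
set (P := fun z => (prim (fun z => fst (f z)) (fun z => - snd (f z)) p z, prim (fun z => snd (f z)) (fun z => fst (f z)) p z) : C).
assert (HP : forall z, Cmod (z - p) < R0 -> cder P z (f z)).
{ intros z Hz. destruct (f z) as [u v] eqn:E.
  apply fder_cder; simpl.
  - assert (H := prim_fder (fun z => fst (f z)) (fun z => - snd (f z)) p R0). cbv beta in H. specialize (H) with (z := z).
    rewrite E in H. apply H; auto.
    intros; apply ccont_fst; auto. intros; apply contR_opp, ccont_snd; auto.
    intros a b w h H1 H2 H3. destruct (Hn a b w h H1 H2 H3) as [X _]. exact X.
  - assert (H := prim_fder (fun z => snd (f z)) (fun z => fst (f z)) p R0). cbv beta in H. specialize (H) with (z := z).
    rewrite E in H. apply H; auto.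
    intros; apply ccont_snd; auto. intros; apply ccont_fst; auto.
    intros a b w h H1 H2 H3. destruct (Hn a b w h H1 H2 H3) as [_ X]. exact X. }
exists P. split; auto. split; auto.
assert (Sh : forall z, (p + z - p)%C = z) by (intros; ring).
destruct (cauchy_PS (fun w => P (p + w)%C) (fun w => f (p + w)%C) R0 HR) as [a [Ca [Ea Ba]]].
{ intros z Hz. apply cder_shift, HP. rewrite Sh; auto. }
{ intros z Hz. apply ccont_shift, Hc. rewrite Sh; auto. }
exists a. split; [|split; [|split]]; auto.
intros z Hz. apply (cder_unique (fun w => P (p + w)%C) z).
- apply cder_shift, HP. rewrite Sh; auto.
- apply cder_ext with (PS a). 2: apply (PS_cder a R0); auto.
  exists (R0 - Cmod z). split. lra. intros w Hw. symmetry. apply Ea.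
  assert (T := Cmod_triangle z (w - z)). replace (z + (w - z))%C with w in T by ring. lra.
Qed.

Lemma cder_null_rect f a b w h : 0 <= w -> 0 <= h ->
  (forall z, inrect a b w h z -> exists l, cder f z l) -> null_rect f a b w h.
Proof.
intros Hw Hh H. split; apply goursat_form; auto; intros z Hz; destruct (H z Hz) as [[p q] Hl];
 apply cder_fder in Hl; destruct Hl as [H1 H2]; simpl in H1, H2.
- exists p, (- q), (- p). split; auto.
  intros e He. destruct (H2 e He) as [d [Hd F]]. exists d. split; auto. intros z' Hz'. specialize (F z' Hz').
  rewrite <- Rabs_Ropp. eapply Rle_trans; [|apply F]. right. f_equal. ring.
- exists q, p, (- q). split; auto.
Qed.

(** Goursat makes the rectangle integrals vanish, Morera then shows that the derivative is
    continuous, and only after that does [cauchy_PS] apply to [f] itself, with its estimate on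
    circles. *)
Lemma holo_PS f p R0 : 0 < R0 -> (forall z, Cmod (z - p) < R0 -> exists l, cder f z l) ->
  exists a, cvr a R0 /\ (forall z, Cmod (z - p) < R0 -> f z = PS a (z - p)%C) /\
  forall rho M, 0 < rho < R0 -> (forall t, Cmod (f (p + rho * cis t)%C) <= M) -> forall n, Cmod (a n) * rho ^ n <= 2 * M.
Proof.
intros HR H.
destruct (morera_PS f p R0 HR) as [P [HP [_ [b [Cb [Eb [Fb _]]]]]]].
{ intros z Hz. destruct (H z Hz) as [l Hl]. eapply cder_ccont; eauto. }
{ intros a b w h Hw Hh Hin. apply cder_null_rect; auto. }
destruct (cauchy_PS (fun w => f (p + w)%C) (PS (dps (dps b))) R0 HR) as [a [Ca [Ea Ba]]].
- intros z Hz. apply cder_ext with (PS (dps b)). 2: apply (PS_cder _ R0); auto; apply cvr_dps; auto.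
  exists (R0 - Cmod z). split. lra. intros w Hw. symmetry. apply Fb.
  assert (T := Cmod_triangle z (w - z)). replace (z + (w - z))%C with w in T by ring. lra.
- intros z Hz. apply (PS_ccont _ R0); auto. apply cvr_dps, cvr_dps; auto.
- exists a. split; [|split]; auto. intros z Hz.
  rewrite <- Ea by auto. f_equal. ring.
Qed.

(** A maximum principle with a constant: Cauchy's estimate [2 M] times a geometric series of ratio
    at most [/ 2]. *)
Lemma holo_bound f p R0 rho M : 0 < rho < R0 -> (forall z, Cmod (z - p) < R0 -> exists l, cder f z l) ->
  (forall t, Cmod (f (p + rho * cis t)%C) <= M) -> forall z, Cmod (z - p) <= rho / 2 -> Cmod (f z) <= 4 * M.
Proof.
intros Hr H HM z Hz. destruct (holo_PS f p R0 ltac:(lra) H) as [a [Ca [Ea Ba]]].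
assert (B := Ba rho M Hr HM). rewrite Ea by lra.
assert (HM0 : 0 <= M) by (eapply Rle_trans; [apply Cmod_ge_0|apply (HM 0)]).
assert (L := PS_is a R0 (z - p)%C Ca ltac:(lra)).
apply le_epsilon. intros e He. destruct (L e He) as [N HN]. specialize (HN N ltac:(lia)).
set (s := csum _ N) in *.
assert (Cmod s <= 2 * M / (1 - / 2)).
{ apply csum_geom_bound; try lra. intros n. rewrite Cmod_mult, Cmod_pow. specialize (B n).
  assert (Cmod (z - p) ^ n <= (rho / 2) ^ n) by (apply pow_incr; split; auto; apply Cmod_ge_0).
  replace (rho / 2) with (rho * / 2) in H0 by field. rewrite Rpow_mult_distr in H0.
  assert (0 <= (/ 2) ^ n) by (apply pow_le; lra). assert (Pa := Cmod_ge_0 (a n)).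
  apply Rle_trans with (Cmod (a n) * (rho ^ n * (/ 2) ^ n)). apply Rmult_le_compat_l; auto. nra. }
replace (PS a (z - p)) with (s + - (s - PS a (z - p)))%C by ring.
eapply Rle_trans. apply Cmod_triangle. rewrite Cmod_opp. lra.
Qed.

(** * Circle means and the gradient bound *)

Ltac Rring := match goal with |- ?a = ?b => change (a = b :> R) end; ring.

Lemma Rmult3_pos a b c : 0 <= a -> 0 <= b -> 0 <= c -> 0 <= a * b * c.
Proof. intros. apply Rmult_le_pos; auto. apply Rmult_le_pos; auto. Qed.

Lemma der_le f df a b : a <= b -> (forall x, a <= x <= b -> is_derive f x (df x)) ->
  (forall x, a < x < b -> 0 <= df x) -> f a <= f b.
Proof.
intros Hab H Hp. destruct (Req_dec a b) as [->|Hne]; [lra|].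
destruct (MVT_cor2 f df a b) as [c [Hc1 Hc2]]; try lra.
- intros c Hc. apply is_derive_Reals, H; auto.
- specialize (Hp c Hc2). nra.
Qed.

(** The derivatives are named functions with total differentials, so that products and compositions
    are differentiated by rules; symmetry of the mixed ones is derived in [mixed_partials]. *)
Record C2on (U : C -> Prop) (f fs ft fss fst_ fts ftt : C -> R) : Prop := {
  c2_f : forall z, U z -> fder f z (fs z) (ft z);
  c2_s : forall z, U z -> fder fs z (fss z) (fst_ z);
  c2_t : forall z, U z -> fder ft z (fts z) (ftt z);
  c2_ss : forall z, U z -> contR fss z;
  c2_st : forall z, U z -> contR fst_ z;
  c2_ts : forall z, U z -> contR fts z;
  c2_tt : forall z, U z -> contR ftt z }.

Arguments c2_f {U f fs ft fss fst_ fts ftt}.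
Arguments c2_s {U f fs ft fss fst_ fts ftt}.
Arguments c2_t {U f fs ft fss fst_ fts ftt}.
Arguments c2_ss {U f fs ft fss fst_ fts ftt}.
Arguments c2_st {U f fs ft fss fst_ fts ftt}.
Arguments c2_ts {U f fs ft fss fst_ fts ftt}.
Arguments c2_tt {U f fs ft fss fst_ fts ftt}.
Section Polar.
Variable p : C.
Variable R0 : R.
Let U (z : C) := Cmod (z - p) < R0.

Definition pol (r t : R) : C := (p + RtoC r * cis t)%C.

Let pol_in r t : Rabs r < R0 -> U (pol r t).
Proof.
intros H. unfold U, pol. replace (p + RtoC r * cis t - p)%C with (RtoC r * cis t)%C by ring.
rewrite Cmod_mult, Cmod_R, Cmod_cis; lra.
Qed.

Let cont2_pol r t : cont2 pol r t.
Proof.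
apply (cont2_plus (fun _ _ => p)). apply cont2_const.
apply (cont2_mult (fun u _ => RtoC u)). apply cont2_fst. apply cont2_cis.
Qed.

Lemma continuity_2d_slice (g : R -> R -> R) r t : continuity_2d_pt g r t -> continuous (g r) t.
Proof.
intros H. apply continuity_pt_filterlim. intros e He.
destruct (H (mkposreal e He)) as [d Hd]. exists d. split. apply cond_pos.
intros y [_ Hy]. apply Hd; auto. replace (r - r) with 0 by ring. rewrite Rabs_R0. apply cond_pos.
Qed.

Lemma contR_pol g r t : Rabs r < R0 -> (forall z, U z -> contR g z) -> continuous (fun t => g (pol r t)) t.
Proof.
intros Hr Hg. apply (continuity_2d_slice (fun r t => g (pol r t))).
apply contR_cont2; auto.
Qed.

Lemma polar_der g gs gt (w : R -> R) r : Rabs r < R0 ->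
  (forall z, U z -> fder g z (gs z) (gt z)) -> (forall z, U z -> contR gs z) -> (forall z, U z -> contR gt z) ->
  (forall t, continuous w t) ->
  is_derive (fun r => RInt (fun t => g (pol r t) * w t) 0 (2 * PI)) r
    (RInt (fun t => (gs (pol r t) * cos t + gt (pol r t) * sin t) * w t) 0 (2 * PI)).
Proof.
intros Hr Hg Hs Ht Hw.
assert (Cg : forall z, U z -> contR g z) by (intros; eapply fder_contR; eauto).
apply (RInt_param_deriv (fun r t => g (pol r t) * w t) (fun r t => (gs (pol r t) * cos t + gt (pol r t) * sin t) * w t)
  0 (2 * PI) r (R0 - Rabs r)).
- generalize PI_RGT_0; lra.
- lra.
- intros y t Hy.
  assert (Hy' : Rabs y < R0). { assert (T := Rabs_triang r (y - r)). replace (r + (y - r)) with y in T by ring. lra. }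
  replace ((gs (pol y t) * cos t + gt (pol y t) * sin t) * w t) with (w t * (gs (pol y t) * cos t + gt (pol y t) * sin t)) by ring.
  apply is_derive_ext with (fun u => w t * g (pol u t)). { intros; apply Rmult_comm. }
  apply is_derive_scal.
  apply is_derive_ext with (fun u => g (fst p + u * cos t, snd p + u * sin t)).
  { intros u. f_equal. unfold pol. Cring. }
  apply (fder_path g (fun u => fst p + u * cos t) (fun u => snd p + u * sin t)).
  + replace (fst p + y * cos t, snd p + y * sin t) with (pol y t).
    apply Hg, pol_in; auto. unfold pol. Cring.
  + auto_derive; auto; ring.
  + auto_derive; auto; ring.
- intros t. apply continuity_2d_pt_mult.
  + apply continuity_2d_pt_plus; apply continuity_2d_pt_mult.
    * apply contR_cont2; auto.
    * apply continuity_1d_2d_pt_comp. apply derivable_continuous_pt, derivable_pt_cos. apply continuity_2d_pt_id2.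
    * apply contR_cont2; auto.
    * apply continuity_1d_2d_pt_comp. apply derivable_continuous_pt, derivable_pt_sin. apply continuity_2d_pt_id2.
  + apply (continuity_1d_2d_pt_comp w (fun _ v => v)). apply continuity_pt_filterlim, Hw. apply continuity_2d_pt_id2.
- intros y t Hy.
  assert (Hy' : Rabs y < R0). { assert (T := Rabs_triang r (y - r)). replace (r + (y - r)) with y in T by ring. lra. }
  apply (continuous_mult (K := R_AbsRing)); auto. apply contR_pol; auto.
Qed.

Variables f fs ft fss fst_ fts ftt : C -> R.
Hypothesis H2 : C2on U f fs ft fss fst_ fts ftt.
Variable k : R.
Hypothesis Hk : forall z, U z -> Rabs (fss z + ftt z) <= k.

Let Cf : forall z, U z -> contR f z. Proof. intros; eapply fder_contR, (c2_f H2); auto. Qed.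
Let Cs : forall z, U z -> contR fs z. Proof. intros; eapply fder_contR, (c2_s H2); auto. Qed.
Let Ct : forall z, U z -> contR ft z. Proof. intros; eapply fder_contR, (c2_t H2); auto. Qed.

Variables c e1 e2 : R.
(** The weight [w = c + q] covers two cases at once: [q = 0] gives the circle mean, and [c = 0] the
    first Fourier mode, which sees the gradient at the centre. *)
Let q t := e1 * cos t + e2 * sin t.
Let w t := c + q t.

Let cont_cos t : continuous cos t. Proof. apply continuous_cos. Qed.
Let cont_sin t : continuous sin t. Proof. apply continuous_sin. Qed.
Let cont_q t : continuous q t.
Proof. apply ex_derive_cont. unfold q. auto_derive; auto. Qed.
Let cont_w t : continuous w t.
Proof. apply ex_derive_cont. unfold w, q. auto_derive; auto. Qed.

Let A r := RInt (fun t => f (pol r t) * w t) 0 (2 * PI).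
Let A1 r := RInt (fun t => (fs (pol r t) * cos t + ft (pol r t) * sin t) * w t) 0 (2 * PI).
Let A2 r := RInt (fun t => ((fss (pol r t) * cos t + fst_ (pol r t) * sin t) * cos t +
                            (fts (pol r t) * cos t + ftt (pol r t) * sin t) * sin t) * w t) 0 (2 * PI).
Let Aq r := RInt (fun t => f (pol r t) * q t) 0 (2 * PI).
Let B r := RInt (fun t => (fss (pol r t) + ftt (pol r t)) * w t) 0 (2 * PI).

Lemma ex_RInt_c (g : R -> R) a b : (forall t, continuous g t) -> ex_RInt g a b.
Proof. intros H. apply (ex_RInt_continuous (V := R_CompleteNormedModule)). auto. Qed.

Let A_der r : Rabs r < R0 -> is_derive A r (A1 r).
Proof. intros Hr. apply polar_der; auto. apply (c2_f H2). Qed.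

Ltac ct := repeat (match goal with
  | |- continuous (fun t => _ + _) _ => apply (continuous_plus (K := R_AbsRing) (V := R_NormedModule))
  | |- continuous (fun t => _ - _) _ => apply (continuous_minus (K := R_AbsRing) (V := R_NormedModule))
  | |- continuous (fun t => _ * _) _ => apply (continuous_mult (K := R_AbsRing))
  | |- continuous (fun t => - _) _ => apply (continuous_opp (K := R_AbsRing) (V := R_NormedModule))
  | |- continuous (fun t => ?g (pol _ t)) _ => apply contR_pol
  end); auto; try apply continuous_const; try apply (c2_ss H2); try apply (c2_st H2);
  try apply (c2_ts H2); try apply (c2_tt H2).

Let A1_der r : Rabs r < R0 -> is_derive A1 r (A2 r).
Proof.
intros Hr.
assert (D1 := polar_der fs fss fst_ (fun t => cos t * w t) r Hr (c2_s H2) (c2_ss H2) (c2_st H2)).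
assert (D2 := polar_der ft fts ftt (fun t => sin t * w t) r Hr (c2_t H2) (c2_ts H2) (c2_tt H2)).
specialize (D1 ltac:(intros; ct)). specialize (D2 ltac:(intros; ct)).
assert (D := is_derive_plus _ _ _ _ _ D1 D2).
eapply is_derive_ext_loc.
2: { replace (A2 r) with (plus (RInt (fun t => (fss (pol r t) * cos t + fst_ (pol r t) * sin t) * (cos t * w t)) 0 (2 * PI))
      (RInt (fun t => (fts (pol r t) * cos t + ftt (pol r t) * sin t) * (sin t * w t)) 0 (2 * PI))).
     exact D. unfold A2.
     rewrite <- (RInt_plus (V := R_CompleteNormedModule)) by (apply ex_RInt_c; intros; ct).
     apply RInt_extR. intros t. unfold plus; simpl. ring. }
exists (mkposreal (R0 - Rabs r) ltac:(lra)). intros y Hy.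
assert (Hy' : Rabs y < R0).
{ change (Rabs (y - r) < R0 - Rabs r) in Hy. assert (T := Rabs_triang_inv y r). lra. }
unfold A1. rewrite <- (RInt_plus (V := R_CompleteNormedModule)) by (apply ex_RInt_c; intros; ct).
apply RInt_extR. intros t. unfold plus; simpl. ring.
Qed.

(* The polar Laplacian r (r F_r)_r + F_tt = r^2 (lap f), integrated by parts twice in t against w, with w'' = - q. *)
Let polar_id r : Rabs r < R0 -> r * A1 r + r * r * A2 r - Aq r = r * r * B r.
Proof.
intros Hr.
set (P := fun t => r * (- fs (pol r t) * sin t + ft (pol r t) * cos t) * w t - f (pol r t) * (e2 * cos t - e1 * sin t)).
set (P' := fun t => (- r * (fs (pol r t) * cos t + ft (pol r t) * sin t)
   + r * r * ((fss (pol r t) * sin t - fst_ (pol r t) * cos t) * sin t + (- fts (pol r t) * sin t + ftt (pol r t) * cos t) * cos t)) * w t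
   + f (pol r t) * q t).
assert (DF : forall g gs gt, (forall z, U z -> fder g z (gs z) (gt z)) -> forall t,
   is_derive (fun t => g (pol r t)) t (gs (pol r t) * (- r * sin t) + gt (pol r t) * (r * cos t))).
{ intros g gs gt Hg t.
  apply is_derive_ext with (fun u => g (fst p + r * cos u, snd p + r * sin u)).
  { intros u. f_equal. unfold pol. Cring. }
  apply (fder_path g (fun u => fst p + r * cos u) (fun u => snd p + r * sin u)).
  replace (fst p + r * cos t, snd p + r * sin t) with (pol r t). apply Hg, pol_in; auto.
  unfold pol. Cring.
  auto_derive; auto; ring. auto_derive; auto; ring. }
assert (DP : forall t, is_derive P t (P' t)).
{ intros t.
  assert (D1 := DF f fs ft (c2_f H2) t). assert (D2 := DF fs fss fst_ (c2_s H2) t).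
  assert (D3 := DF ft fts ftt (c2_t H2) t).
  assert (G : forall (u0 u1 u2 : R -> R) d0 d1 d2, is_derive u0 t d0 -> is_derive u1 t d1 -> is_derive u2 t d2 ->
    is_derive (fun t => r * (- u1 t * sin t + u2 t * cos t) * w t - u0 t * (e2 * cos t - e1 * sin t)) t
     (r * (- d1 * sin t - u1 t * cos t + d2 * cos t - u2 t * sin t) * w t + r * (- u1 t * sin t + u2 t * cos t) * (e2 * cos t - e1 * sin t)
      - d0 * (e2 * cos t - e1 * sin t) + u0 t * q t)).
  { intros u0 u1 u2 d0 d1 d2 X0 X1 X2. unfold w, q. auto_derive.
    repeat split; auto; eexists; eauto.
    replace (Derive (fun x => u0 x) t) with d0 by (symmetry; apply is_derive_unique, X0).
    replace (Derive (fun x => u1 x) t) with d1 by (symmetry; apply is_derive_unique, X1).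
    replace (Derive (fun x => u2 x) t) with d2 by (symmetry; apply is_derive_unique, X2). ring. }
  assert (X := G _ _ _ _ _ _ D1 D2 D3). unfold P. evar_last. exact X. unfold P'. ring. }
assert (I : RInt P' 0 (2 * PI) = 0).
{ transitivity (minus (P (2 * PI)) (P 0)).
  - apply is_RInt_unique. apply (is_RInt_derive (V := R_CompleteNormedModule)); intros; auto. unfold P'. ct.
  - assert (E : pol r (2 * PI) = pol r 0) by (unfold pol; rewrite cis_2PI; auto).
    unfold P, minus, plus, opp, w, q; simpl. rewrite E, cos_2PI, sin_2PI, cos_0, sin_0. ring. }
assert (E : r * A1 r + (- r * r) * B r + 1 * (r * r * A2 r - Aq r) = - RInt P' 0 (2 * PI) ).
2: { rewrite I in E. lra. }
assert (X1 : r * r * A2 r - Aq r = RInt (fun t => r * r * (((fss (pol r t) * cos t + fst_ (pol r t) * sin t) * cos t +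
      (fts (pol r t) * cos t + ftt (pol r t) * sin t) * sin t) * w t) + (-1) * (f (pol r t) * q t)) 0 (2 * PI)).
{ rewrite (RInt_lin2 (fun t => ((fss (pol r t) * cos t + fst_ (pol r t) * sin t) * cos t +
      (fts (pol r t) * cos t + ftt (pol r t) * sin t) * sin t) * w t) (fun t => f (pol r t) * q t)) by (apply ex_RInt_c; intros; ct).
  unfold A2, Aq. ring. }
assert (X2 : r * A1 r + (- r * r) * B r = RInt (fun t => r * ((fs (pol r t) * cos t + ft (pol r t) * sin t) * w t) +
     (- r * r) * ((fss (pol r t) + ftt (pol r t)) * w t)) 0 (2 * PI)).
{ rewrite (RInt_lin2 (fun t => (fs (pol r t) * cos t + ft (pol r t) * sin t) * w t) (fun t => (fss (pol r t) + ftt (pol r t)) * w t)) by (apply ex_RInt_c; intros; ct).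
  unfold A1, B. ring. }
rewrite X1, X2.
rewrite <- (Rmult_1_l (RInt _ _ _)) at 1.
rewrite <- (RInt_lin2 (fun t => r * ((fs (pol r t) * cos t + ft (pol r t) * sin t) * w t) +
     (- r * r) * ((fss (pol r t) + ftt (pol r t)) * w t)) (fun t => r * r * (((fss (pol r t) * cos t + fst_ (pol r t) * sin t) * cos t +
      (fts (pol r t) * cos t + ftt (pol r t) * sin t) * sin t) * w t) + (-1) * (f (pol r t) * q t)) 1 1) by (apply ex_RInt_c; intros; ct).
replace (- RInt P' 0 (2 * PI)) with (0 * RInt P' 0 (2 * PI) + (-1) * RInt P' 0 (2 * PI)) by ring.
rewrite <- (RInt_lin2 P' P') by (apply ex_RInt_c; intros; unfold P'; ct).
apply RInt_extR. intros t. unfold P'.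
assert (T := sin2_cos2 t). unfold Rsqr in T.
replace (fss (pol r t) + ftt (pol r t)) with ((fss (pol r t) + ftt (pol r t)) * (sin t * sin t + cos t * cos t)) by (rewrite T; ring).
ring.
Qed.

Hypothesis Hw1 : forall t, Rabs (w t) <= 1.

Let k0 : 0 < R0 -> 0 <= k.
Proof.
intros HR. eapply Rle_trans. 2: apply (Hk p). apply Rabs_pos.
unfold U. rewrite Cmod_diag; auto.
Qed.

Let B_bound r : Rabs r < R0 -> Rabs (B r) <= 2 * PI * k.
Proof.
intros Hr. unfold B.
replace (2 * PI * k) with ((2 * PI - 0) * k) by ring.
apply abs_RInt_le_const. generalize PI_RGT_0; lra. apply ex_RInt_c; intros; ct.
intros t _. rewrite Rabs_mult.
assert (Rabs (fss (pol r t) + ftt (pol r t)) <= k) by (apply Hk, pol_in; auto).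
specialize (Hw1 t). assert (P1 := Rabs_pos (w t)). assert (P2 := Rabs_pos (fss (pol r t) + ftt (pol r t))). nra.
Qed.

(** When the integral against [q] vanishes, [polar_id] reads [(r A1)' = r B], and [B] is at most
    [2 PI k] in absolute value. *)
Lemma radial_der_bound r : 0 < r < R0 -> (forall x, 0 <= x <= r -> Aq x = 0) ->
  - PI * k * r <= A1 r.
Proof.
intros Hr Hq. assert (P := PI_RGT_0).
assert (D : forall x, 0 <= x <= r -> is_derive (fun x => x * A1 x + PI * k * x ^ 2) x (A1 x + x * A2 x + 2 * PI * k * x)).
{ intros x Hx. assert (D1 := A1_der x ltac:(rewrite Rabs_pos_eq; lra)).
  auto_derive. repeat split; auto. eexists; eauto.
  replace (Derive (fun x => A1 x) x) with (A2 x) by (symmetry; apply is_derive_unique, D1). ring. }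
assert (H := der_le _ _ 0 r ltac:(lra) D).
assert (H' : 0 <= r * A1 r + PI * k * r ^ 2).
{ replace 0 with (0 * A1 0 + PI * k * 0 ^ 2) by ring. apply H. intros x Hx.
  assert (I := polar_id x ltac:(rewrite Rabs_pos_eq; lra)). rewrite Hq in I by lra.
  assert (Bb := B_bound x ltac:(rewrite Rabs_pos_eq; lra)). apply Rabs_le_between in Bb.
  assert (A1 x + x * A2 x = x * B x). { apply Rmult_eq_reg_l with x; lra. }
  nra. }
apply Rmult_le_reg_l with r; nra.
Qed.

(** For the first mode [polar_id] is an Euler equation, [(r ^ 2 A1 - r A)' = r ^ 2 B]. Integrating
    twice controls the variation of [A / r], whose limit at [0] is [A1 0]. *)
Lemma first_mode_bound r : 0 < r < R0 -> c = 0 -> Rabs (A1 0) <= Rabs (A r) / r + 2 * PI * k * r.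
Proof.
intros Hr Hc. assert (P := PI_RGT_0). assert (K := k0 ltac:(lra)).
assert (EA : forall x, A x = Aq x). { intros x. unfold A, Aq. apply RInt_extR. intros t. unfold w. rewrite Hc. ring. }
assert (H1 : forall s x, Rabs s = 1 -> 0 <= x <= r -> s * (x * x * A1 x - x * A x) <= PI * k * x ^ 3).
{ intros s x Hs Hx.
  assert (D : forall x, 0 <= x <= r -> is_derive (fun x => PI * k * x ^ 3 - s * (x * x * A1 x - x * A x)) x
     (3 * PI * k * x ^ 2 - s * (x * A1 x + x * x * A2 x - A x))).
  { intros y Hy. assert (D1 := A1_der y ltac:(rewrite Rabs_pos_eq; lra)). assert (D0 := A_der y ltac:(rewrite Rabs_pos_eq; lra)).
    auto_derive. repeat split; auto; eexists; eauto.
    replace (Derive (fun x => A1 x) y) with (A2 y) by (symmetry; apply is_derive_unique, D1).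
    replace (Derive (fun x => A x) y) with (A1 y) by (symmetry; apply is_derive_unique, D0). ring. }
  assert (H := der_le _ _ 0 x ltac:(lra) (fun y Hy => D y ltac:(lra))). cbv beta in H.
  assert (H' : 0 <= PI * k * x ^ 3 - s * (x * x * A1 x - x * A x)). 2: lra.
  replace 0 with (PI * k * 0 ^ 3 - s * (0 * 0 * A1 0 - 0 * A 0)) at 1 by ring. apply H. intros y Hy.
  rewrite EA, polar_id by (rewrite Rabs_pos_eq; lra).
  assert (Bb := B_bound y ltac:(rewrite Rabs_pos_eq; lra)).
  assert (Rabs (s * B y) <= 2 * PI * k) by (rewrite Rabs_mult, Hs; lra). apply Rabs_le_between in H0. nra. }
assert (H3 : forall s x, Rabs s = 1 -> 0 < x <= r -> s * (A r / r) - PI * k * r <= s * (A x / x) - PI * k * x).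
{ intros s x Hs Hx.
  assert (D : forall y, x <= y <= r -> is_derive (fun y => PI * k * y - s * (A y / y)) y (PI * k - s * ((y * A1 y - A y) / (y * y)))).
  { intros y Hy. assert (D0 := A_der y ltac:(rewrite Rabs_pos_eq; lra)).
    auto_derive. repeat split; auto; try lra; eexists; eauto.
    replace (Derive (fun x => A x) y) with (A1 y) by (symmetry; apply is_derive_unique, D0). field; lra. }
  assert (H := der_le _ _ x r ltac:(lra) D). cbv beta in H.
  assert (PI * k * x - s * (A x / x) <= PI * k * r - s * (A r / r)). 2: lra.
  apply H. intros y Hy. specialize (H1 s y Hs ltac:(lra)).
  replace (s * ((y * A1 y - A y) / (y * y))) with ((s * (y * y * A1 y - y * A y)) / y ^ 3) by (field; lra).
  assert (s * (y * y * A1 y - y * A y) / y ^ 3 <= PI * k). 2: lra.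
  apply Rle_div_l; auto. apply pow_lt; lra. }
assert (A0 : A 0 = 0).
{ unfold A. rewrite (RInt_extR _ (fun t => f p * w t + 0 * w t)).
  2: { intros t. unfold pol. replace (p + 0 * cis t)%C with p by ring. ring. }
  rewrite (RInt_lin2 w w) by (apply ex_RInt_c; auto).
  assert (RInt w 0 (2 * PI) = 0). 2: { rewrite H. Rring. }
  transitivity (minus (e1 * sin (2 * PI) - e2 * cos (2 * PI)) (e1 * sin 0 - e2 * cos 0)).
  - apply is_RInt_unique. apply (is_RInt_derive (V := R_CompleteNormedModule) (fun t => e1 * sin t - e2 * cos t)); intros; auto.
    unfold w, q. rewrite Hc. auto_derive; auto. ring.
  - unfold minus, plus, opp; simpl. rewrite cos_2PI, sin_2PI, cos_0, sin_0. Rring. }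
assert (L := A_der 0 ltac:(rewrite Rabs_R0; lra)).
apply le_epsilon. intros e He.
apply is_derive_eps with (e := e) in L; auto. destruct L as [d [Hd L]].
set (x := Rmin (d / 2) r). assert (x <= d / 2) by apply Rmin_l. assert (x <= r) by apply Rmin_r.
assert (Hx : 0 < x) by (apply Rmin_pos; lra).
specialize (L x). replace (x - 0) with x in L by ring. rewrite (Rabs_pos_eq x), A0 in L by lra. specialize (L ltac:(lra)).
assert (L' : Rabs (A x / x - A1 0) <= e).
{ replace (A x / x - A1 0) with ((A x - 0 - A1 0 * x) / x) by (field; lra).
  rewrite Rabs_div by lra. rewrite (Rabs_pos_eq x) by lra. apply Rle_div_l; lra. }
assert (Y1 := H3 1 x ltac:(rewrite Rabs_R1; auto) ltac:(lra)). assert (Y2 := H3 (-1) x ltac:(rewrite Rabs_left; lra) ltac:(lra)).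
assert (Rabs (A r / r) = Rabs (A r) / r) by (rewrite Rabs_div, (Rabs_pos_eq r); lra).
rewrite <- H4. apply Rabs_le_between in L'.
assert (Z := Rle_abs (A r / r)). assert (Z' := Rle_abs (- (A r / r))). rewrite Rabs_Ropp in Z'.
assert (0 <= PI * k * r) by (apply Rmult3_pos; lra). assert (0 <= PI * k * x) by (apply Rmult3_pos; lra).
apply Rabs_le. lra.
Qed.
End Polar.

Lemma sq_sum_1_bound e1 e2 t : e1 * e1 + e2 * e2 = 1 -> Rabs (0 + (e1 * cos t + e2 * sin t)) <= 1.
Proof.
intros He. assert (T := sin2_cos2 t). unfold Rsqr in T.
assert (S : (e1 * cos t + e2 * sin t) ^ 2 + (e1 * sin t - e2 * cos t) ^ 2 = 1).
{ replace ((e1 * cos t + e2 * sin t) ^ 2 + (e1 * sin t - e2 * cos t) ^ 2) with ((e1 * e1 + e2 * e2) * (sin t * sin t + cos t * cos t)) by ring.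
  rewrite He, T; ring. }
set (X := e1 * cos t + e2 * sin t) in *. set (Y := e1 * sin t - e2 * cos t) in *.
assert (0 <= Y ^ 2) by apply pow2_ge_0. apply Rabs_le. split; nra.
Qed.

(** The radial derivative of the first Fourier mode at radius [0] is [PI] times the directional
    derivative at [p]. As the weight is at most [1], the mode at radius [r] is bounded by the
    integral of [m0 - f], that is, by the circle mean; the mean is at least the central value up to
    a multiple of [k r ^ 2]. So a one-sided bound of [f] controls the gradient. *)
Lemma grad_bound p R0 f fs ft fss fst_ fts ftt k m0 r e1 e2 :
  C2on (fun z => Cmod (z - p) < R0) f fs ft fss fst_ fts ftt ->
  (forall z, Cmod (z - p) < R0 -> Rabs (fss z + ftt z) <= k) ->
  (forall z, Cmod (z - p) < R0 -> f z <= m0) ->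
  0 < r < R0 -> e1 * e1 + e2 * e2 = 1 ->
  Rabs (e1 * fs p + e2 * ft p) <= 2 / r * (m0 - f p) + 3 * k * r.
Proof.
intros H2 Hk Hm Hr He. assert (P := PI_RGT_0).
assert (Cf : forall z, Cmod (z - p) < R0 -> contR f z) by (intros; eapply fder_contR, (c2_f H2); auto).
assert (Hin : forall x t, 0 <= x <= r -> Cmod (pol p x t - p) < R0).
{ intros x t Hx. unfold pol. replace (p + RtoC x * cis t - p)%C with (RtoC x * cis t)%C by ring.
  rewrite Cmod_mult, Cmod_R, Cmod_cis, Rabs_pos_eq; lra. }
assert (Hk0 : 0 <= k). { eapply Rle_trans. apply Rabs_pos. apply (Hk _ (Hin 0 0 ltac:(lra))). }
assert (Ec : forall x (w : R -> R), 0 <= x <= r -> (forall t, continuous w t) -> ex_RInt (fun t => f (pol p x t) * w t) 0 (2 * PI)).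
{ intros x w Hx Hw. apply ex_RInt_c. intros t. apply (continuous_mult (K := R_AbsRing)); auto. apply (contR_pol p R0); auto. rewrite Rabs_pos_eq; lra. }
set (M := fun x => RInt (fun t => f (pol p x t) * (1 + (0 * cos t + 0 * sin t))) 0 (2 * PI)).
assert (Cw : forall c a b t, continuous (fun t => c + (a * cos t + b * sin t)) t).
{ intros. apply ex_derive_cont. auto_derive; auto. }
assert (HM : 2 * PI * f p - PI * k * r ^ 2 / 2 <= M r).
{ assert (D : forall x, 0 <= x <= r -> is_derive (fun x => M x + PI * k * x ^ 2 / 2) x
    (RInt (fun t => (fs (pol p x t) * cos t + ft (pol p x t) * sin t) * (1 + (0 * cos t + 0 * sin t))) 0 (2 * PI) + PI * k * x)).
  { intros x Hx. assert (D0 := polar_der p R0 f fs ft (fun t => 1 + (0 * cos t + 0 * sin t)) x ltac:(rewrite Rabs_pos_eq; lra)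
      (c2_f H2)
      (fun z Hz => fder_contR _ _ _ _ (c2_s H2 z Hz)) (fun z Hz => fder_contR _ _ _ _ (c2_t H2 z Hz)) (Cw 1 0 0)).
    change (is_derive M x (RInt (fun t => (fs (pol p x t) * cos t + ft (pol p x t) * sin t) * (1 + (0 * cos t + 0 * sin t))) 0 (2 * PI))) in D0.
    auto_derive. eexists; exact D0.
    replace (Derive (fun x => M x) x) with (RInt (fun t => (fs (pol p x t) * cos t + ft (pol p x t) * sin t) * (1 + (0 * cos t + 0 * sin t))) 0 (2 * PI)) by (symmetry; apply is_derive_unique, D0). field. }
  assert (H := der_le _ _ 0 r ltac:(lra) D). cbv beta in H.
  assert (M0 : M 0 = 2 * PI * f p).
  { unfold M. rewrite (RInt_extR _ (fun _ => f p)).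
    rewrite RInt_const. change ((2 * PI - 0) * f p = 2 * PI * f p). ring.
    intros t. unfold pol. replace (p + 0 * cis t)%C with p by ring. ring. }
  assert (M 0 + PI * k * 0 ^ 2 / 2 <= M r + PI * k * r ^ 2 / 2). 2: { rewrite M0 in H0. lra. }
  apply H. intros x Hx.
  assert (B := radial_der_bound p R0 f fs ft fss fst_ fts ftt H2 k Hk 1 0 0). cbv beta in B.
  specialize (B ltac:(intros; rewrite Rabs_pos_eq; lra) x ltac:(lra)).
  assert (- PI * k * x <= RInt (fun t => (fs (pol p x t) * cos t + ft (pol p x t) * sin t) * (1 + (0 * cos t + 0 * sin t))) 0 (2 * PI)). 2: lra.
  apply B. intros y Hy. rewrite (RInt_extR _ (fun _ => 0)) by (intros; ring). rewrite RInt_const. apply Rmult_0_r. }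
set (A := RInt (fun t => f (pol p r t) * (0 + (e1 * cos t + e2 * sin t))) 0 (2 * PI)).
(* The weight has mean zero, so [f] may be replaced by [f - m0], which has a sign. *)
assert (HA : Rabs A <= 2 * PI * m0 - M r).
{ assert (Z : forall s, Rabs s = 1 -> s * A <= 2 * PI * m0 - M r).
  { intros s Hs.
    assert (I0 : RInt (fun t => 0 + (e1 * cos t + e2 * sin t)) 0 (2 * PI) = 0).
    { transitivity (minus (e1 * sin (2 * PI) - e2 * cos (2 * PI)) (e1 * sin 0 - e2 * cos 0)).
      apply is_RInt_unique. apply (is_RInt_derive (V := R_CompleteNormedModule) (fun t => e1 * sin t - e2 * cos t)); intros; auto.
      auto_derive; auto. ring.
      unfold minus, plus, opp; simpl. rewrite cos_2PI, sin_2PI, cos_0, sin_0. Rring. }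
    assert (I1 : RInt (fun _ : R => m0) 0 (2 * PI) = 2 * PI * m0). { rewrite RInt_const. change ((2 * PI - 0) * m0 = 2 * PI * m0). ring. }
    assert (L : RInt (fun t => s * (f (pol p r t) * (0 + (e1 * cos t + e2 * sin t))) + (- s * m0) * (0 + (e1 * cos t + e2 * sin t))) 0 (2 * PI)
      <= RInt (fun t => 1 * m0 + (-1) * (f (pol p r t) * (1 + (0 * cos t + 0 * sin t)))) 0 (2 * PI)).
    { apply RInt_le. lra.
      - apply ex_RInt_c; intros t. apply (continuous_plus (K := R_AbsRing) (V := R_NormedModule)); apply (continuous_mult (K := R_AbsRing)); try apply continuous_const; auto.
        apply (continuous_mult (K := R_AbsRing)); auto. apply (contR_pol p R0); auto. rewrite Rabs_pos_eq; lra.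
      - apply ex_RInt_c; intros t. apply (continuous_plus (K := R_AbsRing) (V := R_NormedModule)); apply (continuous_mult (K := R_AbsRing)); try apply continuous_const; auto.
        apply (continuous_mult (K := R_AbsRing)); auto. apply (contR_pol p R0); auto. rewrite Rabs_pos_eq; lra.
      - intros t _. assert (F := Hm _ (Hin r t ltac:(lra))). assert (Q := sq_sum_1_bound e1 e2 t He).
        assert (Q' : Rabs (s * (0 + (e1 * cos t + e2 * sin t))) <= 1) by (rewrite Rabs_mult, Hs; lra).
        apply Rabs_le_between in Q'. nra. }
    rewrite (RInt_lin2 (fun t => f (pol p r t) * (0 + (e1 * cos t + e2 * sin t))) (fun t => 0 + (e1 * cos t + e2 * sin t))) in L.
    rewrite (RInt_lin2 (fun t => m0) (fun t => f (pol p r t) * (1 + (0 * cos t + 0 * sin t)))) in L.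
    rewrite I0, I1 in L. fold A in L. fold (M r) in L. lra.
    apply ex_RInt_const. apply Ec; auto; lra. apply Ec; auto; lra. apply ex_RInt_c; auto. }
  assert (Z1 := Z 1 Rabs_R1). assert (Z2 := Z (-1) ltac:(rewrite Rabs_left; lra)). apply Rabs_le. lra. }
assert (F := first_mode_bound p R0 f fs ft fss fst_ fts ftt H2 k Hk 0 e1 e2 (fun t => sq_sum_1_bound e1 e2 t He) r Hr eq_refl).
(* Orthogonality of [cos] and [sin], by an explicit primitive. *)
assert (E : RInt (fun t => (fs (pol p 0 t) * cos t + ft (pol p 0 t) * sin t) * (0 + (e1 * cos t + e2 * sin t))) 0 (2 * PI) = PI * (e1 * fs p + e2 * ft p)).
{ set (G := fun t => fs p * e1 * ((t + sin t * cos t) / 2) + ft p * e2 * ((t - sin t * cos t) / 2) + (fs p * e2 + ft p * e1) * (sin t * sin t / 2)).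
  transitivity (minus (G (2 * PI)) (G 0)).
  - rewrite (RInt_extR _ (fun t => (fs p * cos t + ft p * sin t) * (0 + (e1 * cos t + e2 * sin t)))).
    2: { intros t. unfold pol. replace (p + 0 * cis t)%C with p by ring. auto. }
    apply is_RInt_unique. apply (is_RInt_derive (V := R_CompleteNormedModule) G).
    + intros t _. unfold G. auto_derive; auto. assert (T := sin2_cos2 t). unfold Rsqr in T.
      replace (1 + (1 * cos t * cos t + sin t * (1 * - sin t))) with ((sin t * sin t + cos t * cos t) + (1 * cos t * cos t + sin t * (1 * - sin t))) by (rewrite T; ring).
      replace (1 + - (1 * cos t * cos t + sin t * (1 * - sin t))) with ((sin t * sin t + cos t * cos t) + - (1 * cos t * cos t + sin t * (1 * - sin t))) by (rewrite T; ring).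
      field.
    + intros t _. apply ex_derive_cont. auto_derive; auto.
  - unfold G, minus, plus, opp; simpl. rewrite cos_2PI, sin_2PI, cos_0, sin_0. match goal with |- ?a = ?b => change (a = b :> R) end. field. }
assert (F' : Rabs (PI * (e1 * fs p + e2 * ft p)) <= Rabs A / r + 2 * PI * k * r) by (rewrite <- E; exact F).
clear F; rename F' into F. rewrite Rabs_mult, (Rabs_pos_eq PI) in F by lra.
apply Rmult_le_reg_l with PI; auto.
eapply Rle_trans. apply F.
assert (Rabs A / r <= (2 * PI * m0 - (2 * PI * f p - PI * k * r ^ 2 / 2)) / r).
{ apply Rmult_le_compat_r. apply Rlt_le, Rinv_0_lt_compat; lra. lra. }
replace ((2 * PI * m0 - (2 * PI * f p - PI * k * r ^ 2 / 2)) / r) with (2 * PI / r * (m0 - f p) + PI * k * r / 2) in H by (field; lra).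
replace (PI * (2 / r * (m0 - f p) + 3 * k * r)) with (2 * PI / r * (m0 - f p) + 3 * PI * k * r) by (field; lra).
assert (0 <= PI * k * r) by (apply Rmult3_pos; lra). lra.
Qed.

Lemma Cmod_pair_le (x y : R) : Cmod (x, y) <= Rabs x + Rabs y.
Proof. apply (Cmod_le_sum (x, y)). Qed.

Lemma fder_partials f fs ft z d : 0 < d ->
  (forall w, Cmod (w - z) < d -> is_derive (fun s => f (s, snd w)) (fst w) (fs w) /\
     is_derive (fun t => f (fst w, t)) (snd w) (ft w)) ->
  contR fs z -> contR ft z -> fder f z (fs z) (ft z).
Proof.
intros Hd H Cs Ct e He.
destruct (Cs (e / 2)) as [d1 [Hd1 F1]]; try lra. destruct (Ct (e / 2)) as [d2 [Hd2 F2]]; try lra.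
set (m := Rmin d (Rmin d1 d2)). assert (M1 : m <= d) by apply Rmin_l.
assert (M2 : m <= Rmin d1 d2) by apply Rmin_r. min_le d1 d2 M3 M4.
exists m. split. { repeat apply Rmin_pos; auto. }
intros [s' t'] Hw. destruct z as [s t]. cbn [fst snd].
set (D := Cmod ((s', t') - (s, t))) in *.
assert (W1 : Rabs (s' - s) <= D) by apply (Cmod_fst ((s', t') - (s, t))).
assert (W2 : Rabs (t' - t) <= D) by apply (Cmod_snd ((s', t') - (s, t))).
assert (Near : forall x y, Rabs (x - s) <= Rabs (s' - s) -> Rabs (y - t) <= Rabs (t' - t) -> Cmod ((x, y) - (s, t)) < m).
{ intros x y Hx Hy. apply Rle_lt_trans with D; auto. apply Cmod_le_of_abs; auto. }
assert (Z1 : Rabs (s - s) <= Rabs (s' - s)) by (replace (s - s) with 0 by ring; rewrite Rabs_R0; apply Rabs_pos).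
assert (Z2 : Rabs (t - t) <= Rabs (t' - t)) by (replace (t - t) with 0 by ring; rewrite Rabs_R0; apply Rabs_pos).
assert (Btw : forall a b c, Rmin a b <= c <= Rmax a b -> Rabs (c - a) <= Rabs (b - a)).
{ intros a b c0 H0. unfold Rmin, Rmax in H0. destruct (Rle_dec a b).
  rewrite !Rabs_pos_eq; lra. rewrite !Rabs_left1; lra. }
destruct (MVT_gen (fun x => f (x, t')) s s' (fun x => fs (x, t'))) as [c1 [Hc1 E1]].
{ intros x Hx. apply (H (x, t')). specialize (Near x t' (Btw s s' x ltac:(lra)) ltac:(lra)). lra. }
{ intros x Hx. apply continuity_pt_filterlim. apply ex_derive_cont.
  exists (fs (x, t')). apply (H (x, t')). specialize (Near x t' (Btw s s' x ltac:(lra)) ltac:(lra)). lra. }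
destruct (MVT_gen (fun y => f (s, y)) t t' (fun y => ft (s, y))) as [c2 [Hc2 E2]].
{ intros y Hy. apply (H (s, y)). specialize (Near s y ltac:(lra) (Btw t t' y ltac:(lra))). lra. }
{ intros y Hy. apply continuity_pt_filterlim. apply ex_derive_cont.
  exists (ft (s, y)). apply (H (s, y)). specialize (Near s y ltac:(lra) (Btw t t' y ltac:(lra))). lra. }
assert (G1 := F1 (c1, t')). assert (G2 := F2 (s, c2)).
specialize (G1 ltac:(specialize (Near c1 t' (Btw _ _ _ Hc1) ltac:(lra)); lra)).
specialize (G2 ltac:(specialize (Near s c2 ltac:(lra) (Btw _ _ _ Hc2)); lra)).
replace (f (s', t') - f (s, t) - (fs (s, t) * (s' - s) + ft (s, t) * (t' - t))) with
  ((fs (c1, t') - fs (s, t)) * (s' - s) + (ft (s, c2) - ft (s, t)) * (t' - t)) by (cbv beta in E1, E2; lra).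
eapply Rle_trans. apply Rabs_triang. rewrite !Rabs_mult.
assert (P1 := Rabs_pos (s' - s)). assert (P2 := Rabs_pos (t' - t)).
assert (Rabs (fs (c1, t') - fs (s, t)) * Rabs (s' - s) <= e / 2 * D) by (apply Rmult_le_compat; auto; try lra; apply Rabs_pos).
assert (Rabs (ft (s, c2) - ft (s, t)) * Rabs (t' - t) <= e / 2 * D) by (apply Rmult_le_compat; auto; try lra; apply Rabs_pos).
lra.
Qed.

Lemma C2on_sub (U V : C -> Prop) f fs ft fss fst_ fts ftt : (forall z, V z -> U z) ->
  C2on U f fs ft fss fst_ fts ftt -> C2on V f fs ft fss fst_ fts ftt.
Proof. intros H [H1 H2 H3 H4 H5 H6 H7]. split; auto. Qed.

(** The shift [kap] absorbs the right-hand side: [u = m0 - f + kap] satisfies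
    [|grad u| <= 4 u / rho], the differential form of Harnack's inequality. *)
Lemma grad_bound_u p rho f fs ft fss fst_ fts ftt k m0 kap e1 e2 : 0 < rho ->
  C2on (fun z => Cmod (z - p) < rho) f fs ft fss fst_ fts ftt ->
  (forall z, Cmod (z - p) < rho -> Rabs (fss z + ftt z) <= k) ->
  (forall z, Cmod (z - p) < rho -> f z <= m0) -> k * rho ^ 2 <= kap ->
  e1 * e1 + e2 * e2 = 1 ->
  Rabs (e1 * fs p + e2 * ft p) <= 4 / rho * (m0 - f p + kap).
Proof.
intros Hr H2 Hk Hm Hkap He.
assert (G := grad_bound p rho f fs ft fss fst_ fts ftt k m0 (rho / 2) e1 e2 H2 Hk Hm ltac:(lra) He).
assert (Hk0 : 0 <= k). { eapply Rle_trans. apply Rabs_pos. apply (Hk p). rewrite Cmod_diag; auto. }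
eapply Rle_trans. apply G.
replace (2 / (rho / 2) * (m0 - f p)) with (4 / rho * (m0 - f p)) by (field; lra).
rewrite Rmult_plus_distr_l. apply Rplus_le_compat_l.
apply Rle_trans with (4 / rho * (k * rho ^ 2)).
- replace (4 / rho * (k * rho ^ 2)) with (4 * k * rho) by (field; lra). nra.
- apply Rmult_le_compat_l; auto. apply Rlt_le, Rdiv_lt_0_compat; lra.
Qed.

(** [u x e^(- L x)] is nonincreasing. *)
Lemma gronwall_exp (u du : R -> R) L : 0 <= L ->
  (forall x, 0 <= x <= 1 -> is_derive u x (du x)) -> (forall x, 0 <= x <= 1 -> du x <= L * u x) -> u 1 <= u 0 * exp L.
Proof.
intros HL Hd H.
assert (D : forall x, 0 <= x <= 1 -> is_derive (fun x => - (u x * exp (- L * x))) x (- ((du x - L * u x) * exp (- L * x)))).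
{ intros x Hx. assert (D := Hd x Hx). auto_derive. repeat split; auto; eexists; eauto.
  replace (Derive (fun x => u x) x) with (du x) by (symmetry; apply is_derive_unique, D). ring. }
assert (X := der_le _ _ 0 1 ltac:(lra) D). cbv beta in X.
assert (X' : - (u 0 * exp (- L * 0)) <= - (u 1 * exp (- L * 1))).
{ apply X. intros x Hx. specialize (H x ltac:(lra)). assert (P := exp_pos (- L * x)).
  assert (0 <= (L * u x - du x) * exp (- L * x)) by (apply Rmult_le_pos; lra). lra. }
replace (- L * 0) with 0 in X' by ring. rewrite exp_0 in X'. replace (- L * 1) with (- L) in X' by ring.
assert (E : exp L * exp (- L) = 1) by (rewrite <- exp_plus; replace (L + - L) with 0 by ring; apply exp_0).
assert (P := exp_pos L).
assert (X2 : u 1 * exp (- L) * exp L <= u 0 * exp L) by (apply Rmult_le_compat_r; lra).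
replace (u 1) with (u 1 * (exp L * exp (- L))) by (rewrite E; ring). lra.
Qed.

(** Gronwall's lemma along the segment, applied to [u = m0 - f + kap]. *)
Lemma harnack_segment (a b : C) rho f fs ft fss fst_ fts ftt k m0 kap : 0 < rho ->
  (forall x, 0 <= x <= 1 -> forall z, Cmod (z - (a + RtoC x * (b - a))) < rho ->
     f z <= m0 /\ Rabs (fss z + ftt z) <= k) ->
  C2on (fun z => exists x, 0 <= x <= 1 /\ Cmod (z - (a + RtoC x * (b - a))) < rho) f fs ft fss fst_ fts ftt ->
  k * rho ^ 2 <= kap ->
  m0 - f b + kap <= (m0 - f a + kap) * exp (4 * Cmod (b - a) / rho).
Proof.
intros Hr H H2 Hkap.
set (L := Cmod (b - a)). assert (HL : 0 <= L) by apply Cmod_ge_0.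
destruct (Req_dec L 0) as [HL0|HL0].
{ assert (b = a). { apply Cmod_eq_0 in HL0. replace b with (b - a + a)%C by ring. rewrite HL0; ring. }
  subst b. rewrite HL0. replace (4 * 0 / rho) with 0 by (field; lra). rewrite exp_0. lra. }
set (c1 := fst (b - a)%C). set (c2 := snd (b - a)%C).
set (g := fun x : R => (fst a + x * c1, snd a + x * c2)).
assert (Eg : forall x, g x = (a + RtoC x * (b - a))%C) by (intros; unfold g, c1, c2; apply injective_projections; simpl; ring).
set (e1 := c1 / L). set (e2 := c2 / L).
assert (He : e1 * e1 + e2 * e2 = 1).
{ unfold e1, e2. assert (S : L ^ 2 = c1 ^ 2 + c2 ^ 2) by (unfold L; rewrite Cmod2_alt; auto).
  replace (c1 / L * (c1 / L) + c2 / L * (c2 / L)) with ((c1 ^ 2 + c2 ^ 2) / L ^ 2) by (field; auto).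
  rewrite <- S. field; auto. }
assert (G := gronwall_exp (fun x => m0 - f (g x) + kap) (fun x => - (fs (g x) * c1 + ft (g x) * c2)) (4 * L / rho)).
cbv beta in G. rewrite !Eg in G.
replace (a + 1 * (b - a))%C with b in G by ring. replace (a + 0 * (b - a))%C with a in G by ring.
apply G.
- apply Rdiv_le_0_compat; lra.
- intros x Hx.
  assert (Fd : fder f (g x) (fs (g x)) (ft (g x))).
  { apply (c2_f H2). exists x. split; auto. rewrite Eg. match goal with |- Cmod ?q < _ => replace q with (RtoC 0) by ring end. rewrite Cmod_0; auto. }
  assert (D : is_derive (fun x => f (g x)) x (fs (g x) * c1 + ft (g x) * c2)).
  { apply (fder_path f (fun x => fst a + x * c1) (fun x => snd a + x * c2)); auto.
    clearbody c1; auto_derive; auto; ring. clearbody c2; auto_derive; auto; ring. }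
  set (F := fun x => f (g x)) in *. change (is_derive (fun x => m0 - F x + kap) x (- (fs (g x) * c1 + ft (g x) * c2))).
  auto_derive. eexists; exact D. replace (Derive (fun x => F x) x) with (fs (g x) * c1 + ft (g x) * c2) by (symmetry; apply is_derive_unique, D). ring.
- intros x Hx.
  assert (B := grad_bound_u (g x) rho f fs ft fss fst_ fts ftt k m0 kap e1 e2 Hr).
  assert (B' : Rabs (e1 * fs (g x) + e2 * ft (g x)) <= 4 / rho * (m0 - f (g x) + kap)).
  { apply B; auto.
    - eapply C2on_sub. 2: apply H2. intros z Hz. exists x. rewrite <- Eg. auto.
    - intros z Hz. rewrite Eg in Hz. apply (H x Hx z Hz).
    - intros z Hz. rewrite Eg in Hz. apply (H x Hx z Hz). }
  apply Rabs_le_between in B'.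
  replace (fs (g x) * c1 + ft (g x) * c2) with (L * (e1 * fs (g x) + e2 * ft (g x))) by (unfold e1, e2; field; auto).
  replace (4 * L / rho * (m0 - f (g x) + kap)) with (L * (4 / rho * (m0 - f (g x) + kap))) by (field; lra).
  nra.
Qed.

(** * Maximum principle *)

(** A positive second derivative excludes a maximum at [x0]: the function rises to the right if
    [f' x0 >= 0], and to the left otherwise. *)
Lemma increase_1d (f f' : R -> R) x0 l d0 : 0 < d0 -> (forall x, Rabs (x - x0) < d0 -> is_derive f x (f' x)) ->
  is_derive f' x0 l -> 0 < l -> forall d, 0 < d -> exists x, Rabs (x - x0) < d /\ f x0 < f x.
Proof.
intros Hd0 Hf Hf' Hl d Hd.
apply is_derive_eps with (e := l / 2) in Hf'; try lra. destruct Hf' as [d1 [Hd1 F]].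
set (m := Rmin d0 (Rmin d d1) / 2).
min_le d0 (Rmin d d1) M1 M2. min_le d d1 M3 M4.
assert (Hm : 0 < m) by (unfold m; apply Rdiv_lt_0_compat; [repeat apply Rmin_pos; auto|lra]).
assert (Hm2 : 2 * m = Rmin d0 (Rmin d d1)) by (unfold m; field).
destruct (Rle_dec 0 (f' x0)) as [Hp|Hn].
- exists (x0 + m). split. { rewrite Rabs_pos_eq; lra. }
  destruct (MVT_cor2 f f' x0 (x0 + m)) as [c [Hc1 Hc2]]; try lra.
  { intros c Hc. apply is_derive_Reals, Hf. rewrite Rabs_pos_eq; lra. }
  specialize (F c). rewrite (Rabs_pos_eq (c - x0)) in F by lra. specialize (F ltac:(lra)). apply Rabs_le_between in F.
  assert (0 < f' c) by nra. nra.
- exists (x0 - m). split. { rewrite Rabs_left; lra. }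
  destruct (MVT_cor2 f f' (x0 - m) x0) as [c [Hc1 Hc2]]; try lra.
  { intros c Hc. apply is_derive_Reals, Hf. rewrite Rabs_left1; lra. }
  specialize (F c). rewrite (Rabs_left (c - x0)) in F by lra. specialize (F ltac:(lra)). apply Rabs_le_between in F.
  assert (f' c < 0) by nra. nra.
Qed.

(** If the Laplacian of [f - g] is positive, so is one of the two pure second derivatives, and the
    corresponding coordinate line through [p] carries a larger value. *)
Lemma lap_increase (f fs ft g gs gt : C -> R) p fss ftt gss gtt d0 : 0 < d0 ->
  (forall z, Cmod (z - p) < d0 -> is_derive (fun s => f (s, snd z)) (fst z) (fs z) /\ is_derive (fun t => f (fst z, t)) (snd z) (ft z)) ->
  (forall z, Cmod (z - p) < d0 -> is_derive (fun s => g (s, snd z)) (fst z) (gs z) /\ is_derive (fun t => g (fst z, t)) (snd z) (gt z)) ->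
  is_derive (fun s => fs (s, snd p)) (fst p) fss -> is_derive (fun t => ft (fst p, t)) (snd p) ftt ->
  is_derive (fun s => gs (s, snd p)) (fst p) gss -> is_derive (fun t => gt (fst p, t)) (snd p) gtt ->
  gss + gtt < fss + ftt -> forall d, 0 < d -> exists q, Cmod (q - p) < d /\ f p - g p < f q - g q.
Proof.
intros Hd0 Hf Hg F1 F2 G1 G2 Hl d Hd. destruct p as [s0 t0]. cbn [fst snd] in *.
destruct (Rle_dec (fss - gss) 0) as [Hn|Hp].
- destruct (increase_1d (fun t => f (s0, t) - g (s0, t)) (fun t => ft (s0, t) - gt (s0, t)) t0 (ftt - gtt) d0) with (d := d) as [t [Ht1 Ht2]]; auto; try lra.
  + intros t Ht. assert (N : Cmod ((s0, t) - (s0, t0)) < d0).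
    { eapply Rle_lt_trans. apply Cmod_le_sum. simpl. replace (s0 + - s0) with 0 by ring. rewrite Rabs_R0. unfold Rminus in Ht; lra. }
    apply (is_derive_minus (fun t => f (s0, t)) (fun t => g (s0, t))). apply (Hf (s0, t) N). apply (Hg (s0, t) N).
  + apply (is_derive_minus (fun t => ft (s0, t)) (fun t => gt (s0, t))); auto.
  + exists (s0, t). split; auto. eapply Rle_lt_trans. apply Cmod_le_sum. simpl. replace (s0 + - s0) with 0 by ring. rewrite Rabs_R0. unfold Rminus in Ht1; lra.
- destruct (increase_1d (fun s => f (s, t0) - g (s, t0)) (fun s => fs (s, t0) - gs (s, t0)) s0 (fss - gss) d0) with (d := d) as [s [Hs1 Hs2]]; auto; try lra.
  + intros t Ht. assert (N : Cmod ((t, t0) - (s0, t0)) < d0).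
    { eapply Rle_lt_trans. apply Cmod_le_sum. simpl. replace (t0 + - t0) with 0 by ring. rewrite Rabs_R0. unfold Rminus in Ht; lra. }
    apply (is_derive_minus (fun t => f (t, t0)) (fun t => g (t, t0))). apply (Hf (t, t0) N). apply (Hg (t, t0) N).
  + apply (is_derive_minus (fun t => fs (t, t0)) (fun t => gs (t, t0))); auto.
  + exists (s, t0). split; auto. eapply Rle_lt_trans. apply Cmod_le_sum. simpl. replace (t0 + - t0) with 0 by ring. rewrite Rabs_R0. unfold Rminus in Hs1; lra.
Qed.

(** A strict inequality between the normal derivatives takes the place of Hopf's lemma. *)
Lemma axis_increase (f g : R -> R) l m : filterlim (fun t => (f t - f 0) / t) (at_right 0) (locally l) ->
  is_derive g 0 m -> m < l -> forall d, 0 < d -> exists t, 0 < t < d /\ f 0 - g 0 < f t - g t.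
Proof.
intros Hf Hg Hml d Hd.
destruct (proj1 (filterlim_locally _ _) Hf (mkposreal ((l - m) / 2) ltac:(lra))) as [d1 F].
apply is_derive_eps with (e := (l - m) / 4) in Hg; try lra. destruct Hg as [d2 [Hd2 G]].
set (t := Rmin d (Rmin d1 d2) / 2).
min_le d (Rmin d1 d2) M1 M2. min_le d1 d2 M3 M4.
assert (Hm : 0 < t) by (unfold t; apply Rdiv_lt_0_compat; [repeat apply Rmin_pos; auto; apply cond_pos|lra]).
assert (Hm2 : 2 * t = Rmin d (Rmin d1 d2)) by (unfold t; field).
exists t. split. lra.
specialize (F t). assert (Ft : Rabs ((f t - f 0) / t - l) < (l - m) / 2).
{ apply F; auto. change (Rabs (t - 0) < d1). rewrite Rabs_pos_eq; lra. }
specialize (G t). rewrite (Rabs_pos_eq (t - 0)) in G by lra. specialize (G ltac:(lra)).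
apply Rabs_lt_between in Ft. apply Rabs_le_between in G.
assert (X : (f t - f 0) = ((f t - f 0) / t) * t) by (field; lra). nra.
Qed.

Lemma max_principle (S : C -> Prop) (f : C -> R) (B : R) :
  (forall z, S z -> Rabs (fst z) <= B /\ Rabs (snd z) <= B) ->
  (forall z, ~ S z -> exists d, 0 < d /\ forall w, Cmod (w - z) < d -> ~ S w) ->
  (forall z, S z -> forall e, 0 < e -> exists d, 0 < d /\
     forall w, S w -> Cmod (w - z) < d -> Rabs (f w - f z) < e) ->
  (forall z, S z -> 0 < f z -> exists w, S w /\ f z < f w) ->
  forall z, S z -> f z <= 0.
Proof.
intros HB Hcl Hc Hinc z Hz. destruct (Rle_dec (f z) 0) as [|Hn]; auto.
destruct (compact_max S f B z Hz HB Hcl Hc) as [m [Hm1 Hm2]].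
destruct (Hinc m Hm1) as [w [Hw1 Hw2]]. { specialize (Hm2 z Hz). lra. }
specialize (Hm2 w Hw1). lra.
Qed.

Definition contS (S : C -> Prop) (f : C -> R) (z : C) : Prop :=
  forall e, 0 < e -> exists d, 0 < d /\ forall w, S w -> Cmod (w - z) < d -> Rabs (f w - f z) < e.

Lemma contS_comp S f g z : continuity_pt g (f z) -> contS S f z -> contS S (fun w => g (f w)) z.
Proof.
intros Hg Hf e He. destruct (Hg e He) as [d [Hd G]]. destruct (Hf d Hd) as [d' [Hd' F]].
exists d'. split; auto. intros w Hw Hd''. specialize (F w Hw Hd'').
destruct (Req_dec (f w) (f z)) as [E|E]. { rewrite E. unfold Rminus. rewrite Rplus_opp_r, Rabs_R0; auto. }
apply G. split; auto. split; auto. exact I.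
Qed.

Lemma contS_2 S f g (h : R -> R -> R) z : continuity_2d_pt h (f z) (g z) -> contS S f z -> contS S g z ->
  contS S (fun w => h (f w) (g w)) z.
Proof.
intros Hh Hf Hg e He. destruct (Hh (mkposreal e He)) as [d H].
destruct (Hf d (cond_pos d)) as [d1 [Hd1 F]]. destruct (Hg d (cond_pos d)) as [d2 [Hd2 G]].
exists (Rmin d1 d2). split. apply Rmin_pos; auto. intros w Hw Hd.
apply H. apply F; auto. eapply Rlt_le_trans; [apply Hd|apply Rmin_l]. apply G; auto. eapply Rlt_le_trans; [apply Hd|apply Rmin_r].
Qed.

Lemma contS_plus S f g z : contS S f z -> contS S g z -> contS S (fun w => f w + g w) z.
Proof. apply (contS_2 S f g Rplus). apply (continuity_2d_pt_plus (fun u v => u) (fun u v => v)).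
apply continuity_2d_pt_id1. apply continuity_2d_pt_id2. Qed.

Lemma contS_minus S f g z : contS S f z -> contS S g z -> contS S (fun w => f w - g w) z.
Proof. apply (contS_2 S f g Rminus). apply (continuity_2d_pt_minus (fun u v => u) (fun u v => v)).
apply continuity_2d_pt_id1. apply continuity_2d_pt_id2. Qed.

Lemma contS_mult S f g z : contS S f z -> contS S g z -> contS S (fun w => f w * g w) z.
Proof. apply (contS_2 S f g Rmult). apply (continuity_2d_pt_mult (fun u v => u) (fun u v => v)).
apply continuity_2d_pt_id1. apply continuity_2d_pt_id2. Qed.

Lemma contS_const S c z : contS S (fun _ => c) z.
Proof. intros e He. exists 1. split. lra. intros. unfold Rminus. rewrite Rplus_opp_r, Rabs_R0; auto. Qed.

Lemma contS_fst S z : contS S fst z.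
Proof. intros e He. exists e. split; auto. intros w _ H. eapply Rle_lt_trans. apply (Cmod_fst (w - z)). auto. Qed.

Lemma contS_snd S z : contS S snd z.
Proof. intros e He. exists e. split; auto. intros w _ H. eapply Rle_lt_trans. apply (Cmod_snd (w - z)). auto. Qed.

Lemma Cmod_lip (x y : C) : Rabs (Cmod x - Cmod y) <= Cmod (x - y).
Proof.
apply Rabs_le. assert (T := Cmod_triangle (x - y) y). assert (T' := Cmod_triangle (- (x - y)) x).
rewrite Cmod_opp in T'. replace (x - y + y)%C with x in T by ring. replace (- (x - y) + x)%C with y in T' by ring. lra.
Qed.

Lemma contS_Cmod S a z : contS S (fun w => Cmod (w - a)) z.
Proof. intros e He. exists e. split; auto. intros w _ H. eapply Rle_lt_trans. apply Cmod_lip.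
replace (w - a - (z - a))%C with (w - z)%C by ring. auto. Qed.

Lemma contS_contR f z : contS (fun _ => True) f z -> contR f z.
Proof. intros H e He. destruct (H e He) as [d [Hd F]]. exists d. split; auto. Qed.

Lemma contS_sub (S T : C -> Prop) f z : (forall w, T w -> S w) -> contS S f z -> contS T f z.
Proof. intros H Hf e He. destruct (Hf e He) as [d [Hd F]]. exists d. split; auto. Qed.

Lemma fder_slices f z p q : fder f z p q ->
  is_derive (fun s => f (s, snd z)) (fst z) p /\ is_derive (fun t => f (fst z, t)) (snd z) q.
Proof.
intros H. assert (H' : fder f (fst z, snd z) p q) by (rewrite <- surjective_pairing; auto). split.
- replace p with (p * 1 + q * 0) by ring. apply (fder_path f (fun s => s) (fun _ => snd z)); auto.
  apply (is_derive_id (K := R_AbsRing)). apply (is_derive_const (K := R_AbsRing) (V := R_NormedModule)).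
- replace q with (p * 0 + q * 1) by ring. apply (fder_path f (fun _ => fst z) (fun t => t)); auto.
  apply (is_derive_const (K := R_AbsRing) (V := R_NormedModule)). apply (is_derive_id (K := R_AbsRing)).
Qed.

Definition HD (eps : R) (z : C) : Prop := Cmod z < eps /\ 0 < snd z.
(** Unlike [Dbar], this set is open at the outer circle, so that its points off the axis form
    exactly the open set [HD]. *)
Definition HB (eps : R) (z : C) : Prop := Cmod z < eps /\ 0 <= snd z /\ z <> 0.

(** The input of the estimates. The Neumann data enter through the bound [c0] and the finite area
    through [ls_area], a scale-invariant statement about squares near the origin. *)
Record LS (K eps c0 : R) (v vs vt vss vst vts vtt : C -> R) : Prop := {
  ls_K : Rabs K <= 1;
  ls_eps : 0 < eps;
  ls_c0 : 0 <= c0;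
  ls_C2 : C2on (HD eps) v vs vt vss vst vts vtt;
  ls_eq : forall z, HD eps z -> vss z + vtt z = - 2 * K * exp (v z);
  ls_cont : forall z, HB eps z -> contS (HB eps) v z;
  ls_bd : forall s, s <> 0 -> Rabs s < eps -> exists l, Rabs l <= c0 * exp (v (s, 0) / 2) /\
    filterlim (fun t => (v (s, t) - v (s, 0)) / t) (at_right 0) (locally l);
  ls_area : forall k, 0 < k -> exists d, 0 < d /\ forall a b l, 0 < l ->
    (forall z, inrect a b l l z -> HD eps z /\ Cmod z < d) ->
    (forall z, inrect a b l l z -> k <= l ^ 2 * exp (v z)) -> False }.

Arguments ls_K {K eps c0 v vs vt vss vst vts vtt}.
Arguments ls_eps {K eps c0 v vs vt vss vst vts vtt}.
Arguments ls_c0 {K eps c0 v vs vt vss vst vts vtt}.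
Arguments ls_C2 {K eps c0 v vs vt vss vst vts vtt}.
Arguments ls_eq {K eps c0 v vs vt vss vst vts vtt}.
Arguments ls_cont {K eps c0 v vs vt vss vst vts vtt}.
Arguments ls_bd {K eps c0 v vs vt vss vst vts vtt}.
Arguments ls_area {K eps c0 v vs vt vss vst vts vtt}.
Lemma HD_open eps z : HD eps z -> exists d, 0 < d /\ forall w, Cmod (w - z) < d -> HD eps w.
Proof.
intros [H1 H2]. exists (Rmin (eps - Cmod z) (snd z)). split. apply Rmin_pos; lra.
intros w Hw. lt_min Hw W1 W2.
split.
- assert (T := Cmod_triangle z (w - z)). replace (z + (w - z))%C with w in T by ring. lra.
- assert (T := Cmod_snd (w - z)). simpl in T. apply Rabs_le_between in T. lra.
Qed.

Lemma HD_HB eps z : HD eps z -> HB eps z.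
Proof. intros [H1 H2]. split; auto. split. lra. intros ->. simpl in H2. lra. Qed.

Section EpsReg.
Variables (K eps c0 : R) (v vs vt vss vst vts vtt : C -> R).
Hypothesis H : LS K eps c0 v vs vt vss vst vts vtt.

Lemma C2_partials z : HD eps z -> exists d, 0 < d /\ forall w, Cmod (w - z) < d ->
   is_derive (fun s => v (s, snd w)) (fst w) (vs w) /\ is_derive (fun t => v (fst w, t)) (snd w) (vt w).
Proof using H.
intros Hz. destruct (HD_open _ _ Hz) as [d [Hd F]]. exists d. split; auto. intros w Hw.
apply fder_slices, (c2_f (ls_C2 H)). auto.
Qed.

(** Where [v > g], a strict inequality between the Laplacians (inside) or between the normal
    derivatives (on the axis) leads to a larger value of [v - g] within [S]. The maximum of [v - g]
    on the compact set [S] is therefore not positive. The first alternative of the last hypothesis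
    serves the remaining boundary of [S]. *)
Lemma comparison (S : C -> Prop) (g gs gt gss gtt : C -> R) (B : R) :
  (forall z, S z -> Rabs (fst z) <= B /\ Rabs (snd z) <= B) ->
  (forall z, ~ S z -> exists d, 0 < d /\ forall w, Cmod (w - z) < d -> ~ S w) ->
  (forall z, S z -> HB eps z) ->
  (forall z, HB eps z -> contR g z) ->
  (forall z, HB eps z -> is_derive (fun s => g (s, snd z)) (fst z) (gs z) /\ is_derive (fun t => g (fst z, t)) (snd z) (gt z)) ->
  (forall z, HD eps z -> is_derive (fun s => gs (s, snd z)) (fst z) (gss z) /\ is_derive (fun t => gt (fst z, t)) (snd z) (gtt z)) ->
  (forall z, S z -> v z <= g z \/
     (0 < snd z /\ (exists d, 0 < d /\ forall w, Cmod (w - z) < d -> S w) /\ gss z + gtt z < - 2 * K * exp (v z)) \/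
     (snd z = 0 /\ (exists d, 0 < d /\ forall t, 0 < t < d -> S (fst z, t)) /\ gt z < - c0 * exp (v z / 2))) ->
  forall z, S z -> v z <= g z.
Proof using H.
intros HBd Hcl HS Hgc Hg Hg2 Hcase z Hz.
assert (v z - g z <= 0). 2: lra.
apply (max_principle S (fun z => v z - g z) B); auto.
- intros w Hw. apply contS_minus.
  + apply contS_sub with (HB eps); auto. apply (ls_cont H); auto.
  + intros e He. destruct (Hgc w (HS w Hw) e He) as [d [Hd F]]. exists d. split; auto.
- intros p Hp Hpos. destruct (Hcase p Hp) as [X|[(X1 & (d & Hd & X2) & X3)|(X1 & (d & Hd & X2) & X3)]]; [lra| |].
  + assert (Up : HD eps p) by (split; auto; apply (HS p Hp)).
    destruct (C2_partials p Up) as [d1 [Hd1 F1]]. destruct (HD_open _ _ Up) as [d2 [Hd2 F2]].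
    destruct (Hg2 p Up) as [G1 G2]. assert (C2 := ls_C2 H).
    destruct (lap_increase v vs vt g gs gt p (vss p) (vtt p) (gss p) (gtt p) (Rmin d1 d2)) with (d := d) as [q [Q1 Q2]]; auto.
    * apply Rmin_pos; auto.
    * intros w Hw. apply F1. eapply Rlt_le_trans; [apply Hw|apply Rmin_l].
    * intros w Hw. apply Hg, HD_HB, F2. eapply Rlt_le_trans; [apply Hw|apply Rmin_r].
    * apply (fder_slices _ _ _ _ (c2_s C2 p Up)).
    * apply (fder_slices _ _ _ _ (c2_t C2 p Up)).
    * rewrite (ls_eq H p Up). auto.
    * exists q. split; auto.
  + destruct (HS p Hp) as [P1 [P2 P3]].
    assert (Ep : p = (fst p, 0)) by (rewrite <- X1; apply surjective_pairing).
    assert (Hs0 : fst p <> 0). { intros E. apply P3. rewrite Ep, E. auto. }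
    assert (Hs1 : Rabs (fst p) < eps). { eapply Rle_lt_trans. apply Cmod_fst. auto. }
    destruct (ls_bd H (fst p) Hs0 Hs1) as [l [Hl1 Hl2]]. rewrite <- Ep in Hl1.
    assert (G := proj2 (Hg p (HS p Hp))). rewrite X1 in G.
    destruct (axis_increase (fun t => v (fst p, t)) (fun t => g (fst p, t)) l (gt p) Hl2 G) with (d := d) as [t [T1 T2]]; auto.
    { apply Rabs_le_between in Hl1. lra. }
    exists (fst p, t). split; auto. cbv beta in T2. rewrite <- Ep in T2. auto.
Qed.

Lemma closed_rect a b c d : forall z : C, ~ (a <= fst z <= b /\ c <= snd z <= d) ->
  exists r, 0 < r /\ forall w, Cmod (w - z) < r -> ~ (a <= fst w <= b /\ c <= snd w <= d).
Proof.
intros z Hz.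
assert (X : fst z < a \/ b < fst z \/ snd z < c \/ d < snd z).
{ apply NNPP. intros N. apply Hz. repeat split; apply Rnot_lt_le; intros Hlt; apply N; auto. }
assert (Y : exists r, 0 < r /\ (fst z + r <= a \/ b <= fst z - r \/ snd z + r <= c \/ d <= snd z - r)).
{ destruct X as [X|[X|[X|X]]].
  exists (a - fst z); split; [lra|left; lra]. exists (fst z - b); split; [lra|right; left; lra].
  exists (c - snd z); split; [lra|right; right; left; lra]. exists (snd z - d); split; [lra|right; right; right; lra]. }
destruct Y as [r [Hr Y]]. exists r. split; auto. intros w Hw.
assert (W1 := Cmod_fst (w - z)). assert (W2 := Cmod_snd (w - z)). simpl in W1, W2.
apply Rabs_le_between in W1. apply Rabs_le_between in W2. lra.
Qed.

(* At the points z0 and scale lam produced by point picking, v is at least v0 - 2 at some point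
   of height comparable to lam: otherwise the quadratic barrier would force v z0 < v0. *)
Lemma lift_point h0 z0 lam : 0 < h0 <= / 2 -> 10 * h0 ^ 2 + (2 * c0 + 1) * h0 <= 19 / 10 ->
  0 < lam -> exp (v z0) = / lam ^ 2 ->
  (forall z, Cmod (z - z0) <= 2 * lam -> 0 <= snd z -> HB eps z /\ exp (v z) <= 4 / lam ^ 2 /\ v z <= v z0 + 2) ->
  0 <= snd z0 ->
  exists z2, Cmod (z2 - z0) <= 2 * lam /\ h0 * lam <= snd z2 /\ v z0 - 2 <= v z2.
Proof using H.
intros Hh Hh2 Hlam Ev Hnear Ht0.
destruct (Rle_dec (h0 * lam) (snd z0)) as [Hhigh|Hlow].
{ exists z0. rewrite Cmod_diag. repeat split; auto; lra. }
apply NNPP. intros Hno.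
set (s0 := fst z0) in *. set (L := 2 * c0 + 1) in *. set (v0 := v z0) in *.
set (S := fun z : C => (s0 - lam <= fst z <= s0 + lam) /\ (0 <= snd z <= h0 * lam)).
(* In units of [lam ^ -2] the Laplacian is [8 - 20 = - 12], below the least possible value [- 8] of
   [- 2 K e^v]. On the lateral sides the term [4] outweighs the rise [2] of [v] and the loss
   [19 / 10]; on the upper side [19 / 10 + / 100 < 2]. The slope [L] beats the Neumann data, and
   [/ 100] makes the conclusion at [z0] contradictory. *)
set (g := fun z : C => v0 + 4 * (fst z - s0) ^ 2 / lam ^ 2 - 10 * snd z ^ 2 / lam ^ 2 - L * snd z / lam - / 100).
assert (HL : 0 < L) by (unfold L; generalize (ls_c0 H); lra).
assert (Hl2 : 0 < lam ^ 2) by (apply pow_lt; auto).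
assert (SN : forall z, S z -> Cmod (z - z0) <= 2 * lam).
{ intros z [S1 S2]. eapply Rle_trans. apply Cmod_le_sum. simpl.
  assert (Rabs (fst z + - fst z0) <= lam) by (apply Rabs_le; fold s0; lra).
  assert (Rabs (snd z + - snd z0) <= h0 * lam) by (apply Rabs_le; lra). nra. }
assert (X : v z0 <= g z0).
2: { unfold g in X. fold v0 in X. fold s0 in X. replace (s0 - s0) with 0 in X by ring.
  assert (0 <= 10 * snd z0 ^ 2 / lam ^ 2). { apply Rdiv_le_0_compat; auto. generalize (pow2_ge_0 (snd z0)); lra. }
  assert (0 <= L * snd z0 / lam). { apply Rdiv_le_0_compat; auto. nra. }
  replace (4 * 0 ^ 2 / lam ^ 2) with 0 in X by (field; lra). lra. }
apply (comparison S g (fun z => 8 * (fst z - s0) / lam ^ 2) (fun z => - 20 * snd z / lam ^ 2 - L / lam)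
  (fun _ => 8 / lam ^ 2) (fun _ => - 20 / lam ^ 2) (Rabs s0 + lam)).
- intros z [S1 S2]. split.
  + apply Rabs_le. generalize (Rle_abs s0) (Rle_abs (- s0)). rewrite Rabs_Ropp. lra.
  + rewrite Rabs_pos_eq by lra. generalize (Rabs_pos s0). nra.
- intros z Hz. apply closed_rect. auto.
- intros z Hz. apply Hnear; auto. apply Hz.
- intros z _. apply contS_contR. unfold g, Rdiv.
  repeat (match goal with |- contS _ (fun z => _ - _) _ => apply contS_minus | |- contS _ (fun z => _ + _) _ => apply contS_plus
    | |- contS _ (fun z => _ * _) _ => apply contS_mult | |- contS _ (fun z => _ ^ _) _ => simpl end);
  try apply contS_fst; try apply contS_snd; try apply contS_const.
- intros z _. unfold g. split; simpl; auto_derive; auto; field; lra.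
- intros z _. simpl. split; auto_derive; auto; field; lra.
- intros z Hz. destruct (Hnear z (SN z Hz) (proj1 (proj2 Hz))) as (N1 & N2 & N3). destruct Hz as [S1 S2].
  assert (Gy : 10 * snd z ^ 2 / lam ^ 2 + L * snd z / lam <= 19 / 10).
  { set (y := snd z / lam). replace (10 * snd z ^ 2 / lam ^ 2) with (10 * y ^ 2) by (unfold y; field; lra).
    replace (L * snd z / lam) with (L * y) by (unfold y; field; lra).
    assert (0 <= y) by (apply Rdiv_le_0_compat; lra). assert (y <= h0) by (apply Rle_div_l; lra). nra. }
  destruct (Req_dec (snd z) (h0 * lam)) as [Ht|Ht].
  { left. apply Rnot_lt_le. intros Hlt. apply Hno. exists z. split; [|split].
    - apply SN. split; auto.
    - lra.
    - unfold g in Hlt. assert (0 <= 4 * (fst z - s0) ^ 2 / lam ^ 2). { apply Rdiv_le_0_compat; auto. generalize (pow2_ge_0 (fst z - s0)); lra. } lra. }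
  destruct (Req_dec (Rabs (fst z - s0)) lam) as [Hx|Hx].
  { left. unfold g. assert (E : 4 * (fst z - s0) ^ 2 / lam ^ 2 = 4). { rewrite <- (pow2_abs (fst z - s0)), Hx. field; lra. } lra. }
  assert (Hx' : s0 - lam < fst z < s0 + lam).
  { split; destruct (Rle_lt_or_eq_dec _ _ (proj1 S1)); destruct (Rle_lt_or_eq_dec _ _ (proj2 S1)); auto; exfalso; apply Hx.
    rewrite Rabs_left1; lra. rewrite Rabs_left1; lra. rewrite Rabs_pos_eq; lra. rewrite Rabs_pos_eq; lra. }
  right. destruct (Rle_lt_or_eq_dec 0 (snd z)) as [Hp|Hp]; try lra.
  + left. split; auto. split.
    * set (d := Rmin (Rmin (fst z - (s0 - lam)) (s0 + lam - fst z)) (Rmin (snd z) (h0 * lam - snd z))).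
      exists d. split. { repeat apply Rmin_pos; lra. }
      intros w Hw.
      min_le (Rmin (fst z - (s0 - lam)) (s0 + lam - fst z)) (Rmin (snd z) (h0 * lam - snd z)) D1 D2. fold d in D1, D2.
      min_le (fst z - (s0 - lam)) (s0 + lam - fst z) D3 D4.
      min_le (snd z) (h0 * lam - snd z) D5 D6.
      assert (W1 := Cmod_fst (w - z)). assert (W2 := Cmod_snd (w - z)). simpl in W1, W2.
      apply Rabs_le_between in W1. apply Rabs_le_between in W2. split; lra.
    * assert (KK := ls_K H). apply Rabs_le_between in KK.
      assert (Pe := exp_pos (v z)).
      replace (8 / lam ^ 2 + - 20 / lam ^ 2) with (- 3 * (4 / lam ^ 2)) by (field; lra).
      assert (- 2 * (4 / lam ^ 2) <= - 2 * K * exp (v z)) by nra.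
      assert (0 < 4 / lam ^ 2) by (apply Rdiv_lt_0_compat; lra). lra.
  + right. split; auto. split.
    * exists (h0 * lam). split. nra. intros t Ht'. split; simpl; lra.
    * rewrite <- Hp. replace (- 20 * 0 / lam ^ 2 - L / lam) with (- (L / lam)) by (field; lra).
      assert (E2 : exp (v z / 2) <= 2 / lam).
      { apply Rsqr_incr_0. 2: apply Rlt_le, exp_pos. 2: apply Rlt_le, Rdiv_lt_0_compat; lra.
        unfold Rsqr. rewrite <- exp_plus. replace (v z / 2 + v z / 2) with (v z) by field.
        replace (2 / lam * (2 / lam)) with (4 / lam ^ 2) by (field; lra). auto. }
      assert (C0 := ls_c0 H).
      assert (c0 * exp (v z / 2) <= c0 * (2 / lam)) by (apply Rmult_le_compat_l; auto).
      unfold L. replace ((2 * c0 + 1) / lam) with (c0 * (2 / lam) + / lam) by (field; lra).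
      assert (0 < / lam) by (apply Rinv_0_lt_compat; auto). lra.
- split; fold s0; lra.
Qed.

Lemma exp_2_ge_4 : 4 <= exp 2.
Proof. replace 2 with (1 + 1) by ring. rewrite exp_plus. assert (E := exp_ineq1 1 ltac:(lra)). nra. Qed.

(** Point picking: if the bound fails at [z1], a maximum point [z0] of [(Rr - |z - z1|) e^(v/2)]
    over a half disc has a surrounding half ball of radius more than [3 lam], with
    [lam = e^(-v(z0)/2)], on which [v <= v z0 + 2]. [lift_point] leads away from the axis, and
    Harnack's inequality yields a square of side comparable with [lam] on which [l ^ 2 e^v] is
    bounded below, against [ls_area]. *)
Lemma eps_regularity : exists d, 0 < d <= eps /\ forall z, HB eps z -> Cmod z < d -> exp (v z) * Cmod z ^ 2 <= 144.
Proof using H.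
assert (Heps := ls_eps H). assert (C0 := ls_c0 H).
set (h0 := / (20 * (c0 + 1))).
assert (Hh : 0 < h0 <= / 20). { unfold h0. split. apply Rinv_0_lt_compat; lra. apply Rinv_le_contravar; lra. }
assert (Hh2 : 10 * h0 ^ 2 + (2 * c0 + 1) * h0 <= 19 / 10).
{ assert (h0 * (c0 + 1) = / 20) by (unfold h0; field; lra). nra. }
(* The square has side [h0 lam / 8], and Harnack's inequality with factor [exp 2] keeps
   [v z0 + 4 - v] below [6 exp 2] on it. *)
set (k0 := h0 ^ 2 / 64 * exp (4 - 6 * exp 2)).
assert (Hk0 : 0 < k0). { unfold k0. apply Rmult_lt_0_compat. apply Rdiv_lt_0_compat. apply pow_lt; lra. lra. apply exp_pos. }
destruct (ls_area H k0 Hk0) as [d [Hd Harea]].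
exists (Rmin d eps / 2). min_le d eps M1 M2.
assert (M0 : 0 < Rmin d eps) by (apply Rmin_pos; auto). split. lra.
intros z1 Hz1 Hz1d. apply Rnot_lt_le. intros Hbig.
assert (Pz1 : 0 < Cmod z1) by (apply Cmod_gt_0; apply Hz1).
(* Half the modulus, so that the half disc stays away from the origin. *)
set (Rr := Cmod z1 / 2). assert (HR : 0 < Rr) by (unfold Rr; lra).
set (S := fun z : C => Cmod (z - z1) <= Rr /\ 0 <= snd z).
assert (SB : forall z, S z -> HB eps z /\ Cmod z < Rmin d eps).
{ intros z [S1 S2]. assert (T := Cmod_lip z z1). apply Rabs_le_between in T. unfold Rr in S1.
  split; [|lra]. split; [lra|]. split; auto. intros E. rewrite E, Cmod_0 in T. rewrite E in S1. lra. }
destruct (compact_max S (fun z => (Rr - Cmod (z - z1)) * exp (v z / 2)) (2 * Cmod z1) z1) as [z0 [S0 Hmax]].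
{ split. rewrite Cmod_diag; lra. apply Hz1. }
{ intros z [S1 S2]. assert (T := Cmod_lip z z1). apply Rabs_le_between in T. unfold Rr in S1.
  assert (T1 := Cmod_fst z). assert (T2 := Cmod_snd z). lra. }
{ intros z Hz. destruct (Rlt_dec (snd z) 0) as [Hn|Hn].
  - exists (- snd z). split. lra. intros w Hw [_ W]. assert (T := Cmod_snd (w - z)). simpl in T. apply Rabs_le_between in T. lra.
  - assert (Hfar : Rr < Cmod (z - z1)). { apply Rnot_le_lt. intros Hle. apply Hz. split; auto. lra. }
    exists (Cmod (z - z1) - Rr). split. lra. intros w Hw [W _].
    assert (T := Cmod_lip (w - z1) (z - z1)). replace (w - z1 - (z - z1))%C with (w - z)%C in T by ring.
    apply Rabs_le_between in T. lra. }
{ intros z Hz. apply (contS_mult S (fun z => Rr - Cmod (z - z1)) (fun z => exp (v z / 2))).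
  - apply contS_minus. apply contS_const. apply contS_Cmod.
  - apply (contS_comp S (fun z => v z / 2) exp). apply derivable_continuous_pt, derivable_pt_exp.
    apply (contS_mult S v (fun _ => / 2)). 2: apply contS_const.
    apply contS_sub with (HB eps). intros w Hw; apply SB; auto. apply (ls_cont H), SB; auto. }
cbv beta in Hmax.
set (sig := (Rr - Cmod (z0 - z1)) / 2).
set (lam := exp (- v z0 / 2)). assert (Hlam : 0 < lam) by apply exp_pos.
assert (E1 : exp (v z0 / 2) = / lam). { unfold lam. rewrite <- exp_Ropp. f_equal. field. }
(* The constant [144 = 4 * 6 ^ 2] of the statement is made for this [6], which gives [3 lam < sig]
   below. *)
assert (Big : 6 < exp (v z1 / 2) * Rr).
{ apply Rsqr_incrst_0. 2: lra. 2: { apply Rmult_le_pos. apply Rlt_le, exp_pos. lra. }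
  unfold Rsqr, Rr. replace (exp (v z1 / 2) * (Cmod z1 / 2) * (exp (v z1 / 2) * (Cmod z1 / 2))) with
   ((exp (v z1 / 2) * exp (v z1 / 2)) * Cmod z1 ^ 2 / 4) by field.
  rewrite <- exp_plus. replace (v z1 / 2 + v z1 / 2) with (v z1) by field. lra. }
assert (Hsig : 3 * lam < sig).
{ assert (M := Hmax z1). replace (z1 - z1)%C with (RtoC 0) in M by ring. rewrite Cmod_0, E1 in M.
  assert (M' : S z1). { split. rewrite Cmod_diag; lra. apply Hz1. }
  specialize (M M'). assert (6 < 2 * sig * / lam). { unfold sig. lra. }
  apply (Rmult_lt_compat_r lam) in H0; auto. rewrite Rmult_assoc, Rinv_l in H0 by lra. lra. }
assert (Ev : exp (v z0) = / lam ^ 2).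
{ replace (v z0) with (v z0 / 2 + v z0 / 2) by field. rewrite exp_plus, E1. field; lra. }
assert (Hnear : forall z, Cmod (z - z0) <= sig -> 0 <= snd z -> S z /\ exp (v z) <= 4 / lam ^ 2 /\ v z <= v z0 + 2).
{ intros z Hz Hz'.
  assert (T := Cmod_triangle (z - z0) (z0 - z1)). replace (z - z0 + (z0 - z1))%C with (z - z1)%C in T by ring.
  assert (Sz : S z). { split; auto. unfold sig in *. lra. }
  assert (M := Hmax z Sz). rewrite E1 in M.
  assert (B : exp (v z / 2) <= 2 / lam).
  { apply Rmult_le_reg_l with sig. lra. apply Rle_trans with ((Rr - Cmod (z - z1)) * exp (v z / 2)).
    apply Rmult_le_compat_r. apply Rlt_le, exp_pos. unfold sig in *; lra.
    eapply Rle_trans. apply M. right. unfold sig. field; lra. }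
  assert (B2 : exp (v z) <= 4 / lam ^ 2).
  { replace (v z) with (v z / 2 + v z / 2) by field. rewrite exp_plus.
    replace (4 / lam ^ 2) with (2 / lam * (2 / lam)) by (field; lra).
    apply Rmult_le_compat; auto; apply Rlt_le, exp_pos. }
  split; auto. split; auto.
  apply Rnot_lt_le. intros Hlt. apply exp_increasing in Hlt. rewrite exp_plus, Ev in Hlt.
  assert (E := exp_2_ge_4). assert (0 < / lam ^ 2) by (apply Rinv_0_lt_compat, pow_lt; auto).
  unfold Rdiv in B2. nra. }
destruct (lift_point h0 z0 lam) as [z2 [Hz2 [Hh3 Hv2]]]; auto; try lra.
{ intros z Hz Hz'. destruct (Hnear z ltac:(lra) Hz') as [N1 [N2 N3]]. split; auto. apply SB; auto. }
{ apply S0. }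
set (l := h0 * lam / 8).
assert (Hl : 0 < l) by (unfold l; nra).
assert (Ball : forall z, Cmod (z - z2) < h0 * lam -> HD eps z /\ Cmod z < d /\ exp (v z) <= 4 / lam ^ 2 /\ v z <= v z0 + 2).
{ intros z Hz. assert (T := Cmod_triangle (z - z2) (z2 - z0)). replace (z - z2 + (z2 - z0))%C with (z - z0)%C in T by ring.
  assert (T2 := Cmod_snd (z - z2)). simpl in T2. apply Rabs_le_between in T2.
  assert (Sn : 0 < snd z) by lra.
  destruct (Hnear z ltac:(nra) ltac:(lra)) as [N1 [N2 N3]]. destruct (SB z N1) as [B1 B2].
  split. split; auto. apply B1. repeat split; auto. lra. }
assert (Low : forall z, Cmod (z - z2) <= h0 * lam / 4 -> v z0 + (4 - 6 * exp 2) <= v z).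
{ intros z Hz.
  assert (Seg : forall x, 0 <= x <= 1 -> forall w, Cmod (w - (z2 + RtoC x * (z - z2))) < h0 * lam / 2 -> Cmod (w - z2) < h0 * lam).
  { intros x Hx w Hw. assert (T := Cmod_triangle (w - (z2 + RtoC x * (z - z2))) (RtoC x * (z - z2))).
    replace (w - (z2 + RtoC x * (z - z2)) + RtoC x * (z - z2))%C with (w - z2)%C in T by ring.
    rewrite Cmod_mult, Cmod_R, Rabs_pos_eq in T by lra. assert (P := Cmod_ge_0 (z - z2)). nra. }
  assert (Hk := harnack_segment z2 z (h0 * lam / 2) v vs vt vss vst vts vtt (8 / lam ^ 2) (v z0 + 2) 2 ltac:(nra)).
  assert (X : v z0 + 2 - v z + 2 <= (v z0 + 2 - v z2 + 2) * exp (4 * Cmod (z - z2) / (h0 * lam / 2))).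
  { apply Hk.
    - intros x Hx w Hw. destruct (Ball w (Seg x Hx w Hw)) as (B1 & B2 & B3 & B4). split; auto.
      rewrite (ls_eq H w B1).
      assert (KK := ls_K H).
      rewrite !Rabs_mult, (Rabs_pos_eq (exp (v w))) by (apply Rlt_le, exp_pos).
      replace (Rabs (-2)) with 2 by (rewrite Rabs_left; lra).
      replace (8 / lam ^ 2) with (2 * 1 * (4 / lam ^ 2)) by (field; lra).
      assert (Pe := exp_pos (v w)). apply Rmult_le_compat; auto; try lra. generalize (Rabs_pos K); lra.
    - eapply C2on_sub. 2: apply (ls_C2 H). intros w [x [Hx Hw]]. apply (Ball w (Seg x Hx w Hw)).
    - replace (8 / lam ^ 2 * (h0 * lam / 2) ^ 2) with (2 * h0 ^ 2) by (field; lra). nra. }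
  assert (Y : exp (4 * Cmod (z - z2) / (h0 * lam / 2)) <= exp 2).
  { assert (4 * Cmod (z - z2) / (h0 * lam / 2) <= 2). { apply Rle_div_l; nra. }
    apply exp_le_exp, H0. }
  assert (v z2 <= v z0 + 2). { apply Ball. rewrite Cmod_diag. nra. }
  assert (Z : (v z0 + 2 - v z2 + 2) * exp (4 * Cmod (z - z2) / (h0 * lam / 2)) <= 6 * exp 2).
  { apply Rmult_le_compat; try lra. apply Rlt_le, exp_pos. }
  lra. }
assert (Sq : forall z, inrect (fst z2) (snd z2) l l z -> Cmod (z - z2) <= h0 * lam / 4).
{ intros z [Q1 Q2]. eapply Rle_trans. apply Cmod_le_sum. simpl.
  assert (Rabs (fst z + - fst z2) <= l) by (apply Rabs_le; lra). assert (Rabs (snd z + - snd z2) <= l) by (apply Rabs_le; lra).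
  unfold l in *; lra. }
apply (Harea (fst z2) (snd z2) l Hl).
- intros z Hz. assert (Q := Sq z Hz). destruct (Ball z ltac:(nra)) as (B1 & B2 & _). auto.
- intros z Hz. assert (Lz := Low z (Sq z Hz)).
  assert (exp (v z0 + (4 - 6 * exp 2)) <= exp (v z)).
  { apply exp_le_exp, Lz. }
  rewrite exp_plus, Ev in H0. unfold k0, l.
  replace ((h0 * lam / 8) ^ 2) with (h0 ^ 2 / 64 * lam ^ 2) by field.
  assert (0 < lam ^ 2) by (apply pow_lt; auto). assert (0 < h0 ^ 2 / 64) by (apply Rdiv_lt_0_compat; [apply pow_lt; lra|lra]).
  rewrite Rmult_assoc. apply Rmult_le_compat_l. lra.
  apply (Rmult_le_compat_l (lam ^ 2)) in H0; try lra. rewrite <- Rmult_assoc, Rinv_r, Rmult_1_l in H0 by lra. lra.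
Qed.
End EpsReg.

(** * The logarithmic barrier and a lower bound of v *)

Definition rq (z : C) : R := fst z ^ 2 + snd z ^ 2.

Lemma rq_Cmod z : rq z = Cmod z ^ 2.
Proof. symmetry. apply Cmod2_alt. Qed.

Lemma rq_pos (z : C) : z <> 0 -> 0 < rq z.
Proof. intros H. rewrite rq_Cmod. apply Cmod_gt_0 in H. apply pow_lt; auto. Qed.

Lemma ln_rq (z : C) : z <> 0 -> ln (rq z) = 2 * ln (Cmod z).
Proof. intros H. apply Cmod_gt_0 in H. rewrite rq_Cmod. simpl. rewrite Rmult_1_r, ln_mult; auto. ring. Qed.

Lemma contR_rq z : contR rq z.
Proof.
apply contS_contR. unfold rq. simpl.
apply contS_plus; repeat apply contS_mult; try apply contS_fst; try apply contS_snd; apply contS_const.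
Qed.

Lemma lin4_der (a b c d : R -> R) x1 x2 x3 x4 x5 x a' b' c' d' :
  is_derive a x a' -> is_derive b x b' -> is_derive c x c' -> is_derive d x d' ->
  is_derive (fun t => x1 * a t + x2 * b t + x3 * c t + x4 * d t + x5) x (x1 * a' + x2 * b' + x3 * c' + x4 * d').
Proof.
intros Ha Hb Hc Hd. auto_derive. repeat split; auto; eexists; eauto.
replace (Derive (fun x => a x) x) with a' by (symmetry; apply is_derive_unique, Ha).
replace (Derive (fun x => b x) x) with b' by (symmetry; apply is_derive_unique, Hb).
replace (Derive (fun x => c x) x) with c' by (symmetry; apply is_derive_unique, Hc).
replace (Derive (fun x => d x) x) with d' by (symmetry; apply is_derive_unique, Hd). ring.
Qed.

Section Barrier.
Variables x1 x2 x3 x4 x5 : R.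

(** In polar coordinates the terms are [2 ln r], [4 (ln r) ^ 2], [cos (2 theta) / r ^ 2],
    [sin theta] and a constant, with Laplacians [0], [8 / r ^ 2], [0], [- sin theta / r ^ 2] and
    [0]. Only [sin theta] has a normal derivative on the axis. *)
Definition bar (z : C) : R :=
  x1 * ln (rq z) + x2 * ln (rq z) ^ 2 + x3 * ((fst z ^ 2 - snd z ^ 2) / rq z ^ 2) + x4 * (snd z / sqrt (rq z)) + x5.
Definition bar_s (z : C) : R :=
  x1 * (2 * fst z / rq z) + x2 * (4 * ln (rq z) * fst z / rq z)
  + x3 * (2 * fst z / rq z ^ 2 - 4 * fst z * (fst z ^ 2 - snd z ^ 2) / rq z ^ 3)
  + x4 * (- (fst z * snd z) / (rq z * sqrt (rq z))) + 0.
Definition bar_t (z : C) : R :=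
  x1 * (2 * snd z / rq z) + x2 * (4 * ln (rq z) * snd z / rq z)
  + x3 * (- 2 * snd z / rq z ^ 2 - 4 * snd z * (fst z ^ 2 - snd z ^ 2) / rq z ^ 3)
  + x4 * (fst z ^ 2 / (rq z * sqrt (rq z))) + 0.

Lemma contR_bar (z : C) : z <> 0 -> contR bar z.
Proof.
intros Hz. apply rq_pos in Hz. assert (Hs := sqrt_lt_R0 _ Hz).
assert (Q : contS (fun _ => True) rq z). { intros e He. destruct (contR_rq z e He) as [d [Hd F]]. exists d; auto. }
assert (L : contS (fun _ => True) (fun z => ln (rq z)) z).
{ apply (contS_comp _ rq ln); auto. apply derivable_continuous_pt. exists (/ rq z). apply derivable_pt_lim_ln; auto. }
apply contS_contR. unfold bar.
apply contS_plus. 2: apply contS_const. apply contS_plus; [apply contS_plus; [apply contS_plus|]|].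
- apply contS_mult; auto. apply contS_const.
- apply contS_mult. apply contS_const. simpl. repeat apply contS_mult; auto; apply contS_const.
- apply contS_mult. apply contS_const. unfold Rdiv. apply contS_mult.
  + simpl. apply contS_minus; repeat apply contS_mult; try apply contS_fst; try apply contS_snd; apply contS_const.
  + apply (contS_comp _ rq (fun x => / x ^ 2)); auto.
    apply continuity_pt_filterlim. apply (ex_derive_cont (fun x => / x ^ 2)). auto_derive.
    apply Rgt_not_eq. simpl. repeat apply Rmult_lt_0_compat; lra.
- apply contS_mult. apply contS_const. unfold Rdiv. apply contS_mult. apply contS_snd.
  apply (contS_comp _ rq (fun x => / sqrt x)); auto.
  apply continuity_pt_filterlim. apply (ex_derive_cont (fun x => / sqrt x)). auto_derive. split; auto. split; auto.
  apply Rgt_not_eq; auto.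
Qed.

Ltac dq s t q := auto_derive; replace (s * (s * 1) + t * (t * 1)) with q by (unfold q; ring).

Lemma bar_slices (z : C) : z <> 0 -> is_derive (fun s => bar (s, snd z)) (fst z) (bar_s z) /\ is_derive (fun t => bar (fst z, t)) (snd z) (bar_t z).
Proof.
intros Hz. apply rq_pos in Hz. destruct z as [s t]. unfold bar, bar_s, bar_t. rewrite !Rplus_0_r. cbn [fst snd].
assert (Hs := sqrt_lt_R0 _ Hz). assert (Hss := sqrt_sqrt _ (Rlt_le _ _ Hz)).
unfold rq in *. cbn [fst snd] in *. set (q := s ^ 2 + t ^ 2) in *.
assert (q3 : 0 < q ^ 3) by (apply pow_lt; auto).
assert (D1 : is_derive (fun s => ln (s ^ 2 + t ^ 2)) s (2 * s / q)).
{ dq s t q; auto. field; lra. }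
assert (D1' : is_derive (fun t => ln (s ^ 2 + t ^ 2)) t (2 * t / q)).
{ dq s t q; auto. field; lra. }
assert (D2 : is_derive (fun s => ln (s ^ 2 + t ^ 2) ^ 2) s (4 * ln q * s / q)).
{ dq s t q; auto. field; lra. }
assert (D2' : is_derive (fun t => ln (s ^ 2 + t ^ 2) ^ 2) t (4 * ln q * t / q)).
{ dq s t q; auto. field; lra. }
assert (D3 : is_derive (fun s => (s ^ 2 - t ^ 2) / (s ^ 2 + t ^ 2) ^ 2) s (2 * s / q ^ 2 - 4 * s * (s ^ 2 - t ^ 2) / q ^ 3)).
{ dq s t q. apply Rgt_not_eq; nra. field; lra. }
assert (D3' : is_derive (fun t => (s ^ 2 - t ^ 2) / (s ^ 2 + t ^ 2) ^ 2) t (- 2 * t / q ^ 2 - 4 * t * (s ^ 2 - t ^ 2) / q ^ 3)).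
{ dq s t q. apply Rgt_not_eq; nra. field; lra. }
assert (D4 : is_derive (fun s => t / sqrt (s ^ 2 + t ^ 2)) s (- (s * t) / (q * sqrt q))).
{ dq s t q. repeat split; auto; apply Rgt_not_eq; auto.
  set (w := sqrt q) in *. rewrite <- Hss. field. lra. }
assert (D4' : is_derive (fun t => t / sqrt (s ^ 2 + t ^ 2)) t (s ^ 2 / (q * sqrt q))).
{ dq s t q. repeat split; auto; apply Rgt_not_eq; auto.
  set (w := sqrt q) in *. replace (s ^ 2) with (w * w - t ^ 2) by (rewrite Hss; unfold q; ring).
  rewrite <- Hss. field. lra. }
split; apply lin4_der; auto.
Qed.

Lemma bar_second (z : C) : z <> 0 -> exists a b,
  is_derive (fun s => bar_s (s, snd z)) (fst z) a /\ is_derive (fun t => bar_t (fst z, t)) (snd z) b /\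
  a + b = (8 * x2 - x4 * (snd z / sqrt (rq z))) / rq z.
Proof.
intros Hz. apply rq_pos in Hz. destruct z as [s t]. unfold bar_s, bar_t. cbn [fst snd].
assert (Hs := sqrt_lt_R0 _ Hz). assert (Hss := sqrt_sqrt _ (Rlt_le _ _ Hz)).
unfold rq in *. cbn [fst snd] in *. set (q := s ^ 2 + t ^ 2) in *.
assert (q3 : 0 < q ^ 3) by (apply pow_lt; auto).
assert (D1 : is_derive (fun s => 2 * s / (s ^ 2 + t ^ 2)) s (2 / q - 4 * s ^ 2 / q ^ 2)).
{ dq s t q; auto. lra. field; lra. }
assert (D1' : is_derive (fun t => 2 * t / (s ^ 2 + t ^ 2)) t (2 / q - 4 * t ^ 2 / q ^ 2)).
{ dq s t q; auto. lra. field; lra. }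
assert (D2 : is_derive (fun s => 4 * ln (s ^ 2 + t ^ 2) * s / (s ^ 2 + t ^ 2)) s (8 * s ^ 2 / q ^ 2 + 4 * ln q / q - 8 * ln q * s ^ 2 / q ^ 2)).
{ dq s t q. repeat split; auto; lra. field; lra. }
assert (D2' : is_derive (fun t => 4 * ln (s ^ 2 + t ^ 2) * t / (s ^ 2 + t ^ 2)) t (8 * t ^ 2 / q ^ 2 + 4 * ln q / q - 8 * ln q * t ^ 2 / q ^ 2)).
{ dq s t q. repeat split; auto; lra. field; lra. }
assert (D3 : is_derive (fun s => 2 * s / (s ^ 2 + t ^ 2) ^ 2 - 4 * s * (s ^ 2 - t ^ 2) / (s ^ 2 + t ^ 2) ^ 3) s
  (2 / q ^ 2 - 8 * s ^ 2 / q ^ 3 - 4 * (3 * s ^ 2 - t ^ 2) / q ^ 3 + 24 * s ^ 2 * (s ^ 2 - t ^ 2) / q ^ 4)).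
{ dq s t q. split; [|split; auto]; apply Rgt_not_eq; simpl in q3; nra. field; lra. }
assert (D3' : is_derive (fun t => - 2 * t / (s ^ 2 + t ^ 2) ^ 2 - 4 * t * (s ^ 2 - t ^ 2) / (s ^ 2 + t ^ 2) ^ 3) t
  (- 2 / q ^ 2 + 8 * t ^ 2 / q ^ 3 - 4 * (s ^ 2 - 3 * t ^ 2) / q ^ 3 + 24 * t ^ 2 * (s ^ 2 - t ^ 2) / q ^ 4)).
{ dq s t q. split; [|split; auto]; apply Rgt_not_eq; simpl in q3; nra. field; lra. }
assert (D4 : is_derive (fun s => - (s * t) / ((s ^ 2 + t ^ 2) * sqrt (s ^ 2 + t ^ 2))) s (- t / (q * sqrt q) + 3 * s ^ 2 * t / (q ^ 2 * sqrt q))).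
{ dq s t q. repeat split; auto; apply Rgt_not_eq; nra.
  set (w := sqrt q) in *. rewrite <- Hss. field. lra. }
assert (D4' : is_derive (fun t => s ^ 2 / ((s ^ 2 + t ^ 2) * sqrt (s ^ 2 + t ^ 2))) t (- 3 * s ^ 2 * t / (q ^ 2 * sqrt q))).
{ dq s t q. repeat split; auto; apply Rgt_not_eq; nra.
  set (w := sqrt q) in *. rewrite <- Hss. field. lra. }
eexists. eexists. split; [|split].
- apply lin4_der; [apply D1|apply D2|apply D3|apply D4].
- apply lin4_der; [apply D1'|apply D2'|apply D3'|apply D4'].
(* After substituting [q = w ^ 2] and [s ^ 2 = w ^ 2 - t ^ 2] the sum is a rational identity. *)
- set (w := sqrt q) in *. assert (Eq : q = w * w) by lra. clearbody w.
  assert (Es : s ^ 2 = w * w - t ^ 2) by (rewrite <- Eq; unfold q; ring).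
  clearbody q. set (Lq := ln q). clearbody Lq. subst q. rewrite Es. field. lra.
Qed.
End Barrier.

Section LowerBound.
Variables (K eps c0 : R) (v vs vt vss vst vts vtt : C -> R).
Hypothesis H : LS K eps c0 v vs vt vss vst vts vtt.
Variable r1 : R.
Hypothesis Hr1 : 0 < r1 <= eps.
Hypothesis Hreg : forall z, HB eps z -> Cmod z < r1 -> exp (v z) * Cmod z ^ 2 <= 144.

Lemma exp_le_bound (z : C) : HB eps z -> Cmod z < r1 -> forall m, 0 < m <= Cmod z -> exp (v z) <= 144 / m ^ 2.
Proof using Hreg.
intros Hz Hz1 m Hm. assert (B := Hreg z Hz Hz1). assert (P := exp_pos (v z)).
apply Rle_div_r. apply pow_lt; lra. assert (m ^ 2 <= Cmod z ^ 2) by (apply pow_incr; lra). nra.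
Qed.

Lemma lap_bound z k : HD eps z -> exp (v z) <= k -> Rabs (vss z + vtt z) <= 2 * k.
Proof using H.
intros Hz Hk. rewrite (ls_eq H z Hz). assert (KK := ls_K H).
rewrite !Rabs_mult, (Rabs_pos_eq (exp (v z))) by (apply Rlt_le, exp_pos).
replace (Rabs (-2)) with 2 by (rewrite Rabs_left; lra). assert (P := exp_pos (v z)). assert (P' := Rabs_pos K). nra.
Qed.

Lemma v_le_ln z x : 0 < x -> exp (v z) <= x -> v z <= ln x.
Proof. intros Hx E. rewrite <- (ln_exp (v z)). apply ln_le; auto. apply exp_pos. Qed.

Lemma harnack_height (a b : C) (r h : R) : 0 < h <= r -> r + h / 2 < r1 ->
  (forall x, 0 <= x <= 1 -> h <= snd (a + RtoC x * (b - a))%C /\ Cmod (a + RtoC x * (b - a)) <= r) ->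
  let m0 := ln (576 / h ^ 2) in
  m0 - v b + 288 <= (m0 - v a + 288) * exp (8 * Cmod (b - a) / h).
Proof using H Hr1 Hreg.
intros Hh Hrh Hseg m0.
assert (Hin : forall x, 0 <= x <= 1 -> forall z, Cmod (z - (a + RtoC x * (b - a))) < h / 2 -> HD eps z /\ exp (v z) <= 576 / h ^ 2).
{ intros x Hx z Hz. destruct (Hseg x Hx) as [S1 S2]. set (p := (a + RtoC x * (b - a))%C) in *.
  assert (T := Cmod_snd (z - p)). change (Rabs (snd z - snd p) <= Cmod (z - p)) in T. apply Rabs_le_between in T.
  assert (T2 := Cmod_lip z p). apply Rabs_le_between in T2.
  assert (Sz : h / 2 < snd z) by lra. assert (Cz := Cmod_snd z). rewrite Rabs_pos_eq in Cz by lra.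
  assert (U : HD eps z) by (split; lra). split; auto.
  replace (576 / h ^ 2) with (144 / (h / 2) ^ 2) by (field; lra). apply exp_le_bound; try lra. apply HD_HB; auto. }
assert (Hp : 0 < 576 / h ^ 2) by (apply Rdiv_lt_0_compat; [lra|apply pow_lt; lra]).
replace (8 * Cmod (b - a) / h) with (4 * Cmod (b - a) / (h / 2)) by (field; lra).
apply (harnack_segment a b (h / 2) v vs vt vss vst vts vtt (2 * (576 / h ^ 2)) m0 288).
- lra.
- intros x Hx z Hz. destruct (Hin x Hx z Hz) as [U B]. split. apply v_le_ln; auto. apply lap_bound; auto.
- eapply C2on_sub. 2: apply (ls_C2 H). intros z [x [Hx Hz]]. apply (Hin x Hx z Hz).
- right. field. lra.
Qed.

Let r0 := Rmin r1 1 / 2.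

Lemma r0_bounds : 0 < r0 /\ r0 < r1 /\ r0 <= / 2.
Proof using Hr1.
unfold r0. assert (0 < Rmin r1 1) by (apply Rmin_pos; lra). min_le r1 1 A B. lra.
Qed.

(* Lower barrier in the half annulus r < |z| < r0: the log term carries the value -v(0,r) = M outwards,
   the harmonic term (s^2 - t^2)/|z|^4 corrects the inner circle near the axis, where no lower bound of -v is known,
   and ln^2|z| and t/|z| absorb the right-hand side and the Neumann data. *)
Lemma center_lower : exists A, 0 < A /\ forall r, 0 < r <= r0 / 4 -> - v (0, r) <= A * ln (r0 / r) ^ 3.
Proof using H Hr1 Hreg.
destruct r0_bounds as [R1 [R2 R3]]. assert (C0 := ls_c0 H).
(* [C3] beats the Neumann data, which are at most [12 c0 / |z|]. [C2] makes [|z| ^ 2] times the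
   Laplacian of the barrier at most [- 289], below [- 288 <= - 2 K e^v |z| ^ 2]. *)
set (C3 := 12 * c0 + 1). set (C2 := (C3 + 289) / 2).
set (C4 := C3 + 288 + Rabs (ln 2304) + Rabs (ln 144) - 2 * ln r0).
(* [exp 32] is the Harnack factor between [(0, r)] and the points of the inner circle above height
   [r / 2]; [3] is the largest value of [1 - 2 cos (2 theta)]. *)
set (e1 := / (3 * exp 32)). set (V0 := v (0, r0 / 2)).
assert (He1 : 0 < e1). { unfold e1. apply Rinv_0_lt_compat. generalize (exp_pos 32); lra. }
assert (Hln2 : 0 < ln 2) by (rewrite <- ln_1; apply ln_increasing; lra).
set (B := Rabs (C4 - V0) + 2 + C2).
assert (HC3 : 1 <= C3) by (unfold C3; lra). assert (HC2 : 145 <= C2) by (unfold C2; lra).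
assert (HB0 : 0 < B). { unfold B. generalize (Rabs_pos (C4 - V0)); lra. }
exists (B / (e1 * ln 2)). split. { apply Rdiv_lt_0_compat; auto. apply Rmult_lt_0_compat; auto. }
intros r Hr. set (M := - v (0, r)). set (l := ln (r0 / r)).
assert (Hl : 1 <= l).
{ unfold l. rewrite <- (ln_exp 1). apply ln_le. apply exp_pos. apply Rle_trans with 4. generalize exp_le_3; lra.
  apply (Rle_div_r 4 r0 r); lra. }
assert (Hl' : l = ln r0 - ln r) by (unfold l, Rdiv; rewrite ln_mult, ln_Rinv; auto; [lra|apply Rinv_0_lt_compat; lra]).
assert (Hl3 : 1 <= l ^ 3 /\ l <= l ^ 3 /\ l ^ 2 * l = l ^ 3) by (simpl; nra).
destruct (Rle_dec M 0) as [HM|HM].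
{ apply Rle_trans with 0; auto. apply Rmult_le_pos; [|lra]. apply Rlt_le, Rdiv_lt_0_compat; auto. apply Rmult_lt_0_compat; auto. }
apply Rnot_le_lt in HM.
set (x1 := e1 * M / (2 * l) + C2 * ln r0). set (x2 := - C2 / 4). set (x3 := 2 * e1 * M * r ^ 2). set (x4 := - C3).
set (x5 := - e1 * M * (ln r0 / l - 2 * r ^ 2 / r0 ^ 2) + C2 * (l ^ 2 - ln r0 ^ 2) + C4 + 2 * l).
assert (Eb : forall z : C, z <> 0 -> bar x1 x2 x3 x4 x5 z =
  - e1 * M * ((ln r0 - ln (Cmod z)) / l - 2 * r ^ 2 * (fst z ^ 2 - snd z ^ 2) / Cmod z ^ 4 - 2 * r ^ 2 / r0 ^ 2)
  + C2 * (l ^ 2 - (ln r0 - ln (Cmod z)) ^ 2) - C3 * (snd z / Cmod z) + C4 + 2 * l).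
{ intros z Hz. unfold bar. rewrite ln_rq by auto. rewrite rq_Cmod. apply Cmod_gt_0 in Hz.
  replace (sqrt (Cmod z ^ 2)) with (Cmod z) by (symmetry; apply sqrt_pow2; lra).
  unfold x1, x2, x3, x4, x5. field. lra. }
set (S := fun z : C => r <= Cmod z <= r0 /\ 0 <= snd z).
assert (SB : forall z, S z -> HB eps z).
{ intros z [S1 S2]. split; [lra|]. split; auto. intros E. rewrite E, Cmod_0 in S1. lra. }
assert (Main : forall z, S z -> v z <= bar x1 x2 x3 x4 x5 z).
{ apply (comparison K eps c0 v vs vt vss vst vts vtt H S (bar x1 x2 x3 x4 x5) (bar_s x1 x2 x3 x4) (bar_t x1 x2 x3 x4)
    (fun z => Derive (fun s => bar_s x1 x2 x3 x4 (s, snd z)) (fst z)) (fun z => Derive (fun t => bar_t x1 x2 x3 x4 (fst z, t)) (snd z)) r0).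
  - intros z [S1 S2]. assert (T1 := Cmod_fst z). assert (T2 := Cmod_snd z). lra.
  - intros z Hz.
    assert (X : Cmod z < r \/ r0 < Cmod z \/ snd z < 0).
    { apply NNPP. intros N. apply Hz. split; [split|]; apply Rnot_lt_le; intros Hlt; apply N; auto. }
    destruct X as [X|[X|X]].
    + exists (r - Cmod z). split. lra. intros w Hw [W1 W2]. assert (T := Cmod_lip w z). apply Rabs_le_between in T. lra.
    + exists (Cmod z - r0). split. lra. intros w Hw [W1 W2]. assert (T := Cmod_lip w z). apply Rabs_le_between in T. lra.
    + exists (- snd z). split. lra. intros w Hw [W1 W2]. assert (T := Cmod_snd (w - z)). simpl in T. apply Rabs_le_between in T. lra.
  - auto.
  - intros z Hz. apply contR_bar, Hz.
  - intros z Hz. apply bar_slices, Hz.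
  - intros z Hz. destruct (bar_second x1 x2 x3 x4 z) as (a & b & Da & Db & _). apply HD_HB in Hz; apply Hz.
    split; apply Derive_correct; eexists; eauto.
  - intros z Hz. assert (Bz := SB z Hz). assert (Bz' := Bz). destruct Bz' as [Z1 [Z2 Z3]]. destruct Hz as [[S1 S1'] S2].
    assert (Pz : 0 < Cmod z) by lra.
    assert (Ez := Hreg z Bz ltac:(lra)). assert (Q := rq_Cmod z). unfold rq in Q.
    assert (Tr : 0 <= snd z / Cmod z <= 1).
    { split. apply Rdiv_le_0_compat; lra. apply Rle_div_l; auto. assert (T := Cmod_snd z). rewrite Rabs_pos_eq in T; lra. }
    destruct (Req_dec (Cmod z) r) as [Er|Er]; [left|destruct (Req_dec (Cmod z) r0) as [Er0|Er0]; [left|right]].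
    +      rewrite Eb by auto. rewrite Er. fold l. replace (ln r0 - ln r) with l by lra.
      assert (Vz : v z <= ln 144 + 2 * l - 2 * ln r0).
      { assert (X := v_le_ln z (144 / r ^ 2)). rewrite Er in Ez.
        assert (0 < 144 / r ^ 2) by (apply Rdiv_lt_0_compat; [lra|apply pow_lt; lra]).
        specialize (X H0 ltac:(apply Rle_div_r; [apply pow_lt; lra|lra])).
        unfold Rdiv in X. rewrite ln_mult, ln_Rinv in X; try lra; try (apply pow_lt; lra); try (apply Rinv_0_lt_compat, pow_lt; lra).
        simpl in X. rewrite Rmult_1_r, ln_mult in X by lra. lra. }
      replace (l / l) with 1 by (field; lra). replace (l ^ 2 - l ^ 2) with 0 by ring.
      rewrite Er in Q, Tr, Pz.
      replace (2 * r ^ 2 * (fst z ^ 2 - snd z ^ 2) / r ^ 4) with (2 * (1 - 2 * (snd z / r) ^ 2)).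
      2: { replace (fst z ^ 2) with (r ^ 2 - snd z ^ 2) by lra. field. lra. }
      assert (Rr : 0 <= 2 * r ^ 2 / r0 ^ 2). { apply Rdiv_le_0_compat. generalize (pow2_ge_0 r); lra. apply pow_lt; lra. }
      set (y := snd z / r) in *. set (b := 2 * r ^ 2 / r0 ^ 2) in *.
      assert (A1 := Rle_abs (ln 144)). assert (A2 := Rabs_pos (ln 2304)).
      assert (CT : C3 * y <= C3) by nra.
      assert (EM : 0 < e1 * M) by (apply Rmult_lt_0_compat; auto).
      destruct (Rle_dec y (/ 2)) as [Hy|Hy].
      (* For [sin theta <= / 2] the factor [1 - 2 cos (2 theta)] is not positive, so the barrier
         lies above the upper bound of [v] without any information on [v (0, r)]. *)
      * assert (0 <= - e1 * M * (1 - 2 * (1 - 2 * y ^ 2) - b)).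
        { replace (- e1 * M * (1 - 2 * (1 - 2 * y ^ 2) - b)) with (e1 * M * (1 - 4 * y ^ 2 + b)) by ring.
          apply Rmult_le_pos; [lra|]. nra. }
        unfold C4. lra.
      * assert (HH := harnack_height z (0, r) r (r / 2) ltac:(lra) ltac:(lra)).
        assert (Hyr : r / 2 <= snd z). { apply Rnot_le_lt in Hy. unfold y in Hy. apply Rlt_div_r in Hy; lra. }
        assert (HH' : ln (576 / (r / 2) ^ 2) - v (0, r) + 288 <= (ln (576 / (r / 2) ^ 2) - v z + 288) * exp (8 * Cmod ((0, r) - z) / (r / 2))).
        { apply HH. intros x Hx. split.
          - simpl. nra.
          - replace (z + RtoC x * ((0, r) - z))%C with (RtoC (1 - x) * z + RtoC x * (0, r))%C by (rewrite RtoC_minus; ring).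
            eapply Rle_trans. apply Cmod_triangle. rewrite !Cmod_mult, !Cmod_R, !Rabs_pos_eq, Er by lra.
            assert (Cmod (0, r) <= r). { eapply Rle_trans. apply Cmod_pair_le. rewrite Rabs_R0, Rabs_pos_eq; lra. } nra. }
        assert (Ln : ln (576 / (r / 2) ^ 2) = ln 2304 + 2 * l - 2 * ln r0).
        { replace (576 / (r / 2) ^ 2) with (2304 * / (r * r)) by (field; lra).
          rewrite ln_mult, ln_Rinv, ln_mult; try lra; try nra. apply Rinv_0_lt_compat; nra. }
        rewrite Ln in HH'. clear HH.
        assert (Pm : 0 <= ln 2304 + 2 * l - 2 * ln r0).
        { assert (0 <= ln 2304) by (rewrite <- ln_1; apply ln_le; lra).
          assert (ln r0 <= 0) by (rewrite <- ln_1; apply ln_le; lra). lra. }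
        assert (Ex : exp (8 * Cmod ((0, r) - z) / (r / 2)) <= exp 32).
        { assert (8 * Cmod ((0, r) - z) / (r / 2) <= 32).
          { apply Rle_div_l. lra. assert (T := Cmod_triangle (0, r) (- z)). rewrite Cmod_opp, Er in T.
            assert (Cmod (0, r) <= r). { eapply Rle_trans. apply Cmod_pair_le. rewrite Rabs_R0, Rabs_pos_eq; lra. }
            unfold Cminus. lra. }
          apply exp_le_exp, H0. }
        assert (A3 := Rle_abs (ln 2304)). assert (A4 := Rabs_pos (ln 144)).
        assert (X2 : v z <= ln 2304 + 2 * l - 2 * ln r0 + 288 - M / exp 32).
        { set (u := ln 2304 + 2 * l - 2 * ln r0 - v z + 288) in *. assert (Pe := exp_pos 32).
          assert (Pe' := exp_pos (8 * Cmod ((0, r) - z) / (r / 2))).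
          assert (Mu : M <= u * exp (8 * Cmod ((0, r) - z) / (r / 2))) by (unfold M; lra).
          assert (0 < u). { apply Rnot_le_lt. intros Hu. nra. }
          assert (M <= u * exp 32) by nra.
          assert (M / exp 32 <= u) by (apply Rle_div_l; lra). unfold u in H2. lra. }
        assert (X3 : - e1 * M * (1 - 2 * (1 - 2 * y ^ 2) - b) >= - (M / exp 32)).
        { assert (Y2 : y ^ 2 <= 1) by nra.
          assert (3 * (e1 * M) = M / exp 32). { unfold e1. field. apply Rgt_not_eq, exp_pos. }
          nra. }
        unfold C4. lra.
    +      rewrite Eb by auto. rewrite Er0. replace (ln r0 - ln r0) with 0 by ring.
      assert (Vz : v z <= ln 144 - 2 * ln r0).
      { assert (X := v_le_ln z (144 / r0 ^ 2)). rewrite Er0 in Ez.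
        assert (0 < 144 / r0 ^ 2) by (apply Rdiv_lt_0_compat; [lra|apply pow_lt; lra]).
        specialize (X H0 ltac:(apply Rle_div_r; [apply pow_lt; lra|lra])).
        unfold Rdiv in X. rewrite ln_mult, ln_Rinv in X; try lra; try (apply pow_lt; lra); try (apply Rinv_0_lt_compat, pow_lt; lra).
        simpl in X. rewrite Rmult_1_r, ln_mult in X by lra. lra. }
      rewrite Er0 in Q, Tr.
      replace (2 * r ^ 2 * (fst z ^ 2 - snd z ^ 2) / r0 ^ 4) with (2 * r ^ 2 / r0 ^ 2 * (1 - 2 * (snd z / r0) ^ 2)).
      2: { replace (fst z ^ 2) with (r0 ^ 2 - snd z ^ 2) by lra. field. lra. }
      assert (Rr : 0 <= 2 * r ^ 2 / r0 ^ 2). { apply Rdiv_le_0_compat. generalize (pow2_ge_0 r); lra. apply pow_lt; lra. }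
      set (y := snd z / r0) in *. set (b := 2 * r ^ 2 / r0 ^ 2) in *.
      assert (A1 := Rle_abs (ln 144)). assert (A2 := Rabs_pos (ln 2304)).
      assert (CT : C3 * y <= C3) by nra.
      assert (EM : 0 < e1 * M) by (apply Rmult_lt_0_compat; auto).
      replace (0 / l) with 0 by (field; lra).
      assert (0 <= - e1 * M * (0 - b * (1 - 2 * y ^ 2) - b)).
      { replace (- e1 * M * (0 - b * (1 - 2 * y ^ 2) - b)) with (e1 * M * (b * (2 - 2 * y ^ 2))) by ring.
        apply Rmult_le_pos; [lra|]. apply Rmult_le_pos; auto. nra. }
      assert (0 <= C2 * (l ^ 2 - 0 ^ 2)) by nra.
      unfold C4. lra.
    + destruct (Rle_lt_or_eq_dec 0 (snd z) S2) as [Hp|Hp]; [left|right].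
      * split; auto. split.
        { set (d := Rmin (Rmin (Cmod z - r) (r0 - Cmod z)) (snd z)). exists d. split. { repeat apply Rmin_pos; lra. }
          intros w Hw. min_le (Rmin (Cmod z - r) (r0 - Cmod z)) (snd z) D1 D2.
          fold d in D1, D2. min_le (Cmod z - r) (r0 - Cmod z) D3 D4.
          assert (T := Cmod_lip w z). assert (T2 := Cmod_snd (w - z)). simpl in T2. apply Rabs_le_between in T. apply Rabs_le_between in T2.
          split; lra. }
        destruct (bar_second x1 x2 x3 x4 z Z3) as (a & b & Da & Db & Eab).
        assert (Ea : Derive (fun s => bar_s x1 x2 x3 x4 (s, snd z)) (fst z) = a) by apply is_derive_unique, Da.
        assert (Eb' : Derive (fun t => bar_t x1 x2 x3 x4 (fst z, t)) (snd z) = b) by apply is_derive_unique, Db.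
        rewrite Ea, Eb', Eab.
        assert (KK := ls_K H). apply Rabs_le_between in KK. assert (Pe := exp_pos (v z)).
        rewrite rq_Cmod. replace (sqrt (Cmod z ^ 2)) with (Cmod z) by (symmetry; apply sqrt_pow2; lra).
        assert (P2 : 0 < Cmod z ^ 2) by (apply pow_lt; auto).
        apply Rlt_div_l; auto.
        set (X := exp (v z) * Cmod z ^ 2) in *. assert (X0 : 0 <= X) by (apply Rmult_le_pos; lra).
        replace (-2 * K * exp (v z) * Cmod z ^ 2) with (-2 * (K * X)) by (unfold X; ring).
        assert (KX : K * X <= 144) by nra.
        assert (CY : C3 * (snd z / Cmod z) <= C3) by nra.
        unfold x2, x4, C2. lra.
      * symmetry in Hp. split; auto. split.
        { assert (Ef : Cmod z = Rabs (fst z)). { rewrite <- Cmod_R. f_equal. apply injective_projections; simpl; auto. }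
          exists (r0 - Cmod z). split. lra. intros t Ht. split; simpl; try lra. split.
          - apply Rle_trans with (Cmod z); auto. rewrite Ef. apply (Cmod_fst (fst z, t)).
          - eapply Rle_trans. apply Cmod_pair_le. rewrite <- Ef, (Rabs_pos_eq t); lra. }
        assert (E12 : exp (v z / 2) <= 12 / Cmod z).
        { apply Rsqr_incr_0. 2: apply Rlt_le, exp_pos. 2: apply Rlt_le, Rdiv_lt_0_compat; lra.
          unfold Rsqr. rewrite <- exp_plus. replace (v z / 2 + v z / 2) with (v z) by field.
          replace (12 / Cmod z * (12 / Cmod z)) with (144 / Cmod z ^ 2) by (field; lra). apply Rle_div_r; auto. apply pow_lt; auto. }
        unfold bar_t. rewrite Hp, rq_Cmod.
        replace (sqrt (Cmod z ^ 2)) with (Cmod z) by (symmetry; apply sqrt_pow2; lra).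
        replace (fst z ^ 2) with (Cmod z ^ 2) by (rewrite Hp in Q; lra).
        match goal with |- ?X < _ => replace X with (- C3 / Cmod z) by (unfold x4; field; lra) end.
        assert (c0 * exp (v z / 2) <= c0 * (12 / Cmod z)) by (apply Rmult_le_compat_l; auto).
        assert (- C3 / Cmod z = - (c0 * (12 / Cmod z)) - / Cmod z) by (unfold C3; field; lra).
        assert (0 < / Cmod z) by (apply Rinv_0_lt_compat; auto). lra. }
(* At this fixed point [v] does not depend on [r], while the barrier is at most [- e1 M ln 2 / l] up
   to a term [O(l ^ 2)]; hence [M = O(l ^ 3)]. *)
assert (Z0 : ((0, r0 / 2) : C) <> 0). { intros E. apply (f_equal snd) in E. simpl in E. lra. }
assert (Cm : Cmod (0, r0 / 2) = r0 / 2).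
{ unfold Cmod. simpl. replace (0 * (0 * 1) + r0 / 2 * (r0 / 2 * 1)) with ((r0 / 2) ^ 2) by ring. apply sqrt_pow2; lra. }
assert (F := Main (0, r0 / 2)). rewrite Eb in F by auto. rewrite Cm in F. cbn [fst snd] in F. fold V0 in F.
assert (F' : V0 <= - (e1 * M * (ln 2 / l)) + C2 * l ^ 2 + C4 + 2 * l).
{ eapply Rle_trans. apply F. split; [rewrite Cm; lra|simpl; lra].
  replace (ln r0 - ln (r0 / 2)) with (ln 2). 2: { unfold Rdiv. rewrite ln_mult, ln_Rinv; lra. }
  replace (2 * r ^ 2 * (0 ^ 2 - (r0 / 2) ^ 2) / (r0 / 2) ^ 4) with (- (8 * r ^ 2 / r0 ^ 2)) by (field; lra).
  replace (r0 / 2 / (r0 / 2)) with 1 by (field; lra).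
  assert (Rr : 0 <= r ^ 2 / r0 ^ 2). { apply Rdiv_le_0_compat. generalize (pow2_ge_0 r); lra. apply pow_lt; lra. }
  replace (- e1 * M * (ln 2 / l - - (8 * r ^ 2 / r0 ^ 2) - 2 * r ^ 2 / r0 ^ 2)) with
   (- (e1 * M * (ln 2 / l)) - e1 * M * (6 * (r ^ 2 / r0 ^ 2))) by (field; lra).
  assert (0 <= e1 * M * (6 * (r ^ 2 / r0 ^ 2))) by (apply Rmult_le_pos; [nra|lra]).
  assert (0 <= C2 * ln 2 ^ 2) by (apply Rmult_le_pos; [lra|apply pow2_ge_0]). lra. }
apply Rmult_le_reg_r with (e1 * ln 2). apply Rmult_lt_0_compat; auto.
replace (B / (e1 * ln 2) * l ^ 3 * (e1 * ln 2)) with (B * l ^ 3) by (field; lra).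
replace (M * (e1 * ln 2)) with (l * (e1 * M * (ln 2 / l))) by (field; lra).
apply Rle_trans with (l * (C2 * l ^ 2 + C4 + 2 * l - V0)). { apply Rmult_le_compat_l; lra. }
unfold B. assert (A5 := Rle_abs (C4 - V0)). assert (A6 := Rabs_pos (C4 - V0)).
replace (l * (C2 * l ^ 2 + C4 + 2 * l - V0)) with (C2 * l ^ 3 + 2 * l ^ 2 + (C4 - V0) * l) by ring.
assert (l ^ 2 <= l ^ 3) by (simpl; nra).
assert ((C4 - V0) * l <= Rabs (C4 - V0) * l ^ 3).
{ apply Rle_trans with (Rabs (C4 - V0) * l). apply Rmult_le_compat_r; lra. apply Rmult_le_compat_l; lra. }
lra.
Qed.
End LowerBound.

(** * Growth of the gradient towards the axis *)

Section GradGrowth.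
Variables (K eps c0 : R) (v vs vt vss vst vts vtt : C -> R).
Hypothesis H : LS K eps c0 v vs vt vss vst vts vtt.

(** Along a vertical, [u = m0 - v + 288] changes at relative rate at most [8 / y], so between height
    [r] and height [t] it grows at most by [(r / t) ^ 8]. At height [r] Harnack's inequality
    compares it with its value at [(0, r)], which [center_lower] bounds. The gradient bound
    [8 u / t] supplies the ninth power. *)
Lemma grad_growth : exists A r2, 0 < A /\ 0 < r2 <= / 2 /\ r2 <= eps / 4 /\ forall z e1 e2, HD eps z -> Cmod z < r2 ->
  e1 * e1 + e2 * e2 = 1 -> Rabs (e1 * vs z + e2 * vt z) <= A * (1 - ln (Cmod z)) ^ 3 * Cmod z ^ 8 / snd z ^ 9.
Proof using H.
destruct (eps_regularity _ _ _ _ _ _ _ _ _ _ H) as [r1 [Hr1 Hreg]].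
destruct (center_lower _ _ _ _ _ _ _ _ _ _ H r1 Hr1 Hreg) as [A [HA Hc]].
destruct (r0_bounds eps r1 Hr1) as [R1 [R2 R3]]. set (r0 := Rmin r1 1 / 2) in *.
assert (R1e : r0 <= r1 / 2). { unfold r0. generalize (Rmin_l r1 1). lra. }
exists (8 * exp 8 * (ln 576 + 288 + 2 + A)), (r0 / 4).
assert (L576 : 0 <= ln 576) by (rewrite <- ln_1; apply ln_le; lra).
assert (Pe := exp_pos 8).
split. { nra. } split. lra. split. lra.
intros z e1 e2 Hz Hzr He.
destruct Hz as [Hz1 Hz2]. set (r := Cmod z) in *.
assert (Hr : 0 < r). { eapply Rlt_le_trans. apply Hz2. eapply Rle_trans. apply Rle_abs. apply Cmod_snd. }
assert (Ht : snd z <= r). { eapply Rle_trans. apply Rle_abs. apply Cmod_snd. }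
assert (Hs : Rabs (fst z) <= r) by apply Cmod_fst.
set (s := fst z) in *. set (t := snd z) in *.
assert (Ez : z = (s, t)) by (unfold s, t; apply surjective_pairing).
set (m0 := ln (576 / r ^ 2)).
assert (P576 : 0 < 576 / r ^ 2) by (apply Rdiv_lt_0_compat; [lra|apply pow_lt; lra]).
assert (Cz : forall y, t <= y -> r <= Cmod (s, y)).
{ intros y Hy. unfold r. rewrite Ez. apply Cmod_le_of_abs. lra. rewrite !Rabs_pos_eq; lra. }
assert (Ball : forall y, t <= y <= r -> forall w, Cmod (w - (s, y)) < y / 2 -> HD eps w /\ v w <= m0 /\ Rabs (vss w + vtt w) <= 2 * (576 / r ^ 2)).
{ intros y Hy w Hw.
  assert (T := Cmod_snd (w - (s, y))). change (Rabs (snd w - y) <= Cmod (w - (s, y))) in T. apply Rabs_le_between in T.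
  assert (T2 := Cmod_lip w (s, y)). apply Rabs_le_between in T2.
  assert (C1 := Cz y (proj1 Hy)). assert (C2 : Cmod (s, y) <= 2 * r). { eapply Rle_trans. apply Cmod_pair_le. rewrite (Rabs_pos_eq y); lra. }
  assert (U : HD eps w) by (split; lra).
  assert (E : exp (v w) <= 576 / r ^ 2).
  { replace (576 / r ^ 2) with (144 / (r / 2) ^ 2) by (field; lra). apply (exp_le_bound eps v r1 Hreg); try lra. apply HD_HB; auto. }
  split; auto. split. apply v_le_ln; auto. apply (lap_bound K eps c0 v vs vt vss vst vts vtt H); auto. }
assert (Kap : forall y, t <= y <= r -> 2 * (576 / r ^ 2) * (y / 2) ^ 2 <= 288).
{ intros y Hy. replace (2 * (576 / r ^ 2) * (y / 2) ^ 2) with (288 * (y / r) ^ 2) by (field; lra).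
  assert (0 <= y / r <= 1). { split. apply Rdiv_le_0_compat; lra. apply (Rle_div_l y 1 r); lra. } nra. }
assert (G : forall y e1 e2, t <= y <= r -> e1 * e1 + e2 * e2 = 1 -> Rabs (e1 * vs (s, y) + e2 * vt (s, y)) <= 8 / y * (m0 - v (s, y) + 288)).
{ intros y f1 f2 Hy Hf. replace (8 / y) with (4 / (y / 2)) by (field; lra).
  apply (grad_bound_u (s, y) (y / 2) v vs vt vss vst vts vtt (2 * (576 / r ^ 2))); auto; try lra.
  - eapply C2on_sub. 2: apply (ls_C2 H). intros w Hw; apply (Ball y Hy w Hw).
  - intros w Hw; apply (Ball y Hy w Hw).
  - intros w Hw; apply (Ball y Hy w Hw). }
(* u y^8 is nondecreasing along the vertical segment *)
assert (V : (m0 - v (s, t) + 288) * t ^ 8 <= (m0 - v (s, r) + 288) * r ^ 8).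
{ apply (der_le (fun y => (m0 - v (s, y) + 288) * y ^ 8) (fun y => - vt (s, y) * y ^ 8 + (m0 - v (s, y) + 288) * (8 * y ^ 7))); auto.
  - intros y Hy.
    assert (U : HD eps (s, y)). { apply (Ball y Hy). replace ((s, y) - (s, y))%C with (RtoC 0) by ring. rewrite Cmod_0. lra. }
    assert (D := proj2 (fder_slices _ _ _ _ (c2_f (ls_C2 H) _ U))). cbn [fst snd] in D.
    set (F := fun y => v (s, y)) in *. change (is_derive (fun y => (m0 - F y + 288) * y ^ 8) y (- vt (s, y) * y ^ 8 + (m0 - F y + 288) * (8 * y ^ 7))).
    auto_derive. eexists; exact D. replace (Derive (fun x => F x) y) with (vt (s, y)) by (symmetry; apply is_derive_unique, D). ring.
  - intros y Hy. assert (B := G y 0 1 ltac:(lra) ltac:(ring)). replace (0 * vs (s, y) + 1 * vt (s, y)) with (vt (s, y)) in B by ring.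
    apply Rabs_le_between in B. destruct B as [_ B].
    apply (Rmult_le_compat_r (y ^ 8)) in B. 2: apply pow_le; lra.
    replace (8 / y * (m0 - v (s, y) + 288) * y ^ 8) with ((m0 - v (s, y) + 288) * (8 * y ^ 7)) in B by (field; lra). lra. }
assert (Hor : m0 - v (s, r) + 288 <= (m0 - v (0, r) + 288) * exp 8).
{ assert (HH := harnack_height K eps c0 v vs vt vss vst vts vtt H r1 Hr1 Hreg (0, r) (s, r) (2 * r) r ltac:(lra) ltac:(lra)).
  assert (X : m0 - v (s, r) + 288 <= (m0 - v (0, r) + 288) * exp (8 * Cmod ((s, r) - (0, r)) / r)).
  { apply HH. intros x Hx. split.
    - simpl. lra.
    - replace ((0, r) + RtoC x * ((s, r) - (0, r)))%C with ((x * s, r) : C) by Cring.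
      eapply Rle_trans. apply Cmod_pair_le. rewrite Rabs_mult, !(Rabs_pos_eq r), (Rabs_pos_eq x) by lra. generalize (Rabs_pos s). nra. }
  assert (U0 : 0 < m0 - v (0, r) + 288).
  { assert (v (0, r) <= m0). 2: lra. apply v_le_ln; auto.
    assert (Cr : Cmod (0, r) = r). { unfold Cmod. simpl. replace (0 * (0 * 1) + r * (r * 1)) with (r ^ 2) by ring. apply sqrt_pow2; lra. }
    apply Rle_trans with (144 / r ^ 2).
    - apply (exp_le_bound eps v r1 Hreg); rewrite ?Cr; try lra. split; rewrite ?Cr. lra. split. simpl; lra.
      intros E. apply (f_equal snd) in E. simpl in E. lra.
    - apply Rmult_le_compat_r. apply Rlt_le, Rinv_0_lt_compat, pow_lt; lra. lra. }
  eapply Rle_trans. apply X. apply Rmult_le_compat_l. lra.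
  assert (8 * Cmod ((s, r) - (0, r)) / r <= 8).
  { apply (Rle_div_l _ 8 r); auto. replace ((s, r) - (0, r))%C with ((s, 0) : C) by Cring.
    assert (Cmod (s, 0) <= r). { eapply Rle_trans. apply Cmod_pair_le. rewrite Rabs_R0. lra. } lra. }
  apply exp_le_exp, H0. }
set (L := 1 - ln r).
assert (Hln : ln r <= 0). { rewrite <- ln_1. apply ln_le; lra. }
assert (HL : 1 <= L) by (unfold L; lra).
assert (HL3 : 1 <= L ^ 3 /\ L <= L ^ 3) by (simpl; nra).
assert (Cen : m0 - v (0, r) + 288 <= (ln 576 + 288 + 2 + A) * L ^ 3).
{ assert (X := Hc r ltac:(lra)).
  assert (Y : ln (r0 / r) <= L /\ 0 <= ln (r0 / r)).
  { unfold Rdiv. rewrite ln_mult, ln_Rinv; auto. 2: apply Rinv_0_lt_compat; auto.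
    assert (ln r0 <= 0) by (rewrite <- ln_1; apply ln_le; lra). assert (ln r <= ln r0) by (apply ln_le; lra). unfold L; lra. }
  assert (Z : ln (r0 / r) ^ 3 <= L ^ 3) by (apply pow_incr; lra).
  assert (M : m0 = ln 576 + 2 * (L - 1)).
  { unfold m0, Rdiv. rewrite ln_mult, ln_Rinv; try lra; try (apply pow_lt; lra); try (apply Rinv_0_lt_compat, pow_lt; lra).
    simpl. rewrite Rmult_1_r, ln_mult by lra. unfold L. ring. }
  assert (A * ln (r0 / r) ^ 3 <= A * L ^ 3) by (apply Rmult_le_compat_l; lra). nra. }
assert (B := G t e1 e2 ltac:(lra) He). rewrite <- Ez in B.
eapply Rle_trans. apply B. rewrite <- Ez in V.
assert (t8 : 0 < t ^ 8) by (apply pow_lt; auto). assert (r8 : 0 < r ^ 8) by (apply pow_lt; auto).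
apply Rmult_le_reg_r with (t ^ 9). apply pow_lt; auto.
replace (8 / t * (m0 - v z + 288) * t ^ 9) with (8 * ((m0 - v z + 288) * t ^ 8)) by (field; lra).
replace (8 * exp 8 * (ln 576 + 288 + 2 + A) * L ^ 3 * r ^ 8 / t ^ 9 * t ^ 9) with (8 * (((ln 576 + 288 + 2 + A) * L ^ 3 * exp 8) * r ^ 8)) by (field; lra).
apply Rmult_le_compat_l. lra. eapply Rle_trans. apply V.
apply Rmult_le_compat_r. lra. eapply Rle_trans. apply Hor. apply Rmult_le_compat_r; lra.
Qed.
End GradGrowth.

Lemma fder_eq f z p q p' q' : p = p' -> q = q' -> fder f z p q -> fder f z p' q'.
Proof. intros -> ->; auto. Qed.

Lemma fder_plus f g z p q p' q' : fder f z p q -> fder g z p' q' -> fder (fun w => f w + g w) z (p + p') (q + q').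
Proof.
intros Hf Hg e He. destruct (Hf (e / 2)) as [d1 [Hd1 F]]; try lra. destruct (Hg (e / 2)) as [d2 [Hd2 G]]; try lra.
exists (Rmin d1 d2). split. apply Rmin_pos; auto. intros w Hw.
specialize (F w (Rlt_le_trans _ _ _ Hw (Rmin_l _ _))). specialize (G w (Rlt_le_trans _ _ _ Hw (Rmin_r _ _))).
match goal with |- Rabs ?X <= _ => replace X with ((f w - f z - (p * (fst w - fst z) + q * (snd w - snd z))) +
 (g w - g z - (p' * (fst w - fst z) + q' * (snd w - snd z)))) by ring end.
eapply Rle_trans. apply Rabs_triang. lra.
Qed.
Arguments fder_plus {f g z p q p' q'}.

Lemma fder_lip f z p q : fder f z p q -> exists d, 0 < d /\ forall w, Cmod (w - z) < d ->
  Rabs (f w - f z) <= (1 + Rabs p + Rabs q) * Cmod (w - z).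
Proof.
intros H. destruct (H 1) as [d [Hd F]]; try lra. exists d. split; auto. intros w Hw. specialize (F w Hw).
assert (X1 := Cmod_fst (w - z)). assert (X2 := Cmod_snd (w - z)).
change (Rabs (fst w - fst z) <= Cmod (w - z)) in X1. change (Rabs (snd w - snd z) <= Cmod (w - z)) in X2.
replace (f w - f z) with ((f w - f z - (p * (fst w - fst z) + q * (snd w - snd z))) + (p * (fst w - fst z) + q * (snd w - snd z))) by ring.
eapply Rle_trans. apply Rabs_triang.
assert (Rabs (p * (fst w - fst z) + q * (snd w - snd z)) <= Rabs p * Cmod (w - z) + Rabs q * Cmod (w - z)).
{ eapply Rle_trans. apply Rabs_triang. rewrite !Rabs_mult. apply Rplus_le_compat; apply Rmult_le_compat_l; auto; apply Rabs_pos. }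
lra.
Qed.

Lemma fder_comp1 f g z p q m : fder f z p q -> is_derive g (f z) m -> fder (fun w => g (f w)) z (m * p) (m * q).
Proof.
intros Hf Hg e He.
destruct (fder_lip f z p q Hf) as [d1 [Hd1 L]]. set (A := 1 + Rabs p + Rabs q) in *.
assert (HA : 1 <= A) by (unfold A; generalize (Rabs_pos p) (Rabs_pos q); lra).
apply is_derive_eps with (e := e / 2 / A) in Hg. 2: { apply Rdiv_lt_0_compat; lra. }
destruct Hg as [d2 [Hd2 G]].
set (B := Rabs m + 1). assert (HB : 1 <= B) by (unfold B; generalize (Rabs_pos m); lra).
destruct (Hf (e / 2 / B)) as [d3 [Hd3 F]]. { apply Rdiv_lt_0_compat; lra. }
exists (Rmin d1 (Rmin (d2 / A) d3)). split. { repeat apply Rmin_pos; auto. apply Rdiv_lt_0_compat; lra. }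
intros w Hw.
min_le d1 (Rmin (d2 / A) d3) B1 B2.
min_le (d2 / A) d3 B3 B4.
specialize (L w ltac:(lra)). specialize (F w ltac:(lra)). set (D := Cmod (w - z)) in *.
assert (HD : D < d2 / A) by lra. apply Rlt_div_r in HD; try lra.
specialize (G (f w) ltac:(lra)).
match goal with |- Rabs ?X <= _ => replace X with ((g (f w) - g (f z) - m * (f w - f z)) +
 m * (f w - f z - (p * (fst w - fst z) + q * (snd w - snd z)))) by ring end.
eapply Rle_trans. apply Rabs_triang. rewrite Rabs_mult.
assert (0 <= D) by apply Cmod_ge_0.
assert (e / 2 / A * Rabs (f w - f z) <= e / 2 * D).
{ apply Rle_trans with (e / 2 / A * (A * D)). apply Rmult_le_compat_l. apply Rlt_le, Rdiv_lt_0_compat; lra. auto. right; field; lra. }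
assert (Rabs m * Rabs (f w - f z - (p * (fst w - fst z) + q * (snd w - snd z))) <= e / 2 * D).
{ apply Rle_trans with (B * (e / 2 / B * D)). apply Rmult_le_compat; auto. apply Rabs_pos. apply Rabs_pos. unfold B; lra. right; field; lra. }
lra.
Qed.

Lemma fder_scal c f z p q : fder f z p q -> fder (fun w => c * f w) z (c * p) (c * q).
Proof.
intros H. apply (fder_comp1 f (fun x => c * x)); auto. auto_derive; auto; ring.
Qed.
Arguments fder_scal c {f z p q}.

(** By polarisation, from the chain rule for squares. *)
Lemma fder_mult f g z p q p' q' : fder f z p q -> fder g z p' q' ->
  fder (fun w => f w * g w) z (p * g z + f z * p') (q * g z + f z * q').
Proof.
intros Hf Hg.
assert (S : forall h p q, fder h z p q -> fder (fun w => h w * h w) z (2 * h z * p) (2 * h z * q)).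
{ intros h a b Hh. apply (fder_comp1 h (fun x => x * x)); auto. auto_derive; auto; ring. }
assert (X1 := S _ _ _ (fder_plus Hf Hg)).
assert (X2 := S _ _ _ (fder_plus Hf (fder_scal (-1) Hg))).
assert (X := fder_plus (fder_scal (/ 4) X1) (fder_scal (- / 4) X2)).
replace (fun w => f w * g w) with (fun w => / 4 * ((f w + g w) * (f w + g w)) + - / 4 * ((f w + -1 * g w) * (f w + -1 * g w))).
2: { apply functional_extensionality. intros w. field. }
eapply fder_eq. 3: exact X. cbv beta; field. cbv beta; field.
Qed.
Arguments fder_mult {f g z p q p' q'}.

Lemma cder_conj f z l : cder f (Cconj z) l -> cder (fun w => Cconj (f (Cconj w))) z (Cconj l).
Proof.
intros H e He. destruct (H e He) as [d [Hd F]]. exists d. split; auto. intros w Hw.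
assert (E : (Cconj w - Cconj z)%C = Cconj (w - z)) by Cring.
specialize (F (Cconj w)). rewrite E, Cmod_conj in F. specialize (F Hw).
replace (Cconj (f (Cconj w)) - Cconj (f (Cconj z)) - Cconj l * (w - z))%C with (Cconj (f (Cconj w) - f (Cconj z) - l * Cconj (w - z))).
rewrite Cmod_conj. auto. Cring.
Qed.

(** * Rectangle integrals across the real axis *)

Lemma unif_cont_rect f a0 b0 w0 h0 : 0 <= w0 -> 0 <= h0 -> (forall z, inrect a0 b0 w0 h0 z -> contR f z) ->
  forall e, 0 < e -> exists d, 0 < d /\ forall z w, inrect a0 b0 w0 h0 z -> inrect a0 b0 w0 h0 w -> Cmod (w - z) < d -> Rabs (f w - f z) < e.
Proof.
intros Hw Hh Hc e He.
set (P := fun a b l : R => exists d, 0 < d /\ forall z w, inrect a b (l * w0) (l * h0) z -> inrect a0 b0 w0 h0 w -> Cmod (w - z) < d -> Rabs (f w - f z) < e).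
assert (HP : P a0 b0 1).
2: { destruct HP as [d [Hd F]]. exists d. split; auto. intros z w Hz. apply F. rewrite !Rmult_1_l. auto. }
apply cousin2 with w0 h0; auto.
- intros a b l Hl _ _ _ _ [d1 [D1 P1]] [d2 [D2 P2]] [d3 [D3 P3]] [d4 [D4 P4]].
  exists (Rmin (Rmin d1 d2) (Rmin d3 d4)). split. { repeat apply Rmin_pos; auto. }
  intros z w [Hz1 Hz2] Hin Hd.
  min_le (Rmin d1 d2) (Rmin d3 d4) X1 X2.
  min_le d1 d2 X3 X4. min_le d3 d4 X5 X6.
  destruct (Rle_dec (fst z) (a + l / 2 * w0)); destruct (Rle_dec (snd z) (b + l / 2 * h0)).
  + apply P1; auto; try lra. split; lra.
  + apply P3; auto; try lra. split; lra.
  + apply P2; auto; try lra. split; lra.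
  + apply P4; auto; try lra. split; lra.
- intros x y Hx Hy. destruct (Hc (x, y)) with (e := e / 2) as [d [Hd F]]; try lra. { split; simpl; lra. }
  exists (d / 2 / (w0 + h0 + 1)). split. apply Rdiv_lt_0_compat; lra.
  intros a b l [Hl0 Hl] Hl1 _ _ _ _ H5 H6. apply Rlt_div_r in Hl; try lra.
  exists (d / 2). split. lra. intros z w [Hz1 Hz2] Hin Hd'.
  assert (Nz : Cmod (z - (x, y)) < d / 2).
  { eapply Rle_lt_trans. apply Cmod_le_sum. simpl.
    assert (Rabs (fst z + - x) <= l * w0) by (apply Rabs_le; lra). assert (Rabs (snd z + - y) <= l * h0) by (apply Rabs_le; lra). nra. }
  assert (T := Cmod_triangle (w - z) (z - (x, y))). replace (w - z + (z - (x, y)))%C with (w - (x, y))%C in T by ring.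
  assert (F1 := F w ltac:(lra)). assert (F2 := F z ltac:(lra)).
  apply Rabs_lt_between in F1. apply Rabs_lt_between in F2. apply Rabs_lt_between. lra.
Qed.

(** A strip of small height around the axis is cut out. Its horizontal sides nearly cancel by
    uniform continuity of [al], and its vertical sides are short; so closedness off the axis and
    continuity on it suffice. *)
Lemma RI_axis al be a b w h : 0 <= w -> 0 <= h ->
  (forall z, inrect a b w h z -> contR al z /\ contR be z) ->
  (forall b' h', 0 <= h' -> b <= b' -> b' + h' <= b + h -> (0 < b' \/ b' + h' < 0) -> RI al be a b' w h' = 0) ->
  RI al be a b w h = 0.
Proof.
intros Hw Hh Hc H0.
destruct (Rlt_dec 0 b) as [Hb|Hb]. { apply H0; lra. }
destruct (Rlt_dec (b + h) 0) as [Hb'|Hb']. { apply H0; lra. }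
assert (Ha : forall z, inrect a b w h z -> contR al z) by (intros; apply Hc; auto).
assert (Hbe : forall z, inrect a b w h z -> contR be z) by (intros; apply Hc; auto).
assert (Main : forall e, 0 < e -> Rabs (RI al be a b w h) <= e).
2: { destruct (Req_dec (RI al be a b w h) 0) as [|Hne]; auto. apply Rabs_pos_lt in Hne. specialize (Main (Rabs (RI al be a b w h) / 2)). lra. }
intros e He.
destruct (unif_cont_rect al a b w h Hw Hh Ha (e / (4 * (w + 1)))) as [d1 [Hd1 U1]]. { apply Rdiv_lt_0_compat; lra. }
destruct (unif_cont_rect be a b w h Hw Hh Hbe 1) as [d2 [Hd2 U2]]; try lra.
set (M := Rabs (be (a + w, 0) - be (a, 0)) + 2). assert (HM : 2 <= M) by (unfold M; generalize (Rabs_pos (be (a + w, 0) - be (a, 0))); lra).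
set (d := Rmin (Rmin d1 d2) (e / (4 * M)) / 3).
min_le (Rmin d1 d2) (e / (4 * M)) X1 X2.
min_le d1 d2 X3 X4.
assert (Hd : 0 < d). { unfold d. assert (0 < Rmin (Rmin d1 d2) (e / (4 * M))). { repeat apply Rmin_pos; auto. apply Rdiv_lt_0_compat; lra. } lra. }
set (b1 := Rmax b (- d)). set (b2 := Rmin (b + h) d).
assert (B1 : b <= b1 /\ - d <= b1 /\ b1 <= 0). { unfold b1. split. apply Rmax_l. split. apply Rmax_r. apply Rmax_lub; lra. }
assert (B2 : b2 <= b + h /\ b2 <= d /\ 0 <= b2). { unfold b2. split. apply Rmin_l. split. apply Rmin_r. apply Rmin_glb; lra. }
assert (Z1 : RI al be a b w (b1 - b) = 0).
{ unfold b1, Rmax. destruct (Rle_dec b (- d)). apply H0; lra.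
  unfold RI. replace (b - b) with 0 by ring. rewrite Rplus_0_r. rewrite !RInt_point. unfold zero; simpl. ring. }
assert (Z2 : RI al be a b2 w (b + h - b2) = 0).
{ unfold b2, Rmin. destruct (Rle_dec (b + h) d).
  unfold RI. replace (b + h - (b + h)) with 0 by ring. rewrite Rplus_0_r. rewrite !RInt_point. unfold zero; simpl. ring.
  apply H0; lra. }
assert (Sp : RI al be a b w h = RI al be a b1 w (b2 - b1)).
{ replace h with ((b1 - b) + ((b2 - b1) + (b + h - b2))) by ring.
  rewrite (RI_hsplit al be a b w h) by (auto; lra). replace (b + (b1 - b)) with b1 by ring.
  rewrite (RI_hsplit al be a b w h) by (auto; lra). replace (b1 + (b2 - b1)) with b2 by ring. lra. }
rewrite Sp.
assert (In : forall s t, a <= s <= a + w -> b1 <= t <= b2 -> inrect a b w h (s, t)) by (intros; split; simpl; lra).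
assert (K1 : Rabs (RInt (fun s => al (s, b1) - al (s, b1 + (b2 - b1))) a (a + w) - 0 * w) <= e / (4 * (w + 1)) * w).
{ apply RInt_near_const; auto.
  - apply (ex_RInt_minus (fun s => al (s, b1)) (fun s => al (s, b1 + (b2 - b1)))); apply (ex_RInt_slice_s al a b w h); auto; lra.
  - intros s Hs. rewrite Rminus_0_r. left. replace (b1 + (b2 - b1)) with b2 by ring. apply U1.
    + apply In; lra.
    + apply In; lra.
    + eapply Rle_lt_trans. apply Cmod_le_sum. simpl. replace (s + - s) with 0 by ring. rewrite Rabs_R0.
      assert (Rabs (b1 + - b2) <= 2 * d) by (apply Rabs_le; lra). unfold d in *; lra. }
assert (K2 : Rabs (RInt (fun t => be (a + w, t) - be (a, t)) b1 (b1 + (b2 - b1)) - 0 * (b2 - b1)) <= M * (b2 - b1)).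
{ apply RInt_near_const. lra.
  - apply (ex_RInt_minus (fun t => be (a + w, t)) (fun t => be (a, t))); apply (ex_RInt_slice_t be a b w h); auto; lra.
  - intros t Ht. rewrite Rminus_0_r. replace (b1 + (b2 - b1)) with b2 in Ht by ring.
    assert (Y : forall s, a <= s <= a + w -> Rabs (be (s, t) - be (s, 0)) < 1).
    { intros s Hs. apply U2. apply In; lra. apply In; lra. eapply Rle_lt_trans. apply Cmod_le_sum. simpl.
      replace (s + - s) with 0 by ring. rewrite Rabs_R0. assert (Rabs (t + - 0) <= d) by (apply Rabs_le; lra). unfold d in *; lra. }
    assert (Y1 := Y (a + w) ltac:(lra)). assert (Y2 := Y a ltac:(lra)).
    apply Rabs_lt_between in Y1. apply Rabs_lt_between in Y2.
    assert (A1 := Rle_abs (be (a + w, 0) - be (a, 0))). assert (A2 := Rle_abs (- (be (a + w, 0) - be (a, 0)))). rewrite Rabs_Ropp in A2.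
    apply Rabs_le. unfold M. lra. }
rewrite (RInt_minus (fun s => al (s, b1)) (fun s => al (s, b1 + (b2 - b1)))) in K1 by (apply (ex_RInt_slice_s al a b w h); auto; lra).
rewrite (RInt_minus (fun t => be (a + w, t)) (fun t => be (a, t))) in K2 by (apply (ex_RInt_slice_t be a b w h); auto; lra).
unfold minus, plus, opp in K1, K2; simpl in K1, K2. rewrite Rmult_0_l, Rminus_0_r in K1, K2.
assert (L1 : e / (4 * (w + 1)) * w <= e / 4).
{ replace (e / (4 * (w + 1)) * w) with (e / 4 * (w / (w + 1))) by (field; lra). rewrite <- (Rmult_1_r (e / 4)) at 2.
  apply Rmult_le_compat_l. lra. apply Rle_div_l; lra. }
assert (L2 : M * (b2 - b1) <= e / 4 * (2 / 3)).
{ assert (M * d <= e / 4 / 3). { unfold d. assert (M * Rmin (Rmin d1 d2) (e / (4 * M)) <= M * (e / (4 * M))) by (apply Rmult_le_compat_l; lra).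
  replace (M * (e / (4 * M))) with (e / 4) in H by (field; lra). lra. } nra. }
unfold RI. apply Rabs_le_between in K1. apply Rabs_le_between in K2. apply Rabs_le. lra.
Qed.

Lemma null_rect_axis f a b w h : 0 <= w -> 0 <= h ->
  (forall z, inrect a b w h z -> ccont f z) ->
  (forall z, inrect a b w h z -> snd z <> 0 -> exists l, cder f z l) -> null_rect f a b w h.
Proof.
intros Hw Hh Hc Hd.
assert (N : forall b' h', 0 <= h' -> b <= b' -> b' + h' <= b + h -> (0 < b' \/ b' + h' < 0) -> null_rect f a b' w h').
{ intros b' h' H1 H2 H3 H4. apply cder_null_rect; auto. intros z [Z1 Z2]. apply Hd. split; lra. lra. }
split; apply RI_axis; auto.
- intros z Hz. split. apply ccont_fst; auto. apply contR_opp, ccont_snd; auto.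
- intros b' h' H1 H2 H3 H4. apply (N b' h' H1 H2 H3 H4).
- intros z Hz. split. apply ccont_snd; auto. apply ccont_fst; auto.
- intros b' h' H1 H2 H3 H4. apply (N b' h' H1 H2 H3 H4).
Qed.

Lemma mixed_partials U f fs ft fss fst_ fts ftt z : C2on U f fs ft fss fst_ fts ftt ->
  (exists d, 0 < d /\ forall w, Cmod (w - z) < d -> U w) -> fst_ z = fts z.
Proof.
intros H [d [Hd HU]]. destruct z as [x y].
assert (Near : forall u w, Rabs (u - x) < d / 2 -> Rabs (w - y) < d / 2 -> U (u, w)).
{ intros u w Hu Hw. apply HU. eapply Rle_lt_trans. apply Cmod_le_sum. simpl. unfold Rminus in *. lra. }
assert (Hd2 : 0 < d / 2) by lra.
assert (D1 : forall u w, U (u, w) -> is_derive (fun t => f (t, w)) u (fs (u, w)) /\ is_derive (fun t => f (u, t)) w (ft (u, w))).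
{ intros u w Hu. apply (fder_slices f (u, w)), (c2_f H); auto. }
assert (Sub : forall (g : R -> R) x0, Rabs (x0 - x) < d / 2 -> exists r : posreal, forall y0, Rabs (y0 - x0) < r -> Rabs (y0 - x) < d / 2).
{ intros g x0 Hx0. exists (mkposreal (d / 2 - Rabs (x0 - x)) ltac:(lra)). intros y0 Hy0. simpl in Hy0.
  replace (y0 - x) with ((y0 - x0) + (x0 - x)) by ring. eapply Rle_lt_trans. apply Rabs_triang. lra. }
assert (Sub' : forall y1, Rabs (y1 - y) < d / 2 -> exists r : posreal, forall y0, Rabs (y0 - y1) < r -> Rabs (y0 - y) < d / 2).
{ intros x0 Hx0. exists (mkposreal (d / 2 - Rabs (x0 - y)) ltac:(lra)). intros y0 Hy0. simpl in Hy0.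
  replace (y0 - y) with ((y0 - x0) + (x0 - y)) by ring. eapply Rle_lt_trans. apply Rabs_triang. lra. }
assert (E1 : forall u w, Rabs (u - x) < d / 2 -> Rabs (w - y) < d / 2 ->
   is_derive (fun z => Derive (fun t => f (z, t)) w) u (fts (u, w))).
{ intros u w Hu Hw. destruct (Sub (fun x => x) u Hu) as [r Hr].
  apply is_derive_ext_loc with (fun z => ft (z, w)).
  - exists r. intros y0 Hy0. symmetry. apply is_derive_unique. apply D1, Near; auto.
  - apply (fder_slices ft (u, w) (fts (u, w)) (ftt (u, w))), (c2_t H), Near; auto. }
assert (E2 : forall u w, Rabs (u - x) < d / 2 -> Rabs (w - y) < d / 2 ->
   is_derive (fun z => Derive (fun t => f (t, z)) u) w (fst_ (u, w))).
{ intros u w Hu Hw. destruct (Sub' w Hw) as [r Hr].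
  apply is_derive_ext_loc with (fun z => fs (u, z)).
  - exists r. intros y0 Hy0. symmetry. apply is_derive_unique. apply D1, Near; auto.
  - apply (fder_slices fs (u, w) (fss (u, w)) (fst_ (u, w))), (c2_s H), Near; auto. }
assert (Z0 : Rabs (x - x) < d / 2 /\ Rabs (y - y) < d / 2) by (split; unfold Rminus; rewrite Rplus_opp_r, Rabs_R0; auto).
assert (S := Schwarz (fun u w => f (u, w)) x y).
assert (C2id : cont2 (fun u w => (u, w)) x y) by (split; simpl; [apply continuity_2d_pt_id1|apply continuity_2d_pt_id2]).
cbv beta in S.
assert (X : Derive (fun z => Derive (fun t => f (z, t)) y) x = Derive (fun z => Derive (fun t => f (t, z)) x) y).
{ apply S.
  - exists (mkposreal (d / 2) Hd2). intros u w Hu Hw. simpl in Hu, Hw. split; [|split; [|split]].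
    + exists (fs (u, w)). exact (proj1 (D1 u w (Near u w Hu Hw))).
    + exists (ft (u, w)). exact (proj2 (D1 u w (Near u w Hu Hw))).
    + exists (fts (u, w)). exact (E1 u w Hu Hw).
    + exists (fst_ (u, w)). exact (E2 u w Hu Hw).
  - apply continuity_2d_pt_ext_loc with (fun u w => fts (u, w)).
    + exists (mkposreal (d / 2) Hd2). intros u w Hu Hw. symmetry. apply is_derive_unique, E1; auto.
    + apply (contR_cont2 fts (fun u w => (u, w))); auto. apply (c2_ts H), Near; apply Z0.
  - apply continuity_2d_pt_ext_loc with (fun u w => fst_ (u, w)).
    + exists (mkposreal (d / 2) Hd2). intros u w Hu Hw. symmetry. apply is_derive_unique, E2; auto.
    + apply (contR_cont2 fst_ (fun u w => (u, w))); auto. apply (c2_st H), Near; apply Z0. }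
assert (Y1 : Derive (fun z => Derive (fun t => f (z, t)) y) x = fts (x, y)) by exact (is_derive_unique _ _ _ (E1 x y (proj1 Z0) (proj2 Z0))).
assert (Y2 : Derive (fun z => Derive (fun t => f (t, z)) x) y = fst_ (x, y)) by exact (is_derive_unique _ _ _ (E2 x y (proj1 Z0) (proj2 Z0))).
rewrite Y1, Y2 in X. auto.
Qed.

(** * The Schwarzian map *)

(** [l2_axis] says that the imaginary part of the Schwarzian map vanishes on the axis. *)
Record LS2 (K eps c0 : R) (v vs vt vss vst vts vtt : C -> R) : Prop := {
  l2_ls : LS K eps c0 v vs vt vss vst vts vtt;
  l2_s : forall z, HB eps z -> contS (HB eps) vs z;
  l2_t : forall z, HB eps z -> contS (HB eps) vt z;
  l2_ss : forall z, HB eps z -> contS (HB eps) vss z;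
  l2_st : forall z, HB eps z -> contS (HB eps) vst z;
  l2_ts : forall z, HB eps z -> contS (HB eps) vts z;
  l2_tt : forall z, HB eps z -> contS (HB eps) vtt z;
  l2_axis : forall s, s <> 0 -> Rabs s < eps -> vst (s, 0) + vts (s, 0) = vs (s, 0) * vt (s, 0) }.

Arguments l2_ls {K eps c0 v vs vt vss vst vts vtt}.
(** With [y = 1 - ln r] the claim is that [y ^ 6 e^(-y)] tends to [0], which follows from
    [e^y >= (y / 7) ^ 7]. *)
Lemma log_pow_small : forall e, 0 < e -> exists d, 0 < d /\ forall r, 0 < r < d -> r * (1 - ln r) ^ 6 <= e.
Proof.
intros e He. set (Y := exp 1 * 7 ^ 7 / e + 1).
assert (P1 := exp_pos 1).
assert (HY : 1 <= Y). { unfold Y. assert (0 <= exp 1 * 7 ^ 7 / e) by (apply Rdiv_le_0_compat; lra). lra. }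
exists (exp (1 - Y)). split. apply exp_pos. intros r [Hr1 Hr2].
assert (Hy : Y < 1 - ln r). { apply ln_increasing in Hr2; auto. rewrite ln_exp in Hr2. lra. }
set (y := 1 - ln r) in *.
assert (Er : r = exp 1 * exp (- y)). { rewrite <- exp_plus. unfold y. replace (1 + - (1 - ln r)) with (ln r) by ring. symmetry; apply exp_ln; auto. }
assert (E7 : (y / 7) ^ 7 <= exp y).
{ replace (exp y) with (exp (y / 7) ^ 7). 2: { simpl. rewrite Rmult_1_r, <- !exp_plus. f_equal. field. }
  apply pow_incr. split. lra. assert (E := exp_ineq1_le (y / 7)). lra. }
assert (Pe := exp_pos y). assert (Ey : exp (- y) * exp y = 1) by (rewrite <- exp_plus; replace (- y + y) with 0 by ring; apply exp_0).
assert (Pe' := exp_pos (- y)).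
apply Rmult_le_reg_r with (exp y); auto. rewrite Er.
replace (exp 1 * exp (- y) * y ^ 6 * exp y) with (exp 1 * y ^ 6 * (exp (- y) * exp y)) by ring. rewrite Ey, Rmult_1_r.
apply Rle_trans with (e * (y / 7) ^ 7). 2: apply Rmult_le_compat_l; lra.
replace (e * (y / 7) ^ 7) with (e * y / 7 ^ 7 * y ^ 6) by field.
apply Rmult_le_compat_r. apply pow_le; lra.
apply Rle_div_r. apply pow_lt; lra.
assert (exp 1 * 7 ^ 7 / e <= y) by (unfold Y in Hy; lra). apply Rle_div_l in H; lra.
Qed.

Lemma is_PS_conj a z l : is_PS a z l -> is_PS (fun n => Cconj (a n)) (Cconj z) (Cconj l).
Proof.
intros H e He. destruct (H e He) as [N F]. exists N. intros n Hn. specialize (F n Hn).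
rewrite <- Cmod_conj in F.
replace (csum (fun k => Cconj (a k) * Cconj z ^ k)%C n - Cconj l)%C with (Cconj (csum (fun k => a k * z ^ k)%C n - l)); auto.
assert (E : forall n, Cconj (csum (fun k => a k * z ^ k)%C n) = csum (fun k => Cconj (a k) * Cconj z ^ k)%C n).
{ clear. induction n; simpl. Cring. rewrite <- IHn, <- Cpow_conj. Cring. }
rewrite <- E. Cring.
Qed.

Lemma cvr_conj a R0 : cvr a R0 -> cvr (fun n => Cconj (a n)) R0.
Proof. intros H r Hr. destruct (H r Hr) as [M HM]. exists M. intros n. rewrite Cmod_conj. auto. Qed.

(** Extended by [0], a function that is [o(z)] is differentiable at [0] with derivative [0]; so it
    is a power series whose first two coefficients vanish. *)
Lemma removable_PS2 (f : C -> C) R0 : 0 < R0 -> (forall z, 0 < Cmod z < R0 -> exists l, cder f z l) ->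
  (forall e, 0 < e -> exists d, 0 < d /\ forall z, 0 < Cmod z < d -> Cmod (f z) <= e * Cmod z) ->
  exists b, cvr b R0 /\ forall z, 0 < Cmod z < R0 -> f z = (z * z * PS b z)%C.
Proof.
intros HR Hd Hs.
set (F := fun z => if Ceq_dec z 0 then RtoC 0 else f z).
assert (FE : forall z, 0 < Cmod z -> F z = f z). { intros z Hz. unfold F. destruct (Ceq_dec z 0) as [->|]; auto. rewrite Cmod_0 in Hz; lra. }
assert (F0 : F 0 = 0). { unfold F. destruct (Ceq_dec 0 0); auto. elim n; auto. }
assert (D0 : cder F 0 0).
{ intros e He. destruct (Hs e He) as [d [Hd0 G]]. exists d. split; auto. intros w Hw. replace (w - 0)%C with w in * by ring. rewrite F0.
  replace (F w - 0 - 0 * w)%C with (F w) by ring.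
  destruct (Ceq_dec w 0) as [->|Hw0]. rewrite F0, Cmod_0; lra. apply Cmod_gt_0 in Hw0. rewrite FE; auto. }
destruct (holo_PS F 0 R0 HR) as [a [Ca [Ea _]]].
{ intros z Hz. replace (z - 0)%C with z in Hz by ring. destruct (Ceq_dec z 0) as [->|Hz0]. exists 0; auto.
  apply Cmod_gt_0 in Hz0. destruct (Hd z ltac:(lra)) as [l Hl]. exists l. apply cder_ext with f; auto.
  exists (Cmod z). split; auto. intros w Hw. symmetry; apply FE. assert (T := Cmod_lip w z). apply Rabs_le_between in T. lra. }
assert (Ea' : forall z, Cmod z < R0 -> F z = PS a z). { intros z Hz. rewrite Ea; replace (z - 0)%C with z by ring; auto. }
assert (A0 : a O = 0). { rewrite <- PS_0, <- Ea', F0; auto. rewrite Cmod_0; auto. }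
assert (A1 : a 1%nat = 0).
{ assert (D1 := PS_cder a R0 0 Ca ltac:(rewrite Cmod_0; auto)). rewrite PS_0 in D1.
  assert (E : dps a 0 = 0). { apply (cder_unique F 0); auto. apply cder_ext with (PS a); auto. exists R0. split; auto.
    intros w Hw. symmetry; apply Ea'. replace (w - 0)%C with w in Hw by ring. auto. }
  unfold dps in E. simpl in E. rewrite <- E. ring. }
exists (fun n => a (S (S n))). split. apply (cvr_shift (fun n => a (S n))), cvr_shift; auto.
intros z Hz. rewrite <- FE, Ea', (PS_shift a R0) by (auto; lra). rewrite (PS_shift _ R0) by (auto; try lra; apply cvr_shift; auto).
rewrite A0, A1. ring.
Qed.

Section SchwarzianMap.
Variables (K eps c0 : R) (v vs vt vss vst vts vtt : C -> R).
Hypothesis H : LS2 K eps c0 v vs vt vss vst vts vtt.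

Let H1 := l2_ls H.
Let HC2 := ls_C2 H1.

(* v_zz - v_z^2 / 2 with v_z = (v_s - i v_t) / 2. *)
Definition Qf (z : C) : C :=
  ((vss z - vtt z) / 4 - (vs z * vs z - vt z * vt z) / 8, - (vst z + vts z) / 4 + vs z * vt z / 4).

Lemma vst_vts z : HD eps z -> vst z = vts z.
Proof using H. intros Hz. apply (mixed_partials (HD eps) v vs vt vss vst vts vtt z HC2). apply HD_open; auto. Qed.

Lemma Qf_contS z : HB eps z -> contS (HB eps) (fun w => fst (Qf w)) z /\ contS (HB eps) (fun w => snd (Qf w)) z.
Proof using H.
intros Hz. unfold Qf. cbn [fst snd].
assert (S1 := l2_s _ _ _ _ _ _ _ _ _ _ H z Hz). assert (S2 := l2_t _ _ _ _ _ _ _ _ _ _ H z Hz).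
assert (S3 := l2_ss _ _ _ _ _ _ _ _ _ _ H z Hz). assert (S4 := l2_st _ _ _ _ _ _ _ _ _ _ H z Hz).
assert (S5 := l2_ts _ _ _ _ _ _ _ _ _ _ H z Hz). assert (S6 := l2_tt _ _ _ _ _ _ _ _ _ _ H z Hz).
split.
- apply contS_minus; unfold Rdiv; apply contS_mult; try apply contS_const; apply contS_minus; auto; apply contS_mult; auto.
- apply contS_plus; unfold Rdiv; apply contS_mult; try apply contS_const. 2: apply contS_mult; auto.
  intros e He. destruct (contS_plus _ _ _ _ S4 S5 e He) as [d [Hd F]]. exists d. split; auto.
  intros w Hw Hw'. replace (- (vst w + vts w) - - (vst z + vts z)) with (- ((vst w + vts w) - (vst z + vts z))) by ring. rewrite Rabs_Ropp. auto.
Qed.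

Lemma RInt_abs_bound f a b M : ex_RInt f a b -> (forall x, Rmin a b <= x <= Rmax a b -> Rabs (f x) <= M) -> Rabs (RInt f a b) <= M * Rabs (b - a).
Proof.
intros Hf HM. assert (X := near_const f a b 0 M Hf). rewrite Rmult_0_l, Rminus_0_r in X. apply X. intros; rewrite Rminus_0_r; auto.
Qed.

(** Each of the two legs of the path is at most [|z - p|] long. *)
Lemma prim_bound al be p R0 M z : (forall w, Cmod (w - p) < R0 -> contR al w /\ contR be w) -> Cmod (z - p) < R0 ->
  (forall w, Cmod (w - p) <= Cmod (z - p) -> Rabs (al w) <= M /\ Rabs (be w) <= M) ->
  Rabs (prim al be p z) <= M * (2 * Cmod (z - p)).
Proof.
intros Hc Hz HM. destruct z as [s t]. destruct p as [p1 p2]. unfold prim. cbn [fst snd].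
set (D := Cmod ((s, t) - (p1, p2))) in *.
assert (X1 : Rabs (s - p1) <= D) by apply (Cmod_fst ((s, t) - (p1, p2))).
assert (X2 : Rabs (t - p2) <= D) by apply (Cmod_snd ((s, t) - (p1, p2))).
assert (Btw : forall a b c, Rmin a b <= c <= Rmax a b -> Rabs (c - a) <= Rabs (b - a)).
{ intros a b c H0. unfold Rmin, Rmax in H0. destruct (Rle_dec a b). rewrite !Rabs_pos_eq; lra. rewrite !Rabs_left1; lra. }
assert (N1 : forall x, Rmin p1 s <= x <= Rmax p1 s -> Cmod ((x, p2) - (p1, p2)) <= D).
{ intros x Hx. apply Cmod_le_of_abs; simpl. apply (Btw p1 s x Hx). replace (p2 + - p2) with 0 by ring. rewrite Rabs_R0. apply Rabs_pos. }
assert (N2 : forall y, Rmin p2 t <= y <= Rmax p2 t -> Cmod ((s, y) - (p1, p2)) <= D).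
{ intros y Hy. apply Cmod_le_of_abs; simpl. lra. apply (Btw p2 t y Hy). }
eapply Rle_trans. apply Rabs_triang.
assert (HM0 : 0 <= M). { eapply Rle_trans. apply Rabs_pos. apply (HM (p1, p2)). replace ((p1, p2) - (p1, p2))%C with (RtoC 0) by ring. rewrite Cmod_0. apply Cmod_ge_0. }
assert (B1 : Rabs (RInt (fun x => al (x, p2)) p1 s) <= M * Rabs (s - p1)).
{ apply RInt_abs_bound. apply (ex_RInt_s al (p1, p2) R0). intros; apply Hc; auto. intros x Hx; specialize (N1 x Hx); lra.
  intros x Hx. apply HM; auto. }
assert (B2 : Rabs (RInt (fun y => be (s, y)) p2 t) <= M * Rabs (t - p2)).
{ apply RInt_abs_bound. apply (ex_RInt_t be (p1, p2) R0). intros; apply Hc; auto. intros x Hx; specialize (N2 x Hx); lra.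
  intros x Hx. apply HM; auto. }
nra.
Qed.

(* Q dz = d(v_z) + omega with omega = (K/2) e^v dzbar - (1/2) v_z^2 dz, a closed form with C^1 coefficients. *)
Lemma Q_local p R0 : 0 < R0 -> (forall z, Cmod (z - p) < R0 -> HD eps z) ->
  (exists l, cder Qf p l) /\
  forall rho G E, 0 < rho < R0 -> (forall z, Cmod (z - p) <= rho -> Rabs (vs z) <= G /\ Rabs (vt z) <= G /\ exp (v z) <= E) ->
   Cmod (Qf p) <= 4 * (G + 4 * rho * (E / 2 + G * G / 4)) / rho.
Proof using H.
intros HR HU.
set (al1 := fun z => K / 2 * exp (v z) + - / 8 * (vs z * vs z + (-1) * (vt z * vt z))).
set (be1 := fun z => - / 4 * (vs z * vt z)).
set (al2 := fun z => / 4 * (vs z * vt z)).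
set (be2 := fun z => - (K / 2) * exp (v z) + - / 8 * (vs z * vs z + (-1) * (vt z * vt z))).
assert (Fv : forall z, HD eps z -> fder v z (vs z) (vt z)) by (intros; apply (c2_f HC2); auto).
assert (Fs : forall z, HD eps z -> fder vs z (vss z) (vst z)) by (intros; apply (c2_s HC2); auto).
assert (Ft : forall z, HD eps z -> fder vt z (vts z) (vtt z)) by (intros; apply (c2_t HC2); auto).
assert (Fe : forall z, HD eps z -> fder (fun z => exp (v z)) z (exp (v z) * vs z) (exp (v z) * vt z)).
{ intros z Hz. apply (fder_comp1 v exp); auto. apply is_derive_exp. }
assert (Fq : forall z, HD eps z -> fder (fun z => vs z * vs z + (-1) * (vt z * vt z)) z (2 * (vs z * vss z - vt z * vts z)) (2 * (vs z * vst z - vt z * vtt z))).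
{ intros z Hz. eapply fder_eq. 3: apply (fder_plus (fder_mult (Fs z Hz) (Fs z Hz)) (fder_scal (-1) (fder_mult (Ft z Hz) (Ft z Hz)))).
  cbv beta; ring. cbv beta; ring. }
assert (Fm : forall z, HD eps z -> fder (fun z => vs z * vt z) z (vss z * vt z + vs z * vts z) (vst z * vt z + vs z * vtt z)).
{ intros z Hz. apply fder_mult; auto. }
assert (Fa1 : forall z, HD eps z -> fder al1 z (K / 2 * (exp (v z) * vs z) + - / 8 * (2 * (vs z * vss z - vt z * vts z))) (K / 2 * (exp (v z) * vt z) + - / 8 * (2 * (vs z * vst z - vt z * vtt z)))).
{ intros z Hz. apply (@fder_plus (fun z => K / 2 * exp (v z))); apply fder_scal; auto. }
assert (Fb2 : forall z, HD eps z -> fder be2 z (- (K / 2) * (exp (v z) * vs z) + - / 8 * (2 * (vs z * vss z - vt z * vts z))) (- (K / 2) * (exp (v z) * vt z) + - / 8 * (2 * (vs z * vst z - vt z * vtt z)))).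
{ intros z Hz. apply (@fder_plus (fun z => - (K / 2) * exp (v z))); apply fder_scal; auto. }
assert (Fb1 : forall z, HD eps z -> fder be1 z (- / 4 * (vss z * vt z + vs z * vts z)) (- / 4 * (vst z * vt z + vs z * vtt z))).
{ intros z Hz. apply fder_scal; auto. }
assert (Fa2 : forall z, HD eps z -> fder al2 z (/ 4 * (vss z * vt z + vs z * vts z)) (/ 4 * (vst z * vt z + vs z * vtt z))).
{ intros z Hz. apply fder_scal; auto. }
assert (Eq : forall z, HD eps z -> K * exp (v z) = - (vss z + vtt z) / 2).
{ intros z Hz. rewrite (ls_eq H1 z Hz). field. }
assert (CR : forall z, Cmod (z - p) < R0 -> contR al1 z /\ contR be1 z /\ contR al2 z /\ contR be2 z).
{ intros z Hz. specialize (HU z Hz). repeat split; eapply fder_contR; eauto. }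
assert (W1 : forall z, Cmod (z - p) < R0 -> fder (prim al1 be1 p) z (al1 z) (be1 z)).
{ intros z Hz. apply (prim_fder al1 be1 p R0); auto; try (intros; apply CR; auto).
  intros a b w h Hw Hh Hin. apply goursat_form; auto. intros y Hy. assert (Uy := HU y (Hin y Hy)).
  eexists. eexists. eexists. split. eapply fder_eq. 3: apply Fa1; auto. reflexivity. 2: { eapply fder_eq. 3: apply Fb1; auto. reflexivity. reflexivity. }
  assert (E := Eq y Uy). rewrite (vst_vts y Uy).
  replace (K / 2 * (exp (v y) * vt y)) with ((K * exp (v y)) * vt y / 2) by field. rewrite E. field. }
assert (W2 : forall z, Cmod (z - p) < R0 -> fder (prim al2 be2 p) z (al2 z) (be2 z)).
{ intros z Hz. apply (prim_fder al2 be2 p R0); auto; try (intros; apply CR; auto).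
  intros a b w h Hw Hh Hin. apply goursat_form; auto. intros y Hy. assert (Uy := HU y (Hin y Hy)).
  eexists. eexists. eexists. split. eapply fder_eq. 3: apply Fa2; auto. reflexivity. 2: { eapply fder_eq. 3: apply Fb2; auto. reflexivity. reflexivity. }
  assert (E := Eq y Uy). rewrite (vst_vts y Uy).
  replace (- (K / 2) * (exp (v y) * vs y)) with (- (K * exp (v y)) * vs y / 2) by field. rewrite E. field. }
(* As [v] is only twice differentiable, [Q] cannot be differentiated directly. It is the continuous
   complex derivative of this [P], hence a power series. *)
set (P := fun z => (/ 2 * vs z + prim al1 be1 p z, - / 2 * vt z + prim al2 be2 p z) : C).
assert (HP : forall z, Cmod (z - p) < R0 -> cder P z (Qf z)).
{ intros z Hz. assert (Uz := HU z Hz). assert (E := Eq z Uz). assert (M := vst_vts z Uz).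
  unfold Qf. apply fder_cder; simpl.
  - eapply fder_eq. 3: apply (fder_plus (fder_scal (/ 2) (Fs z Uz)) (W1 z Hz)).
    + unfold al1. replace (K / 2 * exp (v z)) with ((K * exp (v z)) / 2) by field. rewrite E. field.
    + unfold be1. rewrite M. field.
  - eapply fder_eq. 3: apply (fder_plus (fder_scal (- / 2) (Ft z Uz)) (W2 z Hz)).
    + unfold al2. rewrite M. field.
    + unfold be2. replace (- (K / 2) * exp (v z)) with (- (K * exp (v z)) / 2) by field. rewrite E. field. }
assert (HQc : forall z, Cmod (z - p) < R0 -> ccont Qf z).
{ intros z Hz. destruct (Qf_contS z (HD_HB _ _ (HU z Hz))) as [Q1 Q2]. destruct (HD_open _ _ (HU z Hz)) as [d [Hd O]].
  apply ccont_pair; intros e He; [destruct (Q1 e He) as [d1 [Hd1 F]]|destruct (Q2 e He) as [d1 [Hd1 F]]];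
   exists (Rmin d d1); (split; [apply Rmin_pos; auto|]); intros w Hw; apply F;
   try (apply HD_HB, O; eapply Rlt_le_trans; [apply Hw|apply Rmin_l]); eapply Rlt_le_trans; [apply Hw|apply Rmin_r|apply Hw|apply Rmin_r]. }
assert (Sh : forall z, (p + z - p)%C = z) by (intros; ring).
destruct (cauchy_PS (fun w => P (p + w)%C) (fun w => Qf (p + w)%C) R0 HR) as [a [Ca [Ea Ba]]].
{ intros z Hz. apply cder_shift, HP. rewrite Sh; auto. }
{ intros z Hz. apply ccont_shift, HQc. rewrite Sh; auto. }
assert (EQ : forall z, Cmod z < R0 -> Qf (p + z)%C = PS (dps a) z).
{ intros z Hz. apply (cder_unique (fun w => P (p + w)%C) z).
  - apply cder_shift, HP. rewrite Sh; auto.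
  - apply cder_ext with (PS a). 2: apply (PS_cder a R0); auto.
    exists (R0 - Cmod z). split. lra. intros w Hw. symmetry. apply Ea.
    assert (T := Cmod_triangle z (w - z)). replace (z + (w - z))%C with w in T by ring. lra. }
split.
- exists (PS (dps (dps a)) 0).
  assert (D := PS_cder (dps a) R0 0 (cvr_dps _ _ Ca) ltac:(rewrite Cmod_0; auto)).
  intros e He. destruct (D e He) as [d [Hd F]]. exists (Rmin d R0). split. apply Rmin_pos; auto. intros w Hw.
  specialize (F (w - p)%C). replace (w - p - 0)%C with (w - p)%C in F by ring.
  rewrite <- (EQ (w - p)%C), <- (EQ 0) in F; try (rewrite Cmod_0; auto).
  + replace (p + (w - p))%C with w in F by ring. replace (p + 0)%C with p in F by ring.
    apply F. eapply Rlt_le_trans; [apply Hw|apply Rmin_l].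
  + eapply Rlt_le_trans; [apply Hw|apply Rmin_r].
- intros rho G E Hr HG.
  assert (G0 : 0 <= G). { eapply Rle_trans. apply Rabs_pos. apply (HG p). rewrite Cmod_diag; lra. }
  assert (KK := ls_K H1).
  set (B := E / 2 + G * G / 4).
  assert (BB : forall w, Cmod (w - p) <= rho -> Rabs (al1 w) <= B /\ Rabs (be1 w) <= B /\ Rabs (al2 w) <= B /\ Rabs (be2 w) <= B).
  { intros w Hw. destruct (HG w Hw) as [X1 [X2 X3]]. apply Rabs_le_between in X1. apply Rabs_le_between in X2. apply Rabs_le_between in KK.
    assert (Pe := exp_pos (v w)).
    assert (Y1 : - (G * G) <= vs w * vt w <= G * G) by (split; nra).
    assert (Y2 : 0 <= vs w * vs w <= G * G) by (split; nra). assert (Y3 : 0 <= vt w * vt w <= G * G) by (split; nra).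
    assert (Y4 : - E <= K * exp (v w) <= E) by (split; nra).
    unfold al1, be1, al2, be2, B. repeat split; apply Rabs_le; split; lra. }
  (* [Qf p] is the first Taylor coefficient of [P], so Cauchy's estimate bounds it by the first
     derivatives of [v] and by [e^v] alone. *)
  assert (Bd := Ba rho (2 * (G + 2 * rho * B)) Hr).
  assert (Circ : forall t, Cmod (P (p + rho * cis t)%C) <= 2 * (G + 2 * rho * B)).
  { intros t. set (z := (p + rho * cis t)%C).
    assert (Cz : Cmod (z - p) = rho). { unfold z. replace (p + rho * cis t - p)%C with (rho * cis t)%C by ring. rewrite Cmod_mult, Cmod_cis, Cmod_R, Rabs_pos_eq; lra. }
    destruct (HG z ltac:(lra)) as [X1 [X2 X3]].
    assert (U1 : Rabs (prim al1 be1 p z) <= B * (2 * Cmod (z - p))).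
    { apply (prim_bound al1 be1 p R0); try lra. intros w Hw. split; apply CR; auto. intros w Hw. rewrite Cz in Hw. split; apply BB; auto. }
    assert (U2 : Rabs (prim al2 be2 p z) <= B * (2 * Cmod (z - p))).
    { apply (prim_bound al2 be2 p R0); try lra. intros w Hw. split; apply CR; auto. intros w Hw. rewrite Cz in Hw. split; apply BB; auto. }
    rewrite Cz in U1, U2. eapply Rle_trans. apply Cmod_le_sum. unfold P. cbn [fst snd].
    apply Rabs_le_between in X1. apply Rabs_le_between in X2. apply Rabs_le_between in U1. apply Rabs_le_between in U2.
    assert (Rabs (/ 2 * vs z + prim al1 be1 p z) <= G + B * (2 * rho)) by (apply Rabs_le; lra).
    assert (Rabs (- / 2 * vt z + prim al2 be2 p z) <= G + B * (2 * rho)) by (apply Rabs_le; lra). lra. }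
  specialize (Bd Circ 1%nat).
  assert (EQ0 := EQ 0 ltac:(rewrite Cmod_0; auto)). rewrite PS_0 in EQ0. replace (p + 0)%C with p in EQ0 by ring.
  rewrite EQ0. unfold dps. simpl INR. rewrite Cmult_1_l. fold B.
  apply Rle_div_r. lra. simpl in Bd. rewrite Rmult_1_r in Bd.
  assert (0 <= B). { eapply Rle_trans. apply Rabs_pos. apply (BB p). rewrite Cmod_diag; lra. }
  nra.
Qed.
End SchwarzianMap.

(** * Reflection of Q and its pole at the origin *)

Section ExtendedQ.
Variables (K eps c0 : R) (v vs vt vss vst vts vtt : C -> R).
Hypothesis H : LS2 K eps c0 v vs vt vss vst vts vtt.

Let H1 := l2_ls H.
Let Q := Qf vs vt vss vst vts vtt.

Definition Qe (z : C) : C := if Rle_dec 0 (snd z) then Qf vs vt vss vst vts vtt z else Cconj (Qf vs vt vss vst vts vtt (Cconj z)).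

Lemma Qe_up z : 0 <= snd z -> Qe z = Q z.
Proof. intros Hz. unfold Qe. destruct (Rle_dec 0 (snd z)); auto. lra. Qed.

(** Off the axis this is the definition; on the axis it is the reality of [Q], that is [l2_axis]. *)
Lemma Qe_conj z : Cmod z < eps -> z <> 0 -> Qe (Cconj z) = Cconj (Qe z).
Proof using H.
intros Hz Hz0. unfold Qe. simpl.
assert (CC : forall w, Cconj (Cconj w) = w) by (intros; apply injective_projections; simpl; ring).
destruct (Rle_dec 0 (- snd z)); destruct (Rle_dec 0 (snd z)); rewrite ?CC; auto; try lra.
assert (E : snd z = 0) by lra. destruct z as [s t]. simpl in E. subst t.
assert (Hs : s <> 0) by (intros ->; apply Hz0; auto).
assert (A := l2_axis _ _ _ _ _ _ _ _ _ _ H s Hs).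
assert (Hs' : Rabs s < eps). { eapply Rle_lt_trans. apply (Cmod_fst (s, 0)). auto. } specialize (A Hs').
unfold Cconj, Qf. cbn [fst snd]. replace (- 0) with 0 by ring. apply injective_projections; simpl; auto. lra.
Qed.

(** Off the axis by [Q_local] and conjugation. Across the axis [Qe] is continuous, because [Q] is
    real there; [null_rect_axis] and Morera's theorem do the rest. *)
Lemma Qe_cder z : 0 < Cmod z < eps -> exists l, cder Qe z l.
Proof using H.
intros [Hz1 Hz2].
assert (Up : forall z, HD eps z -> exists l, cder Qe z l).
{ intros w Hw. destruct (HD_open _ _ Hw) as [d [Hd O]].
  destruct (Q_local _ _ _ _ _ _ _ _ _ _ H w d Hd O) as [[l Hl] _]. exists l. apply cder_ext with Q; auto.
  exists d. split; auto. intros y Hy. symmetry. apply Qe_up. destruct (O y Hy). lra. }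
assert (Off : forall z, 0 < Cmod z < eps -> snd z <> 0 -> exists l, cder Qe z l).
{ intros w [W1 W2] Hw. destruct (Rlt_dec 0 (snd w)) as [Hp|Hp]. apply Up; split; auto.
  assert (Hc : HD eps (Cconj w)). { split. rewrite Cmod_conj; auto. simpl. lra. }
  destruct (Up _ Hc) as [l Hl]. exists (Cconj l). apply cder_ext with (fun y => Cconj (Qe (Cconj y))). 2: apply cder_conj; auto.
  exists (Rmin (Cmod w) (eps - Cmod w)). split. apply Rmin_pos; lra. intros y Hy.
  assert (Y1 := Rlt_le_trans _ _ _ Hy (Rmin_l _ _)). assert (Y2 := Rlt_le_trans _ _ _ Hy (Rmin_r _ _)).
  assert (T := Cmod_lip y w). apply Rabs_le_between in T.
  assert (Y0 : y <> 0). { intros E. rewrite E, Cmod_0 in T. rewrite E in Y1. replace (0 - w)%C with (- w)%C in Y1 by ring. rewrite Cmod_opp in Y1. lra. }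
  rewrite <- Qe_conj. f_equal. Cring. rewrite Cmod_conj; lra.
  intros E. apply Y0. apply (f_equal Cconj) in E. replace y with (Cconj (Cconj y)) by Cring. rewrite E.
  Cring. }
destruct (Req_dec (snd z) 0) as [Hs|Hs]. 2: apply Off; auto.
assert (Cont : forall w, 0 < Cmod w < eps -> ccont Qe w).
{ intros w Hw. destruct (Req_dec (snd w) 0) as [Hw0|Hw0]. 2: { destruct (Off w Hw Hw0) as [l Hl]. eapply cder_ccont; eauto. }
  assert (Bw : HB eps w). { split; [lra|]. split. lra. apply Cmod_gt_0; lra. }
  assert (Cw : Cconj w = w). { apply injective_projections; simpl; auto. rewrite Hw0; ring. }
  destruct (Qf_contS _ _ _ _ _ _ _ _ _ _ H w Bw) as [F1 F2].
  assert (Qw : Cconj (Qe w) = Qe w). { rewrite <- Qe_conj, Cw; auto. lra. apply Bw. }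
  assert (X : forall e, 0 < e -> exists d, 0 < d /\ forall y, HB eps y -> Cmod (y - w) < d -> Cmod (Q y - Q w) < e).
  { intros e He. destruct (F1 (e / 2)) as [d1 [Hd1 G1]]; try lra. destruct (F2 (e / 2)) as [d2 [Hd2 G2]]; try lra.
    exists (Rmin d1 d2). split. apply Rmin_pos; auto. intros y Hy Hd.
    specialize (G1 y Hy (Rlt_le_trans _ _ _ Hd (Rmin_l _ _))). specialize (G2 y Hy (Rlt_le_trans _ _ _ Hd (Rmin_r _ _))).
    eapply Rle_lt_trans. apply Cmod_le_sum.
    change (Rabs (fst (Q y) - fst (Q w)) + Rabs (snd (Q y) - snd (Q w)) < e). unfold Q. lra. }
  intros e He. destruct (X e He) as [d [Hd G]].
  exists (Rmin d (Rmin (Cmod w) (eps - Cmod w))). split. { repeat apply Rmin_pos; lra. }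
  intros y Hy. min_le d (Rmin (Cmod w) (eps - Cmod w)) B1 B2.
  min_le (Cmod w) (eps - Cmod w) B3 B4.
  assert (T := Cmod_lip y w). apply Rabs_le_between in T.
  assert (Y0 : y <> 0). { apply Cmod_gt_0. lra. }
  rewrite (Qe_up w) by lra.
  destruct (Rle_dec 0 (snd y)) as [Hy0|Hy0].
  - rewrite Qe_up by auto. apply G; try lra. split; [lra|]. auto.
  - replace (Qe y) with (Cconj (Q (Cconj y))). 2: { unfold Qe. destruct (Rle_dec 0 (snd y)); auto. lra. }
    rewrite (Qe_up w) in Qw by lra. rewrite <- Qw.
    replace (Cconj (Q (Cconj y)) - Cconj (Q w))%C with (Cconj (Q (Cconj y) - Q w)) by Cring.
    rewrite Cmod_conj. apply G.
    + split. rewrite Cmod_conj; lra. split. simpl; lra. intros E. apply Y0. apply (f_equal Cconj) in E.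
      replace y with (Cconj (Cconj y)) by Cring. rewrite E. Cring.
    + replace (Cconj y - w)%C with (Cconj (y - w)). rewrite Cmod_conj; lra. rewrite <- Cw at 2. Cring. }
set (R0 := Rmin (Cmod z) (eps - Cmod z)).
assert (HR : 0 < R0) by (apply Rmin_pos; lra).
assert (HRin : forall w, Cmod (w - z) < R0 -> 0 < Cmod w < eps).
{ intros w Hw. lt_min Hw W1 W2.
  assert (T := Cmod_lip w z). apply Rabs_le_between in T. lra. }
destruct (morera_PS Qe z R0 HR) as [P [_ [_ [a [Ca [_ [Fa _]]]]]]].
{ intros w Hw. apply Cont, HRin; auto. }
{ intros a b w h Hw Hh Hin. apply null_rect_axis; auto. }
exists (PS (dps (dps a)) 0).
assert (D := PS_cder (dps a) R0 0 (cvr_dps _ _ Ca) ltac:(rewrite Cmod_0; auto)).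
intros e He. destruct (D e He) as [d [Hd F]]. exists (Rmin d R0). split. apply Rmin_pos; auto. intros w Hw.
lt_min Hw W1 W2.
specialize (F (w - z)%C). replace (w - z - 0)%C with (w - z)%C in F by ring.
rewrite <- (Fa (w - z)%C), <- (Fa 0) in F; try (rewrite Cmod_0); auto.
replace (z + (w - z))%C with w in F by ring. replace (z + 0)%C with z in F by ring. auto.
Qed.

(** [Q_local] on a disc of radius [t / 4] bounds [Q] essentially by the square of the gradient,
    which doubles the exponents [3], [8] and [9] of [grad_growth]. *)
Lemma Q_height_bound : exists A r3, 0 < A /\ 0 < r3 <= / 4 /\ r3 <= eps / 4 /\ forall z, HD eps z -> Cmod z < r3 ->
  Cmod (Q z) <= A * (1 - ln (Cmod z)) ^ 6 * Cmod z ^ 16 / snd z ^ 18.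
Proof using H.
destruct (grad_growth _ _ _ _ _ _ _ _ _ _ H1) as (A & r2 & HA & Hr2 & Hr2e & HG).
destruct (eps_regularity _ _ _ _ _ _ _ _ _ _ H1) as [r1 [Hr1 Hreg]].
(* On the disc [1 - ln |w| <= 2 L], [|w| <= 5 r / 4] and [Im w >= 3 t / 4]. *)
set (A1 := A * 8 * (5 / 4) ^ 8 / (3 / 4) ^ 9).
assert (HA1 : 0 < A1). { unfold A1. apply Rdiv_lt_0_compat. 2: apply pow_lt; lra. apply Rmult_lt_0_compat; [lra|apply pow_lt; lra]. }
exists (16 * A1 + 16 * (128 + A1 * A1 / 4)), (Rmin r1 r2 / 4).
min_le r1 r2 M1 M2. assert (M0 : 0 < Rmin r1 r2) by (apply Rmin_pos; lra).
split. nra. split. lra. split. lra.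
intros z Hz Hzr. destruct Hz as [Hz1 Hz2]. set (r := Cmod z) in *. set (t := snd z) in *.
assert (Ht : t <= r). { eapply Rle_trans. apply Rle_abs. apply Cmod_snd. }
assert (Hr : 0 < r) by lra.
assert (In : forall w, Cmod (w - z) < t / 2 -> HD eps w /\ t / 2 < snd w).
{ intros w Hw. assert (T := Cmod_lip w z). apply Rabs_le_between in T. fold r in T.
  assert (T2 := Cmod_snd (w - z)). change (Rabs (snd w - t) <= Cmod (w - z)) in T2. apply Rabs_le_between in T2.
  split. split; lra. lra. }
destruct (Q_local _ _ _ _ _ _ _ _ _ _ H z (t / 2) ltac:(lra) (fun w Hw => proj1 (In w Hw))) as [_ B].
set (L := 1 - ln r).
assert (Hln : ln r <= 0). { rewrite <- ln_1. apply ln_le; lra. }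
assert (HL : 1 <= L) by (unfold L; lra).
set (x := r / t). assert (Hx : 1 <= x). { unfold x. apply (Rle_div_r 1 r t); lra. }
set (G := A1 * L ^ 3 * x ^ 8 / t). set (E := 256 / t ^ 2).
assert (HL3 : 1 <= L ^ 3) by (apply pow_R1_Rle; auto). assert (Hx8 : 1 <= x ^ 8) by (apply pow_R1_Rle; auto).
assert (BB : Cmod (Q z) <= 4 * (G + 4 * (t / 4) * (E / 2 + G * G / 4)) / (t / 4)).
{ apply (B (t / 4) G E). lra. intros w Hw.
  assert (Hw' : Cmod (w - z) < t / 2) by lra. destruct (In w Hw') as [Uw _].
  assert (T := Cmod_lip w z). apply Rabs_le_between in T. fold r in T.
  assert (T2 := Cmod_snd (w - z)). change (Rabs (snd w - t) <= Cmod (w - z)) in T2. apply Rabs_le_between in T2.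
  assert (Lw : 0 <= 1 - ln (Cmod w) <= 2 * L).
  { split. assert (ln (Cmod w) <= 0) by (rewrite <- ln_1; apply ln_le; lra). lra.
    assert (X : ln (r * / 2) <= ln (Cmod w)) by (apply ln_le; lra). rewrite ln_mult, ln_Rinv in X by lra.
    assert (ln 2 <= 1). { rewrite <- (ln_exp 1). apply ln_le. lra. assert (Z := exp_ineq1 1 ltac:(lra)). lra. }
    unfold L. lra. }
  assert (GG : forall e1 e2, e1 * e1 + e2 * e2 = 1 -> Rabs (e1 * vs w + e2 * vt w) <= G).
  { intros e1 e2 He. eapply Rle_trans. apply (HG w e1 e2 Uw); auto. lra.
    apply Rle_trans with (A * (2 * L) ^ 3 * (5 / 4 * r) ^ 8 / (3 / 4 * t) ^ 9).
    - unfold Rdiv. apply Rmult_le_compat.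
      + apply Rmult_le_pos. apply Rmult_le_pos. lra. apply pow_le; lra. apply pow_le; lra.
      + apply Rlt_le, Rinv_0_lt_compat, pow_lt; lra.
      + apply Rmult_le_compat. apply Rmult_le_pos. lra. apply pow_le; lra. apply pow_le; lra.
        apply Rmult_le_compat_l. lra. apply pow_incr; lra. apply pow_incr; lra.
      + apply Rinv_le_contravar. apply pow_lt; lra. apply pow_incr; lra.
    - right. unfold G, A1, x. field. lra. }
  split; [|split].
  - replace (vs w) with (1 * vs w + 0 * vt w) by ring. apply GG. ring.
  - replace (vt w) with (0 * vs w + 1 * vt w) by ring. apply GG. ring.
  - apply Rle_trans with (144 / (3 / 4 * r) ^ 2).
    + apply (exp_le_bound eps v r1 Hreg). apply HD_HB; auto. lra. lra.
    + unfold E. apply Rle_trans with (256 / r ^ 2). right; field; lra.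
      apply Rmult_le_compat_l. lra. apply Rinv_le_contravar. apply pow_lt; lra. apply pow_incr; lra. }
eapply Rle_trans. apply BB.
replace (4 * (G + 4 * (t / 4) * (E / 2 + G * G / 4)) / (t / 4)) with (16 * (A1 * (L ^ 3 * x ^ 8) + (128 + A1 * A1 / 4 * (L ^ 3 * x ^ 8) ^ 2)) / t ^ 2).
2: { unfold G, E. field. lra. }
replace ((16 * A1 + 16 * (128 + A1 * A1 / 4)) * L ^ 6 * r ^ 16 / t ^ 18) with ((16 * A1 + 16 * (128 + A1 * A1 / 4)) * (L ^ 3 * x ^ 8) ^ 2 / t ^ 2).
2: { unfold x. field. lra. }
set (y := L ^ 3 * x ^ 8). assert (Hy : 1 <= y) by (unfold y; nra).
assert (Hy2 : y <= y ^ 2 /\ 1 <= y ^ 2) by (simpl; nra).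
apply Rmult_le_compat_r. apply Rlt_le, Rinv_0_lt_compat, pow_lt; lra.
assert (0 <= A1 * A1 / 4) by nra. nra.
Qed.

(* Near the axis Q is bounded by the maximum principle applied to Q(w) ((w - x0)^2 - s^2)^18 on |w - x0| = s,
   where |(w - x0)^2 - s^2| = 2 s |Im w| compensates the degenerate bound. *)
Lemma Qe_log_bound : exists A r4, 0 < A /\ 0 < r4 <= / 4 /\ r4 <= eps / 4 /\ forall z, 0 < Cmod z < r4 ->
  Cmod (Qe z) <= A * (1 - ln (Cmod z)) ^ 6 / Cmod z ^ 2.
Proof using H.
destruct Q_height_bound as (A & r3 & HA & Hr3 & Hr3e & HQ).
assert (HQe : forall z, 0 < Cmod z < r3 -> snd z <> 0 -> Cmod (Qe z) <= A * (1 - ln (Cmod z)) ^ 6 * Cmod z ^ 16 / Rabs (snd z) ^ 18).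
{ intros z Hz Hs. destruct (Rlt_dec 0 (snd z)) as [Hp|Hp].
  - rewrite Qe_up by lra. rewrite Rabs_pos_eq by lra. apply HQ; try lra. split; lra.
  - replace (Qe z) with (Cconj (Q (Cconj z))). 2: { unfold Qe. destruct (Rle_dec 0 (snd z)); auto. lra. }
    rewrite Cmod_conj. assert (X := HQ (Cconj z)). rewrite Cmod_conj in X. rewrite Rabs_left by lra. apply X; try lra.
    split. rewrite Cmod_conj; lra. simpl; lra. }
exists (4 * (A * 3 ^ 6 * (3 / 2) ^ 16) * (16 / 3) ^ 18 + A * 4 ^ 18), (r3 / 2).
assert (P1 : 0 < (3 / 2) ^ 16) by (apply pow_lt; lra). assert (P2 : 0 < (16 / 3) ^ 18) by (apply pow_lt; lra). assert (P3 : 0 < 4 ^ 18) by (apply pow_lt; lra).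
assert (P4 : 0 < 3 ^ 6) by (apply pow_lt; lra).
assert (P5 : 0 < 4 * (A * 3 ^ 6 * (3 / 2) ^ 16) * (16 / 3) ^ 18) by (repeat apply Rmult_lt_0_compat; lra).
assert (P6 : 0 < A * 4 ^ 18) by (apply Rmult_lt_0_compat; lra).
split. lra. split. lra. split. lra.
intros z Hz. set (r := Cmod z) in *.
set (L := 1 - ln r).
assert (Hln : ln r <= 0). { rewrite <- ln_1. apply ln_le; lra. }
assert (HL : 1 <= L) by (unfold L; lra). assert (HL6 : 1 <= L ^ 6) by (apply pow_R1_Rle; auto).
assert (Hr2 : 0 < r ^ 2) by (apply pow_lt; lra).
destruct (Rle_dec (r / 4) (Rabs (snd z))) as [Hfar|Hnear].
- assert (Hs : snd z <> 0). { intros E. rewrite E, Rabs_R0 in Hfar. lra. }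
  eapply Rle_trans. apply HQe; auto. fold r; lra. fold r L.
  apply Rle_trans with (A * L ^ 6 * r ^ 16 / (r / 4) ^ 18).
  + apply Rmult_le_compat_l. apply Rmult_le_pos. apply Rmult_le_pos; lra. apply pow_le; lra.
    apply Rinv_le_contravar. apply pow_lt; lra. apply pow_incr; lra.
  + replace (A * L ^ 6 * r ^ 16 / (r / 4) ^ 18) with ((A * 4 ^ 18) * L ^ 6 / r ^ 2) by (field; lra).
    apply Rmult_le_compat_r. apply Rlt_le, Rinv_0_lt_compat; auto. apply Rmult_le_compat_r; lra.
- set (x0 := RtoC (fst z)). set (s := r / 2).
  assert (Hd : z = (x0 + (0, snd z))%C) by Cring.
  assert (Hdz : Cmod (z - x0) <= r / 4).
  { replace (z - x0)%C with ((0, snd z) : C) by Cring. eapply Rle_trans. apply Cmod_pair_le. rewrite Rabs_R0. lra. }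
  assert (Hx0 : 3 / 4 * r <= Cmod x0 <= r).
  { assert (T := Cmod_lip z x0). apply Rabs_le_between in T. fold r in T. split. lra. unfold x0. rewrite Cmod_R. apply Cmod_fst. }
  assert (Din : forall w, Cmod (w - x0) < 3 / 4 * r -> 0 < Cmod w < eps).
  { intros w Hw. assert (T := Cmod_lip w x0). apply Rabs_le_between in T. lra. }
  set (f := fun w => (Qe w * ((w - x0) * (w - x0) - RtoC (s * s)) ^ 18)%C).
  assert (Hf : forall w, Cmod (w - x0) < 3 / 4 * r -> exists l, cder f w l).
  { intros w Hw. destruct (Qe_cder w (Din w Hw)) as [l Hl]. eexists. apply cder_mult. exact Hl.
    apply (cder_comp (fun y => y ^ 18)%C (fun w => (w - x0) * (w - x0) - RtoC (s * s))%C). 2: apply cder_pow.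
    assert (Dm := cder_minus (fun w => w) (fun _ => x0) w _ _ (cder_id w) (cder_const x0 w)).
    apply (cder_minus (fun w => (w - x0) * (w - x0))%C (fun _ => RtoC (s * s))). apply cder_mult; exact Dm. apply cder_const. }
  set (M := A * 3 ^ 6 * (3 / 2) ^ 16 * L ^ 6 * r ^ 34).
  assert (HM0 : 0 <= M). { unfold M. repeat apply Rmult_le_pos; try lra. }
  assert (Circ : forall t, Cmod (f (x0 + s * cis t)%C) <= M).
  { intros t. set (w := (x0 + s * cis t)%C). unfold f.
    assert (Ew : (w - x0)%C = (s * cis t)%C) by (unfold w; ring).
    assert (Cw : Cmod (w - x0) = s). { rewrite Ew, Cmod_mult, Cmod_cis, Cmod_R, Rabs_pos_eq; unfold s; lra. }
    assert (Tw := Cmod_lip w x0). apply Rabs_le_between in Tw. rewrite Cw in Tw. unfold s in Tw.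
    assert (Sw : snd w = s * sin t). { unfold w, x0. simpl. ring. }
    assert (Ef : ((w - x0) * (w - x0) - RtoC (s * s))%C = (RtoC (2 * s * snd w) * (Ci * cis t))%C).
    { rewrite Ew, Sw. assert (T := sin2_cos2 t). unfold Rsqr in T. apply injective_projections; simpl.
      replace (s * s) with (s * s * (sin t * sin t + cos t * cos t)) by (rewrite T; ring). ring. ring. }
    rewrite Cmod_mult, Cmod_pow, Ef, !Cmod_mult, Cmod_Ci, Cmod_cis, Cmod_R, !Rmult_1_r.
    rewrite Rabs_mult, (Rabs_pos_eq (2 * s)) by (unfold s; lra).
    (* At the two points of the circle on the axis, where no bound of [Qe] is at hand, the
       polynomial factor vanishes. *)
    destruct (Req_dec (snd w) 0) as [E0|E0].
    { rewrite E0, Rabs_R0, Rmult_0_r, pow_i, Rmult_0_r; auto. lia. }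
    assert (Pw : 0 < Rabs (snd w)) by (apply Rabs_pos_lt; auto).
    eapply Rle_trans. apply Rmult_le_compat_r. apply pow_le. apply Rmult_le_pos; unfold s; lra. apply HQe; auto. lra.
    replace (A * (1 - ln (Cmod w)) ^ 6 * Cmod w ^ 16 / Rabs (snd w) ^ 18 * (2 * s * Rabs (snd w)) ^ 18)
      with (A * (1 - ln (Cmod w)) ^ 6 * Cmod w ^ 16 * r ^ 18) by (unfold s; field; lra).
    assert (Lw : 0 <= 1 - ln (Cmod w) <= 3 * L).
    { split. assert (ln (Cmod w) <= 0) by (rewrite <- ln_1; apply ln_le; lra). lra.
      assert (X : ln (r * / 4) <= ln (Cmod w)) by (apply ln_le; lra). rewrite ln_mult, ln_Rinv in X by lra.
      assert (ln 4 <= 2). { rewrite <- (ln_exp 2). apply ln_le. lra. apply exp_2_ge_4. }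
      unfold L. lra. }
    unfold M. replace (A * 3 ^ 6 * (3 / 2) ^ 16 * L ^ 6 * r ^ 34) with (A * (3 * L) ^ 6 * (3 / 2 * r) ^ 16 * r ^ 18) by ring.
    apply Rmult_le_compat_r. apply pow_le; lra.
    apply Rmult_le_compat. apply Rmult_le_pos. lra. apply pow_le; lra. apply pow_le; lra.
    apply Rmult_le_compat_l. lra. apply pow_incr; lra. apply pow_incr; lra. }
  assert (B := holo_bound f x0 (3 / 4 * r) s M ltac:(unfold s; lra) Hf Circ z ltac:(unfold s; lra)).
  unfold f in B. rewrite Cmod_mult, Cmod_pow in B.
  assert (Lo : 3 / 16 * r ^ 2 <= Cmod ((z - x0) * (z - x0) - RtoC (s * s))%C).
  { assert (T := Cmod_triangle (- ((z - x0) * (z - x0) - RtoC (s * s))) ((z - x0) * (z - x0))). rewrite Cmod_opp in T.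
    replace (- ((z - x0) * (z - x0) - RtoC (s * s)) + (z - x0) * (z - x0))%C with (RtoC (s * s)) in T by ring.
    rewrite Cmod_R, (Rabs_pos_eq (s * s)), Cmod_mult in T by (unfold s; nra).
    assert (P := Cmod_ge_0 (z - x0)). assert (Cmod (z - x0) * Cmod (z - x0) <= r / 4 * (r / 4)) by (apply Rmult_le_compat; lra).
    unfold s in *. nra. }
  assert (Lo18 : (3 / 16 * r ^ 2) ^ 18 <= Cmod ((z - x0) * (z - x0) - RtoC (s * s))%C ^ 18) by (apply pow_incr; split; auto; lra).
  assert (Pl : 0 < (3 / 16 * r ^ 2) ^ 18) by (apply pow_lt; lra).
  assert (Pq := Cmod_ge_0 (Qe z)).
  assert (B' : Cmod (Qe z) * (3 / 16 * r ^ 2) ^ 18 <= 4 * M).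
  { eapply Rle_trans. apply Rmult_le_compat_l; eauto. auto. }
  apply Rmult_le_reg_r with ((3 / 16 * r ^ 2) ^ 18); auto. eapply Rle_trans. apply B'.
  replace (4 * M) with ((4 * (A * 3 ^ 6 * (3 / 2) ^ 16) * (16 / 3) ^ 18) * L ^ 6 / r ^ 2 * (3 / 16 * r ^ 2) ^ 18) by (unfold M; field; lra).
  apply Rmult_le_compat_r. lra. apply Rmult_le_compat_r. apply Rlt_le, Rinv_0_lt_compat; auto. apply Rmult_le_compat_r; lra.
Qed.

(** [z ^ 4 Q] is [O(|z| ^ 2 (1 - ln |z|) ^ 6)], thus [o(z)], and [removable_PS2] gives it a factor
    [z ^ 2]. The coefficients agree with their conjugates because the series is real at small
    positive [z]. *)
Theorem Qe_PS : exists b, cvr b eps /\ (forall n, snd (b n) = 0) /\ forall z, 0 < Cmod z < eps -> (z * z * Qe z)%C = PS b z.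
Proof using H.
assert (Heps := ls_eps H1).
destruct Qe_log_bound as (A & r4 & HA & Hr4 & Hr4e & HB).
destruct (removable_PS2 (fun z => (z * z) * (z * z) * Qe z)%C eps Heps) as [b [Cb Eb]].
{ intros z Hz. destruct (Qe_cder z Hz) as [l Hl]. eexists. apply cder_mult. 2: exact Hl. apply cder_mult; apply cder_mult; apply cder_id. }
{ intros e He. destruct (log_pow_small (e / A)) as [d [Hd F]]. apply Rdiv_lt_0_compat; auto.
  exists (Rmin d r4). split. apply Rmin_pos; lra. intros z [Hz1 Hz2].
  assert (Z1 := Rlt_le_trans _ _ _ Hz2 (Rmin_l _ _)). assert (Z2 := Rlt_le_trans _ _ _ Hz2 (Rmin_r _ _)).
  specialize (F (Cmod z) ltac:(lra)). specialize (HB z ltac:(lra)). rewrite !Cmod_mult. set (r := Cmod z) in *.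
  apply (Rmult_le_compat_l (r * r * (r * r))) in HB. 2: nra. eapply Rle_trans. apply HB.
  replace (r * r * (r * r) * (A * (1 - ln r) ^ 6 / r ^ 2)) with (A * (r * (1 - ln r) ^ 6) * r) by (field; lra).
  apply Rmult_le_compat_r. lra. apply Rle_trans with (A * (e / A)). apply Rmult_le_compat_l; lra. right; field; lra. }
assert (Ez : forall z, 0 < Cmod z < eps -> (z * z * Qe z)%C = PS b z).
{ intros z Hz. assert (E := Eb z Hz). cbv beta in E. assert (Hz0 : z <> 0) by (apply Cmod_gt_0; lra).
  replace (PS b z) with (/ (z * z) * (z * z * PS b z))%C by (field; auto). rewrite <- E. field; auto. }
exists b. split; auto. split; auto.
assert (Cj : forall n, Cconj (b n) = b n).
{ apply (PS_eq_coef _ _ eps); auto. apply cvr_conj; auto.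
  intros d Hd. set (x := Rmin d eps / 2). min_le d eps X1 X2.
  assert (X0 : 0 < Rmin d eps) by (apply Rmin_pos; auto).
  exists (RtoC x). assert (Cx : Cmod (RtoC x) = x) by (rewrite Cmod_R, Rabs_pos_eq; unfold x; lra).
  rewrite Cx. split. unfold x; lra.
  assert (Cc : Cconj (RtoC x) = RtoC x) by Cring.
  apply (is_PS_PS _ eps). apply cvr_conj; auto. rewrite Cx; unfold x; lra.
  rewrite <- Cc at 1. replace (PS b (RtoC x)) with (Cconj (PS b (RtoC x))).
  apply is_PS_conj, (PS_is b eps); auto. rewrite Cx; unfold x; lra.
  assert (Xz : RtoC x <> 0) by (apply Cmod_gt_0; rewrite Cx; unfold x; lra).
  rewrite <- Ez by (rewrite Cx; unfold x; lra).
  replace (Cconj (RtoC x * RtoC x * Qe (RtoC x))) with (Cconj (RtoC x) * Cconj (RtoC x) * Cconj (Qe (RtoC x)))%C by Cring.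
  rewrite <- Qe_conj, Cc; auto. rewrite Cx; unfold x; lra. }
intros n. specialize (Cj n). apply (f_equal snd) in Cj. simpl in Cj. lra.
Qed.
End ExtendedQ.

(** * Frobenius series *)

(** The Cauchy product in the recursive form that matches [PS_shift]:
    [(a0 + z a') b = a0 b + z a' b]. *)
Fixpoint conv (a b : nat -> C) (n : nat) : C :=
  match n with
  | O => (a O * b O)%C
  | S k => (a O * b (S k) + conv (fun j => a (S j)) b k)%C
  end.

Definition rsh (a : nat -> C) (n : nat) : C := match n with O => 0 | S k => a k end.

Lemma cvr_rsh a R0 : cvr a R0 -> cvr (rsh a) R0.
Proof.
intros H r Hr. destruct (H r Hr) as [M HM]. exists (Rabs M * r + 0). intros [|n]; simpl.
- rewrite Cmod_0. generalize (Rabs_pos M). nra.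
- specialize (HM n). assert (T := Rle_abs M).
  replace (Cmod (a n) * (r * r ^ n)) with ((Cmod (a n) * r ^ n) * r) by ring. rewrite Rplus_0_r. apply Rmult_le_compat_r; lra.
Qed.

Lemma PS_rsh a R0 z : cvr a R0 -> Cmod z < R0 -> PS (rsh a) z = (z * PS a z)%C.
Proof.
intros Ha Hz. rewrite (PS_shift _ R0 z (cvr_rsh _ _ Ha) Hz). simpl.
change (fun n => a n) with a. ring.
Qed.

Lemma PS_plus a b R0 z : cvr a R0 -> cvr b R0 -> Cmod z < R0 -> PS (fun n => a n + b n)%C z = (PS a z + PS b z)%C.
Proof.
intros Ha Hb Hz. apply (is_PS_PS _ R0); auto. apply cvr_plus; auto. apply is_PS_plus; eapply PS_is; eauto.
Qed.

Lemma PS_scal c a R0 z : cvr a R0 -> Cmod z < R0 -> PS (fun n => c * a n)%C z = (c * PS a z)%C.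
Proof. intros Ha Hz. apply (is_PS_PS _ R0); auto. apply cvr_scal; auto. apply is_PS_scal; eapply PS_is; eauto. Qed.

Lemma PS_ext a b z : (forall n, a n = b n) -> PS a z = PS b z.
Proof. intros H. f_equal. apply functional_extensionality; auto. Qed.

(** No double series is rearranged: the product is holomorphic, hence a series, and its coefficients
    are identified one by one through division by [z]. *)
Lemma PS_mult a b R0 : 0 < R0 -> cvr a R0 -> cvr b R0 ->
  cvr (conv a b) R0 /\ forall z, Cmod z < R0 -> PS (conv a b) z = (PS a z * PS b z)%C.
Proof.
intros HR Ha Hb.
assert (X : forall n a c, cvr a R0 -> cvr c R0 -> (forall z, Cmod z < R0 -> PS c z = (PS a z * PS b z)%C) -> c n = conv a b n).
{ clear a Ha. induction n as [|n IH]; intros a c Ha Hc E.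
  - assert (E0 := E 0 ltac:(rewrite Cmod_0; auto)). rewrite !PS_0 in E0. auto.
  - assert (E0 := E 0 ltac:(rewrite Cmod_0; auto)). rewrite !PS_0 in E0.
    assert (Hc' := cvr_shift _ _ Hc). assert (Ha' := cvr_shift _ _ Ha). assert (Hb' := cvr_shift _ _ Hb).
    set (c' := fun k => (c (S k) + (- a O) * b (S k))%C).
    assert (Cc' : cvr c' R0). { apply cvr_plus; auto. apply (cvr_scal (- a O)%C); auto. }
    simpl. rewrite <- (IH (fun j => a (S j)) c' Ha' Cc'). unfold c'. ring.
    assert (Pn : forall z, Cmod z < R0 -> z <> 0 -> PS c' z = (PS (fun j => a (S j)) z * PS b z)%C).
    { intros z Hz Hz0. unfold c'. rewrite (PS_plus _ _ R0); auto. 2: apply (cvr_scal (- a O)%C); auto.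
      rewrite (PS_scal _ (fun k => b (S k)) R0); auto.
      assert (E1 := E z Hz). rewrite (PS_shift c R0 z Hc Hz), (PS_shift a R0 z Ha Hz), E0 in E1.
      assert (Eb := PS_shift b R0 z Hb Hz).
      set (x := PS (fun n0 => c (S n0)) z) in *. set (y := PS (fun n0 => a (S n0)) z) in *. set (w := PS (fun n0 => b (S n0)) z) in *.
      replace x with (/ z * ((a O * b O + z * x) - a O * b O))%C by (field; auto). rewrite E1, Eb. field; auto. }
    intros z Hz. destruct (Ceq_dec z 0) as [->|Hz0]; auto.
    assert (C1 : ccont (PS c') 0) by (apply (PS_ccont _ R0); auto).
    assert (C2 : ccont (fun z => PS (fun j => a (S j)) z * PS b z)%C 0) by (apply ccont_mult; apply (PS_ccont _ R0); auto).
    (* At [z = 0], which the division excludes, the identity follows by continuity. *)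
    set (g := fun z => (PS (fun j => a (S j)) z * PS b z)%C) in *. change (PS c' 0 = g 0).
    destruct (Ceq_dec (PS c' 0) (g 0)) as [|Hne]; auto. exfalso.
    set (e := Cmod (PS c' 0 - g 0)). assert (He : 0 < e). { apply Cmod_gt_0. intros Z. apply Hne. replace (PS c' 0) with (PS c' 0 - g 0 + g 0)%C by ring. rewrite Z; ring. }
    destruct (C1 (e / 2)) as [d1 [Hd1 F1]]; try lra. destruct (C2 (e / 2)) as [d2 [Hd2 F2]]; try lra.
    set (w := RtoC (Rmin (Rmin d1 d2) R0 / 2)).
    min_le (Rmin d1 d2) R0 B1 B2. min_le d1 d2 B3 B4.
    assert (B0 : 0 < Rmin (Rmin d1 d2) R0) by (repeat apply Rmin_pos; auto).
    assert (Cw : Cmod w = Rmin (Rmin d1 d2) R0 / 2) by (unfold w; rewrite Cmod_R, Rabs_pos_eq; lra).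
    assert (W0 : (w - 0)%C = w) by ring.
    specialize (F1 w). specialize (F2 w). rewrite W0, Cw in F1, F2. specialize (F1 ltac:(lra)). specialize (F2 ltac:(lra)).
    rewrite Pn in F1 by (try apply Cmod_gt_0; rewrite Cw; lra). fold (g w) in F1.
    assert (T := Cmod_triangle (- (g w - PS c' 0)) (g w - g 0)). rewrite Cmod_opp in T.
    replace (- (g w - PS c' 0) + (g w - g 0))%C with (PS c' 0 - g 0)%C in T by ring. fold e in T. lra. }
destruct (holo_PS (fun z => PS a z * PS b z)%C 0 R0 HR) as [c [Cc [Ec _]]].
{ intros z Hz. replace (z - 0)%C with z in Hz by ring. eexists. apply cder_mult; apply (PS_cder _ R0); auto. }
assert (Ec' : forall z, Cmod z < R0 -> PS c z = (PS a z * PS b z)%C).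
{ intros z Hz. rewrite Ec; replace (z - 0)%C with z by ring; auto. }
assert (Eq : c = conv a b). { apply functional_extensionality. intros n. apply X; auto. }
rewrite <- Eq. auto.
Qed.

Lemma conv_ext a b b' n : (forall k, (k <= n)%nat -> b k = b' k) -> conv a b n = conv a b' n.
Proof.
revert a. induction n as [|n IH]; intros a H; simpl. rewrite H; auto. rewrite H, IH; auto.
Qed.

Lemma conv_real a b n : (forall k, snd (a k) = 0) -> (forall k, (k <= n)%nat -> snd (b k) = 0) -> snd (conv a b n) = 0.
Proof.
revert a. induction n as [|n IH]; intros a Ha Hb; simpl.
- rewrite Ha, Hb by auto. ring.
- rewrite Ha, Hb, IH by auto. ring.
Qed.

(** Geometric decay of [a] against a mere bound of [b]; shifting [a] in the induction multiplies its
    constant by [q / r]. *)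
Lemma conv_bound q r b M n : 0 < r -> 0 <= q < 1 -> 0 <= M -> (forall k, (k <= n)%nat -> Cmod (b k) * r ^ k <= M) ->
  forall a P, (forall k, Cmod (a k) * r ^ k <= P * q ^ k) -> Cmod (conv a b n) * r ^ n <= P * M / (1 - q).
Proof.
intros Hr Hq HM. induction n as [|n IH]; intros Hb a P Ha.
- assert (A0 := Ha O). assert (B0 := Hb O ltac:(lia)). simpl in *. rewrite Cmod_mult. rewrite !Rmult_1_r in *.
  assert (PA := Cmod_ge_0 (a O)). assert (PB := Cmod_ge_0 (b O)).
  apply (Rle_div_r _ (P * M) (1 - q)). lra. assert (Cmod (a O) * Cmod (b O) <= P * M) by (apply Rmult_le_compat; auto).
  assert (0 <= Cmod (a O) * Cmod (b O)) by nra. nra.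
- assert (A0 := Ha O). simpl in A0. rewrite !Rmult_1_r in A0. assert (B0 := Hb (S n) ltac:(lia)).
  assert (PA := Cmod_ge_0 (a O)). assert (PB := Cmod_ge_0 (b (S n))).
  assert (X := IH (fun k Hk => Hb k ltac:(lia)) (fun j => a (S j)) (P * q / r)).
  assert (X' : Cmod (conv (fun j => a (S j)) b n) * r ^ n <= P * q / r * M / (1 - q)).
  { apply X. intros k. specialize (Ha (S k)). simpl in Ha. apply Rmult_le_reg_r with r; auto.
    replace (P * q / r * q ^ k * r) with (P * (q * q ^ k)) by (field; lra). lra. }
  change (conv a b (S n)) with (a O * b (S n) + conv (fun j => a (S j)) b n)%C.
  assert (rn : 0 < r ^ S n) by (apply pow_lt; auto).
  apply Rle_trans with (Cmod (a O) * (Cmod (b (S n)) * r ^ S n) + (Cmod (conv (fun j => a (S j)) b n) * r ^ n) * r).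
  { replace (r ^ S n) with (r ^ n * r) in * by (simpl; ring).
    assert (T := Cmod_triangle (a O * b (S n)) (conv (fun j => a (S j)) b n)). rewrite Cmod_mult in T. nra. }
  replace (P * M / (1 - q)) with (P * M + P * q / r * M / (1 - q) * r) by (field; lra).
  apply Rplus_le_compat. apply Rmult_le_compat; auto; nra. apply Rmult_le_compat_r; lra.
Qed.

Section Recursion.
Variables p r : nat -> C.
Variables s h0 : C.

(** The factor of the coefficient [n + 1] of [h] in the equation [z h'' + (1 + s) h' + p h = r]. Its
    zeros are the resonances, where [fval] takes the default value [0]. *)
Definition fden (n : nat) : C := (RtoC (INR (S n)) * (RtoC (INR (S n)) + s))%C.

Definition fval (h : nat -> C) (n : nat) : C :=
  if Ceq_dec (fden n) 0 then RtoC 0 else ((r n - conv p h n) / fden n)%C.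

(** Course-of-values recursion: [fapp n] holds the coefficients up to index [n]. *)
Fixpoint fapp (n : nat) : nat -> C :=
  match n with
  | O => fun _ => h0
  | S n => fun k => if Nat.leb k n then fapp n k else fval (fapp n) n
  end.

Definition fsol (n : nat) : C := fapp n n.

Lemma fapp_stable n k : (k <= n)%nat -> fapp n k = fsol k.
Proof.
intros H. induction H as [|n H IH]; auto. simpl. destruct (Nat.leb_spec k n); auto. lia.
Qed.

Lemma fsol_S n : fsol (S n) = fval fsol n.
Proof.
unfold fsol at 1. change (fapp (S n) (S n)) with (if Nat.leb (S n) n then fapp n (S n) else fval (fapp n) n).
destruct (Nat.leb_spec (S n) n) as [H|H]. lia.
unfold fval. rewrite (conv_ext p (fapp n) fsol n). auto. apply fapp_stable.
Qed.

Lemma fsol_eq n : fden n <> 0 -> (fden n * fsol (S n) + conv p fsol n)%C = r n.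
Proof. intros H. rewrite fsol_S. unfold fval. destruct (Ceq_dec (fden n) 0). contradiction. field; auto. Qed.

Lemma fsol_real : (forall n, snd (p n) = 0) -> (forall n, snd (r n) = 0) -> snd s = 0 -> snd h0 = 0 -> forall n, snd (fsol n) = 0.
Proof.
intros Hp Hr Hs H0. assert (X : forall n k, (k <= n)%nat -> snd (fsol k) = 0).
{ induction n as [|n IH]; intros k Hk. replace k with O by lia. auto.
  destruct (Nat.eq_dec k (S n)) as [->|]. 2: apply IH; lia.
  rewrite fsol_S. unfold fval. destruct (Ceq_dec (fden n) 0) as [|Hd]; auto.
  assert (Ed : snd (fden n) = 0) by (unfold fden; cbn [fst snd Cmult Cplus RtoC]; rewrite Hs; ring).
  assert (En : snd (r n - conv p fsol n)%C = 0). { cbn [snd Cminus Cplus Copp]. unfold Cminus, Cplus, Copp. cbn [snd]. rewrite Hr, conv_real; auto. ring. }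
  set (x := (r n - conv p fsol n)%C) in *. set (d := fden n) in *. destruct x as [x1 x2]. destruct d as [d1 d2]. simpl in Ed, En. subst.
  unfold Cdiv, Cmult, Cinv. cbn [fst snd]. unfold Rdiv. ring. }
intros n. apply (X n n); auto.
Qed.

(** A majorant argument: the convolution costs a fixed factor, while [fden n] is at least [n + 1]
    for large [n]; so from some index on a bound [M] of the earlier terms reproduces itself. *)
Lemma fsol_cvr R0 : cvr p R0 -> cvr r R0 -> cvr fsol R0.
Proof.
intros Hp Hr rho Hrho.
set (rho' := (rho + R0) / 2). set (q := rho / rho').
assert (Hrho' : rho < rho' < R0) by (unfold rho'; lra).
assert (Hq : 0 <= q < 1). { unfold q. split. apply Rdiv_le_0_compat; lra. apply Rlt_div_l; lra. }
destruct (Hp rho' ltac:(lra)) as [P HP]. destruct (Hr rho Hrho) as [B HB].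
assert (P0 : 0 <= P). { eapply Rle_trans. 2: apply (HP O). simpl. rewrite Rmult_1_r. apply Cmod_ge_0. }
assert (B0 : 0 <= B). { eapply Rle_trans. 2: apply (HB O). simpl. rewrite Rmult_1_r. apply Cmod_ge_0. }
assert (HP' : forall k, Cmod (p k) * rho ^ k <= P * q ^ k).
{ intros k. replace (rho ^ k) with (rho' ^ k * q ^ k). 2: { rewrite <- Rpow_mult_distr. f_equal. unfold q; field; lra. }
  assert (0 <= q ^ k) by (apply pow_le; lra). specialize (HP k). nra. }
set (Z := rho * (P / (1 - q))).
assert (HZ : 0 <= Z). { unfold Z. apply Rmult_le_pos. lra. apply Rdiv_le_0_compat; lra. }
destruct (nfloor_ex (2 * Z + Cmod s + 1)) as [N [_ HN]]. { generalize (Cmod_ge_0 s); lra. }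
assert (Fin : forall n, exists M, forall k, (k <= n)%nat -> Cmod (fsol k) * rho ^ k <= M).
{ induction n as [|n [M IH]]. exists (Cmod (fsol O) * rho ^ O). intros k Hk. replace k with O by lia. lra.
  exists (Rmax M (Cmod (fsol (S n)) * rho ^ S n)). intros k Hk. destruct (Nat.eq_dec k (S n)) as [->|].
  apply Rmax_r. eapply Rle_trans. apply IH; lia. apply Rmax_l. }
destruct (Fin (S N)) as [M0 HM0].
set (M := Rmax M0 (2 * rho * B)).
assert (M1 : M0 <= M) by apply Rmax_l. assert (M2 : 2 * rho * B <= M) by apply Rmax_r.
assert (MP : 0 <= M). { eapply Rle_trans. 2: apply M1. eapply Rle_trans. 2: apply (HM0 O ltac:(lia)). simpl. rewrite Rmult_1_r. apply Cmod_ge_0. }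
exists M.
assert (X : forall n k, (k <= n)%nat -> Cmod (fsol k) * rho ^ k <= M).
{ induction n as [|n IH]; intros k Hk. { eapply Rle_trans. apply HM0; lia. auto. }
  destruct (Nat.eq_dec k (S n)) as [->|]. 2: apply IH; lia.
  destruct (Nat.le_gt_cases (S n) (S N)) as [Hle|Hgt]. { eapply Rle_trans. apply HM0; auto. auto. }
  rewrite fsol_S. unfold fval. destruct (Ceq_dec (fden n) 0) as [|Hd]. { rewrite Cmod_0. lra. }
  rewrite Cmod_div by auto.
  assert (HnR : 2 * Z + Cmod s + 1 <= INR (S n)).
  { apply Rlt_le. eapply Rlt_le_trans. apply HN. rewrite <- S_INR. apply le_INR. lia. }
  assert (Ps := Cmod_ge_0 s).
  assert (Dn : INR (S n) <= Cmod (fden n)).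
  { unfold fden. rewrite Cmod_mult, Cmod_R, (Rabs_pos_eq (INR (S n))) by lra.
    assert (T := Cmod_triangle (RtoC (INR (S n)) + s) (- s)). replace (RtoC (INR (S n)) + s + - s)%C with (RtoC (INR (S n))) in T by ring.
    rewrite Cmod_R, Cmod_opp, Rabs_pos_eq in T by lra. nra. }
  assert (Cb := conv_bound q rho fsol M n ltac:(lra) Hq MP IH p P HP').
  assert (Rb := HB n).
  assert (T := Cmod_triangle (r n) (- conv p fsol n)). rewrite Cmod_opp in T. change (r n + - conv p fsol n)%C with (r n - conv p fsol n)%C in T.
  assert (Pn : 0 < rho ^ n) by (apply pow_lt; lra).
  replace (Cmod (r n - conv p fsol n) / Cmod (fden n) * rho ^ S n) with ((Cmod (r n - conv p fsol n) * rho ^ n) * rho / Cmod (fden n)) by (simpl; field; lra).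
  apply Rle_div_l. lra.
  apply Rle_trans with ((B + P * M / (1 - q)) * rho). { apply Rmult_le_compat_r; nra. }
  replace ((B + P * M / (1 - q)) * rho) with (rho * B + Z * M) by (unfold Z; field; lra).
  apply Rle_trans with (M * INR (S n)). 2: apply Rmult_le_compat_l; auto. nra. }
intros n. apply (X n n); auto.
Qed.
End Recursion.

Lemma fuchs_eq p r s h0 R0 z : 0 < R0 -> cvr p R0 -> cvr r R0 -> Cmod z < R0 ->
  (forall n, (fden s n * fsol p r s h0 (S n) + conv p (fsol p r s h0) n)%C = r n) ->
  let h := fsol p r s h0 in
  (z * PS (dps (dps h)) z + (1 + s) * PS (dps h) z + PS p z * PS h z)%C = PS r z.
Proof.
intros HR Hp Hr Hz E h.
assert (Ch : cvr h R0) by (apply fsol_cvr; auto).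
assert (C1 := cvr_dps _ _ Ch). assert (C2 := cvr_dps _ _ C1).
destruct (PS_mult p h R0 HR Hp Ch) as [C3 E3].
rewrite <- (PS_rsh _ R0 z C2 Hz), <- E3, <- (PS_scal (1 + s)%C (dps h) R0 z C1 Hz) by auto.
assert (C4 := cvr_scal (1 + s)%C _ _ C1). assert (C5 := cvr_rsh _ _ C2).
rewrite <- (PS_plus _ _ R0 z C5 C4 Hz).
rewrite <- (PS_plus _ _ R0 z (cvr_plus _ _ _ C5 C4) C3 Hz).
apply PS_ext. intros n. rewrite <- (E n). unfold h. f_equal.
unfold fden, dps, rsh. destruct n as [|n].
- unfold dps. simpl INR. ring.
- rewrite (S_INR (S n)), !RtoC_plus. ring.
Qed.

(** With [y1 = z^((1+sig)/2) h1] and [y2 = z^((1-sig)/2) h2 + be y1 log z], [fr_e1] and [fr_e2] are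
    the equation for the two solutions after the logarithm has cancelled, and [fr_E] is their
    Wronskian. The second alternative of [fr_h2] is the double exponent, where the logarithmic term
    carries the normalisation. *)
Record frob (p : nat -> C) (R0 : R) (sig be : C) (m : nat) (h1 h2 : nat -> C) : Prop := {
  fr_c1 : cvr h1 R0;
  fr_c2 : cvr h2 R0;
  fr_be : be <> 0 -> sig = RtoC (INR m);
  fr_h1 : h1 O = 1;
  fr_h2 : h2 O = 1 \/ (sig = 0 /\ be = 1 /\ m = O);
  fr_e1 : forall z, Cmod z < R0 -> (z * PS (dps (dps h1)) z + (1 + sig) * PS (dps h1) z + PS p z * PS h1 z)%C = 0;
  fr_e2 : forall z, Cmod z < R0 -> (z * (z * PS (dps (dps h2)) z + (1 - sig) * PS (dps h2) z + PS p z * PS h2 z))%C =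
     (- be * (z ^ m * (RtoC (INR m) * PS h1 z + 2 * (z * PS (dps h1) z))))%C;
  fr_real : (forall n, snd (p n) = 0) -> snd sig = 0 -> snd be = 0 /\ (forall n, snd (h1 n) = 0) /\ (forall n, snd (h2 n) = 0);
  fr_E : exists W : C, W <> 0 /\ forall z, Cmod z < R0 ->
     (z * (PS h1 z * PS (dps h2) z - PS h2 z * PS (dps h1) z) - sig * (PS h1 z * PS h2 z) + be * z ^ m * (PS h1 z * PS h1 z))%C = W }.

Arguments fr_c1 {p R0 sig be m h1 h2}.
Arguments fr_c2 {p R0 sig be m h1 h2}.
Arguments fr_be {p R0 sig be m h1 h2}.
Arguments fr_h1 {p R0 sig be m h1 h2}.
Arguments fr_h2 {p R0 sig be m h1 h2}.
Arguments fr_e1 {p R0 sig be m h1 h2}.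
Arguments fr_e2 {p R0 sig be m h1 h2}.
Arguments fr_real {p R0 sig be m h1 h2}.
Arguments fr_E {p R0 sig be m h1 h2}.
Lemma cvr_zero R0 : cvr (fun _ => 0) R0.
Proof. intros r Hr. exists 0. intros n. rewrite Cmod_0. lra. Qed.

Lemma PS_zero z : PS (fun _ => 0) z = 0.
Proof.
apply (is_PS_PS _ (Cmod z + 1)). apply cvr_zero. lra.
intros e He. exists O. intros n _. rewrite (csum_ext _ (fun k => 0 * 0)%C) by (intros; ring). rewrite csum_scal.
match goal with |- Cmod ?x < _ => replace x with (RtoC 0) by ring end. rewrite Cmod_0; auto.
Qed.

Fixpoint rshn (m : nat) (a : nat -> C) : nat -> C := match m with O => a | S m => rsh (rshn m a) end.

Lemma cvr_rshn m a R0 : cvr a R0 -> cvr (rshn m a) R0.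
Proof. intros H. induction m; simpl; auto. apply cvr_rsh; auto. Qed.

Lemma PS_rshn m a R0 z : cvr a R0 -> Cmod z < R0 -> PS (rshn m a) z = (z ^ m * PS a z)%C.
Proof.
intros Ha Hz. induction m as [|m IH]; simpl. ring. rewrite (PS_rsh _ R0), IH; auto. ring. apply cvr_rshn; auto.
Qed.

Lemma rshn_lt m a n : (n < m)%nat -> rshn m a n = 0.
Proof. revert n. induction m as [|m IH]; intros [|n] H; simpl; auto; try lia. apply IH; lia. Qed.

Lemma rshn_add m a n : rshn m a (m + n)%nat = a n.
Proof. induction m; simpl; auto. Qed.

Lemma rshn_real m a n : (forall k, snd (a k) = 0) -> snd (rshn m a n) = 0.
Proof. intros H. revert n. induction m as [|m IH]; intros [|n]; simpl; auto. Qed.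

Section FrobeniusPair.
Variables (p : nat -> C) (R0 : R) (sig : C).
Hypothesis HR : 0 < R0.
Hypothesis Hp : cvr p R0.
Hypothesis Hsig : 0 <= fst sig.

Let h1 := fsol p (fun _ => 0) sig 1.

Lemma fden_pos n : fden sig n <> 0.
Proof using Hsig.
apply Cmult_neq_0. apply RtoC_neq, not_0_INR; lia.
intros E. apply (f_equal fst) in E. cbn [fst Cplus RtoC] in E. assert (0 < INR (S n)) by (apply lt_0_INR; lia). lra.
Qed.

Let h1_cvr : cvr h1 R0. Proof. apply fsol_cvr; auto. apply cvr_zero. Qed.

Let h1_eq z : Cmod z < R0 -> (z * PS (dps (dps h1)) z + (1 + sig) * PS (dps h1) z + PS p z * PS h1 z)%C = 0.
Proof.
intros Hz. rewrite <- (PS_zero z). apply (fuchs_eq p (fun _ => 0) sig 1 R0 z HR Hp (cvr_zero R0) Hz).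
intros n. apply fsol_eq, fden_pos.
Qed.

(** The contribution of [be y1 log z] to the equation for [h2], divided by [z]. The coefficient
    dropped by the shift is [0]: for [m > 0] by the factor [z ^ m], for [m = 0] by the factor
    [2 * 0 + 0]. *)
Definition logr (be : C) (m : nat) (n : nat) : C := rshn m (fun k => - be * ((2 * INR k + INR m) * h1 k))%C (S n).

Let tser be m := (fun k => - be * ((2 * INR k + INR m) * h1 k))%C.

Let tser_cvr be m : cvr (tser be m) R0.
Proof.
unfold tser. apply cvr_scal.
replace (fun k => (2 * INR k + INR m) * h1 k)%C with (fun k => 2 * (INR k * h1 k) + INR m * h1 k)%C.
2: { apply functional_extensionality; intros; ring. }
apply cvr_plus; apply cvr_scal; auto. apply cvr_INR; auto.
Qed.

Let tser_PS be m z : Cmod z < R0 -> PS (tser be m) z = (- be * (INR m * PS h1 z + 2 * (z * PS (dps h1) z)))%C.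
Proof.
intros Hz. assert (C1 := cvr_dps _ _ h1_cvr). assert (C2 := cvr_rsh _ _ C1).
rewrite <- (PS_rsh _ R0 z C1 Hz), <- (PS_scal (RtoC (INR m)) h1 R0 z h1_cvr Hz), <- (PS_scal 2 (rsh (dps h1)) R0 z C2 Hz).
rewrite <- (PS_plus _ _ R0 z (cvr_scal _ _ _ h1_cvr) (cvr_scal _ _ _ C2) Hz).
rewrite <- (PS_scal (- be)%C _ R0 z (cvr_plus _ _ _ (cvr_scal _ _ _ h1_cvr) (cvr_scal _ _ _ C2)) Hz).
apply PS_ext. intros n. unfold tser. f_equal. destruct n as [|n]; unfold rsh, dps. simpl INR. ring. ring.
Qed.

Lemma logr_cvr be m : cvr (logr be m) R0.
Proof using HR Hp. apply cvr_shift. apply cvr_rshn. apply tser_cvr. Qed.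

Lemma logr_real be m : snd be = 0 -> (forall n, snd (h1 n) = 0) -> forall n, snd (logr be m n) = 0.
Proof.
intros Hb Hh n. unfold logr. apply rshn_real. intros k. simpl. rewrite Hb, Hh. ring.
Qed.

(** By the two equations the expression of [fr_E] has derivative [0] away from the origin, so it
    equals its value [- sig h0 + be 0 ^ m] at the origin. *)
Lemma frob_assemble (be : C) (m : nat) (h0 : C) : (be <> 0 -> sig = RtoC (INR m)) ->
  (h0 = 1 \/ (sig = 0 /\ be = 1 /\ m = O)) ->
  ((forall n, snd (p n) = 0) -> snd sig = 0 -> snd be = 0) -> snd h0 = 0 ->
  (forall n, (fden (- sig) n * fsol p (logr be m) (- sig) h0 (S n) + conv p (fsol p (logr be m) (- sig) h0) n)%C = logr be m n) ->
  (- sig * h0 + be * 0 ^ m <> 0)%C ->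
  frob p R0 sig be m h1 (fsol p (logr be m) (- sig)%C h0).
Proof using HR Hp Hsig.
intros Hbe Hh0 Hbr Hr0 Heq HW. set (h2 := fsol p (logr be m) (- sig)%C h0) in *.
assert (C2 : cvr h2 R0). { apply fsol_cvr; auto. apply logr_cvr. }
assert (E2 : forall z, Cmod z < R0 -> (z * (z * PS (dps (dps h2)) z + (1 - sig) * PS (dps h2) z + PS p z * PS h2 z))%C =
     (- be * (z ^ m * (RtoC (INR m) * PS h1 z + 2 * (z * PS (dps h1) z))))%C).
{ intros z Hz. assert (F := fuchs_eq p (logr be m) (- sig)%C h0 R0 z HR Hp (logr_cvr be m) Hz Heq). cbv zeta in F. fold h2 in F.
  change (1 + - sig)%C with (1 - sig)%C in F. rewrite F.
  rewrite <- (PS_rsh _ R0 z (logr_cvr be m) Hz).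
  transitivity (PS (rshn m (tser be m)) z).
  - apply PS_ext. intros [|n]; auto. simpl. destruct m as [|m]; simpl; auto. unfold tser. simpl INR. ring.
  - rewrite (PS_rshn m _ R0 z (tser_cvr be m) Hz), tser_PS by auto. ring. }
split; auto.
- intros Hpr Hs. assert (Hb := Hbr Hpr Hs). split; auto.
  assert (R1 : forall n, snd (h1 n) = 0) by (apply fsol_real; auto).
  split; auto. apply fsol_real; auto. apply logr_real; auto. simpl. rewrite Hs. ring.
- set (Ef := fun z => (z * (PS h1 z * PS (dps h2) z - PS h2 z * PS (dps h1) z) - sig * (PS h1 z * PS h2 z) + be * z ^ m * (PS h1 z * PS h1 z))%C).
  assert (D : forall z, Cmod z < R0 -> exists l, cder Ef z l /\ (z * l)%C = 0).
  { intros z Hz. assert (C1' := cvr_dps _ _ h1_cvr). assert (C2' := cvr_dps _ _ C2).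
    assert (D1 := PS_cder h1 R0 z h1_cvr Hz). assert (D2 := PS_cder h2 R0 z C2 Hz).
    assert (D1' := PS_cder _ R0 z C1' Hz). assert (D2' := PS_cder _ R0 z C2' Hz).
    eexists. split.
    - unfold Ef. apply (cder_plus (fun z => z * (PS h1 z * PS (dps h2) z - PS h2 z * PS (dps h1) z) - sig * (PS h1 z * PS h2 z))%C (fun z => be * z ^ m * (PS h1 z * PS h1 z))%C).
      + apply (cder_minus (fun z => z * (PS h1 z * PS (dps h2) z - PS h2 z * PS (dps h1) z))%C).
        * apply cder_mult. apply cder_id. apply (cder_minus (fun z => PS h1 z * PS (dps h2) z)%C); apply cder_mult; eauto.
        * apply cder_scal. apply cder_mult; eauto.
      + apply (cder_mult (fun z => be * z ^ m)%C (fun z => PS h1 z * PS h1 z)%C). apply cder_scal. apply cder_pow. apply cder_mult; eauto.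
    - cbv beta. assert (X1 := h1_eq z Hz). assert (X2 := E2 z Hz).
      set (H1 := PS h1 z) in *. set (H2 := PS h2 z) in *. set (H1' := PS (dps h1) z) in *. set (H2' := PS (dps h2) z) in *.
      set (H1'' := PS (dps (dps h1)) z) in *. set (H2'' := PS (dps (dps h2)) z) in *. set (P := PS p z) in *.
      assert (Zm : (z * (INR m * z ^ pred m))%C = (INR m * z ^ m)%C). { destruct m; simpl; ring. }
      set (zm := (z ^ m)%C) in *. set (zp := (z ^ pred m)%C) in *. set (q := RtoC (INR m)) in *.
      (* Multiples of the two equations and of [z m z ^ (m-1) = m z ^ m] are added, which turns the
         claim into an identity of polynomials. *)
      match goal with |- ?X = _ => transitivity (X + (H2 * z) * (z * H1'' + (1 + sig) * H1' + P * H1)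
         + H1 * (- be * (zm * (q * H1 + 2 * (z * H1'))) - z * (z * H2'' + (1 - sig) * H2' + P * H2)) + be * H1 * H1 * (q * zm - z * (q * zp)))%C end.
      + rewrite X1, X2, Zm. ring.
      + ring. }
  destruct (holo_PS Ef 0 R0 HR) as [c [Cc [Ec _]]].
  { intros z Hz. replace (z - 0)%C with z in Hz by ring. destruct (D z Hz) as [l [Hl _]]. eauto. }
  assert (Ec' : forall z, Cmod z < R0 -> Ef z = PS c z). { intros z Hz. rewrite Ec; replace (z - 0)%C with z by ring; auto. }
  assert (Dc : forall n, dps c n = 0).
  { apply (PS_zero_coef _ R0); auto. apply cvr_dps; auto. intros d Hd.
    min_le d R0 B1 B2. assert (B0 : 0 < Rmin d R0) by (apply Rmin_pos; auto).
    exists (RtoC (Rmin d R0 / 2)). assert (Cw : Cmod (RtoC (Rmin d R0 / 2)) = Rmin d R0 / 2) by (rewrite Cmod_R, Rabs_pos_eq; lra).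
    set (w := RtoC (Rmin d R0 / 2)) in *. rewrite Cw. split. lra.
    destruct (D w ltac:(lra)) as [l [Hl Hl0]].
    assert (El : PS (dps c) w = l).
    { apply (cder_unique Ef w); auto. apply cder_ext with (PS c). 2: apply (PS_cder c R0); auto; lra.
      exists (R0 - Cmod w). split. lra. intros y Hy. symmetry. apply Ec'. assert (T := Cmod_triangle w (y - w)). replace (w + (y - w))%C with y in T by ring. lra. }
    rewrite El. assert (Hw : w <> 0) by (apply Cmod_gt_0; lra). replace l with (/ w * (w * l))%C by (field; auto). rewrite Hl0. ring. }
  exists (- sig * h0 + be * 0 ^ m)%C. split; auto.
  intros z Hz. change (Ef z = (- sig * h0 + be * 0 ^ m)%C).
  assert (E0 : Ef 0 = (- sig * h0 + be * 0 ^ m)%C).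
  { unfold Ef. rewrite !PS_0. change (h1 O) with (RtoC 1). change (h2 O) with h0. ring. }
  rewrite <- E0, !Ec', (PS_shift c R0 z Cc Hz), PS_0; auto. 2: rewrite Cmod_0; auto.
  rewrite (PS_ext (fun n => c (S n)) (fun _ => 0) z), PS_zero. ring.
  intros n. specialize (Dc n). unfold dps in Dc.
  assert (Hn : RtoC (INR (S n)) <> 0) by (apply RtoC_neq, not_0_INR; lia).
  replace (c (S n)) with (/ RtoC (INR (S n)) * (RtoC (INR (S n)) * c (S n)))%C by (field; auto). rewrite Dc. ring.
Qed.

(** Three cases for the difference [sig] of the exponents. If it is [0], the logarithm is forced and
    [be = 1]. If it is a positive integer, solvability at the resonant index determines [be].
    Otherwise there is no resonance and no logarithm. *)
Theorem frobenius : exists be m h2, frob p R0 sig be m h1 h2.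
Proof using HR Hp Hsig.
assert (Hn : forall n, RtoC (INR (S n)) <> 0) by (intros; apply RtoC_neq, not_0_INR; lia).
assert (H10 : (1 : C) <> 0) by (apply RtoC_neq; lra).
destruct (classic (exists m, sig = RtoC (INR m))) as [[[|m] Hm]|Hno].
- assert (Hm0 : sig = 0) by (rewrite Hm; auto).
  exists 1, O, (fsol p (logr 1 O) (- sig)%C 0). apply frob_assemble; auto.
  + intros n. apply fsol_eq. unfold fden. rewrite Hm0. replace (RtoC (INR (S n)) + - 0)%C with (RtoC (INR (S n))) by ring. apply Cmult_neq_0; auto.
  + rewrite Hm0. simpl. replace (- 0 * 0 + 1 * 1)%C with (1 : C) by ring. auto.
- set (hh := fsol p (fun _ => 0) (- sig)%C 1).
  (* At index [m] the factor [fden] vanishes, so the recursion demands that [conv p hh m] equal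
     [- be (m + 1)]. The coefficients up to that index do not involve [be], so those of the solution
     [hh] without logarithm may be used. *)
  set (be := (- conv p hh m / RtoC (INR (S m)))%C).
  exists be, (S m), (fsol p (logr be (S m)) (- sig)%C 1).
  assert (Lr : forall n, (n < m)%nat -> logr be (S m) n = 0). { intros n H. unfold logr. apply rshn_lt. lia. }
  assert (Same : forall n k, (k <= n)%nat -> (n <= m)%nat -> fsol p (logr be (S m)) (- sig)%C 1 k = hh k).
  { induction n as [|n IH]; intros k Hk Hkm. replace k with O by lia. auto.
    destruct (Nat.eq_dec k (S n)) as [->|]. 2: apply IH; lia.
    unfold hh. rewrite !fsol_S. unfold fval. destruct (Ceq_dec (fden (- sig) n) 0); auto.
    rewrite Lr by lia. rewrite (conv_ext p _ (fsol p (fun _ => 0) (- sig)%C 1) n). auto. intros; apply IH; lia. }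
  apply frob_assemble; auto.
  + intros Hpr Hs. assert (X : snd (conv p hh m) = 0).
    { apply conv_real; auto. intros k _. apply fsol_real; auto. simpl. rewrite Hs. ring. }
    unfold be. set (x := conv p hh m) in *. destruct x as [x1 x2]. simpl in X. subst x2.
    unfold Cdiv, Cmult, Cinv, Copp, RtoC. cbn [fst snd]. unfold Rdiv. ring.
  + intros n. destruct (Nat.eq_dec n m) as [->|Hnm].
    * assert (Fd : fden (- sig) m = 0). { unfold fden. rewrite Hm. ring. }
      rewrite Fd. rewrite (conv_ext p _ hh m) by (intros; apply (Same m); auto).
      unfold logr. assert (X := rshn_add (S m) (fun k => - be * ((2 * INR k + INR (S m)) * h1 k))%C 0). rewrite Nat.add_0_r in X. rewrite X. change (h1 O) with (RtoC 1).
      unfold be. simpl (INR 0). field. apply Hn.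
    * apply fsol_eq. unfold fden. apply Cmult_neq_0; auto. rewrite Hm. intros E. apply Hnm.
      assert (E' : INR (S n) = INR (S m)). { apply RtoC_inj. replace (RtoC (INR (S n))) with (RtoC (INR (S n)) + - RtoC (INR (S m)) + RtoC (INR (S m)))%C by ring. rewrite E. ring. }
      apply INR_eq in E'. lia.
  + simpl. replace (- sig * 1 + be * (0 * 0 ^ m))%C with (- sig)%C by ring. rewrite Hm. intros E. apply (Hn m).
    replace (RtoC (INR (S m))) with (- - RtoC (INR (S m)))%C by ring. rewrite E. ring.
- exists 0, O, (fsol p (logr 0 O) (- sig)%C 1). apply frob_assemble; auto.
  + intros E. elim E; auto.
  + intros n. apply fsol_eq. unfold fden. apply Cmult_neq_0; auto. intros E. apply Hno. exists (S n).
    replace sig with (RtoC (INR (S n)) - (RtoC (INR (S n)) + - sig))%C by ring. rewrite E. ring.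
  + intros E. apply Hno. exists O. simpl in E. replace sig with (- (- sig * 1 + 0 * 1))%C by ring. rewrite E. simpl. ring.
Qed.
End FrobeniusPair.

(** * Complex powers on the upper half plane *)

Lemma fder_const c z : fder (fun _ => c) z 0 0.
Proof. intros e He. exists 1. split. lra. intros w _. match goal with |- Rabs ?X <= _ => replace X with 0 by ring end.
rewrite Rabs_R0. apply Rmult_le_pos. lra. apply Cmod_ge_0. Qed.

Lemma fder_fst (z : C) : fder fst z 1 0.
Proof. intros e He. exists 1. split. lra. intros w _. match goal with |- Rabs ?X <= _ => replace X with 0 by ring end.
rewrite Rabs_R0. apply Rmult_le_pos. lra. apply Cmod_ge_0. Qed.

Lemma fder_snd (z : C) : fder snd z 0 1.
Proof. intros e He. exists 1. split. lra. intros w _. match goal with |- Rabs ?X <= _ => replace X with 0 by ring end.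
rewrite Rabs_R0. apply Rmult_le_pos. lra. apply Cmod_ge_0. Qed.

Lemma cder_cexp w : cder cexp w (cexp w).
Proof.
assert (X := fder_comp1 fst exp w _ _ _ (fder_fst w) (is_derive_exp (fst w))).
assert (Y := fder_comp1 snd cos w _ _ _ (fder_snd w) (is_derive_cos (snd w))).
assert (Z := fder_comp1 snd sin w _ _ _ (fder_snd w) (is_derive_sin (snd w))).
apply fder_cder.
- eapply fder_eq. 3: apply (fder_mult X Y). cbv beta; unfold Re, Im; ring. cbv beta; unfold Re, Im; ring.
- eapply fder_eq. 3: apply (fder_mult X Z). cbv beta; unfold Re, Im; ring. cbv beta; unfold Re, Im; ring.
Qed.

Lemma cexp_plus a b : cexp (a + b) = (cexp a * cexp b)%C.
Proof. unfold cexp, Re, Im. simpl. rewrite exp_plus, cos_plus, sin_plus. Cring. Qed.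

Lemma Cmod_cexp w : Cmod (cexp w) = exp (fst w).
Proof.
replace (cexp w) with (RtoC (exp (fst w)) * cis (snd w))%C.
rewrite Cmod_mult, Cmod_cis, Cmod_R, Rabs_pos_eq, Rmult_1_r; auto. apply Rlt_le, exp_pos.
unfold cexp, cis, Re, Im. Cring.
Qed.

Lemma Cmod_pos_snd z : 0 < snd z -> 0 < Cmod z.
Proof. intros H. eapply Rlt_le_trans. apply H. eapply Rle_trans. apply Rle_abs. apply Cmod_snd. Qed.

Lemma ratio_le1 z : 0 < Cmod z -> -1 <= fst z / Cmod z <= 1.
Proof.
intros Hz. assert (T := Cmod_fst z). apply Rabs_le_between in T. split.
apply (Rle_div_r (-1) _ (Cmod z)); lra. apply (Rle_div_l _ 1 (Cmod z)); lra.
Qed.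

Lemma sqrt_ratio z : 0 < Cmod z -> 0 <= snd z -> sqrt (1 - (fst z / Cmod z) ^ 2) = snd z / Cmod z.
Proof.
intros Hz Hs. replace (1 - (fst z / Cmod z) ^ 2) with ((snd z / Cmod z) ^ 2).
apply sqrt_pow2. apply Rdiv_le_0_compat; auto.
assert (Q := Cmod2_alt z). unfold Re, Im in Q. replace (fst z / Cmod z) with (fst z * / Cmod z) by auto.
apply Rmult_eq_reg_r with (Cmod z ^ 2). 2: { apply Rgt_not_eq, pow_lt; auto. }
replace ((snd z / Cmod z) ^ 2 * Cmod z ^ 2) with (snd z ^ 2) by (field; lra).
replace ((1 - (fst z * / Cmod z) ^ 2) * Cmod z ^ 2) with (Cmod z ^ 2 - fst z ^ 2) by (field; lra). lra.
Qed.

Lemma cexp_clog (z : C) : 0 < Cmod z -> 0 <= snd z -> cexp (clog z) = z.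
Proof.
intros Hz Hs. unfold cexp, clog, Re, Im. cbn [fst snd].
assert (B := ratio_le1 z Hz).
rewrite exp_ln, cos_acos, sin_acos by auto. unfold Rsqr.
replace (1 - fst z / Cmod z * (fst z / Cmod z)) with (1 - (fst z / Cmod z) ^ 2) by ring.
rewrite sqrt_ratio by auto. apply injective_projections; simpl; field; lra.
Qed.

(** On the open half plane the argument becomes a composition of smooth functions with simple
    derivatives. *)
Lemma arg_atan (z : C) : 0 < snd z -> acos (fst z / Cmod z) = PI / 2 - atan (fst z / snd z).
Proof.
intros Hs. assert (Hz := Cmod_pos_snd z Hs). assert (Q := Cmod2_alt z). unfold Re, Im in Q.
assert (B : -1 < fst z / Cmod z < 1).
{ assert (Rabs (fst z) < Cmod z). { apply Rsqr_incrst_0. 2: apply Rabs_pos. 2: lra. rewrite <- Rsqr_abs. unfold Rsqr. nra. }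
  apply Rabs_lt_between in H. split. apply (Rlt_div_r (-1) _ (Cmod z)); lra. apply (Rlt_div_l _ 1 (Cmod z)); lra. }
rewrite acos_asin by lra. rewrite asin_atan by auto. unfold Rsqr.
replace (1 - fst z / Cmod z * (fst z / Cmod z)) with (1 - (fst z / Cmod z) ^ 2) by ring.
rewrite sqrt_ratio by lra. replace (fst z / Cmod z / (snd z / Cmod z)) with (fst z / snd z) by (field; lra). reflexivity.
Qed.

Lemma cder_clog (z : C) : 0 < snd z -> cder clog z (/ z)%C.
Proof.
intros Hs. assert (Hz := Cmod_pos_snd z Hs).
set (q := fst z * fst z + snd z * snd z). assert (Hq : 0 < q) by (unfold q; nra).
apply cder_ext with (fun z => (/ 2 * ln (fst z * fst z + snd z * snd z), PI / 2 + (-1) * atan (fst z * / snd z)) : C).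
{ exists (snd z). split; auto. intros w Hw. assert (T := Cmod_snd (w - z)). change (Rabs (snd w - snd z) <= Cmod (w - z)) in T.
  apply Rabs_le_between in T. assert (Hw' : 0 < snd w) by lra. assert (Hwm := Cmod_pos_snd w Hw').
  unfold clog, Re, Im. rewrite arg_atan by auto. assert (Q := Cmod2_alt w). unfold Re, Im in Q.
  apply injective_projections; simpl. 2: unfold Rdiv; ring.
  replace (fst w * fst w + snd w * snd w) with (Cmod w * Cmod w) by lra. rewrite ln_mult by auto. field. }
assert (F1 : fder (fun z => fst z * fst z + snd z * snd z) z (2 * fst z) (2 * snd z)).
{ eapply fder_eq. 3: apply (fder_plus (fder_mult (fder_fst z) (fder_fst z)) (fder_mult (fder_snd z) (fder_snd z))). ring. ring. }
assert (F2 : fder (fun z => ln (fst z * fst z + snd z * snd z)) z (/ q * (2 * fst z)) (/ q * (2 * snd z))).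
{ apply (fder_comp1 (fun z => fst z * fst z + snd z * snd z) ln); auto. apply is_derive_ln. auto. }
assert (F3 : fder (fun z => / snd z) z (- / snd z ^ 2 * 0) (- / snd z ^ 2 * 1)).
{ apply (fder_comp1 snd (fun x => / x)). apply fder_snd. auto_derive. lra. field. lra. }
assert (F4 := fder_mult (fder_fst z) F3). cbv beta in F4.
assert (F5 : fder (fun z => atan (fst z * / snd z)) z (snd z / q) (- fst z / q)).
{ eapply fder_eq. 3: apply (fder_comp1 (fun z => fst z * / snd z) atan _ _ _ (/ (1 + (fst z * / snd z) ^ 2)) F4).
  - unfold q. field. repeat split; try lra; apply Rgt_not_eq; nra.
  - unfold q. field. repeat split; try lra; apply Rgt_not_eq; nra.
  - cbv beta. assert (D := derivable_pt_lim_atan (fst z * / snd z)).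
    apply is_derive_Reals. exact D. }
assert (F0 := fder_const (PI / 2) z).
assert (Ei : (/ z)%C = (fst z / q, - snd z / q)).
{ unfold Cinv. replace (fst z ^ 2 + snd z ^ 2) with q by (unfold q; ring). auto. }
rewrite Ei. apply fder_cder; cbn [fst snd].
- eapply fder_eq. 3: apply (fder_scal (/ 2) F2). field. lra. field. lra.
- eapply fder_eq. 3: apply (fder_plus F0 (fder_scal (-1) F5)). field. lra. field. lra.
Qed.

(** The power with complex exponent; [cpow z gamma] is the case of a real one. *)
Definition zp (a z : C) : C := cexp (a * clog z).

Lemma cder_zp (a z : C) : 0 < snd z -> cder (zp a) z (a * zp a z / z)%C.
Proof.
intros Hs. assert (Hz : z <> 0) by (apply Cmod_gt_0, Cmod_pos_snd; auto).
eapply cder_eq. 2: apply (cder_comp cexp (fun z => a * clog z)%C). 2: apply cder_scal, cder_clog; auto. 2: apply cder_cexp.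
unfold zp. field. auto.
Qed.

Lemma zp_plus a b z : zp (a + b) z = (zp a z * zp b z)%C.
Proof. unfold zp. rewrite <- cexp_plus. f_equal. ring. Qed.

Lemma zp_0 (z : C) : zp 0 z = 1.
Proof. unfold zp. replace (0 * clog z)%C with (RtoC 0) by ring. unfold cexp, Re, Im. simpl. rewrite exp_0, cos_0, sin_0. Cring. Qed.

Lemma zp_1 (z : C) : 0 < snd z -> zp 1 z = z.
Proof. intros Hs. unfold zp. replace (1 * clog z)%C with (clog z) by ring. apply cexp_clog. apply Cmod_pos_snd; auto. lra. Qed.

Lemma zp_INR n (z : C) : 0 < snd z -> zp (RtoC (INR n)) z = (z ^ n)%C.
Proof.
intros Hs. induction n as [|n IH]. apply zp_0. rewrite S_INR, RtoC_plus, zp_plus, IH, zp_1 by auto. simpl. ring.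
Qed.

Lemma zp_neq0 a z : zp a z <> 0.
Proof. apply Cmod_gt_0. unfold zp. rewrite Cmod_cexp. apply exp_pos. Qed.

Lemma Cmod_zp_R (a : R) z : Cmod (zp (RtoC a) z) = exp (a * ln (Cmod z)).
Proof. unfold zp. rewrite Cmod_cexp. unfold clog. simpl. f_equal. ring. Qed.

Lemma Cmod_zp_bound (a z : C) : Cmod (zp a z) <= exp (fst a * ln (Cmod z)) * exp (Rabs (snd a) * PI).
Proof.
unfold zp. rewrite Cmod_cexp, <- exp_plus. apply exp_le_exp. unfold clog, Cmult. cbn [fst snd].
assert (B := acos_bound (Re z / Cmod z)).
assert (T := Rle_abs (- snd a)). rewrite Rabs_Ropp in T. assert (P := Rabs_pos (snd a)). nra.
Qed.

(** * Frobenius solutions of y'' + Q y / 2 = 0 *)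

Section Solutions.
Variables (b h1 h2 : nat -> C) (R0 : R) (sig be : C) (m : nat).
Hypothesis HR : 0 < R0.
Hypothesis Hb : cvr b R0.
Let pt (n : nat) := (/ 2 * b (S n))%C.
Hypothesis HF : frob pt R0 sig be m h1 h2.
Hypothesis Hsig : (sig * sig = 1 - 2 * b O)%C.

(** With [Q = b(z) / z ^ 2] the indicial equation is [x (x - 1) + b0 / 2 = 0]. Its roots are
    [(1 + sig) / 2] and [(1 - sig) / 2] by [Hsig], and the other coefficients of [b / 2] form the
    sequence [pt] of the Frobenius equations. *)
Definition sol1 (z : C) : C := (zp ((1 + sig) / 2) z * PS h1 z)%C.
Definition sol1' (z : C) : C := (zp ((1 + sig) / 2) z * ((1 + sig) / 2 * PS h1 z / z + PS (dps h1) z))%C.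
Definition sol2 (z : C) : C := (zp ((1 - sig) / 2) z * PS h2 z + be * (sol1 z * clog z))%C.
Definition sol2' (z : C) : C := (zp ((1 - sig) / 2) z * ((1 - sig) / 2 * PS h2 z / z + PS (dps h2) z) + be * (sol1' z * clog z + sol1 z / z))%C.

Let C2 : (2 : C) <> 0. Proof. apply RtoC_neq; lra. Qed.
Let c1 := fr_c1 HF.
Let c2 := fr_c2 HF.

Section Point.
Variable z : C.
Hypothesis Hz : HD R0 z.

Let zn : z <> 0. Proof. apply Cmod_gt_0, Cmod_pos_snd, Hz. Qed.
Let zR : Cmod z < R0. Proof. apply Hz. Qed.
Let zs : 0 < snd z. Proof. apply Hz. Qed.

Lemma zp_AB : (zp ((1 + sig) / 2) z * zp ((1 - sig) / 2) z)%C = z.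
Proof using Hz. rewrite <- zp_plus. replace ((1 + sig) / 2 + (1 - sig) / 2)%C with (RtoC 1) by (field; auto). apply zp_1; auto. Qed.

Lemma zp_AB_log : be <> 0 -> zp ((1 + sig) / 2) z = (zp ((1 - sig) / 2) z * z ^ m)%C.
Proof using Hz HF. intros Hbe. rewrite <- (zp_INR m z zs), <- zp_plus. f_equal. rewrite <- (fr_be HF Hbe). field; auto. Qed.

Lemma cder_sol1 : cder sol1 z (sol1' z).
Proof using HF Hz.
eapply cder_eq. 2: apply cder_mult. 2: apply cder_zp; auto. 2: apply (PS_cder _ R0); auto.
unfold sol1'. field. auto.
Qed.

Lemma cder_sol2 : cder sol2 z (sol2' z).
Proof using HF Hz.
eapply cder_eq. 2: { apply (cder_plus (fun z => zp ((1 - sig) / 2) z * PS h2 z)%C (fun z => be * (sol1 z * clog z))%C).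
  apply cder_mult. apply cder_zp; auto. apply (PS_cder _ R0); auto. apply cder_scal. apply cder_mult. apply cder_sol1. apply cder_clog; auto. }
unfold sol2'. field. auto.
Qed.

Lemma PS_b_split : PS b z = (b O + 2 * (z * PS pt z))%C.
Proof using Hb Hz.
rewrite (PS_shift b R0 z Hb zR). unfold pt. rewrite (PS_scal (/ 2)%C (fun n => b (S n)) R0 z (cvr_shift _ _ Hb) zR). field; auto.
Qed.

Lemma cder_sol1' : cder sol1' z (- (PS b z / (2 * (z * z))) * sol1 z)%C.
Proof using HF Hz Hb Hsig.
assert (D1 := PS_cder h1 R0 z c1 zR). assert (D2 := PS_cder _ R0 z (cvr_dps _ _ c1) zR).
eapply cder_eq. 2: { apply cder_mult. apply cder_zp; auto. apply (cder_plus (fun z => (1 + sig) / 2 * PS h1 z / z)%C).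
  apply (cder_div (fun z => (1 + sig) / 2 * PS h1 z)%C (fun z => z)). apply cder_scal; eauto. apply cder_id. auto. exact D2. }
cbv beta. assert (E := fr_e1 HF z zR). rewrite PS_b_split. unfold sol1.
set (A := zp _ z) in *. set (H1 := PS h1 z) in *. set (H1' := PS (dps h1) z) in *. set (H1'' := PS (dps (dps h1)) z) in *. set (P := PS pt z) in *.
replace (b O) with ((1 - sig * sig) / 2)%C by (rewrite Hsig; field; auto).
transitivity (A / z * (z * H1'' + (1 + sig) * H1' + P * H1) + - ((1 - sig * sig) / 2 + 2 * (z * P)) / (2 * (z * z)) * (A * H1))%C.
- field. auto.
- rewrite E. field. auto.
Qed.

Lemma cder_sol2' : cder sol2' z (- (PS b z / (2 * (z * z))) * sol2 z)%C.
Proof using HF Hz Hb Hsig.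
assert (D1 := PS_cder h2 R0 z c2 zR). assert (D2 := PS_cder _ R0 z (cvr_dps _ _ c2) zR).
assert (S1 := cder_sol1). assert (S1' := cder_sol1').
eapply cder_eq. 2: {
  apply (cder_plus (fun z => zp ((1 - sig) / 2) z * ((1 - sig) / 2 * PS h2 z / z + PS (dps h2) z))%C (fun z => be * (sol1' z * clog z + sol1 z / z))%C).
  - apply cder_mult. apply cder_zp; auto. apply (cder_plus (fun z => (1 - sig) / 2 * PS h2 z / z)%C).
    apply (cder_div (fun z => (1 - sig) / 2 * PS h2 z)%C (fun z => z)). apply cder_scal; eauto. apply cder_id. auto. exact D2.
  - apply cder_scal. apply (cder_plus (fun z => sol1' z * clog z)%C). apply cder_mult. exact S1'. apply cder_clog; auto.
    apply (cder_div sol1 (fun z => z)). exact S1. apply cder_id. auto. }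
cbv beta. assert (E := fr_e2 HF z zR).
unfold sol2. set (y1 := sol1 z) in *. set (L := clog z) in *.
assert (Ey1 : y1 = (zp ((1 + sig) / 2) z * PS h1 z)%C) by reflexivity.
assert (Ey1' : sol1' z = (zp ((1 + sig) / 2) z * ((1 + sig) / 2 * PS h1 z / z + PS (dps h1) z))%C) by reflexivity.
set (dy1 := sol1' z) in *.
assert (Ezz : (z * z)%C <> 0) by (apply Cmult_neq_0; auto).
(* The derivatives that fall on the logarithm cancel the right side of [fr_e2]; for [be] different
   from [0] this rests on [sig = m]. *)
assert (Key : (zp ((1 - sig) / 2) z * (- be * (z ^ m * (RtoC (INR m) * PS h1 z + 2 * (z * PS (dps h1) z))))
   + be * (2 * z * dy1 - y1))%C = 0).
{ destruct (Ceq_dec be 0) as [->|Hbe]. ring.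
  assert (A := zp_AB_log Hbe). assert (Sm := fr_be HF Hbe). rewrite Ey1, Ey1', A, <- Sm. field. auto. }
rewrite PS_b_split.
set (B := zp ((1 - sig) / 2) z) in *. set (H2 := PS h2 z) in *. set (H2' := PS (dps h2) z) in *. set (H2'' := PS (dps (dps h2)) z) in *. set (P := PS pt z) in *.
set (rhs := (- be * (z ^ m * (RtoC (INR m) * PS h1 z + 2 * (z * PS (dps h1) z))))%C) in *.
replace (b O) with ((1 - sig * sig) / 2)%C by (rewrite Hsig; field; auto).
transitivity (B / (z * z) * (z * (z * H2'' + (1 - sig) * H2' + P * H2) - rhs) + (B * rhs + be * (2 * z * dy1 - y1)) / (z * z)
  + - (((1 - sig * sig) / 2 + 2 * (z * P)) / (2 * (z * z))) * (B * H2 + be * (y1 * L)))%C.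
- field. auto.
- rewrite E, Key. field. auto.
Qed.

Lemma sol_wronskian W : (forall z, Cmod z < R0 ->
     (z * (PS h1 z * PS (dps h2) z - PS h2 z * PS (dps h1) z) - sig * (PS h1 z * PS h2 z) + be * z ^ m * (PS h1 z * PS h1 z))%C = W) ->
  (sol1 z * sol2' z - sol2 z * sol1' z)%C = W.
Proof using HF Hz.
intros HW. rewrite <- (HW z zR). assert (AB := zp_AB). unfold sol2, sol2', sol1, sol1'.
set (L := clog z).
assert (Key : (be * (zp ((1 + sig) / 2) z * zp ((1 + sig) / 2) z))%C = (be * (z * z ^ m))%C).
{ destruct (Ceq_dec be 0) as [->|Hbe]. ring. assert (A := zp_AB_log Hbe). set (P := zp ((1 + sig) / 2) z) in *. transitivity (be * (P * zp ((1 - sig) / 2) z * z ^ m))%C. 2: rewrite AB; auto. rewrite A at 2. ring. }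
set (A := zp ((1 + sig) / 2) z) in *. set (B := zp ((1 - sig) / 2) z) in *.
set (H2 := PS h2 z) in *. set (H2' := PS (dps h2) z) in *. set (H1 := PS h1 z) in *. set (H1' := PS (dps h1) z) in *.
transitivity ((A * B) / z * (z * (H1 * H2' - H2 * H1') - sig * (H1 * H2)) + (be * (A * A)) / z * (H1 * H1))%C.
- field. auto.
- rewrite AB, Key. field. auto.
Qed.
End Point.
End Solutions.

(** * The developing map as a quotient of solutions *)

Lemma cder_0_const f p R0 z : (forall w, Cmod (w - p) < R0 -> cder f w 0) -> Cmod (z - p) < R0 -> f z = f p.
Proof.
intros H Hz. set (g := fun t => (p + RtoC t * (z - p))%C).
assert (Dg : forall t, cpder g t (z - p)%C).
{ intros t. split; unfold g; simpl; auto_derive; auto; ring. }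
assert (D : forall t, 0 <= t <= 1 -> cpder (fun t => f (g t)) t 0).
{ intros t Ht. assert (Hg : Cmod (g t - p) < R0).
  { unfold g. replace (p + RtoC t * (z - p) - p)%C with (RtoC t * (z - p))%C by ring. rewrite Cmod_mult, Cmod_R, Rabs_pos_eq by lra.
    generalize (Cmod_ge_0 (z - p)). nra. }
  assert (X := cder_path f g t 0 _ (H _ Hg) (Dg t)). rewrite Cmult_0_l in X. exact X. }
assert (E0 : g 0 = p) by (unfold g; ring). assert (E1 : g 1 = z) by (unfold g; ring).
rewrite <- E0 at 1. rewrite <- E1.
assert (Ct : forall h : R -> R, (forall t, 0 <= t <= 1 -> is_derive h t 0) -> h 0 = h 1).
{ intros h Hh. apply Rle_antisym. apply (der_le h (fun _ => 0)); auto. lra. intros; lra.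
  apply Ropp_le_cancel. apply (der_le (fun x => - h x) (fun _ => 0)). lra.
  2: intros; lra. intros x Hx. replace 0 with (- 0) by ring. apply (is_derive_opp h). auto. }
apply injective_projections; symmetry.
- apply (Ct (fun t => fst (f (g t)))). intros t Ht. apply (D t Ht).
- apply (Ct (fun t => snd (f (g t)))). intros t Ht. apply (D t Ht).
Qed.

(** Multiplication by [z - p] makes the function [o(z - p)], the situation of [removable_PS2]. *)
Lemma removable_zero f p R0 : 0 < R0 -> (forall z, 0 < Cmod (z - p) < R0 -> exists l, cder f z l) ->
  (forall e, 0 < e -> exists d, 0 < d /\ forall z, 0 < Cmod (z - p) < d -> Cmod (f z) <= e) -> f p = 0 ->
  exists l, cder f p l.
Proof.
intros HR Hd Hs Hp.
destruct (removable_PS2 (fun z => z * f (p + z))%C R0 HR) as [b [Cb Eb]].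
- intros z Hz. destruct (Hd (p + z)%C) as [l Hl]. replace (p + z - p)%C with z by ring; auto.
  eexists. apply cder_mult. apply cder_id. apply cder_shift. eauto.
- intros e He. destruct (Hs e He) as [d [Hd0 F]]. exists d. split; auto. intros z Hz. rewrite Cmod_mult, Rmult_comm.
  apply Rmult_le_compat_r. apply Cmod_ge_0. apply F. replace (p + z - p)%C with z by ring; auto.
- assert (D : cder (fun w => (w - p) * PS b (w - p))%C p (1 * PS b (p - p) + (p - p) * (PS (dps b) (p - p) * 1))%C).
  { assert (Dm : cder (fun w => w - p)%C p 1). { eapply cder_eq. 2: apply cder_minus. 2: apply cder_id. 2: apply cder_const. ring. }
  apply (cder_mult (fun w => w - p)%C (fun w => PS b (w - p))%C p _ _ Dm).
    apply (cder_comp (PS b) (fun w => w - p)%C p _ _ Dm). apply (PS_cder b R0); auto.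
    rewrite Cmod_diag. auto. }
  eexists. eapply cder_ext. 2: exact D. exists R0. split; auto. intros w Hw.
  destruct (Ceq_dec (w - p)%C 0) as [E|E].
  + rewrite E. replace w with p. rewrite Hp. ring. replace w with (p + (w - p))%C by ring. rewrite E. ring.
  + assert (0 < Cmod (w - p)) by (apply Cmod_gt_0; auto). assert (X := Eb (w - p)%C ltac:(lra)). cbv beta in X.
    replace (p + (w - p))%C with w in X by ring.
    replace (f w) with (/ (w - p) * ((w - p) * f w))%C by (field; auto). rewrite X. field. auto.
Qed.

Section Schwarz.
Variables (G G1 G2 G3 : C -> C) (K : R) (v vs vt vss vst vts vtt : C -> R) (p : C) (R0 : R).
Hypothesis HR : 0 < R0.
Let U (z : C) := Cmod (z - p) < R0.
Hypothesis D1 : forall z, U z -> cder G z (G1 z).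
Hypothesis D2 : forall z, U z -> cder G1 z (G2 z).
Hypothesis D3 : forall z, U z -> cder G2 z (G3 z).
Hypothesis N1 : forall z, U z -> G1 z <> 0.
Hypothesis NT : forall z, U z -> 0 < 1 + K * Cmod (G z) ^ 2.
Hypothesis Hv : forall z, U z -> v z = ln (4 * Cmod (G1 z) ^ 2 / (1 + K * Cmod (G z) ^ 2) ^ 2).
Hypothesis HC : C2on U v vs vt vss vst vts vtt.

Let N z := fst (G1 z) * fst (G1 z) + snd (G1 z) * snd (G1 z).
Let T z := 1 + K * (fst (G z) * fst (G z) + snd (G z) * snd (G z)).

Let U_open z : U z -> exists d, 0 < d /\ forall w, Cmod (w - z) < d -> U w.
Proof.
intros H. exists (R0 - Cmod (z - p)). unfold U in *. split. lra. intros w Hw.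
replace (w - p)%C with ((w - z) + (z - p))%C by ring. eapply Rle_lt_trans. apply Cmod_triangle. lra.
Qed.

Let Npos z : U z -> 0 < N z.
Proof. intros H. assert (A := N1 z H). apply Cmod_gt_0 in A. assert (Q := Cmod2_alt (G1 z)). unfold Re, Im, N in *. nra. Qed.

Let Tpos z : U z -> 0 < T z.
Proof. intros H. assert (A := NT z H). assert (Q := Cmod2_alt (G z)). unfold Re, Im, T in *. rewrite Q in A. lra. Qed.

Let v_eq z : U z -> v z = ln 4 + ln (N z) + (-2) * ln (T z).
Proof.
intros H. assert (A := Npos z H). assert (B := Tpos z H). rewrite Hv by auto.
assert (Q := Cmod2_alt (G1 z)). assert (Q' := Cmod2_alt (G z)). unfold Re, Im in *.
replace (Cmod (G1 z) ^ 2) with (N z) by (unfold N; lra). replace (1 + K * Cmod (G z) ^ 2) with (T z) by (rewrite Q'; unfold T; ring).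
rewrite ln_div, ln_mult; try lra. replace (T z ^ 2) with (T z * T z) by ring. rewrite ln_mult by auto. ring. apply pow_lt; auto.
Qed.

Let fderG z : U z -> fder (fun w => fst (G w)) z (fst (G1 z)) (- snd (G1 z)) /\ fder (fun w => snd (G w)) z (snd (G1 z)) (fst (G1 z)).
Proof. intros H. apply cder_fder, D1, H. Qed.
Let fderG1 z : U z -> fder (fun w => fst (G1 w)) z (fst (G2 z)) (- snd (G2 z)) /\ fder (fun w => snd (G1 w)) z (snd (G2 z)) (fst (G2 z)).
Proof. intros H. apply cder_fder, D2, H. Qed.
Let fderG2 z : U z -> fder (fun w => fst (G2 w)) z (fst (G3 z)) (- snd (G3 z)) /\ fder (fun w => snd (G2 w)) z (snd (G3 z)) (fst (G3 z)).
Proof. intros H. apply cder_fder, D3, H. Qed.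

Let Ns z := 2 * (fst (G1 z) * fst (G2 z) + snd (G1 z) * snd (G2 z)).
Let Nt z := 2 * (snd (G1 z) * fst (G2 z) + (-1) * (fst (G1 z) * snd (G2 z))).
Let Ts z := 2 * K * (fst (G z) * fst (G1 z) + snd (G z) * snd (G1 z)).
Let Tt z := 2 * K * (snd (G z) * fst (G1 z) + (-1) * (fst (G z) * snd (G1 z))).

Let fderN z : U z -> fder N z (Ns z) (Nt z).
Proof.
intros H. destruct (fderG1 z H) as [A B]. eapply fder_eq. 3: apply (fder_plus (fder_mult A A) (fder_mult B B)).
unfold Ns; ring. unfold Nt; ring.
Qed.

Let fderT z : U z -> fder T z (Ts z) (Tt z).
Proof.
intros H. destruct (fderG z H) as [A B]. eapply fder_eq. 3: apply (fder_plus (fder_const 1 z) (fder_scal K (fder_plus (fder_mult A A) (fder_mult B B)))).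
unfold Ts; ring. unfold Tt; ring.
Qed.

Lemma fder_unique f z a b a' b' : fder f z a b -> fder f z a' b' -> a = a' /\ b = b'.
Proof.
intros A B. destruct (fder_slices _ _ _ _ A) as [A1 A2]. destruct (fder_slices _ _ _ _ B) as [B1 B2].
split. rewrite <- (is_derive_unique _ _ _ A1). apply (is_derive_unique _ _ _ B1).
rewrite <- (is_derive_unique _ _ _ A2). apply (is_derive_unique _ _ _ B2).
Qed.

Lemma fder_ext f g z a b : (exists d, 0 < d /\ forall w, Cmod (w - z) < d -> f w = g w) -> fder g z a b -> fder f z a b.
Proof.
intros [d [Hd E]] H e He. destruct (H e He) as [d' [Hd' F]]. exists (Rmin d d'). split. apply Rmin_pos; auto.
intros w Hw. min_le d d' A B. assert (E0 : f z = g z) by (apply E; rewrite Cmod_diag; auto).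
rewrite E0, E by lra. apply F. lra.
Qed.

Lemma fder_inv f z a b : f z <> 0 -> fder f z a b -> fder (fun w => / f w) z (- a / (f z * f z)) (- b / (f z * f z)).
Proof.
intros H F. eapply fder_eq. 3: apply (fder_comp1 f (fun x => / x) z a b (- / (f z * f z)) F).
field; auto. field; auto. auto_derive; auto. field; auto.
Qed.

Let vgrad z : U z -> vs z = Ns z * / N z + (-2) * (Ts z * / T z) /\ vt z = Nt z * / N z + (-2) * (Tt z * / T z).
Proof.
intros H. assert (A := Npos z H). assert (B := Tpos z H).
apply (fder_unique v z). apply (c2_f HC); auto.
apply fder_ext with (fun z => ln 4 + ln (N z) + (-2) * ln (T z)).
{ destruct (U_open z H) as [d [Hd O]]. exists d; auto. }
assert (LN := fder_comp1 N ln z _ _ _ (fderN z H) (is_derive_ln _ A)).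
assert (LT := fder_comp1 T ln z _ _ _ (fderT z H) (is_derive_ln _ B)).
eapply fder_eq. 3: apply (fder_plus (fder_plus (fder_const (ln 4) z) LN) (fder_scal (-2) LT)).
ring. ring.
Qed.

Let hess z : U z -> fder vs z (vss z) (vst z) -> fder vt z (vts z) (vtt z) ->
  let a := fst (G1 z) in let b := snd (G1 z) in let c := fst (G2 z) in let d := snd (G2 z) in
  let e := fst (G3 z) in let f := snd (G3 z) in let P := fst (G z) in let Q := snd (G z) in
  let n := N z in let t := T z in
  vss z = 2 * (c * c + a * e + d * d + b * f) / n - Ns z * Ns z / n ^ 2 - 2 * (2 * K * (a * a + P * c + b * b + Q * d) / t - Ts z * Ts z / t ^ 2) /\
  vst z = 2 * (- c * d - a * f + c * d + b * e) / n - Ns z * Nt z / n ^ 2 - 2 * (2 * K * (- b * a - P * d + a * b + Q * c) / t - Ts z * Tt z / t ^ 2) /\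
  vts z = 2 * (d * c + b * e - c * d - a * f) / n - Nt z * Ns z / n ^ 2 - 2 * (2 * K * (b * a + Q * c - a * b - P * d) / t - Tt z * Ts z / t ^ 2) /\
  vtt z = 2 * (c * c - b * f + d * d - a * e) / n - Nt z * Nt z / n ^ 2 - 2 * (2 * K * (a * a - Q * d + b * b - P * c) / t - Tt z * Tt z / t ^ 2).
Proof.
intros H Fs Ft. cbv zeta. assert (A := Npos z H). assert (B := Tpos z H).
destruct (fderG z H) as [FP FQ]. destruct (fderG1 z H) as [Fa Fb]. destruct (fderG2 z H) as [Fc Fd].
assert (IN := fder_inv N z _ _ ltac:(lra) (fderN z H)). assert (IT := fder_inv T z _ _ ltac:(lra) (fderT z H)).
assert (DNs := fder_scal 2 (fder_plus (fder_mult Fa Fc) (fder_mult Fb Fd))).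
assert (DNt := fder_scal 2 (fder_plus (fder_mult Fb Fc) (fder_scal (-1) (fder_mult Fa Fd)))).
assert (DTs := fder_scal (2 * K) (fder_plus (fder_mult FP Fa) (fder_mult FQ Fb))).
assert (DTt := fder_scal (2 * K) (fder_plus (fder_mult FQ Fa) (fder_scal (-1) (fder_mult FP Fb)))).
assert (Es := fder_plus (fder_mult DNs IN) (fder_scal (-2) (fder_mult DTs IT))).
assert (Et := fder_plus (fder_mult DNt IN) (fder_scal (-2) (fder_mult DTt IT))).
destruct (U_open z H) as [d0 [Hd O]].
assert (Es' : fder vs z (vss z) (vst z)) by auto. assert (Et' : fder vt z (vts z) (vtt z)) by auto.
destruct (fder_unique vs z _ _ _ _ Es' (fder_ext vs _ z _ _ (ex_intro _ d0 (conj Hd (fun w Hw => proj1 (vgrad w (O w Hw))))) Es)) as [E1 E2].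
destruct (fder_unique vt z _ _ _ _ Et' (fder_ext vt _ z _ _ (ex_intro _ d0 (conj Hd (fun w Hw => proj2 (vgrad w (O w Hw))))) Et)) as [E3 E4].
rewrite E1, E2, E3, E4. clear - A B. unfold Ns, Nt, Ts, Tt.
set (n := N z) in *. set (t := T z) in *.
repeat split; field; lra.
Qed.

(** A computation from [v = ln 4 + ln |g'| ^ 2 - 2 ln (1 + K |g| ^ 2)]: in [v_zz - v_z ^ 2 / 2] all
    terms containing [1 + K |g| ^ 2] cancel. *)
Lemma schwarzian_of_map z : U z ->
  Qf vs vt vss vst vts vtt z = (G3 z / G1 z - 3 / 2 * (G2 z / G1 z * (G2 z / G1 z)))%C.
Proof using All.
intros H. destruct (vgrad z H) as [Es Et].
destruct (hess z H (c2_s HC z H) (c2_t HC z H)) as [E1 [E2 [E3 E4]]].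
assert (A := Npos z H). assert (B := Tpos z H).
assert (NN := N1 z H).
cut ((Qf vs vt vss vst vts vtt z * (G1 z * G1 z))%C = (G3 z * G1 z - 3 / 2 * (G2 z * G2 z))%C).
{ intros E. replace (Qf vs vt vss vst vts vtt z) with (Qf vs vt vss vst vts vtt z * (G1 z * G1 z) / (G1 z * G1 z))%C by (field; auto).
  rewrite E. field. auto. }
replace (3 / 2)%C with (RtoC (3 / 2)) by (rewrite RtoC_div by lra; auto).
unfold Qf. rewrite E1, E2, E3, E4, Es, Et. unfold Ns, Nt, Ts, Tt.
clearbody T. unfold N in *.
destruct (G z) as [P Q]. destruct (G1 z) as [a b]. destruct (G2 z) as [c d]. destruct (G3 z) as [e f]. cbn [fst snd] in *.
set (t := T z) in *. clearbody t. clear - A B.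
apply injective_projections; simpl; field; lra.
Qed.

End Schwarz.

Section LocalMobius.
Variables (G G1 G2 G3 y1 y2 y1' y2' Q : C -> C) (W p : C) (R0 : R).
Hypothesis HR : 0 < R0.
Let U (z : C) := Cmod (z - p) < R0.
Hypothesis D1 : forall z, U z -> cder G z (G1 z).
Hypothesis D2 : forall z, U z -> cder G1 z (G2 z).
Hypothesis D3 : forall z, U z -> cder G2 z (G3 z).
Hypothesis N1 : forall z, U z -> G1 z <> 0.
Hypothesis HQ : forall z, U z -> Q z = (G3 z / G1 z - 3 / 2 * (G2 z / G1 z * (G2 z / G1 z)))%C.
Hypothesis Dy1 : forall z, U z -> cder y1 z (y1' z).
Hypothesis Dy2 : forall z, U z -> cder y2 z (y2' z).
Hypothesis Dy1' : forall z, U z -> cder y1' z (- (Q z / 2) * y1 z)%C.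
Hypothesis Dy2' : forall z, U z -> cder y2' z (- (Q z / 2) * y2 z)%C.
Hypothesis HW : forall z, U z -> (y1 z * y2' z - y2 z * y1' z)%C = W.
Hypothesis W0 : W <> 0.

Let C2 : (2 : C) <> 0. Proof. apply RtoC_neq; lra. Qed.
Let Up : U p. Proof. unfold U. rewrite Cmod_diag; auto. Qed.

Let x z := (/ 2 * (G2 z / G1 z))%C.
(* Up to the factor [sqrt G1], this is the derivative of [y * sqrt G1]. *)
Let w (y y' : C -> C) z := (y' z + x z * y z)%C.

Let Dw y y' z : U z -> cder y z (y' z) -> cder y' z (- (Q z / 2) * y z)%C -> cder (w y y') z (x z * w y y' z)%C.
Proof.
intros H A B. assert (n := N1 z H).
eapply cder_eq. 2: apply (cder_plus _ _ _ _ _ B (cder_mult _ _ _ _ _ (cder_scal (/ 2)%C _ _ _ (cder_div _ _ _ _ _ (D3 z H) (D2 z H) n)) A)).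
unfold w, x. rewrite HQ by auto. field. auto.
Qed.

(** The classical solutions are [1 / sqrt G1] and [G / sqrt G1]. To avoid a branch of the root, a
    combination [phi] of [y1] and [y2] with [phi' = - x phi] stands for the first; two first
    integrals then express [G] through [y1] and [y2]. *)
Lemma local_mobius : exists a b c d : C, (a * d - b * c)%C <> 0 /\
  forall z, U z -> (G z * (c * y1 z + d * y2 z) = a * y1 z + b * y2 z)%C.
Proof using All.
set (w1 := w y1 y1'). set (w2 := w y2 y2').
assert (Dw1 : forall z, U z -> cder w1 z (x z * w1 z)%C) by (intros; apply Dw; auto).
assert (Dw2 : forall z, U z -> cder w2 z (x z * w2 z)%C) by (intros; apply Dw; auto).
set (k1 := w1 p). set (k2 := w2 p).
set (phi := fun z => (k2 * y1 z - k1 * y2 z)%C).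
(* The difference [u] satisfies [u' = x u], so [u ^ 2 / G1] is constant, and it vanishes at [p]. *)
assert (Zw : forall z, U z -> (k2 * w1 z - k1 * w2 z)%C = 0).
{ intros z Hz. set (u := fun z => (k2 * w1 z - k1 * w2 z)%C).
  assert (Du : forall z, U z -> cder u z (x z * u z)%C).
  { intros z' H. eapply cder_eq. 2: apply (cder_minus _ _ _ _ _ (cder_scal k2 _ _ _ (Dw1 z' H)) (cder_scal k1 _ _ _ (Dw2 z' H))). unfold u. ring. }
  assert (E : (u z * u z / G1 z)%C = (u p * u p / G1 p)%C).
  { apply (cder_0_const (fun z => u z * u z / G1 z)%C p R0); auto. intros z' H.
    eapply cder_eq. 2: apply (cder_div _ _ _ _ _ (cder_mult _ _ _ _ _ (Du z' H) (Du z' H)) (D2 z' H) (N1 z' H)).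
    unfold x. assert (n := N1 z' H). field. auto. }
  assert (Ep : u p = 0) by (unfold u, k1, k2; ring). rewrite Ep in E. assert (n := N1 z Hz). assert (n' := N1 p Up).
  assert (E2 : (u z * u z)%C = 0). { replace (u z * u z)%C with (u z * u z / G1 z * G1 z)%C by (field; auto). rewrite E. field; auto. }
  destruct (Ceq_dec (u z) 0) as [|n2]; auto. exfalso. exact (Cmult_neq_0 _ _ n2 n2 E2). }
assert (Dphi : forall z, U z -> cder phi z (- x z * phi z)%C).
{ intros z H. eapply cder_eq. 2: apply (cder_minus _ _ _ _ _ (cder_scal k2 _ _ _ (Dy1 z H)) (cder_scal k1 _ _ _ (Dy2 z H))).
  assert (E := Zw z H). unfold w1, w2, w in E.
  transitivity (k2 * (y1' z + x z * y1 z) - k1 * (y2' z + x z * y2 z) + - x z * phi z)%C. unfold phi; ring. rewrite E. ring. }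
(* For a solution [y = (a + b G) / sqrt G1] and [phi = c / sqrt G1] this is the constant [c a]. *)
set (cc := fun (y y' : C -> C) z => (y z * G1 z * phi z - G z * phi z * w y y' z)%C).
assert (Cc : forall y y', (forall z, U z -> cder y z (y' z)) -> (forall z, U z -> cder y' z (- (Q z / 2) * y z)%C) ->
  forall z, U z -> cc y y' z = cc y y' p).
{ intros y y' A B z Hz. apply (cder_0_const (cc y y') p R0); auto. intros z' H.
  eapply cder_eq. 2: apply (cder_minus _ _ _ _ _ (cder_mult _ _ _ _ _ (cder_mult _ _ _ _ _ (A z' H) (D2 z' H)) (Dphi z' H))
    (cder_mult _ _ _ _ _ (cder_mult _ _ _ _ _ (D1 z' H) (Dphi z' H)) (Dw y y' z' H (A z' H) (B z' H)))).
  cbv beta. unfold w, x. assert (n := N1 z' H). field. auto. }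
set (a1 := cc y1 y1' p). set (a2 := cc y2 y2' p).
assert (E1 := Cc y1 y1' Dy1 Dy1'). assert (E2 := Cc y2 y2' Dy2 Dy2').
assert (Ww : forall z, U z -> (y1 z * w2 z - y2 z * w1 z)%C = W).
{ intros z H. rewrite <- (HW z H). unfold w1, w2, w. ring. }
exists (- a2)%C, a1, (W * k2)%C, (- (W * k1))%C. split.
- assert (Ephi : phi p = W). { rewrite <- (Ww p Up). unfold phi, k1, k2. ring. }
  replace (- a2 * - (W * k1) - a1 * (W * k2))%C with (- (W * (G1 p * (phi p * phi p))))%C.
  + intros E. assert (X : (W * (G1 p * (phi p * phi p)))%C = 0). { transitivity (- - (W * (G1 p * (phi p * phi p))))%C. ring. rewrite E. ring. }
    revert X. rewrite Ephi. repeat apply Cmult_neq_0; auto.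
  + unfold a1, a2, cc, phi. fold w1 w2. fold k1 k2. change (w y1 y1' p) with k1. change (w y2 y2' p) with k2. ring.
- intros z H. transitivity (G z * phi z * W)%C. unfold phi; ring.
  rewrite <- (Ww z H). unfold a1, a2. rewrite <- (E1 z H), <- (E2 z H). unfold cc. fold w1 w2. ring.
Qed.
End LocalMobius.

(** The relation [g = (a y1 + b y2) / (c y1 + d y2)] with the denominator cleared: poles are
    included, and in each chart of the sphere it is the vanishing of a holomorphic function. *)
Definition quot_rel (g : C -> option C) (a b c d : C) (y1 y2 : C -> C) (z : C) : Prop :=
  match g z with
  | Some u => (u * (c * y1 z + d * y2 z) = a * y1 z + b * y2 z)%C
  | None => (c * y1 z + d * y2 z)%C = 0
  end.

Lemma mero_chart_fin (U : C -> Prop) g p : meromorphic_on U g -> U p -> g p <> None ->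
  (forall z, U z -> exists d, 0 < d /\ forall w, Cmod (w - z) < d -> U w) ->
  exists r, 0 < r /\ (forall z, Cmod (z - p) < r -> U z) /\ (forall z, Cmod (z - p) < r -> exists l, cder (fun w => fin (g w)) z l) /\
   forall z, Cmod (z - p) < r -> g z = Some (fin (g z)).
Proof.
intros [M1 [M2 _]] Hp Hne UO. destruct (UO p Hp) as [d [Hd O]]. destruct (M1 p Hp) as [r1 [Hr1 F1]].
set (r := Rmin d r1). min_le d r1 A B. fold r in A, B.
assert (Hn : forall z, Cmod (z - p) < r -> g z <> None).
{ intros z Hz. destruct (Ceq_dec (z - p)%C 0) as [E|E].
  - replace z with p; auto. replace z with (p + (z - p))%C by ring. rewrite E. ring.
  - apply F1. apply O; lra. apply Cmod_gt_0 in E. lra. }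
exists r. split. apply Rmin_pos; auto. split. intros z Hz. apply O; lra. split.
- intros z Hz. destruct (M2 z (O z ltac:(lra)) (Hn z Hz)) as [l Hl]. exists l. apply cder_is_derive. exact Hl.
- intros z Hz. specialize (Hn z Hz). destruct (g z); simpl; auto. congruence.
Qed.

(** [f] is [g], or [1 / g] if [p] is a pole; in the second case [1 / g] has a removable zero at
    [p]. *)
Lemma mero_chart (U : C -> Prop) g p : meromorphic_on U g -> U p ->
  (forall z, U z -> exists d, 0 < d /\ forall w, Cmod (w - z) < d -> U w) ->
  exists r f, 0 < r /\ (forall z, Cmod (z - p) < r -> U z) /\ (forall z, Cmod (z - p) < r -> exists l, cder f z l) /\
   ((forall z, Cmod (z - p) < r -> g z = Some (f z)) \/
    (forall z, Cmod (z - p) < r -> match g z with Some u => u <> 0 /\ f z = (/ u)%C | None => f z = 0 end)).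
Proof.
intros [M1 [M2 M3]] Hp UO. destruct (UO p Hp) as [d [Hd O]]. destruct (M1 p Hp) as [r1 [Hr1 F1]].
assert (FD : forall z, U z -> g z <> None -> exists l, cder (fun w => fin (g w)) z l).
{ intros z Hz Hn. destruct (M2 z Hz Hn) as [l Hl]. exists l. apply cder_is_derive. exact Hl. }
destruct (g p) as [u|] eqn:Eg.
- destruct (mero_chart_fin U g p (conj M1 (conj M2 M3)) Hp ltac:(congruence) UO) as [r [A [B [A' B']]]].
  exists r, (fun w => fin (g w)). auto.
- destruct (M3 p Hp Eg 1) as [r2 [Hr2 F2]].
  set (r := Rmin d (Rmin r1 r2)). min_le d (Rmin r1 r2) A B. fold r in A, B.
  min_le r1 r2 B1 B2.
  set (f := fun w => match g w with Some u => (/ u)%C | None => 0 end).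
  assert (Hs : forall z, 0 < Cmod (z - p) < r -> exists u, g z = Some u /\ 1 < Cmod u).
  { intros z Hz. assert (Uz : U z) by (apply O; lra). assert (X := F1 z Uz ltac:(lra)). assert (Y := F2 z Uz ltac:(lra)).
    destruct (g z) as [u|]. exists u; auto. congruence. }
  assert (Hr : 0 < r) by (unfold r; repeat apply Rmin_pos; auto).
  assert (fp : f p = 0) by (unfold f; rewrite Eg; auto).
  assert (Dn : forall z, 0 < Cmod (z - p) < r -> exists l, cder f z l).
  { intros z Hz. destruct (Hs z Hz) as [u [Eu Hu]]. destruct (FD z) as [l Hl]. apply O; lra. congruence.
    eexists. eapply cder_ext. 2: apply (cder_inv _ _ _ Hl).
    - exists (Rmin (r - Cmod (z - p)) (Cmod (z - p))). split. apply Rmin_pos; lra. intros w Hw.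
      min_le (r - Cmod (z - p)) (Cmod (z - p)) X Y.
      assert (T := Cmod_lip (w - p) (z - p)). replace (w - p - (z - p))%C with (w - z)%C in T by ring. apply Rabs_le_between in T.
      destruct (Hs w) as [u' [Eu' _]]. lra. unfold f. rewrite Eu'. auto.
    - rewrite Eu. simpl. intros E. rewrite E, Cmod_0 in Hu. lra. }
  exists r, f. split; auto. split. intros z Hz. apply O; lra. split.
  + intros z Hz. destruct (Ceq_dec (z - p)%C 0) as [E|E].
    * replace z with p. 2: { replace z with (p + (z - p))%C by ring. rewrite E. ring. }
      apply (removable_zero f p r Hr); auto. intros e He. destruct (M3 p Hp Eg (/ e)) as [r3 [Hr3 F3]].
      exists (Rmin r r3). split. apply Rmin_pos; auto. intros w Hw. min_le r r3 X Y.
      destruct (Hs w) as [u [Eu Hu]]. lra. assert (F := F3 w ltac:(apply O; lra) ltac:(lra)). unfold f. rewrite Eu in *. simpl in F.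
      rewrite Cmod_inv. 2: { intros E'. rewrite E', Cmod_0 in Hu. lra. }
      rewrite <- (Rinv_inv e). apply Rlt_le, Rinv_lt_contravar; auto. apply Rmult_lt_0_compat. apply Rinv_0_lt_compat; auto. lra.
    * apply Dn. apply Cmod_gt_0 in E. lra.
  + right. intros z Hz. unfold f. destruct (g z) as [u|] eqn:Ez; auto. split; auto.
    destruct (Ceq_dec (z - p)%C 0) as [E|E].
    * exfalso. replace z with p in Ez. congruence. replace z with (p + (z - p))%C by ring. rewrite E. ring.
    * apply Cmod_gt_0 in E. destruct (Hs z ltac:(lra)) as [u' [Eu' Hu']]. intros E0. rewrite Ez in Eu'. injection Eu'. intros <-.
      rewrite E0, Cmod_0 in Hu'. lra.
Qed.

Lemma PS_null a R0 z : cvr a R0 -> Cmod z < R0 -> (forall n, a n = 0) -> PS a z = 0.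
Proof.
intros Ca Hz H. apply (is_PS_PS a R0); auto. intros e He. exists O. intros n _.
assert (E : csum (fun k => a k * z ^ k)%C n = 0). { induction n; simpl; auto. rewrite IHn, H. ring. }
rewrite E. rewrite Cmod_diag. auto.
Qed.

Lemma HD_convex eps p z t : HD eps p -> HD eps z -> 0 <= t <= 1 -> HD eps (p + RtoC t * (z - p))%C.
Proof.
intros [A1 A2] [B1 B2] Ht. split.
- replace (p + RtoC t * (z - p))%C with (RtoC (1 - t) * p + RtoC t * z)%C by (rewrite RtoC_minus; ring).
  eapply Rle_lt_trans. apply Cmod_triangle. rewrite !Cmod_mult, !Cmod_R, !Rabs_pos_eq by lra.
  assert (X : 0 <= (1 - t) * (eps - Cmod p)) by (apply Rmult_le_pos; lra). destruct (Req_dec t 0) as [->|]. lra.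
  assert (Y : 0 < t * (eps - Cmod z)) by (apply Rmult_lt_0_compat; lra). lra.
- simpl. assert (X : 0 <= (1 - t) * snd p) by (apply Rmult_le_pos; lra). destruct (Req_dec t 0) as [->|]. lra.
  assert (Y : 0 < t * snd z) by (apply Rmult_lt_0_compat; lra). lra.
Qed.

Section Global.
Variables (eps : R) (g : C -> option C) (y1 y2 : C -> C) (a b c d p : C) (r : R).
Hypothesis Hg : meromorphic_on (HD eps) g.
Hypothesis D1 : forall z, HD eps z -> exists l, cder y1 z l.
Hypothesis D2 : forall z, HD eps z -> exists l, cder y2 z l.
Hypothesis Hr : 0 < r.
Hypothesis Hin : HD eps p.
Let Rel := quot_rel g a b c d y1 y2.
Hypothesis HRel : forall z, Cmod (z - p) < r -> Rel z.

Let rel_holo q : HD eps q -> exists r0 h, 0 < r0 /\ (forall z, Cmod (z - q) < r0 -> exists l, cder h z l) /\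
  forall z, Cmod (z - q) < r0 -> (Rel z <-> h z = 0).
Proof.
intros Hq. destruct (mero_chart _ g q Hg Hq (fun z => HD_open eps z)) as [r0 [f [Hr0 [O [Df Hf]]]]].
destruct Hf as [Hf|Hf].
- exists r0, (fun z => f z * (c * y1 z + d * y2 z) - (a * y1 z + b * y2 z))%C. split; auto. split.
  + intros z Hz. destruct (Df z Hz) as [l L]. destruct (D1 z (O z Hz)) as [m1 L1]. destruct (D2 z (O z Hz)) as [m2 L2].
    eexists. apply (cder_minus _ _ _ _ _ (cder_mult _ _ _ _ _ L (cder_plus _ _ _ _ _ (cder_scal c _ _ _ L1) (cder_scal d _ _ _ L2)))
      (cder_plus _ _ _ _ _ (cder_scal a _ _ _ L1) (cder_scal b _ _ _ L2))).
  + intros z Hz. unfold Rel, quot_rel. rewrite (Hf z Hz). split; intros E. rewrite E. ring.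
    transitivity (f z * (c * y1 z + d * y2 z) - (a * y1 z + b * y2 z) + (a * y1 z + b * y2 z))%C. ring. rewrite E. ring.
- exists r0, (fun z => (c * y1 z + d * y2 z) - f z * (a * y1 z + b * y2 z))%C. split; auto. split.
  + intros z Hz. destruct (Df z Hz) as [l L]. destruct (D1 z (O z Hz)) as [m1 L1]. destruct (D2 z (O z Hz)) as [m2 L2].
    eexists. apply (cder_minus _ _ _ _ _ (cder_plus _ _ _ _ _ (cder_scal c _ _ _ L1) (cder_scal d _ _ _ L2))
      (cder_mult _ _ _ _ _ L (cder_plus _ _ _ _ _ (cder_scal a _ _ _ L1) (cder_scal b _ _ _ L2)))).
  + intros z Hz. unfold Rel, quot_rel. specialize (Hf z Hz). destruct (g z) as [u|].
    * destruct Hf as [Hu ->]. split; intros E. rewrite <- E. field; auto.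
      transitivity (u * (c * y1 z + d * y2 z - / u * (a * y1 z + b * y2 z)) + (a * y1 z + b * y2 z))%C. field; auto. rewrite E. ring.
    * rewrite Hf. split; intros E. rewrite E. ring. rewrite <- E. ring.
Qed.

(** Continuation along the segment from [p] to [z]. At the supremum of the parameters up to which
    the relation holds it is the vanishing of a power series with accumulating zeros, so it persists
    beyond. *)
Lemma quot_rel_global z : HD eps z -> Rel z.
Proof using All.
intros Hz. set (ga := fun t : R => (p + RtoC t * (z - p))%C).
assert (G1 : ga 1 = z) by (unfold ga; ring).
destruct (Ceq_dec (z - p)%C 0) as [E|Hne].
{ apply HRel. rewrite E, Cmod_0. auto. }
apply Cmod_gt_0 in Hne. set (L := Cmod (z - p)) in *.
assert (Hga : forall s t, Cmod (ga s - ga t) = Rabs (s - t) * L).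
{ intros s t. unfold ga. replace (p + RtoC s * (z - p) - (p + RtoC t * (z - p)))%C with (RtoC (s - t) * (z - p))%C by (rewrite RtoC_minus; ring).
  rewrite Cmod_mult, Cmod_R. auto. }
set (E := fun t => 0 <= t <= 1 /\ forall s, 0 <= s <= t -> Rel (ga s)).
destruct (completeness E) as [T [T1 T2]].
{ exists 1. intros t [Ht _]. lra. }
{ exists 0. split. lra. intros s Hs. replace s with 0 by lra. apply HRel. unfold ga. replace (p + RtoC 0 * (z - p) - p)%C with (RtoC 0) by ring. rewrite Cmod_0; auto. }
assert (TU : T <= 1) by (apply T2; intros t [Ht _]; lra).
assert (T0 : 0 < T).
{ set (t0 := Rmin 1 (r / (2 * L))). min_le 1 (r / (2 * L)) A B. fold t0 in A, B.
  assert (P : 0 < t0). { unfold t0. apply Rmin_pos. lra. apply Rdiv_lt_0_compat; lra. }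
  apply Rlt_le_trans with t0; auto. apply T1. split. lra. intros s Hs. apply HRel.
  replace (ga s - p)%C with (ga s - ga 0)%C by (unfold ga; ring). rewrite Hga, Rminus_0_r, Rabs_pos_eq by lra.
  assert (X : r / (2 * L) * L = r / 2) by (field; lra). nra. }
assert (Below : forall s, 0 <= s < T -> Rel (ga s)).
{ intros s Hs. destruct (classic (exists t, E t /\ s < t)) as [[t [[_ Et] Hst]]|N]. apply Et; lra.
  exfalso. assert (T <= s); [|lra]. apply T2. intros t Ht. apply Rnot_lt_le. intros Hl. apply N. exists t; auto. }
assert (HT : HD eps (ga T)) by (apply HD_convex; auto; lra).
destruct (rel_holo _ HT) as [r0 [h [Hr0 [Dh Eh]]]].
destruct (holo_PS h (ga T) r0 Hr0 Dh) as [k [Ck [Ek _]]].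
assert (Zk : forall n, k n = 0).
{ apply (PS_zero_coef k r0 Hr0 Ck). intros e He.
  set (m := Rmin (Rmin e r0 / L) T). min_le (Rmin e r0 / L) T A B. fold m in A, B.
  min_le e r0 A1 A2. assert (A3 : 0 < Rmin e r0) by (apply Rmin_pos; auto).
  assert (P : 0 < m). { unfold m. apply Rmin_pos; auto. apply Rdiv_lt_0_compat; auto. }
  apply (Rle_div_r m (Rmin e r0) L Hne) in A.
  assert (C1 : Cmod (ga (T - m / 2) - ga T) = m / 2 * L). { rewrite Hga. replace (T - m / 2 - T) with (- (m / 2)) by ring. rewrite Rabs_Ropp, Rabs_pos_eq by lra. auto. }
  assert (C2 : 0 < m / 2 * L < Rmin e r0) by (split; nra).
  set (tm := T - m / 2) in *. exists (ga tm - ga T)%C. rewrite C1. split. lra. rewrite <- Ek by (rewrite C1; lra).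
  apply Eh. rewrite C1; lra. apply Below. unfold tm. lra. }
assert (Near : forall s, Rabs (s - T) * L < r0 -> Rel (ga s)).
{ intros s Hs. assert (X : Cmod (ga s - ga T) < r0) by (rewrite Hga; auto). apply Eh; auto. rewrite Ek by auto. apply (PS_null k r0); auto. }
destruct (Rle_lt_or_eq_dec T 1 TU) as [Hlt|Heq].
- exfalso. set (t1 := Rmin 1 (T + r0 / (2 * L))). min_le 1 (T + r0 / (2 * L)) A B. fold t1 in A, B.
  assert (X : r0 / (2 * L) * L = r0 / 2) by (field; lra).
  assert (X0 : 0 < r0 / (2 * L)) by (apply Rdiv_lt_0_compat; lra).
  assert (P : T < t1). { unfold t1. apply Rmin_glb_lt; lra. }
  assert (t1 <= T); [|lra]. apply T1. split. lra. intros s Hs. destruct (Rlt_le_dec s T). apply Below; lra.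
  apply Near. rewrite Rabs_pos_eq by lra. nra.
- rewrite <- G1, <- Heq. apply Near. replace (T - T) with 0 by ring. rewrite Rabs_R0. lra.
Qed.
End Global.

(** If the zeros of [g'] accumulated at a regular point, [g] would be constant near it, against
    local univalence; so a punctured neighbourhood is free of them. *)
Lemma regular_disc eps g : 0 < eps -> meromorphic_on (HD eps) g -> locally_univalent (HD eps) g ->
  exists p r (G G1 G2 G3 : C -> C), 0 < r /\ (forall z, Cmod (z - p) < r -> HD eps z) /\
  forall z, Cmod (z - p) < r -> cder G z (G1 z) /\ cder G1 z (G2 z) /\ cder G2 z (G3 z) /\ G1 z <> 0 /\ g z = Some (G z) /\
    cder (fun w => fin (g w)) z (G1 z).
Proof.
intros He Hm Hu.
set (p0 := (0, eps / 2) : C). assert (H0 : HD eps p0).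
{ split. 2: simpl; lra. eapply Rle_lt_trans. apply Cmod_le_sum. cbn [fst snd]. unfold p0. cbn [fst snd]. rewrite Rabs_R0, Rabs_pos_eq; lra. }
assert (Hq : exists q, HD eps q /\ g q <> None).
{ destruct (proj1 Hm _ H0) as [r [Hr F]]. destruct (HD_open _ _ H0) as [d [Hd O]]. set (m := Rmin r d / 2).
  min_le r d A B. assert (P : 0 < Rmin r d) by (apply Rmin_pos; auto).
  assert (E : Cmod (p0 + RtoC m - p0) = m).
  { replace (p0 + RtoC m - p0)%C with (RtoC m) by ring. rewrite Cmod_R, Rabs_pos_eq; unfold m; lra. }
  exists (p0 + RtoC m)%C. assert (X : HD eps (p0 + RtoC m)%C). { apply O. rewrite E. unfold m; lra. }
  split; auto. apply F; auto. rewrite E. unfold m; lra. }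
destruct Hq as [q [Hq Hqn]].
destruct (mero_chart_fin _ g q Hm Hq Hqn (fun z => HD_open eps z)) as [r [Hr [O [Df Ef]]]].
destruct (holo_PS _ q r Hr Df) as [k [Ck [Ek _]]].
assert (Sh : forall a z, cvr a r -> Cmod (z - q) < r -> cder (fun w => PS a (w - q)) z (PS (dps a) (z - q)%C)).
{ intros a z Ha Hz. eapply cder_eq. 2: apply (cder_comp (PS a) (fun w => w - q)%C z 1). 3: apply (PS_cder a r); auto. ring.
  eapply cder_eq. 2: apply (cder_minus _ _ _ _ _ (cder_id z) (cder_const q z)). ring. }
destruct (classic (forall d, 0 < d -> exists z : C, 0 < Cmod z < d /\ PS (dps k) z = 0)) as [N|N].
{ exfalso. assert (Z := PS_zero_coef _ r Hr (cvr_dps _ _ Ck) N). destruct (Hu q Hq) as [r1 [Hr1 F]].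
  min_le r r1 A B. assert (P : 0 < Rmin r r1) by (apply Rmin_pos; auto).
  set (m := Rmin r r1 / 2). set (w := (q + RtoC m)%C).
  assert (Ew : Cmod (w - q) = m). { unfold w. replace (q + RtoC m - q)%C with (RtoC m) by ring. rewrite Cmod_R, Rabs_pos_eq; unfold m; lra. }
  assert (E0 : Cmod (q - q) = 0). { replace (q - q)%C with (RtoC 0) by ring. apply Cmod_0. }
  assert (Hw : Cmod (w - q) < r) by (rewrite Ew; unfold m; lra).
  assert (E : w = q).
  { apply F; auto. rewrite Ew; unfold m; lra. rewrite E0; auto. rewrite (Ef w Hw), (Ef q) by (rewrite E0; auto). f_equal.
    apply (cder_0_const (fun w => fin (g w)) q r); auto. intros z Hz. apply cder_ext with (fun w => PS k (w - q)).
    - exists (r - Cmod (z - q)). split. lra. intros y Hy. symmetry. apply Ek. replace (y - q)%C with ((y - z) + (z - q))%C by ring.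
      eapply Rle_lt_trans. apply Cmod_triangle. lra.
    - rewrite <- (PS_null (dps k) r (z - q)%C (cvr_dps _ _ Ck) Hz Z). apply Sh; auto. }
  rewrite E, E0 in Ew. unfold m in Ew. lra. }
apply not_all_ex_not in N. destruct N as [d N]. apply imply_to_and in N. destruct N as [Hd N].
min_le d r A B. assert (P : 0 < Rmin d r) by (apply Rmin_pos; auto).
(* The disc of radius [m] about [q + m] lies in the punctured disc about [q], where [g'] has no
   zero. *)
set (m := Rmin d r / 2). set (p := (q + RtoC m)%C).
exists p, m, (fun w => PS k (w - q)), (fun w => PS (dps k) (w - q)), (fun w => PS (dps (dps k)) (w - q)), (fun w => PS (dps (dps (dps k))) (w - q)).
assert (Hz : forall z, Cmod (z - p) < m -> 0 < Cmod (z - q) < Rmin d r).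
{ intros z Hz. assert (Em : Cmod (p - q) = m). { unfold p. replace (q + RtoC m - q)%C with (RtoC m) by ring. rewrite Cmod_R, Rabs_pos_eq; unfold m; lra. }
  assert (T := Cmod_lip (z - q) (p - q)). replace (z - q - (p - q))%C with (z - p)%C in T by ring. apply Rabs_le_between in T. unfold m in *. lra. }
split. unfold m; lra. split. intros z H. apply O. specialize (Hz z H). lra.
intros z H. specialize (Hz z H). assert (Hr' : Cmod (z - q) < r) by lra.
split. apply Sh; auto. split. apply Sh; auto. apply cvr_dps; auto. split. apply Sh; auto. repeat apply cvr_dps; auto.
split. intros E. apply N. exists (z - q)%C. split; auto. lra.
split. rewrite <- Ek by auto. apply Ef; auto.
apply cder_ext with (fun w => PS k (w - q)). 2: apply Sh; auto.
exists (r - Cmod (z - q)). split. lra. intros y Hy. symmetry. apply Ek. replace (y - q)%C with ((y - z) + (z - q))%C by ring.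
eapply Rle_lt_trans. apply Cmod_triangle. lra.
Qed.

Lemma PS_bounded_near_0 a R0 : 0 < R0 -> cvr a R0 -> exists M d, 0 < M /\ 0 < d /\ forall z, Cmod z < d -> Cmod (PS a z) <= M.
Proof.
intros HR Ca. destruct (PS_ccont a R0 0 Ca ltac:(rewrite Cmod_0; auto) 1 ltac:(lra)) as [d [Hd F]].
exists (Cmod (PS a 0) + 1), d. assert (Q := Cmod_ge_0 (PS a 0)). split. lra. split; auto. intros z Hz.
specialize (F z ltac:(replace (z - 0)%C with z by ring; auto)).
replace (PS a z) with ((PS a z - PS a 0) + PS a 0)%C by ring. eapply Rle_trans. apply Cmod_triangle. lra.
Qed.

(** * The quotient representation and reality of the exponents *)

Section Developing.
Variables (K eps c0 : R) (v vs vt vss vst vts vtt : C -> R).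
Hypothesis H : LS2 K eps c0 v vs vt vss vst vts vtt.
Hypothesis HK : K = -1 \/ K = 0 \/ K = 1.
Variable g : C -> option C.
Hypothesis Hg : developing_map K eps v g.
Variables (b h1 h2 : nat -> C) (sig be : C) (m : nat).
Hypothesis Hb : cvr b eps.
Hypothesis HbQ : forall z, 0 < Cmod z < eps -> (z * z * Qe vs vt vss vst vts vtt z)%C = PS b z.
Hypothesis HF : frob (fun n => (/ 2 * b (S n))%C) eps sig be m h1 h2.
Hypothesis Hsig : (sig * sig = 1 - 2 * b O)%C.

Let y1 := sol1 h1 sig.
Let y2 := sol2 h1 h2 sig be.
Let y1' := sol1' h1 sig.
Let y2' := sol2' h1 h2 sig be.

Let T_pos z a : HD eps z -> g z = Some a -> 0 < 1 + K * Cmod a ^ 2.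
Proof.
intros Hz E. destruct Hg as [_ [_ [H3 _]]]. destruct (Rle_dec K 0) as [HK0|HK0].
- destruct (H3 HK0 z Hz) as [a' [E' P]]. congruence.
- generalize (pow2_ge_0 (Cmod a)). nra.
Qed.

Let v_formula z a l : HD eps z -> g z = Some a -> cder (fun w => fin (g w)) z l -> v z = ln (4 * Cmod l ^ 2 / (1 + K * Cmod a ^ 2) ^ 2).
Proof.
intros Hz E D. destruct Hg as [_ [_ [_ H4]]]. destruct (H4 z a Hz E) as [l' [D' Ev]].
apply cder_is_derive in D'. rewrite (cder_unique _ _ _ _ D D'). auto.
Qed.

Let ode_Q z y : HD eps z -> (- (PS b z / (2 * (z * z))) * y)%C = (- (Qf vs vt vss vst vts vtt z / 2) * y)%C.
Proof.
intros Hz. assert (zn := Cmod_pos_snd z (proj2 Hz)). rewrite <- HbQ. 2: destruct Hz; lra.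
rewrite Qe_up by (destruct Hz; lra). apply Cmod_gt_0 in zn. field. auto.
Qed.

Theorem developing_quotient : exists A B C D : Complex.C, (A * D - B * C)%C <> 0 /\ forall z, HD eps z -> quot_rel g A B C D y1 y2 z.
Proof using All.
destruct Hg as [Hm [Hu _]]. assert (He := ls_eps (l2_ls H)).
destruct (regular_disc eps g He Hm Hu) as [p [r [G [G1 [G2 [G3 [Hr [O F]]]]]]]].
destruct (fr_E HF) as [W [W0 EW]].
assert (HS : forall z, Cmod (z - p) < r -> Qf vs vt vss vst vts vtt z = (G3 z / G1 z - 3 / 2 * (G2 z / G1 z * (G2 z / G1 z)))%C).
{ apply (schwarzian_of_map G G1 G2 G3 K v vs vt vss vst vts vtt p r Hr); try (intros z Hz; apply F; auto).
  - intros z Hz. apply (T_pos z); auto. apply F; auto.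
  - intros z Hz. apply v_formula; auto; apply F; auto.
  - apply (C2on_sub (HD eps)); auto. apply (ls_C2 (l2_ls H)). }
destruct (local_mobius G G1 G2 G3 y1 y2 y1' y2' (Qf vs vt vss vst vts vtt) W p r Hr) as [A [B [C [D [Hdet HM]]]]]; auto; try (intros z Hz; apply F; auto).
- intros z Hz. apply (cder_sol1 b h1 h2 eps sig be m HF); auto.
- intros z Hz. apply (cder_sol2 b h1 h2 eps sig be m HF); auto.
- intros z Hz. rewrite <- ode_Q; auto. apply (cder_sol1' b h1 h2 eps sig be m); auto.
- intros z Hz. rewrite <- ode_Q; auto. apply (cder_sol2' b h1 h2 eps sig be m); auto.
- intros z Hz. apply (sol_wronskian b h1 h2 eps sig be m HF); auto.
- exists A, B, C, D. split; auto. apply (quot_rel_global eps g y1 y2 A B C D p r); auto.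
  + intros z Hz. eexists. apply (cder_sol1 b h1 h2 eps sig be m HF); auto.
  + intros z Hz. eexists. apply (cder_sol2 b h1 h2 eps sig be m HF); auto.
  + apply O. rewrite Cmod_diag; auto.
  + intros z Hz. unfold quot_rel. destruct (F z Hz) as [_ [_ [_ [_ [E _]]]]]. rewrite E. apply HM; auto.
Qed.

Let eps_pos : 0 < eps. Proof. exact (ls_eps (l2_ls H)). Qed.

Lemma solutions_independent z : HD eps z -> y1 z = 0 -> y2 z = 0 -> False.
Proof using HF.
intros Hz E1 E2. destruct (fr_E HF) as [W [W0 EW]]. apply W0.
rewrite <- (sol_wronskian b h1 h2 eps sig be m HF z Hz W EW). fold y1 y2. rewrite E1, E2. ring.
Qed.

Section Quotient.
Variables A B C D : Complex.C.
Hypothesis Hdet : (A * D - B * C)%C <> 0.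
Hypothesis HRel : forall z, HD eps z -> quot_rel g A B C D y1 y2 z.

Let X z := (A * y1 z + B * y2 z)%C.
Let Y z := (C * y1 z + D * y2 z)%C.

Let Xd z : HD eps z -> cder X z (A * y1' z + B * y2' z)%C.
Proof. intros Hz. apply (cder_plus _ _ _ _ _ (cder_scal A _ _ _ (cder_sol1 b h1 h2 eps sig be m HF z Hz)) (cder_scal B _ _ _ (cder_sol2 b h1 h2 eps sig be m HF z Hz))). Qed.
Let Yd z : HD eps z -> cder Y z (C * y1' z + D * y2' z)%C.
Proof. intros Hz. apply (cder_plus _ _ _ _ _ (cder_scal C _ _ _ (cder_sol1 b h1 h2 eps sig be m HF z Hz)) (cder_scal D _ _ _ (cder_sol2 b h1 h2 eps sig be m HF z Hz))). Qed.

Lemma quotient_not_both_zero z : HD eps z -> X z = 0 -> Y z = 0 -> False.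
Proof using HF Hdet.
intros Hz EX EY. apply (solutions_independent z Hz).
- replace (y1 z) with ((D * X z - B * Y z) / (A * D - B * C))%C by (unfold X, Y; field; auto). rewrite EX, EY. field; auto.
- replace (y2 z) with ((A * Y z - C * X z) / (A * D - B * C))%C by (unfold X, Y; field; auto). rewrite EX, EY. field; auto.
Qed.

Lemma quotient_value z u : HD eps z -> g z = Some u -> Y z <> 0 /\ u = (X z / Y z)%C.
Proof using HF Hdet HRel.
intros Hz E. assert (R := HRel z Hz). unfold quot_rel in R. rewrite E in R. fold (X z) (Y z) in R.
assert (N : Y z <> 0). { intros EY. apply (quotient_not_both_zero z Hz); auto. rewrite <- R, EY. ring. }
split; auto. rewrite <- R. field; auto.
Qed.

(* [|Y|^2 + K |X|^2] is, up to a constant factor, [exp (-v/2)]. *)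
Lemma density_lower_bound : exists k, 0 < k /\ forall z u, HD eps z -> g z = Some u ->
  k <= exp (v z) * (Cmod (X z) ^ 2 + Cmod (Y z) ^ 2) ^ 2.
Proof using All.
destruct (fr_E HF) as [W [W0 EW]].
set (q := (Cmod ((A * D - B * C) * W))%C). assert (Hq : 0 < q) by (apply Cmod_gt_0, Cmult_neq_0; auto).
exists (4 * q ^ 2). split. { assert (0 < q ^ 2) by (apply pow_lt; auto). lra. }
intros z u Hz Eu. destruct (quotient_value z u Hz Eu) as [YN Eu'].
destruct Hg as [_ [_ [_ H4]]]. destruct (H4 z u Hz Eu) as [l [Dl Ev]]. apply cder_is_derive in Dl.
assert (Wr := sol_wronskian b h1 h2 eps sig be m HF z Hz W EW). fold y1 y2 in Wr. change (sol2' h1 h2 sig be) with y2' in Wr. change (sol1' h1 sig) with y1' in Wr.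
assert (El : l = (- ((A * D - B * C) * W) / (Y z * Y z))%C).
{ apply (cder_unique (fun w => fin (g w)) z); auto.
  apply cder_ext with (fun w => X w / Y w)%C.
  - destruct (HD_open _ _ Hz) as [d [Hd O]]. destruct (ccont_neq Y z 0 (cder_ccont _ _ _ (Yd z Hz)) YN) as [d' [Hd' NY]].
    exists (Rmin d d'). split. apply Rmin_pos; auto. intros w Hw. min_le d d' A1 A2.
    assert (Hw' : HD eps w) by (apply O; lra). assert (R := HRel w Hw'). unfold quot_rel in R.
    destruct (g w) as [u'|] eqn:Ew. destruct (quotient_value w u' Hw' Ew) as [_ E]. simpl. auto.
    exfalso. apply (NY w). lra. exact R.
  - eapply cder_eq. 2: apply (cder_div _ _ _ _ _ (Xd z Hz) (Yd z Hz) YN). rewrite <- Wr. unfold X, Y. field. auto. }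
assert (Py : 0 < Cmod (Y z)) by (apply Cmod_gt_0; auto).
assert (P := T_pos z u Hz Eu).
assert (Cl : Cmod l * Cmod (Y z) ^ 2 = q).
{ rewrite El, Cmod_div, Cmod_opp, (Cmod_mult (Y z) (Y z)). 2: apply Cmult_neq_0; auto. unfold q. field. lra. }
assert (Cu : Cmod u * Cmod (Y z) = Cmod (X z)).
{ rewrite Eu', Cmod_div by auto. field. lra. }
assert (Pl : 0 < Cmod l). { assert (0 <= Cmod l) by apply Cmod_ge_0. assert (0 < Cmod (Y z) ^ 2) by (apply pow_lt; auto). nra. }
assert (Ee : exp (v z) = 4 * Cmod l ^ 2 / (1 + K * Cmod u ^ 2) ^ 2).
{ rewrite Ev. apply exp_ln. apply Rdiv_lt_0_compat. assert (0 < Cmod l ^ 2) by (apply pow_lt; auto). lra. apply pow_lt; auto. }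
set (t := 1 + K * Cmod u ^ 2) in *. set (y := Cmod (Y z)) in *. set (x := Cmod (X z)) in *.
assert (Ht : t <= 1 + Cmod u ^ 2). { unfold t. assert (0 <= Cmod u ^ 2) by apply pow2_ge_0. destruct HK as [Hk|[Hk|Hk]]; rewrite Hk; lra. }
rewrite Ee, <- Cl.
assert (Hs : x ^ 2 + y ^ 2 = y ^ 2 * (1 + Cmod u ^ 2)) by (rewrite <- Cu; ring). rewrite Hs.
replace (4 * (Cmod l * y ^ 2) ^ 2) with (4 * Cmod l ^ 2 / t ^ 2 * (y ^ 2 * t) ^ 2) by (field; lra).
apply Rmult_le_compat_l. apply Rlt_le, Rdiv_lt_0_compat. assert (0 < Cmod l ^ 2) by (apply pow_lt; auto). lra. apply pow_lt; auto.
apply pow_incr. assert (0 < y ^ 2) by (apply pow_lt; auto). split. apply Rmult_le_pos; lra. apply Rmult_le_compat_l; lra.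
Qed.

(** For imaginary [sig] both exponents have real part [/ 2], so numerator and denominator of [g] are
    [O(|z| ^ (1/2))] and [density_lower_bound] applies. The squares with lower left corner [(0, l)]
    and side [l], where [|z| <= 3 l], then contradict [ls_area]. *)
Lemma exponents_real : fst sig = 0 -> snd sig <> 0 -> False.
Proof using All.
intros S1 S2.
(* A logarithm would make [sig] a natural number, hence real. *)
assert (Hbe : be = 0). { destruct (Ceq_dec be 0) as [|n]; auto. exfalso. apply S2. rewrite (fr_be HF n). auto. }
assert (F1 : fst ((1 + sig) / 2)%C = / 2). { destruct sig; simpl in *. rewrite S1. field. }
assert (F2 : fst ((1 - sig) / 2)%C = / 2). { destruct sig; simpl in *. rewrite S1. field. }
assert (Hbd : forall s h, fst s = / 2 -> cvr h eps -> exists M d, 0 < M /\ 0 < d /\ forall z, 0 < Cmod z < d ->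
  Cmod (zp s z * PS h z) <= M * exp (/ 2 * ln (Cmod z))).
{ intros s h Es Ch. destruct (PS_bounded_near_0 h eps eps_pos Ch) as [M [d [HM [Hd F]]]].
  exists (exp (Rabs (snd s) * PI) * M), d. assert (P := exp_pos (Rabs (snd s) * PI)). split. apply Rmult_lt_0_compat; auto. split; auto.
  intros z Hz. rewrite Cmod_mult. assert (Bz := Cmod_zp_bound s z). rewrite Es in Bz. specialize (F z ltac:(lra)).
  apply Rle_trans with (exp (/ 2 * ln (Cmod z)) * exp (Rabs (snd s) * PI) * M). 2: lra.
  apply Rmult_le_compat; auto; apply Cmod_ge_0. }
destruct (Hbd _ h1 F1 (fr_c1 HF)) as [M1 [d1 [HM1 [Hd1 B1]]]].
destruct (Hbd _ h2 F2 (fr_c2 HF)) as [M2 [d2 [HM2 [Hd2 B2]]]].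
destruct density_lower_bound as [k [Hk LB]].
set (NX := Cmod A * M1 + Cmod B * M2). set (NY := Cmod C * M1 + Cmod D * M2).
set (N := NX ^ 2 + NY ^ 2 + 1).
assert (HN : 0 < N) by (unfold N; generalize (pow2_ge_0 NX) (pow2_ge_0 NY); lra).
set (d := Rmin d1 d2). min_le d1 d2 Ed1 Ed2. fold d in Ed1, Ed2.
assert (Pd : 0 < d) by (apply Rmin_pos; auto).
assert (Fin : forall z u, HD eps z -> Cmod z < d -> g z = Some u -> k <= exp (v z) * (N ^ 2 * Cmod z ^ 2)).
{ intros z u Hz Hzd Eu. assert (Pz := Cmod_pos_snd z (proj2 Hz)).
  eapply Rle_trans. apply (LB z u Hz Eu). apply Rmult_le_compat_l. left; apply exp_pos.
  set (e := exp (/ 2 * ln (Cmod z))) in *. assert (Pe : 0 < e) by apply exp_pos.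
  assert (Ee : e * e = Cmod z). { unfold e. rewrite <- exp_plus. replace (/ 2 * ln (Cmod z) + / 2 * ln (Cmod z)) with (ln (Cmod z)) by field. apply exp_ln; auto. }
  assert (By1 : Cmod (y1 z) <= M1 * e) by (apply B1; lra).
  assert (By2 : Cmod (y2 z) <= M2 * e). { unfold y2, sol2. rewrite Hbe, Cmult_0_l, Cplus_0_r. apply B2; lra. }
  assert (Bc : forall a b, Cmod (a * y1 z + b * y2 z) <= (Cmod a * M1 + Cmod b * M2) * e).
  { intros a b'. eapply Rle_trans. apply Cmod_triangle. rewrite !Cmod_mult.
    assert (T1 := Rmult_le_compat_l (Cmod a) _ _ (Cmod_ge_0 a) By1). assert (T2 := Rmult_le_compat_l (Cmod b') _ _ (Cmod_ge_0 b') By2). lra. }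
  assert (BX := Bc A B). assert (BY := Bc C D). fold (X z) NX in BX. fold (Y z) NY in BY.
  assert (SX : Cmod (X z) ^ 2 <= NX ^ 2 * Cmod z). { rewrite <- Ee. replace (NX ^ 2 * (e * e)) with ((NX * e) ^ 2) by ring. apply pow_incr. split; auto. apply Cmod_ge_0. }
  assert (SY : Cmod (Y z) ^ 2 <= NY ^ 2 * Cmod z). { rewrite <- Ee. replace (NY ^ 2 * (e * e)) with ((NY * e) ^ 2) by ring. apply pow_incr. split; auto. apply Cmod_ge_0. }
  replace (N ^ 2 * Cmod z ^ 2) with ((N * Cmod z) ^ 2) by ring. apply pow_incr. split.
  generalize (pow2_ge_0 (Cmod (X z))) (pow2_ge_0 (Cmod (Y z))); lra. unfold N. lra. }
assert (LS0 := l2_ls H).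
(* The density formula does not apply at a pole of [g]. A nearby regular point and continuity of [v]
   cost the factor [8]: [2] for [e^v] and [4] for [|z| ^ 2]. *)
assert (All : forall z, HD eps z -> Cmod z < d -> k / (8 * N ^ 2) <= exp (v z) * Cmod z ^ 2).
{ intros z Hz Hzd. assert (Pz := Cmod_pos_snd z (proj2 Hz)).
  assert (Cv : contR v z). { eapply fder_contR. apply (c2_f (ls_C2 LS0) z Hz). }
  assert (Pl : 0 < ln 2) by (rewrite <- ln_1; apply ln_increasing; lra).
  destruct (Cv (ln 2) Pl) as [d3 [Hd3 F3]]. destruct (HD_open _ _ Hz) as [d4 [Hd4 O4]].
  destruct Hg as [[G1 _] _]. destruct (G1 z Hz) as [d5 [Hd5 F5]].
  set (mm := Rmin (Rmin d3 d4) (Rmin d5 (Rmin (Cmod z) (d - Cmod z)))).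
  min_le (Rmin d3 d4) (Rmin d5 (Rmin (Cmod z) (d - Cmod z))) Q1 Q2. fold mm in Q1, Q2.
  min_le d3 d4 Q3 Q4. min_le d5 (Rmin (Cmod z) (d - Cmod z)) Q5 Q6.
  min_le (Cmod z) (d - Cmod z) Q7 Q8.
  assert (Pm : 0 < mm). { unfold mm. repeat apply Rmin_pos; lra. }
  set (w := (z + RtoC (mm / 2))%C).
  assert (Ew : Cmod (w - z) = mm / 2). { unfold w. replace (z + RtoC (mm / 2) - z)%C with (RtoC (mm / 2)) by ring. rewrite Cmod_R, Rabs_pos_eq; lra. }
  assert (Hw : HD eps w) by (apply O4; lra).
  assert (Lw : Cmod w <= Cmod z + mm / 2). { replace w with (z + (w - z))%C by ring. rewrite <- Ew. apply Cmod_triangle. }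
  assert (Nw := F5 w Hw ltac:(lra)). destruct (g w) as [u|] eqn:Eu; [|congruence].
  assert (Kw := Fin w u Hw ltac:(lra) Eu). specialize (F3 w ltac:(lra)). apply Rabs_def2 in F3.
  assert (Ev : exp (v w) <= 2 * exp (v z)). { rewrite <- (exp_ln 2) by lra. rewrite <- exp_plus. apply exp_le_exp. lra. }
  assert (Cw : Cmod w ^ 2 <= (2 * Cmod z) ^ 2). { apply pow_incr. split. apply Cmod_ge_0. lra. }
  assert (PN : 0 < N ^ 2) by (apply pow_lt; auto).
  apply (Rle_div_l k (exp (v z) * Cmod z ^ 2) (8 * N ^ 2)). lra.
  eapply Rle_trans. apply Kw. replace (exp (v z) * Cmod z ^ 2 * (8 * N ^ 2)) with (2 * exp (v z) * (N ^ 2 * (2 * Cmod z) ^ 2)) by ring.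
  apply Rmult_le_compat; auto. left; apply exp_pos. apply Rmult_le_pos. lra. apply pow2_ge_0. apply Rmult_le_compat_l; lra. }
set (k' := k / (8 * N ^ 2)) in *.
assert (Pk' : 0 < k'). { apply Rdiv_lt_0_compat; auto. assert (0 < N ^ 2) by (apply pow_lt; auto). lra. }
destruct (ls_area LS0 (k' / 9) ltac:(lra)) as [da [Hda NA]].
set (l := Rmin d (Rmin da eps) / 4).
min_le d (Rmin da eps) Q1 Q2. min_le da eps Q3 Q4.
assert (Pl : 0 < l). { assert (0 < Rmin d (Rmin da eps)) by (repeat apply Rmin_pos; auto). unfold l. lra. }
assert (Bl : forall z, inrect 0 l l l z -> HD eps z /\ Cmod z <= 3 * l).
{ intros z [Ha Hb']. assert (T := Cmod_le_sum z). rewrite !Rabs_pos_eq in T by lra. split. split. unfold l in *; lra. lra. lra. }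
apply (NA 0 l l Pl).
- intros z Hz. destruct (Bl z Hz) as [Hz1 Hz2]. split; auto. unfold l in *; lra.
- intros z Hz. destruct (Bl z Hz) as [Hz1 Hz2]. assert (T := All z Hz1 ltac:(unfold l in *; lra)).
  assert (S : Cmod z ^ 2 <= (3 * l) ^ 2). { apply pow_incr. split; auto. apply Cmod_ge_0. }
  assert (Pv := exp_pos (v z)). assert (exp (v z) * Cmod z ^ 2 <= exp (v z) * (3 * l) ^ 2) by (apply Rmult_le_compat_l; lra). lra.
Qed.
End Quotient.
End Developing.

(** In terms of [q = y2 / y1] the quotient is [(b q + a) / (d q + c)], which gives the order of the
    coefficients; zeros of [y1] are the points where [q] is infinite. *)
Lemma mobius_of_quot_rel g a b c d (y1 y2 : C -> C) z : (a * d - b * c)%C <> 0 -> (y1 z = 0 -> y2 z = 0 -> False) ->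
  quot_rel g a b c d y1 y2 z ->
  mobius_maps b a d c (if Ceq_dec (y1 z) 0 then None else Some (y2 z / y1 z)%C) (g z).
Proof.
intros Hd Hy R. unfold quot_rel in R. set (Y := (c * y1 z + d * y2 z)%C) in *. set (X := (a * y1 z + b * y2 z)%C) in *.
assert (NB : X = 0 -> Y = 0 -> False).
{ intros EX EY. apply Hy.
  - replace (y1 z) with ((d * X - b * Y) / (a * d - b * c))%C by (unfold X, Y; field; auto). rewrite EX, EY. field; auto.
  - replace (y2 z) with ((a * Y - c * X) / (a * d - b * c))%C by (unfold X, Y; field; auto). rewrite EX, EY. field; auto. }
assert (Val : (Y <> 0 /\ g z = Some (X / Y)%C) \/ (Y = 0 /\ g z = None)).
{ destruct (g z) as [u|]; auto. destruct (Ceq_dec Y 0) as [E|n].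
  - exfalso. apply NB; auto. rewrite <- R, E. ring.
  - left. split; auto. f_equal. rewrite <- R. field; auto. }
destruct (Ceq_dec (y1 z) 0) as [E|n]; simpl.
- assert (N2 : y2 z <> 0) by (intros E'; apply (Hy E E')).
  assert (EY : Y = (d * y2 z)%C) by (unfold Y; rewrite E; ring). assert (EX : X = (b * y2 z)%C) by (unfold X; rewrite E; ring).
  destruct Val as [[V1 V2]|[V1 V2]].
  + left. assert (d <> 0). { intros E'. apply V1. rewrite EY, E'. ring. } split; auto. rewrite V2, EX, EY. f_equal. field. auto.
  + right. split; auto. destruct (Ceq_dec d 0) as [|n]; auto. exfalso. apply (Cmult_neq_0 d (y2 z) n N2). rewrite <- EY; auto.
- assert (EY : (d * (y2 z / y1 z) + c)%C = (Y / y1 z)%C) by (unfold Y; field; auto).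
  assert (EX : (b * (y2 z / y1 z) + a)%C = (X / y1 z)%C) by (unfold X; field; auto). rewrite EY, EX.
  destruct Val as [[V1 V2]|[V1 V2]].
  + left. split. intros E. apply V1. replace Y with (Y / y1 z * y1 z)%C by (field; auto). rewrite E. ring.
    rewrite V2. f_equal. field. auto.
  + right. split; auto. rewrite V1. field; auto.
Qed.

Lemma PS_real_axis a R0 z : cvr a R0 -> (forall n, snd (a n) = 0) -> Cmod z < R0 -> snd z = 0 -> snd (PS a z) = 0.
Proof.
intros Ca Ra Hz Sz. assert (P := is_PS_conj _ _ _ (PS_is a R0 z Ca Hz)).
assert (Ea : (fun n => Cconj (a n)) = a). { apply functional_extensionality. intros n. specialize (Ra n). destruct (a n). simpl in *. rewrite Ra. unfold Cconj. simpl. f_equal. ring. }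
assert (Ez : Cconj z = z). { destruct z. simpl in *. rewrite Sz. unfold Cconj. simpl. f_equal. ring. }
rewrite Ea, Ez in P. apply (is_PS_PS a R0) in P; auto. apply (f_equal snd) in P. unfold Cconj in P. cbn [snd] in P. lra.
Qed.

Lemma Cmod_clog_le z : Cmod (clog z) <= Rabs (ln (Cmod z)) + PI.
Proof.
eapply Rle_trans. apply Cmod_le_sum. unfold clog. cbn [fst snd]. apply Rplus_le_compat_l.
assert (B := acos_bound (Re z / Cmod z)). rewrite Rabs_pos_eq; lra.
Qed.

(** * The two forms of the developing map *)

Section Shape.
Variables (h1 h2 : nat -> C) (eps : R).
Hypothesis He : 0 < eps.
Hypothesis C1 : cvr h1 eps.
Hypothesis C2 : cvr h2 eps.
Hypothesis Hzero : forall z, 0 < Cmod z < eps -> PS h1 z = 0 -> PS h2 z <> 0 /\ PS (dps h1) z <> 0.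
Hypothesis R1 : forall n, snd (h1 n) = 0.
Hypothesis R2 : forall n, snd (h2 n) = 0.
Hypothesis H10 : h1 O = 1.

(** Serves both forms: [kap = 1] with [n] equal to [s] rounded up for the power, and [kap = be] with
    [n = m] for the logarithm. The poles are the zeros of [h1]. *)
Definition frac (kap : R) (n : nat) (z : C) : option C :=
  if Ceq_dec (PS h1 z) 0 then None else Some (PS h2 z / (RtoC kap * z ^ n * PS h1 z))%C.

Variables (kap : R) (n : nat).
Hypothesis Hk : kap <> 0.

Let kC : RtoC kap <> 0. Proof. apply RtoC_neq; auto. Qed.
Let zn z : 0 < Cmod z -> (z ^ n)%C <> 0.
Proof. intros H. apply Cpow_nz. apply Cmod_gt_0; auto. Qed.

Lemma frac_zero_simple z : 0 < Cmod z < eps -> PS h1 z = 0 -> exists d, 0 < d /\ forall w, 0 < Cmod (w - z) < d -> PS h1 w <> 0.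
Proof using C1 Hzero.
intros Hz E. destruct (Hzero z Hz E) as [_ N]. apply Cmod_gt_0 in N.
destruct (PS_cder h1 eps z C1 ltac:(lra) (Cmod (PS (dps h1) z) / 2) ltac:(lra)) as [d [Hd F]].
exists d. split; auto. intros w Hw Ew. specialize (F w ltac:(lra)). rewrite E, Ew in F.
replace (0 - 0 - PS (dps h1) z * (w - z))%C with (- (PS (dps h1) z * (w - z)))%C in F by ring.
rewrite Cmod_opp, Cmod_mult in F. nra.
Qed.

Lemma frac_meromorphic : meromorphic_on (Dstar eps) (frac kap n).
Proof using All.
split; [|split].
- intros z Hz. destruct (Ceq_dec (PS h1 z) 0) as [E|N].
  + destruct (frac_zero_simple z Hz E) as [d [Hd F]]. exists d. split; auto. intros w _ Hw. unfold frac.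
    destruct (Ceq_dec (PS h1 w) 0) as [E'|]. exfalso. apply (F w Hw E'). discriminate.
  + destruct (ccont_neq (PS h1) z 0 (PS_ccont h1 eps z C1 ltac:(destruct Hz; auto)) N) as [d [Hd F]].
    exists d. split; auto. intros w _ Hw. unfold frac. destruct (Ceq_dec (PS h1 w) 0) as [E'|]. exfalso. apply (F w ltac:(lra) E'). discriminate.
- intros z Hz Hn. unfold frac in Hn. destruct (Ceq_dec (PS h1 z) 0) as [E|N]. congruence.
  destruct (ccont_neq (PS h1) z 0 (PS_ccont h1 eps z C1 ltac:(destruct Hz; auto)) N) as [d [Hd F]].
  eexists. apply cder_is_derive. apply cder_ext with (fun w => PS h2 w / (RtoC kap * w ^ n * PS h1 w))%C.
  + exists d. split; auto. intros w Hw. unfold frac. destruct (Ceq_dec (PS h1 w) 0) as [E'|]. exfalso. apply (F w Hw E'). auto.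
  + destruct Hz as [Hz1 Hz2]. apply (cder_div _ _ _ _ _ (PS_cder h2 eps z C2 Hz2) (cder_mult _ _ _ _ _ (cder_scal kap _ _ _ (cder_pow n z)) (PS_cder h1 eps z C1 Hz2))).
    repeat apply Cmult_neq_0; auto.
- intros z Hz Hn M. unfold frac in Hn. destruct (Ceq_dec (PS h1 z) 0) as [E|N]; [|discriminate].
  destruct (Hzero z Hz E) as [N2 _]. destruct (frac_zero_simple z Hz E) as [d [Hd F]].
  assert (Hz2 := proj2 Hz).
  assert (K2 := PS_ccont h2 eps z C2 Hz2).
  assert (K1 : ccont (fun w => RtoC kap * w ^ n * PS h1 w)%C z).
  { eapply cder_ccont. apply (cder_mult _ _ _ _ _ (cder_scal kap _ _ _ (cder_pow n z)) (PS_cder h1 eps z C1 Hz2)). }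
  apply Cmod_gt_0 in N2. set (c := Cmod (PS h2 z)) in *.
  destruct (K2 (c / 2) ltac:(lra)) as [d2 [Hd2 F2]].
  assert (HM : 0 < c / 2 / (Rabs M + 1)). { apply Rdiv_lt_0_compat. lra. generalize (Rabs_pos M); lra. }
  destruct (K1 _ HM) as [d1 [Hd1 F1]].
  exists (Rmin d (Rmin (Cmod z) (Rmin d1 d2))). split. repeat apply Rmin_pos; auto. apply Hz.
  intros w Hw Hwz.
  min_le d (Rmin (Cmod z) (Rmin d1 d2)) A1 A2.
  min_le (Cmod z) (Rmin d1 d2) A3 A4. min_le d1 d2 A5 A6.
  specialize (F1 w ltac:(lra)). specialize (F2 w ltac:(lra)). rewrite E in F1.
  replace (RtoC kap * w ^ n * PS h1 w - RtoC kap * z ^ n * 0)%C with (RtoC kap * w ^ n * PS h1 w)%C in F1 by ring.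
  assert (Nw := F w ltac:(lra)). unfold frac. destruct (Ceq_dec (PS h1 w) 0) as [E'|_]. contradiction. simpl.
  assert (Nd : (RtoC kap * w ^ n * PS h1 w)%C <> 0). { repeat apply Cmult_neq_0; auto. apply zn. apply Hw. }
  rewrite Cmod_div by auto. set (D := (RtoC kap * w ^ n * PS h1 w)%C) in *.
  assert (PD : 0 < Cmod D) by (apply Cmod_gt_0; auto).
  assert (T := Cmod_lip (PS h2 w) (PS h2 z)). fold c in T. apply Rabs_le_between in T.
  apply Rlt_le_trans with (c / 2 / Cmod D). 2: { apply Rmult_le_compat_r. left. apply Rinv_0_lt_compat; auto. lra. }
  apply (Rlt_div_r M (c / 2) (Cmod D) PD). apply (Rlt_div_r (Cmod D) (c / 2) (Rabs M + 1)) in F1. 2: generalize (Rabs_pos M); lra.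
  assert (T' := Rle_abs M). nra.
Qed.

Lemma frac_real : real_on_axis eps (frac kap n).
Proof using All.
intros z u Hz Iz E. unfold frac in E. destruct (Ceq_dec (PS h1 z) 0) as [E'|N]; [discriminate|]. injection E. intros <-.
change (snd z = 0) in Iz. destruct Hz as [Hz1 Hz2].
assert (S1 := PS_real_axis h1 eps z C1 R1 Hz2 Iz). assert (S2 := PS_real_axis h2 eps z C2 R2 Hz2 Iz).
assert (Rm : forall x y : C, snd x = 0 -> snd y = 0 -> snd (x * y)%C = 0) by (intros x y A B; simpl; rewrite A, B; ring).
assert (Ri : forall x : C, snd x = 0 -> snd (/ x)%C = 0) by (intros x A; simpl; rewrite A; unfold Rdiv; ring).
assert (Rp : forall k, snd (z ^ k)%C = 0). { induction k. reflexivity. apply Rm; auto. }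
change (snd (PS h2 z / (RtoC kap * z ^ n * PS h1 z))%C = 0). unfold Cdiv. apply Rm; auto.
Qed.

Lemma near_one a : cvr a eps -> a O = 1 -> exists d, 0 < d /\ forall z, Cmod z < d -> / 2 < Cmod (PS a z) < 3 / 2.
Proof using He.
intros Ca Ea. destruct (PS_ccont a eps 0 Ca ltac:(rewrite Cmod_0; auto) (/ 2) ltac:(lra)) as [d [Hd F]].
exists d. split; auto. intros z Hz. specialize (F z ltac:(replace (z - 0)%C with z by ring; auto)).
rewrite PS_0, Ea in F. assert (T := Cmod_lip (PS a z) 1). rewrite Cmod_1 in T. apply Rabs_le_between in T. lra.
Qed.

(** As [h1] has constant coefficient [1], the denominator is comparable with [kap z ^ n] near the
    origin. *)
Lemma frac_not_essential : not_essential_at_0 (frac kap n).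
Proof using All.
destruct (near_one h1 C1 H10) as [d1 [Hd1 F1]].
destruct (PS_ccont h2 eps 0 C2 ltac:(rewrite Cmod_0; auto) 1 ltac:(lra)) as [d2 [Hd2 F2]].
exists (Rmin d1 d2), n, ((Cmod (PS h2 0) + 1) / (Rabs kap * / 2)). split. apply Rmin_pos; auto. intros z Hz.
min_le d1 d2 A1 A2. specialize (F1 z ltac:(lra)).
specialize (F2 z ltac:(replace (z - 0)%C with z by ring; lra)).
assert (N : PS h1 z <> 0) by (apply Cmod_gt_0; lra).
exists (PS h2 z / (RtoC kap * z ^ n * PS h1 z))%C. unfold frac. destruct (Ceq_dec (PS h1 z) 0). contradiction. split; auto.
assert (Nn : (z ^ n)%C <> 0) by (apply zn; lra).
rewrite Cmod_div by (repeat apply Cmult_neq_0; auto). rewrite !Cmod_mult, Cmod_pow, Cmod_R.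
assert (Pk : 0 < Rabs kap) by (apply Rabs_pos_lt; auto). assert (Pz : 0 < Cmod z ^ n) by (apply pow_lt; lra).
replace (Cmod z ^ n * (Cmod (PS h2 z) / (Rabs kap * Cmod z ^ n * Cmod (PS h1 z)))) with (Cmod (PS h2 z) / (Rabs kap * Cmod (PS h1 z))).
2: { field. repeat split; lra. }
assert (T := Cmod_lip (PS h2 z) (PS h2 0)). apply Rabs_le_between in T.
apply Rmult_le_compat. apply Cmod_ge_0. left. apply Rinv_0_lt_compat. apply Rmult_lt_0_compat; lra. lra.
apply Rinv_le_contravar. apply Rmult_lt_0_compat; lra. apply Rmult_le_compat_l; lra.
Qed.
End Shape.

Section Shape2.
Variables (b h1 h2 : nat -> C) (eps s : R) (be : C) (m : nat).
Hypothesis He : 0 < eps.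
Hypothesis Hb : forall n, snd (b n) = 0.
Hypothesis Hs : 0 <= s.
Hypothesis HF : frob (fun n => (/ 2 * b (S n))%C) eps (RtoC s) be m h1 h2.

Let y1 := sol1 h1 (RtoC s).
Let y2 := sol2 h1 h2 (RtoC s) be.
Let zp1 z := zp ((1 + RtoC s) / 2) z.
Let C1 := fr_c1 HF.
Let C2 := fr_c2 HF.
Let H10 := fr_h1 HF.
Let two : (2 : C) <> 0. Proof. apply RtoC_neq; lra. Qed.

Let reals : snd be = 0 /\ (forall n, snd (h1 n) = 0) /\ (forall n, snd (h2 n) = 0).
Proof.
apply (fr_real HF); auto. intros n. assert (E := Hb (S n)). replace (/ 2)%C with (RtoC (/ 2)) by (rewrite RtoC_inv; auto; lra).
destruct (b (S n)). simpl in *. rewrite E. ring.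
Qed.

(** At a zero of [h1] the Wronskian expression reduces to [- z h2 h1']. *)
Lemma frobenius_zero z : 0 < Cmod z < eps -> PS h1 z = 0 -> PS h2 z <> 0 /\ PS (dps h1) z <> 0.
Proof using HF.
intros Hz E. destruct (fr_E HF) as [W [W0 EW]]. specialize (EW z ltac:(lra)). rewrite E in EW.
split; intros E'; apply W0; rewrite <- EW, E'; ring.
Qed.

Lemma zp_split z : zp ((1 - RtoC s) / 2) z = (zp1 z * zp (RtoC (- s)) z)%C.
Proof using. unfold zp1. rewrite <- zp_plus. f_equal. rewrite RtoC_opp. field; auto. Qed.

Lemma sol2_factor z : y2 z = (zp1 z * (zp (RtoC (- s)) z * PS h2 z + be * (PS h1 z * clog z)))%C.
Proof using. unfold y2, sol2, sol1. rewrite zp_split. fold (zp1 z). ring. Qed.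

(** With [be = 0] and [s = 0] the expression of [fr_E] would vanish at the origin. *)
Lemma exponent_nonzero : be = 0 -> 0 < s.
Proof using Hs HF He.
intros E. destruct (Req_dec s 0) as [E0|]; [|lra]. exfalso. destruct (fr_E HF) as [W [W0 EW]]. apply W0.
rewrite <- (EW 0) by (rewrite Cmod_0; auto). rewrite E, E0. ring.
Qed.

Lemma frac_log (z : C) : be <> 0 -> 0 < snd z -> y1 z <> 0 -> PS h1 z <> 0 ->
  (y2 z / be / y1 z)%C = (PS h2 z / (RtoC (fst be) * z ^ m * PS h1 z) + clog z)%C.
Proof using Hb Hs HF.
intros Nb Sz Ny Nh. assert (Sm := fr_be HF Nb). apply RtoC_inj in Sm.
assert (Eb : RtoC (fst be) = be). { destruct reals as [E _]. destruct be. simpl in *. rewrite E. reflexivity. }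
assert (Zi : (zp (RtoC (- s)) z * z ^ m)%C = 1). { rewrite <- (zp_INR m z Sz), <- zp_plus, <- Sm, RtoC_opp. replace (- RtoC s + RtoC s)%C with (RtoC 0) by ring. apply zp_0. }
assert (zn : z <> 0) by (apply Cmod_gt_0, Cmod_pos_snd; auto). assert (znm := Cpow_nz z m zn). assert (Zn := zp_neq0 ((1 + RtoC s) / 2) z).
rewrite sol2_factor, Eb. unfold y1, sol1. fold (zp1 z) in *. replace (zp (RtoC (- s)) z) with (/ z ^ m)%C.
2: { rewrite <- (Cmult_1_l (/ z ^ m)%C), <- Zi. field. auto. }
field. repeat split; auto.
Qed.

(** [z ^ (-s)] is split as [z ^ (n - s) z ^ (-n)]; the integral power goes into the meromorphic
    factor. *)
Lemma frac_pow (z : C) n : be = 0 -> 0 < snd z -> PS h1 z <> 0 ->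
  (y2 z / y1 z)%C = (cpow z (INR n - s) * (PS h2 z / (RtoC 1 * z ^ n * PS h1 z)))%C.
Proof using.
intros Nb Sz Nh. change (cpow z (INR n - s)) with (zp (RtoC (INR n - s)) z).
assert (Zi : zp (RtoC (INR n - s)) z = (zp (RtoC (- s)) z * z ^ n)%C). { rewrite <- (zp_INR n z Sz), <- zp_plus, <- RtoC_plus. f_equal. f_equal. ring. }
assert (zn : z <> 0) by (apply Cmod_gt_0, Cmod_pos_snd; auto). assert (znm := Cpow_nz z n zn). assert (Zn := zp_neq0 ((1 + RtoC s) / 2) z).
rewrite sol2_factor, Nb, Zi. unfold y1, sol1. fold (zp1 z) in *. field. repeat split; auto.
Qed.

Lemma small_log A B : 0 <= A -> 0 <= B -> exists d, 0 < d <= 1 /\ forall r, 0 < r < d -> A + B * (Rabs (ln r) + PI) <= / r / 3.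
Proof.
intros HA HB. assert (P := PI_4). destruct (log_pow_small (/ (3 * (A + 4 * B + 1)))) as [d [Hd F]]. { apply Rinv_0_lt_compat. lra. }
min_le d 1 M1 M2. assert (M3 : 0 < Rmin d 1) by (apply Rmin_pos; lra).
exists (Rmin d 1). split. lra. intros r Hr. specialize (F r ltac:(lra)).
assert (L : ln r < 0) by (rewrite <- ln_1; apply ln_increasing; lra).
rewrite Rabs_left by auto. set (t := 1 - ln r) in *. assert (Ht : 1 <= t) by (unfold t; lra).
assert (T6 : t <= t ^ 6). { replace (t ^ 6) with (t * t ^ 5) by ring. assert (1 <= t ^ 5) by (apply pow_R1_Rle; auto). nra. }
assert (X : A + B * (- ln r + PI) <= (A + 4 * B + 1) * t). { unfold t in *. nra. }
assert (Y : r * t <= / (3 * (A + 4 * B + 1))). { eapply Rle_trans. 2: apply F. apply Rmult_le_compat_l; lra. }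
assert (Z : r * ((A + 4 * B + 1) * t) <= / 3).
{ replace (/ 3) with ((A + 4 * B + 1) * / (3 * (A + 4 * B + 1))) by (field; lra). replace (r * ((A + 4 * B + 1) * t)) with ((A + 4 * B + 1) * (r * t)) by ring.
  apply Rmult_le_compat_l; lra. }
replace (/ r / 3) with (/ 3 / r) by (field; lra). apply (Rle_div_r _ (/ 3) r). lra. nra.
Qed.

(** [y2] dominates [y1]. If [s > 0] the factor [z ^ (-s)] does it, and a logarithm is negligible
    against it; if [s = 0] the logarithm does it, which is present by [exponent_nonzero]. *)
Lemma ratio_infinity M : exists d, 0 < d /\ forall z, HD eps z -> Cmod z < d -> y1 z <> 0 /\ M * Cmod (y1 z) <= Cmod (y2 z).
Proof using HF Hs He.
destruct (near_one eps He h1 C1 H10) as [d1 [Hd1 F1]].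
cut (exists d, 0 < d /\ forall z, HD eps z -> Cmod z < d -> Rabs M * Cmod (PS h1 z) <= Cmod (zp (RtoC (- s)) z * PS h2 z + be * (PS h1 z * clog z))).
{ intros [d [Hd F]]. exists (Rmin d d1). min_le d d1 A1 A2. split. apply Rmin_pos; auto.
  intros z Hz Hzd. specialize (F1 z ltac:(lra)). specialize (F z Hz ltac:(lra)). split.
  - apply Cmult_neq_0. apply zp_neq0. apply Cmod_gt_0. lra.
  - rewrite sol2_factor. unfold y1, sol1. fold (zp1 z). rewrite !Cmod_mult. assert (P := Cmod_ge_0 (zp1 z)).
    assert (T := Rle_abs M). assert (Q : M * Cmod (PS h1 z) <= Rabs M * Cmod (PS h1 z)) by (apply Rmult_le_compat_r; lra).
    replace (M * (Cmod (zp1 z) * Cmod (PS h1 z))) with (Cmod (zp1 z) * (M * Cmod (PS h1 z))) by ring. apply Rmult_le_compat_l; lra. }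
assert (AM := Rabs_pos M).
(* The common part of the cases with [s > 0]. As [|h1| <= 3 / 2] and [|h2| >= / 2] near the origin,
   the other terms may take a third of [|z| ^ (-s)]. *)
assert (Main : h2 O = 1 -> 0 < s -> (exists d, 0 < d /\ forall r, 0 < r < d -> Rabs M + Cmod be * (Rabs (ln r) + PI) <= exp (- s * ln r) / 3) ->
  exists d, 0 < d /\ forall z, HD eps z -> Cmod z < d -> Rabs M * Cmod (PS h1 z) <= Cmod (zp (RtoC (- s)) z * PS h2 z + be * (PS h1 z * clog z))).
{ intros H20 Hs0 [d [Hd F]]. destruct (near_one eps He h2 C2 H20) as [d2 [Hd2 F2]].
  exists (Rmin d (Rmin d1 d2)). split. repeat apply Rmin_pos; auto. intros z Hz Hzd.
  min_le d (Rmin d1 d2) A1 A2. min_le d1 d2 A3 A4.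
  assert (Pz := Cmod_pos_snd z (proj2 Hz)). specialize (F1 z ltac:(lra)). specialize (F2 z ltac:(lra)). specialize (F (Cmod z) ltac:(lra)).
  assert (T := Cmod_triangle (zp (RtoC (- s)) z * PS h2 z + be * (PS h1 z * clog z)) (- (be * (PS h1 z * clog z)))).
  replace (zp (RtoC (- s)) z * PS h2 z + be * (PS h1 z * clog z) + - (be * (PS h1 z * clog z)))%C with (zp (RtoC (- s)) z * PS h2 z)%C in T by ring.
  rewrite Cmod_opp, !Cmod_mult, Cmod_zp_R in T. assert (L := Cmod_clog_le z).
  set (e := exp (- s * ln (Cmod z))) in *. assert (Pe : 0 < e) by apply exp_pos.
  set (x := Cmod (PS h1 z)) in *. set (l := Cmod (clog z)) in *.
  assert (e * / 2 <= e * Cmod (PS h2 z)) by (apply Rmult_le_compat_l; lra).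
  assert (B0 := Cmod_ge_0 be). assert (Cmod be * l <= Cmod be * (Rabs (ln (Cmod z)) + PI)) by (apply Rmult_le_compat_l; lra).
  assert (x * (Rabs M + Cmod be * l) <= x * (e / 3)) by (apply Rmult_le_compat_l; lra).
  assert (x * (e / 3) <= 3 / 2 * (e / 3)) by (apply Rmult_le_compat_r; lra). lra. }
destruct (Ceq_dec be 0) as [Eb|Nb].
- assert (Hs0 := exponent_nonzero Eb). apply Main; auto.
  + destruct (fr_h2 HF) as [|[E _]]; auto. exfalso. apply RtoC_inj in E. lra.
  + exists (exp (- (3 * Rabs M / s))). split. apply exp_pos. intros r Hr. rewrite Eb, Cmod_0.
    assert (L : ln r < - (3 * Rabs M / s)). { rewrite <- (ln_exp (- _)). apply ln_increasing; lra. }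
    assert (X : 3 * Rabs M <= - s * ln r). { replace (3 * Rabs M) with (- s * (- (3 * Rabs M / s))) by (field; lra). nra. }
    assert (T := exp_ineq1_le (- s * ln r)). lra.
- assert (Sm := fr_be HF Nb). apply RtoC_inj in Sm.
  destruct m as [|m'].
  + simpl in Sm. assert (Pb : 0 < Cmod be) by (apply Cmod_gt_0; auto).
    destruct (PS_ccont h2 eps 0 C2 ltac:(rewrite Cmod_0; auto) 1 ltac:(lra)) as [d2 [Hd2 F2]].
    (* Here [h2] is merely bounded; [Q] is the size of [|log z|] from which the logarithmic term
       prevails. *)
    set (Q := (3 / 2 * Rabs M + Cmod (PS h2 0) + 1) / (Cmod be * / 2)).
    exists (Rmin (exp (- Q)) (Rmin d1 d2)). split. repeat apply Rmin_pos; auto. apply exp_pos. intros z Hz Hzd.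
    min_le (exp (- Q)) (Rmin d1 d2) A1 A2. min_le d1 d2 A3 A4.
    assert (Pz := Cmod_pos_snd z (proj2 Hz)). specialize (F1 z ltac:(lra)). specialize (F2 z ltac:(replace (z - 0)%C with z by ring; lra)).
    assert (T2 := Cmod_lip (PS h2 z) (PS h2 0)). apply Rabs_le_between in T2.
    assert (Hl : Q <= Cmod (clog z)).
    { eapply Rle_trans. 2: apply Cmod_fst. unfold clog. cbn [fst]. rewrite <- Rabs_Ropp. eapply Rle_trans. 2: apply Rle_abs.
      assert (ln (Cmod z) < - Q). { rewrite <- (ln_exp (- Q)). apply ln_increasing; lra. } lra. }
    rewrite Sm, Ropp_0. change (zp (RtoC 0) z) with (zp 0 z). rewrite zp_0.
    assert (T := Cmod_triangle (1 * PS h2 z + be * (PS h1 z * clog z)) (- PS h2 z)).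
    replace (1 * PS h2 z + be * (PS h1 z * clog z) + - PS h2 z)%C with (be * (PS h1 z * clog z))%C in T by ring.
    rewrite Cmod_opp, !Cmod_mult in T. set (x := Cmod (PS h1 z)) in *. set (l := Cmod (clog z)) in *.
    assert (EQ : Cmod be * / 2 * Q = 3 / 2 * Rabs M + Cmod (PS h2 0) + 1) by (unfold Q; field; lra).
    assert (l0 : 0 <= l) by apply Cmod_ge_0.
    assert (Cmod be * / 2 * Q <= Cmod be * / 2 * l) by (apply Rmult_le_compat_l; lra).
    assert (Cmod be * (/ 2 * l) <= Cmod be * (x * l)). { apply Rmult_le_compat_l. lra. apply Rmult_le_compat_r; lra. }
    assert (Rabs M * x <= Rabs M * (3 / 2)) by (apply Rmult_le_compat_l; lra). lra.
  + assert (S1 : 1 <= s). { rewrite Sm, S_INR. generalize (pos_INR m'). lra. }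
    apply Main. 2: lra.
    * destruct (fr_h2 HF) as [|[E _]]; auto. exfalso. apply RtoC_inj in E. lra.
    * destruct (small_log (Rabs M) (Cmod be) AM (Cmod_ge_0 be)) as [d [[Hd Hd'] F]]. exists d. split; auto.
      intros r Hr. eapply Rle_trans. apply F; auto. apply Rmult_le_compat_r. lra.
      rewrite <- (exp_ln r) at 1 by lra. rewrite <- exp_Ropp. apply exp_le_exp.
      assert (ln r < 0) by (rewrite <- ln_1; apply ln_increasing; lra). nra.
Qed.

Section Dev.
Variables (g : C -> option C) (A B C D : Complex.C).
Hypothesis Hdet : (A * D - B * C)%C <> 0.
Hypothesis HRel : forall z, HD eps z -> quot_rel g A B C D y1 y2 z.

(** As [y2 / y1] tends to infinity, the limit of [g] is the image of infinity: [B / D], or infinity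
    if [D = 0]. *)
Lemma quotient_extends : extends_cont_to_0 eps g.
Proof using All.
destruct (Ceq_dec D 0) as [ED|ND].
- exists None. intros M.
  assert (NB : B <> 0) by (intros E; apply Hdet; rewrite E, ED; ring).
  apply Cmod_gt_0 in NB.
  destruct (ratio_infinity ((Cmod A + (Cmod C + 1) * (Rabs M + 1)) / Cmod B)) as [d [Hd F]].
  exists d. split; auto. intros z Hz Hzd u Eu. destruct (F z Hz Hzd) as [N1 N2]. assert (R := HRel z Hz). unfold quot_rel in R. rewrite Eu, ED in R.
  apply Cmod_gt_0 in N1. assert (T := Cmod_triangle (u * (C * y1 z + 0 * y2 z)) (- (A * y1 z))).
  replace (u * (C * y1 z + 0 * y2 z) + - (A * y1 z))%C with (B * y2 z)%C in T by (rewrite R; ring).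
  replace (C * y1 z + 0 * y2 z)%C with (C * y1 z)%C in T by ring.
  rewrite Cmod_opp, !Cmod_mult in T.
  assert (X : (Cmod A + (Cmod C + 1) * (Rabs M + 1)) * Cmod (y1 z) <= Cmod B * Cmod (y2 z)).
  { replace ((Cmod A + (Cmod C + 1) * (Rabs M + 1)) * Cmod (y1 z)) with (Cmod B * ((Cmod A + (Cmod C + 1) * (Rabs M + 1)) / Cmod B * Cmod (y1 z))) by (field; lra).
    apply Rmult_le_compat_l; lra. }
  assert (Y : (Cmod C + 1) * (Rabs M + 1) <= Cmod u * Cmod C). { apply Rmult_le_reg_r with (Cmod (y1 z)); auto. lra. }
  assert (T' := Rle_abs M). assert (P := Rabs_pos M). assert (PC := Cmod_ge_0 C). assert (Pu := Cmod_ge_0 u).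
  apply Rnot_le_lt. intros Hle. assert (Cmod u * Cmod C <= Rabs M * Cmod C) by (apply Rmult_le_compat_r; lra). nra.
- exists (Some (B / D)%C). intros e Hee. assert (PD := ND). apply Cmod_gt_0 in PD.
  set (det := (A * D - B * C)%C) in *. assert (Pdet := Hdet). apply Cmod_gt_0 in Pdet. assert (PC := Cmod_ge_0 C).
  (* The first term of [N] makes [D y2] dominate [C y1] in the denominator [Y]; the second makes the
     error [det y1 / (Y D)] smaller than [e]. *)
  set (N := 2 * (Cmod C + 1) / Cmod D + 4 * Cmod det / (e * (Cmod D * Cmod D))).
  destruct (ratio_infinity N) as [d [Hd F]].
  exists d. split; auto. intros z Hz Hzd. destruct (F z Hz Hzd) as [N1 N2]. assert (R := HRel z Hz). unfold quot_rel in R.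
  set (Y := (C * y1 z + D * y2 z)%C) in *. apply Cmod_gt_0 in N1.
  assert (X1 : N * Cmod (y1 z) * Cmod D <= Cmod D * Cmod (y2 z)) by (rewrite (Rmult_comm (Cmod D)); apply Rmult_le_compat_r; lra).
  assert (X2 : N * Cmod D = 2 * (Cmod C + 1) + 4 * Cmod det / (e * Cmod D)) by (unfold N; field; lra).
  assert (X3 : 0 < 4 * Cmod det / (e * Cmod D)). { apply Rdiv_lt_0_compat. lra. apply Rmult_lt_0_compat; lra. }
  set (q := 4 * Cmod det / (e * Cmod D)) in *.
  assert (X4 : (2 * (Cmod C + 1) + q) * Cmod (y1 z) <= Cmod D * Cmod (y2 z)). { rewrite <- X2. lra. }
  assert (T := Cmod_triangle Y (- (C * y1 z))). replace (Y + - (C * y1 z))%C with (D * y2 z)%C in T by (unfold Y; ring).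
  rewrite Cmod_opp, !Cmod_mult in T.
  assert (LY : (q / 2) * Cmod (y1 z) < Cmod Y) by nra.
  assert (NY : Y <> 0). { apply Cmod_gt_0. assert (0 < q / 2 * Cmod (y1 z)) by (apply Rmult_lt_0_compat; lra). lra. }
  destruct (g z) as [u|] eqn:Eu; [|contradiction]. exists u. split; auto.
  assert (Eq : (u - B / D)%C = (det * y1 z / (Y * D))%C).
  { replace u with ((A * y1 z + B * y2 z) / Y)%C by (rewrite <- R; field; auto). unfold det.
    transitivity (((A * y1 z + B * y2 z) * D - B * Y) / (Y * D))%C. field; auto. unfold Y at 1. unfold Cdiv. f_equal. ring. }
  rewrite Eq, Cmod_div, !Cmod_mult by (apply Cmult_neq_0; auto). assert (PY : 0 < Cmod Y) by (apply Cmod_gt_0; auto).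
  apply (Rlt_div_l (Cmod det * Cmod (y1 z)) e (Cmod Y * Cmod D)). apply Rmult_lt_0_compat; auto.
  assert (X5 : q / 2 * (e * Cmod D) = 2 * Cmod det) by (unfold q; field; lra).
  assert (X6 : q / 2 * Cmod (y1 z) * (e * Cmod D) < Cmod Y * (e * Cmod D)). { apply Rmult_lt_compat_r; auto. apply Rmult_lt_0_compat; lra. }
  assert (0 < Cmod det * Cmod (y1 z)) by (apply Rmult_lt_0_compat; auto). nra.
Qed.

Lemma quotient_shape :
       ((exists (gamma : R) (F : Complex.C -> option Complex.C) (a b c d : Complex.C),
           0 <= gamma < 1 /\
           meromorphic_on (Dstar eps) F /\ real_on_axis eps F /\
           not_essential_at_0 F /\
           Cminus (Cmult a d) (Cmult b c) <> RtoC 0 /\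
           forall z, Dplus eps z ->
             mobius_maps a b c d (option_map (fun u => Cmult (cpow z gamma) u) (F z)) (g z))
        \/
        (exists (F : Complex.C -> option Complex.C) (a b c d : Complex.C),
           meromorphic_on (Dstar eps) F /\ real_on_axis eps F /\
           not_essential_at_0 F /\
           Cminus (Cmult a d) (Cmult b c) <> RtoC 0 /\
           forall z, Dplus eps z ->
             mobius_maps a b c d (option_map (fun u => Cplus u (clog z)) (F z)) (g z))).
Proof using All.
destruct reals as [Rb [R1 R2]].
assert (Ind : forall z, HD eps z -> y1 z = 0 -> y2 z = 0 -> False).
{ intros z Hz E1 E2. destruct (fr_E HF) as [W [W0 EW]]. apply W0.
  rewrite <- (sol_wronskian b h1 h2 eps (RtoC s) be m HF z Hz W EW). fold y1 y2. rewrite E1, E2. ring. }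
assert (Y1 : forall z, y1 z = 0 <-> PS h1 z = 0).
{ intros z. unfold y1, sol1. split; intros E. 2: rewrite E; ring. destruct (Ceq_dec (PS h1 z) 0) as [|N]; auto. exfalso. revert E. apply Cmult_neq_0; auto. apply zp_neq0. }
destruct (Ceq_dec be 0) as [Eb|Nb].
- left. destruct (nfloor_ex s Hs) as [n0 Hn0].
  (* [n] is [s] rounded up, and [gamma = n - s]. *)
  assert (Hn : exists n, 0 <= INR n - s < 1). { destruct (Req_dec s (INR n0)). exists n0. lra. exists (S n0). rewrite S_INR. lra. }
  destruct Hn as [n Hn]. assert (K1 : 1 <> 0) by lra.
  exists (INR n - s), (frac h1 h2 1 n), B, A, D, C. split; auto.
  split. exact (frac_meromorphic h1 h2 eps He C1 C2 frobenius_zero R1 R2 H10 _ _ K1). split. exact (frac_real h1 h2 eps He C1 C2 frobenius_zero R1 R2 H10 _ _ K1).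
  split. exact (frac_not_essential h1 h2 eps He C1 C2 frobenius_zero R1 R2 H10 _ _ K1).
  split. { intros E. apply Hdet. transitivity (- (B * C - A * D))%C. ring. rewrite E. ring. }
  intros z Hz. assert (M := mobius_of_quot_rel g A B C D y1 y2 z Hdet (Ind z Hz) (HRel z Hz)).
  unfold frac. destruct (Ceq_dec (y1 z) 0) as [E|N]; destruct (Ceq_dec (PS h1 z) 0) as [E'|N']; try (apply Y1 in E || apply Y1 in E'; contradiction); auto.
  simpl option_map. rewrite <- (frac_pow z n Eb (proj2 Hz) N'). auto.
- right. assert (Kb : fst be <> 0). { intros E. apply Nb. apply injective_projections; auto. }
  (* [y2] is divided by [be] so that the logarithm has coefficient [1]; the Moebius coefficients
     compensate. *)
  exists (frac h1 h2 (fst be) m), (B * be)%C, A, (D * be)%C, C.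
  split. exact (frac_meromorphic h1 h2 eps He C1 C2 frobenius_zero R1 R2 H10 _ _ Kb). split. exact (frac_real h1 h2 eps He C1 C2 frobenius_zero R1 R2 H10 _ _ Kb).
  split. exact (frac_not_essential h1 h2 eps He C1 C2 frobenius_zero R1 R2 H10 _ _ Kb).
  assert (Hd' : (A * (D * be) - (B * be) * C)%C <> 0). { replace (A * (D * be) - B * be * C)%C with ((A * D - B * C) * be)%C by ring. apply Cmult_neq_0; auto. }
  split. { intros E. apply Hd'. transitivity (- (B * be * C - A * (D * be)))%C. ring. rewrite E. ring. }
  intros z Hz. assert (M := mobius_of_quot_rel g A (B * be) C (D * be) y1 (fun z => y2 z / be)%C z Hd').
  assert (Rl := HRel z Hz).
  unfold frac. destruct (Ceq_dec (y1 z) 0) as [E|N]; destruct (Ceq_dec (PS h1 z) 0) as [E'|N']; try (apply Y1 in E || apply Y1 in E'; contradiction).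
  + apply M. intros E1 E2. apply (Ind z Hz E1). replace (y2 z) with (y2 z / be * be)%C by (field; auto). rewrite E2. ring.
    unfold quot_rel in *. destruct (g z) as [u|]. replace (C * y1 z + D * be * (y2 z / be))%C with (C * y1 z + D * y2 z)%C by (field; auto). rewrite Rl. field; auto.
    rewrite <- Rl. field; auto.
  + simpl option_map. rewrite <- (frac_log z Nb (proj2 Hz) N N'). apply M.
    intros E1 E2. apply (Ind z Hz E1). replace (y2 z) with (y2 z / be * be)%C by (field; auto). rewrite E2. ring.
    unfold quot_rel in *. destruct (g z) as [u|]. replace (C * y1 z + D * be * (y2 z / be))%C with (C * y1 z + D * y2 z)%C by (field; auto). rewrite Rl. field; auto.
    rewrite <- Rl. field; auto.
Qed.
End Dev.
End Shape2.

(** * Boundary regularity and the area *)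

Lemma contS_line eps f s e : contS (HB eps) f (s, 0) -> s <> 0 -> Rabs s < eps -> 0 < e ->
  exists d, 0 < d /\ forall y t, Rabs (y - s) < d -> 0 <= t < d -> HB eps (y, t) /\ Rabs (f (y, t) - f (s, 0)) < e.
Proof.
intros Hf Hs He H. destruct (Hf e H) as [d [Hd F]].
assert (As : 0 < Rabs s) by (apply Rabs_pos_lt; auto).
set (m := Rmin (d / 2) (Rmin ((eps - Rabs s) / 2) (Rabs s))).
min_le (d / 2) (Rmin ((eps - Rabs s) / 2) (Rabs s)) M1 M2.
min_le ((eps - Rabs s) / 2) (Rabs s) M3 M4. fold m in M1, M2.
exists m. split. unfold m; repeat apply Rmin_pos; lra. intros y t Hy Ht.
assert (T := Rabs_triang (y - s) s). replace (y - s + s) with y in T by ring.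
assert (T' := Rabs_triang (y - s) (- y)). replace (y - s + - y) with (- s) in T' by ring. rewrite !Rabs_Ropp in T'.
assert (B : HB eps (y, t)).
{ split; [|split]. eapply Rle_lt_trans. apply Cmod_pair_le. rewrite (Rabs_pos_eq t); lra. simpl; lra. intros E. apply (f_equal fst) in E. simpl in E. assert (Y0 : Rabs y = 0) by (rewrite E; apply Rabs_R0). lra. }
split; auto. apply F; auto. replace ((y, t) - (s, 0))%C with (y - s, t) by Cring.
eapply Rle_lt_trans. apply Cmod_pair_le. rewrite (Rabs_pos_eq t); lra.
Qed.

Lemma Rabs_le_all x : (forall e, 0 < e -> Rabs x <= e) -> x = 0.
Proof.
intros F. destruct (Req_dec x 0); auto. exfalso. assert (P : 0 < Rabs x) by (apply Rabs_pos_lt; auto).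
specialize (F (Rabs x / 2) ltac:(lra)). lra.
Qed.

Lemma MVT_bound (f df : R -> R) a b c e : (forall x, Rmin a b <= x <= Rmax a b -> is_derive f x (df x)) ->
  (forall x, Rmin a b <= x <= Rmax a b -> Rabs (df x - c) <= e) -> Rabs (f b - f a - c * (b - a)) <= e * Rabs (b - a).
Proof.
intros D B. destruct (MVT_gen f a b df) as [x [Hx E]].
- intros y Hy. apply D. lra.
- intros y Hy. apply continuity_pt_filterlim. apply (ex_derive_continuous f). eexists. apply D. auto.
- rewrite E. replace (df x * (b - a) - c * (b - a)) with ((df x - c) * (b - a)) by ring. rewrite Rabs_mult.
  apply Rmult_le_compat_r. apply Rabs_pos. auto.
Qed.

(* Differentiate along [t = const > 0] and let [t] tend to [0]. *)
Lemma axis_tangent eps (f fs : C -> R) s : (forall z, HD eps z -> is_derive (fun x => f (x, snd z)) (fst z) (fs z)) ->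
  (forall z, HB eps z -> contS (HB eps) f z) -> contS (HB eps) fs (s, 0) -> s <> 0 -> Rabs s < eps ->
  is_derive (fun x => f (x, 0)) s (fs (s, 0)).
Proof.
intros D Cf Cs Hs He. apply is_derive_eps. intros e Hep.
destruct (contS_line eps fs s e Cs Hs He Hep) as [d [Hd F]]. exists d. split; auto. intros y Hy.
assert (HBs : HB eps (s, 0)) by (apply (F s 0); rewrite ?Rminus_diag, ?Rabs_R0; lra).
assert (HBy : HB eps (y, 0)) by (apply (F y 0); auto; lra).
apply le_epsilon. intros e1 He1. change (Rabs (f (y, 0) - f (s, 0) - fs (s, 0) * (y - s)) <= e * Rabs (y - s) + e1).
destruct (Cf _ HBs (e1 / 2) ltac:(lra)) as [d1 [Hd1 F1]]. destruct (Cf _ HBy (e1 / 2) ltac:(lra)) as [d2 [Hd2 F2]].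
set (t := Rmin d (Rmin d1 d2) / 2). min_le d (Rmin d1 d2) M1 M2. min_le d1 d2 M3 M4.
assert (Pt : 0 < Rmin d (Rmin d1 d2)) by (repeat apply Rmin_pos; auto). assert (Ht : 0 < t) by (unfold t; lra).
assert (Ev : forall x, Cmod ((x, t) - (x, 0)) = t). { intros x. replace ((x, t) - (x, 0))%C with (0, t) by Cring.
  apply Rle_antisym. eapply Rle_trans. apply Cmod_pair_le. rewrite Rabs_R0, Rabs_pos_eq; lra. assert (Q := Cmod_snd (0, t)). simpl in Q. rewrite Rabs_pos_eq in Q; lra. }
assert (Near : forall x, Rmin s y <= x <= Rmax s y -> Rabs (x - s) < d).
{ intros x Hx. apply Rabs_lt_between in Hy. apply Rabs_lt_between. unfold Rmin, Rmax in Hx. destruct (Rle_dec s y); lra. }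
assert (Bt : forall x, Rabs (x - s) < d -> HB eps (x, t)) by (intros x Hx; apply (F x t Hx); unfold t; lra).
assert (X := MVT_bound (fun x => f (x, t)) (fun x => fs (x, t)) s y (fs (s, 0)) e).
assert (Y : Rabs (f (y, t) - f (s, t) - fs (s, 0) * (y - s)) <= e * Rabs (y - s)).
{ apply X. intros x Hx. apply (D (x, t)). destruct (Bt x (Near x Hx)) as [B1 [B2 _]]. split; auto.
  intros x Hx. left. apply (F x t (Near x Hx)). unfold t; lra. }
specialize (F1 (s, t) (Bt s ltac:(rewrite Rminus_diag, Rabs_R0; auto)) ltac:(rewrite Ev; unfold t; lra)).
specialize (F2 (y, t) (Bt y Hy) ltac:(rewrite Ev; unfold t; lra)).
apply Rabs_lt_between in F1. apply Rabs_lt_between in F2. apply Rabs_le_between in Y. apply Rabs_le_between. lra.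
Qed.

(** The mean value theorem on [[t0, t]], inside the half disc, compares the difference quotient at
    the axis with the limit of the interior derivative. *)
Lemma axis_normal eps (f ft : C -> R) s l : (forall z, HD eps z -> is_derive (fun y => f (fst z, y)) (snd z) (ft z)) ->
  (forall z, HB eps z -> contS (HB eps) f z) -> contS (HB eps) ft (s, 0) -> s <> 0 -> Rabs s < eps ->
  dt_boundary f s l -> ft (s, 0) = l.
Proof.
intros D Cf Ct Hs He Hl. apply Rminus_diag_uniq. apply Rabs_le_all. intros e Hep.
destruct (contS_line eps ft s (e / 4) Ct Hs He ltac:(lra)) as [d [Hd F]].
destruct (proj1 (filterlim_locally _ _) Hl (mkposreal (e / 4) ltac:(lra))) as [d1 F1].
set (t := Rmin d d1 / 2). min_le d d1 M1 M2. assert (P1 := cond_pos d1).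
assert (Pt : 0 < Rmin d d1) by (apply Rmin_pos; auto). assert (Ht : 0 < t) by (unfold t; lra).
assert (G : Rabs ((f (s, t) - f (s, 0)) / t - l) < e / 4). { apply F1; auto. change (Rabs (t - 0) < d1). rewrite Rabs_pos_eq; unfold t; lra. }
assert (S0 : Rabs (s - s) < d) by (rewrite Rminus_diag, Rabs_R0; auto).
assert (HB0 : HB eps (s, 0)) by (apply (F s 0 S0); lra).
destruct (Cf _ HB0 (e / 4 * t) ltac:(apply Rmult_lt_0_compat; lra)) as [d2 [Hd2 F2]].
set (L := ft (s, 0)) in *. assert (PL := Rabs_pos L). set (q := e / 4 * t / (Rabs L + 1)).
assert (Pq : 0 < q). { apply Rdiv_lt_0_compat. apply Rmult_lt_0_compat; lra. lra. }
assert (Eq : q * (Rabs L + 1) = e / 4 * t) by (unfold q; field; lra).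
(* So small that both the change of [f] between the axis and height [t0] and the linear term [L t0]
   are at most [e / 4] times [t]. *)
set (t0 := Rmin t (Rmin d2 q) / 2). min_le t (Rmin d2 q) M3 M4.
min_le d2 q M5 M6. assert (Pt0 : 0 < Rmin t (Rmin d2 q)) by (repeat apply Rmin_pos; auto).
assert (Ht0 : 0 < t0) by (unfold t0; lra). assert (Le : t0 <= t / 2) by (unfold t0; lra). assert (Lq : t0 <= q) by (unfold t0; lra).
assert (X := MVT_bound (fun y => f (s, y)) (fun y => ft (s, y)) t0 t L (e / 4)).
assert (Y : Rabs (f (s, t) - f (s, t0) - L * (t - t0)) <= e / 4 * Rabs (t - t0)).
{ apply X; intros x Hx; rewrite Rmin_left, Rmax_right in Hx by lra.
  - apply (D (s, x)). destruct (F s x S0) as [[B1 _] _]. unfold t in *; lra. split; auto. simpl. lra.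
  - left. apply (F s x S0). unfold t in *; lra. }
rewrite (Rabs_pos_eq (t - t0)) in Y by lra.
assert (Bt0 : HB eps (s, t0)) by (apply (F s t0 S0); unfold t, t0 in *; lra).
assert (Et0 : Cmod ((s, t0) - (s, 0)) <= t0). { replace ((s, t0) - (s, 0))%C with (0, t0) by Cring.
  eapply Rle_trans. apply Cmod_pair_le. rewrite Rabs_R0, Rabs_pos_eq; lra. }
specialize (F2 (s, t0) Bt0 ltac:(unfold t0 in *; lra)).
assert (LL : Rabs (L * t0) <= e / 4 * t). { rewrite Rabs_mult, (Rabs_pos_eq t0) by lra. rewrite <- Eq. nra. }
assert (Z : Rabs ((f (s, t) - f (s, 0)) / t - L) <= 3 * e / 4).
{ replace ((f (s, t) - f (s, 0)) / t - L) with ((f (s, t) - f (s, 0) - L * t) / t) by (field; lra). rewrite Rabs_div, (Rabs_pos_eq t) by lra.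
  apply (Rle_div_l _ (3 * e / 4) t Ht). apply Rabs_le_between in Y. apply Rabs_lt_between in F2. apply Rabs_le_between in LL. apply Rabs_le_between. nra. }
apply Rabs_le_between in Z. apply Rabs_lt_between in G. apply Rabs_le_between. lra.
Qed.

(** * From the hypotheses of the theorem to the estimates *)

Section Assembly.
Variables (K c1 c2 eps : R) (v vs vt vss vst vts vtt : C -> R).
Hypothesis HK : K = -1 \/ K = 0 \/ K = 1.
Hypothesis He : 0 < eps.
Hypothesis Cv : cont_on (Dbar eps) v.
Hypothesis Cs : cont_on (Dbar eps) vs.
Hypothesis Ct : cont_on (Dbar eps) vt.
Hypothesis Css : cont_on (Dbar eps) vss.
Hypothesis Cst : cont_on (Dbar eps) vst.
Hypothesis Cts : cont_on (Dbar eps) vts.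
Hypothesis Ctt : cont_on (Dbar eps) vtt.
Hypothesis HD2 : forall z, Dplus eps z ->
      is_derive (fun s => v (s, snd z)) (fst z) (vs z) /\
      is_derive (fun t => v (fst z, t)) (snd z) (vt z) /\
      is_derive (fun s => vs (s, snd z)) (fst z) (vss z) /\
      is_derive (fun t => vs (fst z, t)) (snd z) (vst z) /\
      is_derive (fun s => vt (s, snd z)) (fst z) (vts z) /\
      is_derive (fun t => vt (fst z, t)) (snd z) (vtt z).
Hypothesis Heq : forall z, Dplus eps z -> laplacian v z + 2 * K * exp (v z) = 0.
Hypothesis Hb1 : forall s, 0 < s < eps -> dt_boundary v s (c1 * exp (v (s, 0) / 2)).
Hypothesis Hb2 : forall s, - eps < s < 0 -> dt_boundary v s (c2 * exp (v (s, 0) / 2)).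
Hypothesis Hint : MCInt.finite_exp_integral (Dplus eps) v.

Let toS f z : cont_on (Dbar eps) f -> HB eps z -> contS (HB eps) f z.
Proof.
intros Hf [H1 [H2 H3]] e Hee. assert (Bz : Dbar eps z) by (split; [lra|split; auto]).
destruct (Hf z Bz e Hee) as [d [Hd F]]. exists d. split; auto. intros w [W1 [W2 W3]] Hw. apply F; auto. split; [lra|split; auto].
Qed.

Let toR f z : cont_on (Dbar eps) f -> HD eps z -> contR f z.
Proof.
intros Hf Hz e Hee. destruct (toS f z Hf (HD_HB _ _ Hz) e Hee) as [d [Hd F]]. destruct (HD_open _ _ Hz) as [d' [Hd' O]].
exists (Rmin d d'). split. apply Rmin_pos; auto. min_le d d' A B. intros w Hw.
apply F. apply HD_HB, O. lra. lra.
Qed.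

Lemma HD_C2on : C2on (HD eps) v vs vt vss vst vts vtt.
Proof using HD2 Cs Ct Css Cst Cts Ctt.
assert (P : forall f fs ft z, HD eps z -> (forall z, HD eps z -> is_derive (fun s => f (s, snd z)) (fst z) (fs z) /\ is_derive (fun t => f (fst z, t)) (snd z) (ft z)) ->
  cont_on (Dbar eps) fs -> cont_on (Dbar eps) ft -> fder f z (fs z) (ft z)).
{ intros f fs ft z Hz D C1 C2. destruct (HD_open _ _ Hz) as [d [Hd O]]. apply (fder_partials f fs ft z d Hd); auto. }
constructor; intros z Hz; auto.
- apply P; auto. intros w Hw. destruct (HD2 w Hw) as [A [B _]]. auto.
- apply P; auto. intros w Hw. destruct (HD2 w Hw) as [_ [_ [A [B _]]]]. auto.
- apply P; auto. intros w Hw. destruct (HD2 w Hw) as [_ [_ [_ [_ [A B]]]]]. auto.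
Qed.

Let line z : HD eps z -> locally (fst z) (fun s => HD eps (s, snd z)) /\ locally (snd z) (fun t => HD eps (fst z, t)).
Proof.
intros Hz. destruct (HD_open _ _ Hz) as [d [Hd O]]. destruct z as [x y].
split; exists (mkposreal d Hd); intros w Hw; apply O; cbn [fst snd].
- change (Rabs (w - x) < d) in Hw. replace ((w, y) - (x, y))%C with (w - x, 0) by Cring.
  eapply Rle_lt_trans. apply Cmod_pair_le. rewrite Rabs_R0. lra.
- change (Rabs (w - y) < d) in Hw. replace ((x, w) - (x, y))%C with (0, w - y) by Cring.
  eapply Rle_lt_trans. apply Cmod_pair_le. rewrite Rabs_R0. lra.
Qed.

Lemma pd_values z : HD eps z -> pd_s v z = vs z /\ pd_t v z = vt z /\ pd_s (pd_s v) z = vss z /\ pd_t (pd_s v) z = vst z /\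
  pd_s (pd_t v) z = vts z /\ pd_t (pd_t v) z = vtt z.
Proof using HD2.
assert (E1 : forall z, HD eps z -> pd_s v z = vs z) by (intros w Hw; apply is_derive_unique, HD2, Hw).
assert (E2 : forall z, HD eps z -> pd_t v z = vt z) by (intros w Hw; apply is_derive_unique; apply HD2, Hw).
intros Hz. destruct (line z Hz) as [L1 L2]. destruct (HD2 z Hz) as [_ [_ [A1 [A2 [A3 A4]]]]].
repeat split; auto; apply is_derive_unique.
- apply (is_derive_ext_loc (fun s => vs (s, snd z))); auto. revert L1. apply filter_imp. intros s Hs. symmetry. apply E1; auto.
- apply (is_derive_ext_loc (fun t => vs (fst z, t))); auto. revert L2. apply filter_imp. intros s Hs. symmetry. apply E1; auto.
- apply (is_derive_ext_loc (fun s => vt (s, snd z))); auto. revert L1. apply filter_imp. intros s Hs. symmetry. apply E2; auto.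
- apply (is_derive_ext_loc (fun t => vt (fst z, t))); auto. revert L2. apply filter_imp. intros s Hs. symmetry. apply E2; auto.
Qed.

Let bd s : s <> 0 -> Rabs s < eps -> exists c d, (c = c1 \/ c = c2) /\ 0 < d /\
  forall y, Rabs (y - s) < d -> y <> 0 /\ Rabs y < eps /\ dt_boundary v y (c * exp (v (y, 0) / 2)).
Proof.
intros Hs Hse. apply Rabs_lt_between in Hse.
min_le (Rabs s) (eps - Rabs s) Q1 Q2.
assert (P : 0 < Rmin (Rabs s) (eps - Rabs s)). { apply Rmin_pos. apply Rabs_pos_lt; auto. assert (Rabs s < eps) by (apply Rabs_lt_between; auto). lra. }
destruct (Rlt_le_dec 0 s).
- rewrite (Rabs_pos_eq s) in * by lra. exists c1, (Rmin s (eps - s)). split; auto. split; auto. intros y Hy. apply Rabs_lt_between in Hy.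
  repeat split; try lra. rewrite Rabs_pos_eq; lra. apply Hb1. lra.
- rewrite (Rabs_left s) in * by lra. exists c2, (Rmin (- s) (eps - - s)). split; auto. split; auto. intros y Hy. apply Rabs_lt_between in Hy.
  repeat split; try lra. rewrite Rabs_left; lra. apply Hb2. lra.
Qed.

Let HBs s : s <> 0 -> Rabs s < eps -> HB eps (s, 0).
Proof.
intros Hs Hse. split; [|split]. eapply Rle_lt_trans. apply Cmod_pair_le. rewrite Rabs_R0; lra. simpl; lra. intros E. apply Hs. exact (f_equal fst E).
Qed.

(* On the axis [v_t = c e^{v/2}], whose tangential derivative is [v_s v_t / 2]. *)
Lemma axis_identity s : s <> 0 -> Rabs s < eps -> vst (s, 0) + vts (s, 0) = vs (s, 0) * vt (s, 0).
Proof using All.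
intros Hs Hse. assert (B := HBs s Hs Hse). destruct (bd s Hs Hse) as [c [d [_ [Hd F]]]].
assert (N : forall y, Rabs (y - s) < d -> vt (y, 0) = c * exp (v (y, 0) / 2)).
{ intros y Hy. destruct (F y Hy) as [Y1 [Y2 Y3]]. apply (axis_normal eps v vt y); auto. intros z Hz. apply HD2; auto. }
assert (Dv : is_derive (fun x => v (x, 0)) s (vs (s, 0))). { apply (axis_tangent eps); auto. intros z Hz. apply HD2; auto. }
assert (Dt : is_derive (fun x => vt (x, 0)) s (vts (s, 0))). { apply (axis_tangent eps); auto. intros z Hz. apply HD2; auto. }
assert (E : vts (s, 0) = c * (exp (v (s, 0) / 2) * (vs (s, 0) / 2))).
{ rewrite <- (is_derive_unique _ _ _ Dt). apply is_derive_unique.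
  apply (is_derive_ext_loc (fun y => c * exp (v (y, 0) / 2))).
  - exists (mkposreal d Hd). intros y Hy. symmetry. apply N. exact Hy.
  - set (u := fun x : R => v (x, 0)). change (is_derive u s (vs (s, 0))) in Dv.
    change (is_derive (fun y => c * exp (u y / 2)) s (c * (exp (u s / 2) * (vs (s, 0) / 2)))). clearbody u.
    auto_derive. eexists; exact Dv. replace (Derive (fun x => u x) s) with (vs (s, 0)) by (symmetry; apply is_derive_unique, Dv). unfold Rdiv. ring. }
(* Symmetry of the mixed derivatives holds inside and passes to the axis by continuity. *)
assert (M : vst (s, 0) = vts (s, 0)).
{ apply Rminus_diag_uniq, Rabs_le_all. intros e Hee.
  destruct (contS_line eps vst s (e / 2) (toS _ _ Cst B) Hs Hse ltac:(lra)) as [d1 [Hd1 F1]].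
  destruct (contS_line eps vts s (e / 2) (toS _ _ Cts B) Hs Hse ltac:(lra)) as [d2 [Hd2 F2]].
  set (t := Rmin d1 d2 / 2). min_le d1 d2 Q1 Q2. assert (P : 0 < Rmin d1 d2) by (apply Rmin_pos; auto).
  destruct (F1 s t) as [B1 G1]. rewrite Rminus_diag, Rabs_R0; auto. unfold t; lra.
  destruct (F2 s t) as [_ G2]. rewrite Rminus_diag, Rabs_R0; auto. unfold t; lra.
  assert (Hz : HD eps (s, t)). { destruct B1 as [B1 _]. split; auto. simpl. unfold t; lra. }
  rewrite (mixed_partials (HD eps) v vs vt vss vst vts vtt (s, t) HD_C2on (HD_open _ _ Hz)) in G1.
  apply Rabs_lt_between in G1. apply Rabs_lt_between in G2. apply Rabs_le_between. lra. }
rewrite M, E, (N s) by (rewrite Rminus_diag, Rabs_R0; auto). field.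
Qed.

(** If no [d] worked for [k], there would be such a square within every distance of the origin, and
    [squares_not_accumulating] excludes this with the modulus as [N]. *)
Lemma area_small k : 0 < k -> exists d, 0 < d /\ forall a b l, 0 < l ->
    (forall z, inrect a b l l z -> HD eps z /\ Cmod z < d) ->
    (forall z, inrect a b l l z -> k <= l ^ 2 * exp (v z)) -> False.
Proof using Hint.
intros Hk. apply NNPP. intros NE. apply (AreaLink.squares_not_accumulating (Dplus eps) v Cmod k Hint Hk).
intros d Hd. apply NNPP. intros N. apply NE. exists d. split; auto. intros a b l Hl H1 H2. apply N.
assert (Hb : 0 < b). { apply (H1 (a, b)). unfold inrect; simpl; lra. }
(* The height [b] of the lower side is a positive lower bound of [|z|] on the square. *)
exists a, b, l, b. split; auto. split; auto. intros s t S1 S2 T1 T2.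
assert (I : inrect a b l l (s, t)) by (unfold inrect; simpl; auto). destruct (H1 _ I) as [Z1 Z2]. split; auto. split.
- eapply Rle_trans. 2: apply (Cmod_snd (s, t)). simpl. rewrite Rabs_pos_eq; lra.
- split; auto. assert (X := H2 _ I). simpl in X. rewrite Rmult_1_r in X. exact X.
Qed.

Lemma assembled : LS2 K eps (Rmax (Rabs c1) (Rabs c2)) v vs vt vss vst vts vtt.
Proof using All.
constructor; try (intros; apply toS; auto; fail). 2: apply axis_identity.
constructor; auto.
- destruct HK as [Hk|[Hk|Hk]]; rewrite Hk; apply Rabs_le; lra.
- eapply Rle_trans. apply (Rabs_pos c1). apply Rmax_l.
- apply HD_C2on.
- intros z Hz. assert (E := Heq z Hz). unfold laplacian in E. destruct (pd_values z Hz) as [_ [_ [E1 [_ [_ E2]]]]]. rewrite E1, E2 in E. lra.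
- intros s Hs Hse. destruct (bd s Hs Hse) as [c [d [Hc [Hd F]]]]. exists (c * exp (v (s, 0) / 2)). split.
  + rewrite Rabs_mult, (Rabs_pos_eq (exp _)) by (left; apply exp_pos). apply Rmult_le_compat_r. left; apply exp_pos.
    destruct Hc as [Hc|Hc]; rewrite Hc. apply Rmax_l. apply Rmax_r.
  + apply F. rewrite Rminus_diag, Rabs_R0; auto.
- apply area_small.
Qed.

Lemma schwarzian_map_Qf z : HD eps z -> schwarzian_map v z = Qf vs vt vss vst vts vtt z.
Proof using HD2.
intros Hz. destruct (pd_values z Hz) as [E1 [E2 [E3 [E4 [E5 E6]]]]].
unfold schwarzian_map, v_zz, v_z, Qf. rewrite E1, E2, E3, E4, E5, E6. apply injective_projections; simpl; field.
Qed.
End Assembly.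

(** [b0] is real, so [sig ^ 2 = 1 - 2 b0] has a root that is nonnegative or imaginary, and
    [exponents_real] excludes the second. *)
Lemma developing_map_shape K eps c0 v vs vt vss vst vts vtt g : LS2 K eps c0 v vs vt vss vst vts vtt -> K = -1 \/ K = 0 \/ K = 1 -> developing_map K eps v g ->
  exists (s : R) b h1 h2 be m A B C D, 0 <= s /\ (forall n, snd (b n) = 0) /\ frob (fun n => (/ 2 * b (S n))%C) eps (RtoC s) be m h1 h2 /\
    (A * D - B * C)%C <> 0 /\ forall z, HD eps z -> quot_rel g A B C D (sol1 h1 (RtoC s)) (sol2 h1 h2 (RtoC s) be) z.
Proof.
intros H HK Hg. assert (He := ls_eps (l2_ls H)).
destruct (Qe_PS _ _ _ _ _ _ _ _ _ _ H) as [b [Cb [Rb Eb]]].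
assert (Cp : cvr (fun n => (/ 2 * b (S n))%C) eps) by (apply cvr_scal, cvr_shift; auto).
assert (Eb0 : b O = RtoC (fst (b O))). { specialize (Rb O). destruct (b O). simpl in *. rewrite Rb. reflexivity. }
set (x := 1 - 2 * fst (b O)).
assert (Ex : (1 - 2 * b O)%C = RtoC x). { rewrite Eb0. unfold x. rewrite RtoC_minus, RtoC_mult. reflexivity. }
destruct (Rle_lt_dec 0 x) as [Hx|Hx].
- assert (Hs : (RtoC (sqrt x) * RtoC (sqrt x) = 1 - 2 * b O)%C) by (rewrite Ex, <- RtoC_mult, sqrt_sqrt; auto).
  destruct (frobenius _ eps (RtoC (sqrt x)) He Cp (sqrt_pos x)) as [be [m [h2 HF]]].
  destruct (developing_quotient K eps c0 v vs vt vss vst vts vtt H HK g Hg b _ h2 (RtoC (sqrt x)) be m Cb Eb HF Hs) as [A [B [C [D [Hd HR]]]]].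
  exists (sqrt x), b, (fsol (fun n => (/ 2 * b (S n))%C) (fun _ => RtoC 0) (RtoC (sqrt x)) 1), h2, be, m, A, B, C, D.
  split. apply sqrt_pos. split; auto.
- exfalso. set (sg := (0, sqrt (- x)) : C). assert (P : 0 < sqrt (- x)) by (apply sqrt_lt_R0; lra).
  assert (Hs : (sg * sg = 1 - 2 * b O)%C).
  { rewrite Ex. assert (Q := sqrt_sqrt (- x) ltac:(lra)). apply injective_projections; simpl. replace (0 * 0 - sqrt (- x) * sqrt (- x)) with (- (sqrt (- x) * sqrt (- x))) by ring. rewrite Q; ring. ring. }
  destruct (frobenius _ eps sg He Cp (Rle_refl 0)) as [be [m [h2 HF]]].
  destruct (developing_quotient K eps c0 v vs vt vss vst vts vtt H HK g Hg b _ h2 sg be m Cb Eb HF Hs) as [A [B [C [D [Hd HR]]]]].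
  apply (exponents_real K eps c0 v vs vt vss vst vts vtt H HK g Hg b _ h2 sg be m Cb Eb HF Hs A B C D Hd HR); auto. simpl. lra.
Qed.

Theorem theorem5p1 :
  forall (K c1 c2 eps : R) (v : C -> R),
    (K = -1 \/ K = 0 \/ K = 1) ->
    0 < eps ->
    C2_upto (Dplus eps) (Dbar eps) v ->
    (forall z, Dplus eps z -> laplacian v z + 2 * K * exp (v z) = 0) ->
    (forall s, 0 < s < eps -> dt_boundary v s (c1 * exp (v (s, 0) / 2))) ->
    (forall s, - eps < s < 0 -> dt_boundary v s (c2 * exp (v (s, 0) / 2))) ->
    MCInt.finite_exp_integral (Dplus eps) v ->
    (forall g : C -> option C, developing_map K eps v g ->
       ((exists (gamma : R) (F : C -> option C) (a b c d : C),
           0 <= gamma < 1 /\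
           meromorphic_on (Dstar eps) F /\ real_on_axis eps F /\
           not_essential_at_0 F /\
           Cminus (Cmult a d) (Cmult b c) <> RtoC 0 /\
           forall z, Dplus eps z ->
             mobius_maps a b c d (option_map (fun u => Cmult (cpow z gamma) u) (F z)) (g z))
        \/
        (exists (F : C -> option C) (a b c d : C),
           meromorphic_on (Dstar eps) F /\ real_on_axis eps F /\
           not_essential_at_0 F /\
           Cminus (Cmult a d) (Cmult b c) <> RtoC 0 /\
           forall z, Dplus eps z ->
             mobius_maps a b c d (option_map (fun u => Cplus u (clog z)) (F z)) (g z)))
       /\ extends_cont_to_0 eps g)
    /\
    (exists Qe : C -> C,
       (forall z, Dstar eps z -> ex_derive Qe z) /\
       (forall z, Dplus eps z -> Qe z = schwarzian_map v z) /\
       exists r M, 0 < r /\ forall z, 0 < Cmod z < r -> Cmod (Cmult (Cmult z z) (Qe z)) <= M).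
Proof.
intros K c1 c2 eps v HK He [vs [vt [vss [vst [vts [vtt [Cv [Cs [Ct [Css [Cst [Cts [Ctt HD2]]]]]]]]]]]]] Heq Hb1 Hb2 Hint.
assert (H := assembled K c1 c2 eps v vs vt vss vst vts vtt HK He Cv Cs Ct Css Cst Cts Ctt HD2 Heq Hb1 Hb2 Hint).
split.
- intros g Hg. destruct (developing_map_shape K eps _ v vs vt vss vst vts vtt g H HK Hg)
    as [s [b [h1 [h2 [be [m [A [B [C' [D [Hs [Rb [HF [Hd HR]]]]]]]]]]]]]].
  split.
  + exact (quotient_shape b h1 h2 eps s be m He Rb Hs HF g A B C' D Hd HR).
  + exact (quotient_extends b h1 h2 eps s be m He Rb Hs HF g A B C' D Hd HR).
- exists (Qe vs vt vss vst vts vtt). split; [|split].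
  + intros z Hz. destruct (Qe_cder _ _ _ _ _ _ _ _ _ _ H z Hz) as [l Hl]. exists l. apply cder_is_derive. exact Hl.
  + intros z Hz. rewrite (schwarzian_map_Qf eps v vs vt vss vst vts vtt HD2 z Hz). apply Qe_up. left. apply Hz.
  + destruct (Qe_PS _ _ _ _ _ _ _ _ _ _ H) as [b [Cb [_ Eb]]].
    destruct (PS_bounded_near_0 b eps He Cb) as [M [d [_ [Hd F]]]].
    exists (Rmin d eps), M. split. apply Rmin_pos; auto. intros z Hz.
    min_le d eps A1 A2. rewrite Eb by lra. apply F. lra.
Qed.
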